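(* With the notation of the context, let $T_0$ be given with $\phi_{\mathcal D}=(T_0,0)\in\mathcal H$, and let $\Phi=(1,0)\in\mathcal H$. Consider the Graetz problem $$c\,\partial_{zz}T+\operatorname{div}(\sigma\nabla T)-h\,\partial_zT=0$$ on the semi-infinite cylinder $\Omega\times[0,+\infty)$ (with the lateral boundary conditions), with subexponential growth, together with the Dirichlet inlet/outlet condition $T_{|z=0}=T_0$ on $\Omega$. a) If the constants are controlled, then there exists a unique solution, given by $$T=\sum_{i<0}e^{\lambda_iz}(B_-\phi_{\mathcal D}|\phi_i)_{\mathcal H}U_i .$$ In this case the temperature at infinity is $0$. b) If the constants are not controlled and $\int_\Omega h\neq0$, then there exists a unique solution, given by $$T=\sum_{i<0}e^{\lambda_iz}(B_-(\phi_{\mathcal D}-T_\infty\Phi)|\phi_i)_{\mathcal H}U_i+T_\infty ,$$ where $T_\infty$ is an arbitrary constant in the case $\int_\Omega h<0$, and $$T_\infty=(\Phi-PB_-\Phi|\phi_{\mathcal D})_{\mathcal H}\,(\Phi-PB_-\Phi|\Phi)_{\mathcal H}^{-1}$$ in the case $\int_\Omega h>0$. In this case the temperature at infinity is the constant $T_\infty$. (If $\int_\Omega h>0$, the temperature at infinity is determined by $\phi_{\mathcal D}$, whereas if $\int_\Omega h<0$ it is a free parameter of the problem.) c) In the balanced case, the set of solutions is given by $$T(z)=\sum_{i<0}\big(B_-(\phi_{\mathcal D}-c_1\Phi-c_2(\Delta_\sigma^{-1}h,0))|\phi_i\big)_{\mathcal H}U_ie^{\lambda_iz}+c_1+c_2(z+\Delta_\sigma^{-1}h),$$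 where $c_2$ is an arbitrary constant and $$c_1=(\Phi-PB_-\Phi|\phi_{\mathcal D}-c_2(\Delta_\sigma^{-1}h,0))_{\mathcal H}\,(\Phi-PB_-\Phi|\Phi)_{\mathcal H}^{-1}.$$ In this case the temperature at infinity has the linear growth rate $T(z)\simeq c_2z+(c_2\Delta_\sigma^{-1}h+c_1)+o(z)$. If the temperature is not allowed to have a linear growth rate, then $c_2=0$ and the temperature at infinity is $c_1$, which is determined by the initial conditions.
   Context: $\Omega$ is a two-dimensional domain (the cross-section of the cylinder, of arbitrary geometry) whose boundary is partitioned into $\Gamma_N,\Gamma_D,\Gamma_R,\Gamma_\sharp$ (Neumann, Dirichlet, Robin, periodic parts), some of which may be empty; $\Gamma_\sharp$ is such that periodicity conditions make sense on it (e.g. opposite sides of a square). $h\in L^\infty(\Omega)$; the diffusion coefficients $c,\sigma>0$ are functions on $\Omega$, bounded with bounded inverse; $a>0$. $\operatorname{div}$ and $\nabla$ act on the variables of $\Omega$ only. The lateral boundary conditions are, for all $z$: $\sigma\nabla T\cdot n=0$ on $\Gamma_N$, $T=0$ on $\Gamma_D$, $\sigma\nabla T\cdot n+aT=0$ on $\Gamma_R$, $T$ periodic on $\Gamma_\sharp$. The constants are *controlled* if $\Gamma_D\cup\Gamma_R\neq\emptyset$, and *not controlled* otherwise. The *balanced case* is: constants not controlled and $\int_\Omega h=0$. If the constants are controlled, $H=\{s\in H^1(\Omega): s=0\text{ on }\Gamma_D,\ s\text{ periodic on }\Gamma_\sharp\}$; if not, $H=\{s\in H^1(\Omega)/\mathbb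 R: s\text{ periodic on }\Gamma_\sharp\}$ (quotient by constants). $\mathcal H=L^2(\Omega)\times H$ is a Hilbert space with scalar product $$((u,s)|(u',s'))_{\mathcal H}=\int_\Omega (cuu'+\sigma\nabla s\cdot\nabla s')+\int_{\Gamma_R}a\,ss'.$$ $\mathcal A(u,s)=(c^{-1}hu-c^{-1}\operatorname{div}(\sigma\nabla s),\,u)$, with domain $\mathcal D(\mathcal A)$ the set of $(u,s)\in\mathcal H$ with $u\in H^1(\Omega)$, $u\in H$, $\operatorname{div}(\sigma\nabla s)\in L^2(\Omega)$, and $\sigma\nabla s\cdot n$ equal to $0$ on $\Gamma_N$, equal to $-as$ on $\Gamma_R$ and periodic on $\Gamma_\sharp$. The nonzero eigenvalues of $\mathcal A$ are $\cdots\le\lambda_{-2}\le\lambda_{-1}<0<\lambda_1\le\lambda_2\le\cdots$, with $\lambda_{\pm n}\to\pm\infty$, and $\phi_i=(U_i,\lambda_i^{-1}U_i)$, $i\in\mathbb Z\setminus\{0\}$, are the corresponding (orthogonal) eigenvectors. In the balanced case the kernel of $\mathcal A$ is spanned by $\phi_0=(1,\Delta_\sigma^{-1}h)$; otherwise it is $\{0\}$. The eigenvectors span $\mathcal H$. In the balanced case $\Delta_\sigma^{-1}h$ is the element $s\in H$ with $\operatorname{div}(\sigma\nabla s)=h$, $\sigma\nabla s\cdot n=0$ on $\Gamma_N$ (and periodicity on $\Gamma_\sharp$); it is defined modulo constants, and where it appears as a function a representative is meant. $P(u,s)=(u,0)$ is an orthogonal projection of $\mathcal H$; $\pi_-$ is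 the orthogonal projection of $\mathcal H$ onto the closed span $\mathcal R(\pi_-)$ of $\{\phi_i:i<0\}$. The operator $\pi_-P\pi_-$ is invertible on $\mathcal R(\pi_-)$, and $B_-=\pi_-(\pi_-P\pi_-)^{-1}\pi_-$. Solutions on $\Omega\times I$, here $I=[0,+\infty)$, are sought as $T\in C^1(I,L^2(\Omega))\cap C^0(I,H)$ satisfying the equation and the lateral boundary conditions; for $\phi(z)=(\partial_zT(z),T(z))$ the equation is equivalent to $\partial_z\phi=\mathcal A\phi$. The temperature has *subexponential growth* if for every $\lambda>0$, $T(z)=o(e^{\lambda z})$ as $z\to+\infty$. The temperature at infinity is the limit of $T(z)$ as $z\to+\infty$.
   Formalization: As T_0 is only in L^2, T in C^0([0,∞),H) with T(0)=T_0 may not exist; solutions are taken C^1 in L^2 and C^0 in H for z>0, continuous in L^2 at z=0 (no regularity at z=0 even if T_0 is in H). Growth and limits are in L^2; Ω is assumed to have H^1 traces. *)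

(* Defs.v *)
From HB Require Import structures.
From mathcomp Require Import all_boot all_order all_algebra.
From mathcomp Require Import all_classical all_reals all_analysis.
Import Order.TTheory GRing.Theory Num.Theory.
Import numFieldNormedType.Exports.

Set Implicit Arguments.
Unset Strict Implicit.
Unset Printing Implicit Defensive.

Local Open Scope classical_set_scope.
Local Open Scope ring_scope.

Notation plane R := (R * R)%type (only parsing).

Section hausdorff1.
Context {R : realType}.
Implicit Types (A : set (plane R)) (F : (set (plane R))^nat).
Local Open Scope ereal_scope.

Definition edist (x y : plane R) : R :=
  Num.sqrt ((x.1 - y.1) ^+ 2 + (x.2 - y.2) ^+ 2)%R.

Definition diam A : \bar R :=
  ereal_sup (0 |` [set (edist xy.1 xy.2)%:E | xy in A `*` A]).

(* One-dimensional Hausdorff measure of the Euclidean plane; MathComp's norm on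
   R * R is the sup norm, which would not give arc length. *)
Definition hausdorff1_pre (delta : R) A : \bar R :=
  ereal_inf [set \sum_(k <oo) diam (F k) | F in
    [set F | A `<=` \bigcup_k F k /\ forall k, diam (F k) <= delta%:E]].

Definition hausdorff1 A : \bar R :=
  ereal_sup [set hausdorff1_pre delta A | delta in [set delta | (0 < delta)%R]].

Let all_sets := g_sigma_algebraType [set: set (plane R)].

Let mu (delta : R) (A : set all_sets) : \bar R :=
  if diam A <= delta%:E then diam A else +oo.

Let diam_ge0 A : 0 <= diam A.
Proof. by apply: ereal_sup_ubound; left. Qed.

Let diam0 : diam set0 = 0.
Proof.
rewrite /diam set0X image_set0 setU0; exact: ereal_sup1.
Qed.

Let mu_ge0 delta A : 0 <= mu delta A.
Proof. by rewrite /mu; case: ifP => // _; exact: leey. Qed.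

Let mu0 delta : (0 < delta)%R -> mu delta set0 = 0.
Proof. by move=> d0; rewrite /mu diam0 lee_fin ltW. Qed.

Let preE delta : hausdorff1_pre delta = mu_ext (mu delta).
Proof.
apply/funext => A; apply/eqP; rewrite eq_le; apply/andP; split.
- apply: le_ereal_inf_tmp => _ [F [_ AF] <-].
  have [Fd|] := pselect (forall k, diam (F k) <= delta%:E).
    rewrite (_ : \sum_(k <oo) _ = \sum_(k <oo) diam (F k)).
      by apply: ereal_inf_lbound; exists F.
    by apply: eq_eseriesr => k _; rewrite /mu Fd.
  move=> /existsNP[k /negP/negbTE Fk].
  by rewrite (eseries_pinfty (k := k)) ?leey// /mu ?Fk// => n _;
     rewrite -ltNye (lt_le_trans _ (mu_ge0 _ _)).
- apply: le_ereal_inf_tmp => _ [F [AF Fd] <-].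
  apply: ereal_inf_lbound; exists F.
    by split => // k; exact: sub_sigma_algebra.
  by apply: eq_eseriesr => k _; rewrite /mu Fd.
Qed.

Let pre_ge0 delta A : 0 <= hausdorff1_pre delta A.
Proof. by rewrite preE; exact: mu_ext_ge0. Qed.

Lemma hausdorff1_0 : hausdorff1 set0 = 0.
Proof.
apply/eqP; rewrite eq_le; apply/andP; split.
  apply: ge_ereal_sup => _ [d d0 <-].
  by rewrite preE mu_ext0//; exact: mu0.
by apply: (le_trans (pre_ge0 1 set0)); apply: ereal_sup_ubound; exists 1%R => /=.
Qed.

Lemma hausdorff1_ge0 A : 0 <= hausdorff1 A.
Proof.
by apply: (le_trans (pre_ge0 1 A)); apply: ereal_sup_ubound; exists 1%R => /=.
Qed.

Lemma le_hausdorff1 : {homo hausdorff1 : A B / A `<=` B >-> A <= B}.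
Proof.
move=> A B AB; apply: ge_ereal_sup => _ [d d0 <-].
apply: (@le_trans _ _ (hausdorff1_pre d B)).
  by rewrite preE; exact: le_mu_ext.
by apply: ereal_sup_ubound; exists d.
Qed.

Lemma hausdorff1_sigma_subadditive : sigma_subadditive hausdorff1.
Proof.
move=> F; apply: ge_ereal_sup => _ [d d0 <-].
apply: (@le_trans _ _ (\sum_(i <oo) hausdorff1_pre d (F i))).
  by rewrite preE; have := @mu_ext_sigma_subadditive _ all_sets R (mu d) (mu_ge0 d); exact.
apply: lee_nneseries => // i _.
by apply: ereal_sup_ubound; exists d.
Qed.

HB.instance Definition _ := isOuterMeasure.Build R (plane R) hausdorff1
  hausdorff1_0 hausdorff1_ge0 le_hausdorff1 hausdorff1_sigma_subadditive.

End hausdorff1.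

Definition hausdorff1_outer {R : realType} :
    {outer_measure set (plane R) -> \bar R} := hausdorff1.

Definition arclength {R : realType} :
    {measure set (caratheodory_type (@hausdorff1_outer R)) -> \bar R} :=
  hausdorff1_outer.

Definition area {R : realType} :
    {measure set (measurableTypeR R * measurableTypeR R)%type -> \bar R} :=
  (lebesgue_measure \x lebesgue_measure)%E.

Section L2.
Context d (T : measurableType d) (R : realType).
Variables (mu : {measure set T -> \bar R}) (D : set T) (f : T -> R).

Definition L2 : Prop := f \_ D \in Lfun mu 2%:E.

Definition norm2 : \bar R := ('N[mu]_2%:E[EFin \o (f \_ D)])%E.

End L2.

(* Om is the cross-section; GN, GD, GR, GP are the Neumann, Dirichlet, Robin and
   periodic parts of its boundary; twin x is the point of GP identified with
   x in GP by periodicity; hh, cc, sg, aa stand for h, c, sigma, a. *)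
Record graetz_data (R : realType) := GraetzData {
  Om : set (plane R);
  GN : set (plane R);
  GD : set (plane R);
  GR : set (plane R);
  GP : set (plane R);
  twin : plane R -> plane R;
  hh : plane R -> R;
  cc : plane R -> R;
  sg : plane R -> R;
  aa : plane R -> R }.

Section graetz.
Context {R : realType} (G : graetz_data R).
Local Notation fn := (plane R -> R).
Local Notation Om := (Om G).
Local Notation GN := (GN G).
Local Notation GD := (GD G).
Local Notation GR := (GR G).
Local Notation GP := (GP G).
Local Notation twin := (twin G).
Local Notation hh := (hh G).
Local Notation cc := (cc G).
Local Notation sg := (sg G).
Local Notation aa := (aa G).
Implicit Types (s v u w f g : fn) (x : plane R) (p q : fn * fn).

Definition e1 : plane R := (1, 0).
Definition e2 : plane R := (0, 1).

Definition bdry : set (plane R) := closure Om `\` Om.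

Definition C1 w : Prop :=
  [/\ forall x, derivable w x e1, forall x, derivable w x e2,
      continuous ('D_e1 w) & continuous ('D_e2 w)].

(* C^1 test functions define the same weak derivatives as smooth ones. *)
Definition test_function v : Prop :=
  C1 v /\ exists K, [/\ compact K, K `<=` Om & forall x, ~ K x -> v x = 0].

Definition weak_grad s (g : fn * fn) : Prop :=
  [/\ L2 area Om g.1, L2 area Om g.2 &
      forall v, test_function v ->
        (\int[area]_(x in Om) (s x * 'D_e1 v x)
          = - (\int[area]_(x in Om) (g.1 x * v x))) /\
        (\int[area]_(x in Om) (s x * 'D_e2 v x)
          = - (\int[area]_(x in Om) (g.2 x * v x)))].

Definition grad s : fn * fn := xget 0 [set p | weak_grad s p].

Definition H1 s : Prop := L2 area Om s /\ exists p, weak_grad s p.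

(* g is the limit in L^2(bdry) of the restrictions of C^1 functions w_ n tending
   to s in H^1. *)
Definition is_trace s g : Prop :=
  L2 arclength bdry g /\
  exists w_ : nat -> fn,
    [/\ forall n, C1 (w_ n),
        norm2 area Om (w_ n - s) @[n --> \oo] --> 0%E,
        norm2 area Om ('D_e1 (w_ n) - (grad s).1) @[n --> \oo] --> 0%E,
        norm2 area Om ('D_e2 (w_ n) - (grad s).2) @[n --> \oo] --> 0%E &
        norm2 arclength bdry (w_ n - g) @[n --> \oo] --> 0%E].

Definition trace s : fn := xget 0 [set g | is_trace s g].

(* The domain is regular enough for boundary values of H^1 functions to make
   sense (any bounded Lipschitz domain qualifies). *)
Definition trace_theorem : Prop :=
  (forall s, H1 s -> exists g, is_trace s g) /\
  exists2 K : R, 0 < K & forall w, C1 w ->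
    (norm2 arclength bdry w <=
      K%:E * (norm2 area Om w + norm2 area Om ('D_e1 w)
                              + norm2 area Om ('D_e2 w)))%E.

Definition controlled : Prop := GD `|` GR !=set0.

Definition balanced : Prop :=
  ~ controlled /\ (\int[area]_(x in Om) hh x) = 0.

(* H is the set of classes of elements of V for eqV: when the constants are not
   controlled, functions are taken modulo constants. *)
Definition V s : Prop :=
  [/\ H1 s, trace s = cst 0 %[ae arclength in GD] &
      trace s \o twin = trace s %[ae arclength in GP]].

Definition eqV s v : Prop :=
  (controlled -> s = v %[ae area in Om]) /\
  (~ controlled -> exists k : R, s = v + cst k %[ae area in Om]).

Definition HH p : Prop := L2 area Om p.1 /\ V p.2.

Definition eqHH p q : Prop := p.1 = q.1 %[ae area in Om] /\ eqV p.2 q.2.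

Definition dot_grad s v : fn := fun x =>
  sg x * ((grad s).1 x * (grad v).1 x + (grad s).2 x * (grad v).2 x).

Definition robin s v : R :=
  \int[arclength]_(x in GR) (aa x * trace s x * trace v x).

Definition dot p q : R :=
  (\int[area]_(x in Om) (cc x * p.1 x * q.1 x + dot_grad p.2 q.2 x))
  + robin p.2 q.2.

Definition normHH p : R := Num.sqrt (dot p p).

Definition hilbert : Prop :=
  (forall p, HH p -> dot p p = 0 -> eqHH p 0) /\
  (forall p_ : nat -> fn * fn, (forall n, HH (p_ n)) ->
    (forall e : R, 0 < e -> exists N, forall m n, (N <= m)%N -> (N <= n)%N ->
      normHH (p_ m - p_ n) < e) ->
    exists2 p, HH p & normHH (p_ n - p) @[n --> \oo] --> 0).

Definition is_div s f : Prop :=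
  L2 area Om f /\
  forall v, test_function v ->
    (\int[area]_(x in Om)
       (sg x * ((grad s).1 x * 'D_e1 v x + (grad s).2 x * 'D_e2 v x)))
    = - (\int[area]_(x in Om) (f x * v x)).

Definition div_sigma_grad s : fn := xget 0 [set f | is_div s f].

(* The normal trace sigma grad s . n, as a linear form on boundary values of
   H^1 functions (Green's formula). *)
Definition normal_flux s v : R :=
  \int[area]_(x in Om) (div_sigma_grad s x * v x + dot_grad s v x).

(* The normal flux is 0 on GN, - a s on GR, and takes opposite values at twin
   points of GP, where the outward normals are opposite. *)
Definition lateral_flux s : Prop :=
  forall v, V v -> normal_flux s v = - robin s v.

Definition domA p : Prop :=
  [/\ HH p, V p.1, exists f, is_div p.2 f & lateral_flux p.2].

Definition opA p : fn * fn :=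
  (fun x => (cc x)^-1 * hh x * p.1 x - (cc x)^-1 * div_sigma_grad p.2 x, p.1).

Definition is_inv_Delta_h s : Prop :=
  [/\ V s, is_div s hh & lateral_flux s].

Definition Pproj p : fn * fn := (p.1, 0).

Definition positive_bounded f : Prop :=
  measurable_fun (Om : set (measurableTypeR R * measurableTypeR R)%type) f /\
  exists m M : R, 0 < m /\ \forall x \ae area, Om x -> m <= f x <= M.

Record graetz_setting : Prop := {
  Om_open : open Om;
  Om_connected : connected Om;
  Om_nonempty : Om !=set0;
  (* i.e. (1, 0) is in L^2 x H *)
  Om_area : (area Om < +oo)%E;
  boundary_parts : GN `|` GD `|` GR `|` GP = bdry;
  boundary_disjoint :
    [/\ GN `&` GD = set0, GN `&` GR = set0, GN `&` GP = set0 &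
     [/\ GD `&` GR = set0, GD `&` GP = set0 & GR `&` GP = set0]];
  boundary_measurable :
    [/\ hausdorff1.-caratheodory GN, hausdorff1.-caratheodory GD,
        hausdorff1.-caratheodory GR & hausdorff1.-caratheodory GP];
  (* periodicity: twin points differ by one of finitely many nonzero periods *)
  twin_periodic : exists2 periods : seq (plane R), 0 \notin periods &
    forall x, GP x ->
      [/\ GP (twin x), twin (twin x) = x & twin x - x \in periods];
  h_bounded :
    measurable_fun (Om : set (measurableTypeR R * measurableTypeR R)%type) hh /\
    exists M : R, \forall x \ae area, Om x -> `|hh x| <= M;
  c_bounded : positive_bounded cc;
  sigma_bounded : positive_bounded sg;
  a_bounded :
    measurable_fun (GR : set (caratheodory_type (@hausdorff1_outer R))) aa /\
    exists M : R, \forall x \ae arclength, GR x -> 0 < aa x <= M;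
  traces_exist : trace_theorem;
  HH_hilbert : hilbert }.

Definition cspan (S : set (fn * fn)) : set (fn * fn) := [set p | HH p /\
  forall e : R, 0 < e -> exists (n : nat) (b : 'I_n -> R) (q : 'I_n -> fn * fn),
    (forall k, S (q k)) /\ normHH (p - \sum_(k < n) b k *: q k) < e].

Section spectrum.
Variables (lam : int -> R) (U : int -> fn) (s0 : fn).

Definition phi (i : int) : fn * fn := (U i, (lam i)^-1 *: U i).

(* lam 0 and U 0 are irrelevant: the kernel vector is (1, s0). *)
Record eigenbasis : Prop := {
  eigenvalue_order : forall n : nat,
    [/\ 0 < lam n.+1%:Z, lam n.+1%:Z <= lam n.+2%:Z,
        lam (- n.+1%:Z) < 0 & lam (- n.+2%:Z) <= lam (- n.+1%:Z)];
  eigenvalue_pinfty : lam n%:Z @[n --> \oo] --> +oo;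
  eigenvalue_ninfty : lam (- n%:Z) @[n --> \oo] --> -oo;
  eigenvector : forall i : int, i != 0 ->
    domA (phi i) /\ eqHH (opA (phi i)) (lam i *: phi i);
  eigenvector_orthonormal : forall i j : int, i != 0 -> j != 0 ->
    dot (phi i) (phi j) = (i == j)%:R;
  kernel_vector : balanced -> is_inv_Delta_h s0;
  eigenvector_span : forall p, HH p ->
    cspan [set q | (exists2 i : int, i != 0 & q = phi i) \/
                   (balanced /\ q = (cst 1, s0))] p }.

Definition Rminus : set (fn * fn) :=
  cspan [set q | exists2 i : int, i < 0 & q = phi i].

Definition pi_minus p : fn * fn :=
  xget 0 [set q | Rminus q /\ forall r, Rminus r -> dot (p - q) r = 0].

(* pi_- P pi_- as an operator on R(pi_-), invertible with bounded inverse *)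
Definition compression p : fn * fn := pi_minus (Pproj (pi_minus p)).

Definition compression_invertible : Prop :=
  (forall q, Rminus q -> exists2 p, Rminus p & eqHH (compression p) q) /\
  exists2 k : R, 0 < k &
    forall p, Rminus p -> k * normHH p <= normHH (compression p).

Definition inv_compression q : fn * fn :=
  xget 0 [set p | Rminus p /\ eqHH (compression p) q].

Definition Bminus p : fn * fn := pi_minus (inv_compression (pi_minus p)).

(* At every z >= 0, T(z) is the sum in L^2 of
     \sum_(i < 0) exp (lam_i z) (B_- p | phi_i) U_i + r(z). *)
Definition given_by p (r : R -> fn) (T : R -> fn) : Prop :=
  forall z : R, 0 <= z ->
    L2 area Om (T z) /\
    norm2 area Om
      (\sum_(k < n) (expR (lam (- k.+1%:Z) * z)
                      * dot (Bminus p) (phi (- k.+1%:Z))) *: U (- k.+1%:Z)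
       + r z - T z) @[n --> \oo] --> 0%E.

End spectrum.

(* The equation c T_zz + div (sigma grad T) - h T_z = 0 with the lateral boundary
   conditions, in weak form (tested against V), for T of class C^1 in L^2 and C^0
   in H on ]0, +oo[; dT is the derivative of T. The initial value T0 being only
   in L^2, continuity at z = 0 is in L^2. *)
Definition solves_equation (T dT : R -> fn) : Prop :=
  forall z : R, 0 < z ->
  [/\ L2 area Om (dT z) /\ V (T z),
      norm2 area Om (t^-1 *: (T (z + t) - T z) - dT z) @[t --> 0^'] --> 0%E,
      norm2 area Om (dT y - dT z) @[y --> z] --> 0%E,
      normHH (0, T y - T z) @[y --> z] --> 0 &
      forall v, V v ->
        is_derive z 1 (fun y => \int[area]_(x in Om) (cc x * dT y x * v x))
          ((\int[area]_(x in Om) (hh x * dT z x * v x)) + dot (0, T z) (0, v))].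

Definition subexponential (T : R -> fn) : Prop :=
  forall m : R, 0 < m ->
    (norm2 area Om (T z) * (expR (- (m * z)))%:E)%E @[z --> +oo] --> 0%E.

Definition solution (T0 : fn) (T : R -> fn) : Prop :=
  [/\ forall z : R, 0 <= z -> L2 area Om (T z),
      exists dT, solves_equation T dT,
      norm2 area Om (T z - T 0) @[z --> 0^'+] --> 0%E,
      T 0 = T0 %[ae area in Om] &
      subexponential T].

Definition at_infinity (T : R -> fn) (l : fn) : Prop :=
  norm2 area Om (T z - l) @[z --> +oo] --> 0%E.

Definition sublinear (T : R -> fn) : Prop :=
  (norm2 area Om (T z) * (z^-1)%:E)%E @[z --> +oo] --> 0%E.

Definition ae_unique (Q : (R -> fn) -> Prop) (T : R -> fn) : Prop :=
  Q T /\ forall T', Q T' ->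
    forall z : R, 0 <= z -> T' z = T z %[ae area in Om].

End graetz.

(* Main.v *)
Require Import Defs.
From mathcomp Require Import all_boot all_order all_algebra.
From mathcomp Require Import all_classical all_reals all_analysis measurable_realfun ring lra.
Import Order.TTheory GRing.Theory Num.Theory.
Import numFieldNormedType.Exports.
Local Open Scope classical_set_scope.
Local Open Scope ring_scope.
Set Implicit Arguments.
Unset Strict Implicit.
Unset Printing Implicit Defensive.

(** A solution is read off from the coefficients of [(dT z, T z)] on the eigenvectors. For [i != 0]
    the coefficient solves [y' = lam i * y], so it is an exponential ([mode_derive], [mode_exp]).
    The weak eigenvector equation rewrites it as an L^2-continuous expression in [dT z] and [T z]
    ([sol_coef]), on which the L^2 growth bound can act: subexponential growth kills every
    coefficient with [lam i > 0] ([no_growth], [positive_mode_eq0]). In the balanced case the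
    coefficient on [(1, s0)] comes from a quantity constant in [z] ([kernel_mode_const]). So
    [(dT z, T z)] is [k] times the kernel vector plus a series of decaying modes
    ([sol_decomposition]).

    The second component of the operator is the first component of its argument ([sum_graph], which
    rests on [closable]). The decomposition therefore determines [T z] in [H], that is, up to a
    constant when the constants are not controlled, and pairing with 1 shows that this constant is
    affine in [z] ([dec_kap_lin]). Altogether [T z] is the first component of a decaying flow plus
    [c + k * (s0 + z)], with [c = 0] in the controlled case and [k = 0] outside the balanced case.
    Invertibility of the compression bounds an element of the range of pi_- by its first component
    ([Rminus_lower]), so L^2 continuity at the inlet gives the flow a starting vector [psi] in that
    range ([coefs_bounded], [sol_structure]). Conversely such functions satisfy the equation and all
    the limit conditions ([mild_equation], [mild_solution]).

    What remains is a question about the inlet: for which [c] and [k] is [u = T0 - c - k * s0] the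
    first component of an element of the range of pi_-? The only candidate is [B_- (u, 0)]
    ([B_fix_conv]), and the difference [v] between [u] and its first component is orthogonal, for
    the weight [cc], to every [U i] with [i < 0]. When [(v, 0)] is a sum of positive modes, apply
    the inverse of the operator to it: the first component of the result is null in [H], hence 0 or
    a constant, while the product of the result with [(v, 0)] is a sum of terms [lam * square]. This
    forces [v = 0] when the constants are controlled, when [v] is orthogonal to 1, or when the
    integral of [h] is negative ([ortho_Rminus_null]).

    If the constants are not controlled and the integral of [h] is nonnegative, this leaves for [v]
    only the multiples of [defect], the first component of [Phi - P B_- Phi], which is nonzero by an
    energy argument ([defect_neq0]). So [u] is attained exactly when it is orthogonal to [defect]
    ([B_fix], [B_fix_conv]). This is one linear equation for [c], and its solution is the formula
    for the temperature at infinity or for c_1 ([defect_rest]). Hence the three cases: [c] and [k]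
    both vanish when the constants are controlled; [c] is free or determined according to the sign
    of the integral of [h]; in the balanced case [k] is free and determines [c]. *)

Lemma cvg_dist_le {R : realType} {T : Type} (F : set_system T) {FF : Filter F}
    (f g : T -> R) a :
  (\forall x \near F, `|f x - a| <= g x) -> g x @[x --> F] --> 0 ->
  f x @[x --> F] --> a.
Proof.
move=> fg g0; apply/(@subr_cvg0 _ _ _ _ FF); apply: (@norm_cvg0 _ _ _ _ FF).
apply: (@squeeze_cvgr _ _ FF _ (cst 0) g) => //; last exact: cvg_cst.
by apply: filterS fg => x; rewrite normr_ge0.
Qed.

Lemma cvgZ0 {R : realType} {T : Type} (F : set_system T) {FF : Filter F}
    (c : R) (f : T -> R) :
  f x @[x --> F] --> 0 -> c * f x @[x --> F] --> 0.
Proof.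
move=> f0; suff : c * f x @[x --> F] --> c * 0 by rewrite mulr0.
by apply: cvgM => //; exact: cvg_cst.
Qed.

Lemma ler_cvg0 {R : realType} {T : Type} (F : set_system T) {FF : ProperFilter F}
    (a b : R) (e : T -> R) :
  (\forall x \near F, a <= b + e x) -> e x @[x --> F] --> 0 -> a <= b.
Proof.
move=> ab e0; apply/ler_addgt0Pr => r r0.
have er := (@cvgrPdist_lt _ _ _ _ _ _ _).1 e0 _ r0.
have [x [h1 h2]] := filter_ex (filterI ab (er _)).
apply: (le_trans h1); rewrite lerD2l ltW//; apply: le_lt_trans h2.
by rewrite sub0r normrN ler_norm.
Qed.

(** * Semi-inner product spaces *)

Section preinner.
Context {R : realType} {E : lmodType R}.

(** Definiteness is left out: elements of [HH] and [L2] are functions rather than classes, and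
    constants are null vectors for the product of [H] when they are not controlled. Equality of
    vectors is therefore expressed throughout by [nrm (p - q) = 0]. *)
Record preinner (H : set E) (d : E -> E -> R) : Prop := {
  hilb0 : H 0;
  hilb_lin : forall a p q, H p -> H q -> H (a *: p + q);
  hilbC : forall p q, H p -> H q -> d p q = d q p;
  hilb_dotl : forall a p q r, H p -> H q -> H r ->
    d (a *: p + q) r = a * d p r + d q r;
  hilb_ge0 : forall p, H p -> 0 <= d p p }.

Definition dot_complete (H : set E) (d : E -> E -> R) : Prop :=
  forall u : nat -> E, (forall n, H (u n)) ->
    (forall e : R, 0 < e -> exists N, forall m n, (N <= m)%N -> (N <= n)%N ->
      Num.sqrt (d (u m - u n) (u m - u n)) < e) ->
    exists2 p, H p & Num.sqrt (d (u n - p) (u n - p)) @[n --> \oo] --> 0.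

Variables (H : set E) (d : E -> E -> R).
Hypothesis PH : preinner H d.
Local Notation nrm p := (Num.sqrt (d p p)).

Lemma hilbD p q : H p -> H q -> H (p + q).
Proof. by move=> Hp Hq; rewrite -[p]scale1r; exact: (hilb_lin PH). Qed.

Lemma hilbZ a p : H p -> H (a *: p).
Proof. by move=> Hp; rewrite -[_ *: _]addr0; apply: (hilb_lin PH) => //; exact: (hilb0 PH). Qed.

Lemma hilbN p : H p -> H (- p).
Proof. by move=> Hp; rewrite -scaleN1r; exact: hilbZ. Qed.

Lemma hilbB p q : H p -> H q -> H (p - q).
Proof. by move=> Hp Hq; apply: hilbD => //; exact: hilbN. Qed.

Lemma hilb_sum n (F : 'I_n -> E) : (forall k, H (F k)) -> H (\sum_(k < n) F k).
Proof.
move=> HF; elim/big_ind: _ => //; first exact: (hilb0 PH).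
by move=> *; exact: hilbD.
Qed.

Lemma dotDl p q r : H p -> H q -> H r -> d (p + q) r = d p r + d q r.
Proof. by move=> *; rewrite -[p in LHS]scale1r (hilb_dotl PH)// mul1r. Qed.

Lemma dot0l r : H r -> d 0 r = 0.
Proof.
move=> Hr; have H0 := hilb0 PH; have := dotDl H0 H0 Hr.
by rewrite addr0 => /eqP; rewrite eq_sym -subr_eq0 addrK => /eqP.
Qed.

Lemma dotZl a p r : H p -> H r -> d (a *: p) r = a * d p r.
Proof.
move=> Hp Hr; have H0 := hilb0 PH.
by rewrite -[a *: p]addr0 (hilb_dotl PH)// dot0l// addr0.
Qed.

Lemma dotNl p r : H p -> H r -> d (- p) r = - d p r.
Proof. by move=> *; rewrite -scaleN1r dotZl// mulN1r. Qed.

Lemma dotBl p q r : H p -> H q -> H r -> d (p - q) r = d p r - d q r.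
Proof. by move=> *; rewrite dotDl// ?dotNl//; exact: hilbN. Qed.

Lemma dotDr p q r : H p -> H q -> H r -> d r (p + q) = d r p + d r q.
Proof.
move=> Hp Hq Hr; rewrite (hilbC PH Hr (hilbD Hp Hq)) dotDl//.
by rewrite (hilbC PH Hr Hp) (hilbC PH Hr Hq).
Qed.

Lemma dotZr a p r : H p -> H r -> d r (a *: p) = a * d r p.
Proof. by move=> *; rewrite (hilbC PH)// ?dotZl// 1?(hilbC PH (p := r))//; exact: hilbZ. Qed.

Lemma dotNr p r : H p -> H r -> d r (- p) = - d r p.
Proof. by move=> *; rewrite -scaleN1r dotZr// mulN1r. Qed.

Lemma dotBr p q r : H p -> H q -> H r -> d r (p - q) = d r p - d r q.
Proof. by move=> *; rewrite dotDr// ?dotNr//; exact: hilbN. Qed.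

Lemma dot_suml n (F : 'I_n -> E) r : (forall k, H (F k)) -> H r ->
  d (\sum_(k < n) F k) r = \sum_(k < n) d (F k) r.
Proof.
elim: n F => [|n IH] F HF Hr; first by rewrite !big_ord0 dot0l.
by rewrite !big_ord_recr/= dotDl// ?IH//; exact: hilb_sum.
Qed.

Lemma nrm2E p : H p -> nrm p ^+ 2 = d p p.
Proof. by move=> Hp; rewrite sqr_sqrtr// (hilb_ge0 PH). Qed.

Lemma dot_sqrD p q : H p -> H q -> d (p + q) (p + q) = d p p + 2 * d p q + d q q.
Proof.
move=> Hp Hq; rewrite dotDl ?dotDr//; last exact: hilbD.
by rewrite (hilbC PH (p := q) (q := p))//; ring.
Qed.

Lemma dot_sqrB p q : H p -> H q -> d (p - q) (p - q) = d p p - 2 * d p q + d q q.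
Proof.
move=> Hp Hq; have HNq := hilbN Hq.
by rewrite dot_sqrD// dotNr// dotNl// ?dotNr//; ring.
Qed.

Lemma dot_cauchy_schwarz p q : H p -> H q -> `|d p q| <= nrm p * nrm q.
Proof.
move=> Hp Hq; rewrite -(@ler_pXn2r _ 2)// ?nnegrE ?mulr_ge0 ?sqrtr_ge0//.
rewrite real_normK ?num_real// exprMn !nrm2E//.
have pos t : 0 <= d p p + 2 * (t * d p q) + t ^+ 2 * d q q.
  have := hilb_ge0 PH (hilbD Hp (hilbZ t Hq)).
  rewrite dot_sqrD//; last exact: hilbZ.
  by rewrite !dotZr ?dotZl//; [rewrite expr2 -mulrA|exact: hilbZ].
have q0 := hilb_ge0 PH Hq; have p0 := hilb_ge0 PH Hp.
(* Without definiteness [d q q = 0] does not give [q = 0]. In that case the polynomial of [pos] is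
   affine in [t], and at the value chosen below it would be [- d p p - 2], so its slope must
   vanish. *)
have [qq0|qq0] := eqVneq (d q q) 0.
  rewrite qq0 mulr0; suff -> : d p q = 0 by rewrite expr0n.
  apply/eqP; apply: contraT => dpq.
  have := pos (- ((d p p + 1) / (d p q))).
  rewrite qq0 mulr0 addr0 mulNr divfK// => pos1.
  lra.
have := pos (- (d p q / d q q)).
have {qq0 q0} q0 : 0 < d q q by rewrite lt_neqAle eq_sym qq0.
move=> /(ler_wpM2r (ltW q0)); rewrite mul0r => h.
suff : 0 <= d p p * d q q - d p q ^+ 2 by rewrite subr_ge0.
apply: (le_trans h); rewrite le_eqVlt; apply/orP; left; apply/eqP.
by field; rewrite gt_eqF.
Qed.

Lemma nrmZ a p : H p -> nrm (a *: p) = `|a| * nrm p.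
Proof.
move=> Hp; rewrite dotZl ?dotZr//; last exact: hilbZ.
by rewrite mulrA -expr2 sqrtrM ?sqr_ge0// sqrtr_sqr.
Qed.

Lemma nrm0 : nrm 0 = 0.
Proof. by rewrite dot0l ?sqrtr0//; exact: (hilb0 PH). Qed.

Lemma nrmN p : H p -> nrm (- p) = nrm p.
Proof. by move=> Hp; rewrite -scaleN1r nrmZ// normrN1 mul1r. Qed.

Lemma nrm_distC p q : H p -> H q -> nrm (p - q) = nrm (q - p).
Proof. by move=> Hp Hq; rewrite -nrmN ?opprB//; exact: hilbB. Qed.

Lemma ler_nrmD p q : H p -> H q -> nrm (p + q) <= nrm p + nrm q.
Proof.
move=> Hp Hq; rewrite -(@ler_pXn2r _ 2)// ?nnegrE ?addr_ge0 ?sqrtr_ge0//.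
rewrite nrm2E ?dot_sqrD//; last exact: hilbD.
rewrite sqrrD !nrm2E// lerD2r lerD2l mulr_natl lerMn2r/=.
by apply: le_trans (dot_cauchy_schwarz Hp Hq); exact: ler_norm.
Qed.

Lemma ler_nrm_dist p q r : H p -> H q -> H r ->
  nrm (p - r) <= nrm (p - q) + nrm (q - r).
Proof.
move=> Hp Hq Hr; rewrite (_ : p - r = (p - q) + (q - r)); last by rewrite addrA subrK.
by apply: ler_nrmD; exact: hilbB.
Qed.

Lemma dot_null_l p r : H p -> H r -> nrm p = 0 -> d p r = 0.
Proof.
move=> Hp Hr p0; have := dot_cauchy_schwarz Hp Hr.
by rewrite p0 mul0r normr_le0 => /eqP.
Qed.

Lemma dot_null_eql p q r : H p -> H q -> H r -> nrm (p - q) = 0 -> d p r = d q r.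
Proof.
move=> Hp Hq Hr pq; apply/eqP; rewrite -subr_eq0 -dotBl//; apply/eqP.
by apply: dot_null_l => //; exact: hilbB.
Qed.

Lemma nrm_null_eq p q : H p -> H q -> nrm (p - q) = 0 -> nrm p = nrm q.
Proof.
move=> Hp Hq pq; congr Num.sqrt.
rewrite (dot_null_eql Hp Hq Hp pq) (hilbC PH Hq Hp).
by rewrite (dot_null_eql Hp Hq Hq pq).
Qed.

Lemma cvg_nrm_dot (u : nat -> E) p r : (forall n, H (u n)) -> H p -> H r ->
  nrm (u n - p) @[n --> \oo] --> 0 -> d (u n) r @[n --> \oo] --> d p r.
Proof.
move=> Hu Hp Hr up.
apply: (@cvg_dist_le _ _ _ _ _ (fun n => nrm (u n - p) * nrm r)).
  apply: nearW => n; rewrite -dotBl//.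
  by apply: dot_cauchy_schwarz => //; exact: hilbB.
by rewrite -(mul0r (nrm r)); apply: cvgM => //; exact: cvg_cst.
Qed.

Lemma ler_dist_nrm p q : H p -> H q -> `|nrm p - nrm q| <= nrm (p - q).
Proof.
move=> Hp Hq; rewrite ler_norml; apply/andP; split.
  rewrite lerBrDl lerBlDr (nrm_distC Hp Hq).
  by have := ler_nrm_dist Hq Hp (hilb0 PH); rewrite !subr0 addrC.
by rewrite lerBlDr; have := ler_nrm_dist Hp Hq (hilb0 PH); rewrite !subr0.
Qed.

Lemma cvg_nrm (u : nat -> E) p : (forall n, H (u n)) -> H p ->
  nrm (u n - p) @[n --> \oo] --> 0 -> nrm (u n) @[n --> \oo] --> nrm p.
Proof.
move=> Hu Hp; apply: cvg_dist_le.
by apply: nearW => n; exact: ler_dist_nrm.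
Qed.

Lemma nrm_cvg_uniq (u : nat -> E) p q : (forall n, H (u n)) -> H p -> H q ->
  nrm (u n - p) @[n --> \oo] --> 0 -> nrm (u n - q) @[n --> \oo] --> 0 ->
  nrm (p - q) = 0.
Proof.
move=> Hu Hp Hq up uq; apply/eqP; rewrite eq_le sqrtr_ge0 andbT.
have /cvg_lim <- // : (nrm (u n - p) + nrm (u n - q)) @[n --> \oo] --> 0.
  by rewrite -[0]addr0; exact: cvgD.
apply: limr_ge.
  apply/cvg_ex; exists (0 + 0); exact: cvgD.
apply: nearW => n.
by rewrite (nrm_distC (Hu n) Hp); exact: ler_nrm_dist.
Qed.

(** The hypothesis says that [q] is orthogonal to [p - q], as an orthogonal projection of [p] is;
    Cauchy-Schwarz then gives [nrm q ^ 2 <= nrm p * nrm q]. *)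
Lemma nrm_le_of_dot p q : H p -> H q -> d q q = d p q -> nrm q <= nrm p.
Proof.
move=> Hp Hq pq; have h := dot_cauchy_schwarz Hp Hq; have n2 := nrm2E Hq.
have F (x y c D : R) : 0 <= x -> 0 <= y -> x ^+ 2 = c -> c = D -> `|D| <= y * x -> x <= y.
  move=> x0 y0 xc cD; rewrite -cD -xc ger0_norm ?sqr_ge0// expr2 => yx.
  have [->//|z] := eqVneq x 0.
  by rewrite ler_pM2r// lt_neqAle eq_sym z x0 in yx.
exact: F (sqrtr_ge0 _) (sqrtr_ge0 _) n2 pq h.
Qed.

Lemma nrm_null_sym p q : H p -> H q -> nrm (p - q) = 0 -> nrm (q - p) = 0.
Proof. by move=> Hp Hq; rewrite nrm_distC. Qed.

End preinner.

(** * Orthonormal sequences and Fourier series *)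

Section orthonormal.
Context {R : realType} {E : lmodType R} (H : set E) (d : E -> E -> R).
Hypothesis PH : preinner H d.
Local Notation nrm p := (Num.sqrt (d p p)).

(** [cspan] for an abstract product, so that arguments on closed spans are made once. *)
Definition hspan (S : set E) : set E := [set p | H p /\
  forall e : R, 0 < e -> exists (n : nat) (b : 'I_n -> R) (q : 'I_n -> E),
    (forall k, S (q k)) /\ nrm (p - \sum_(k < n) b k *: q k) < e].

Lemma hspan_orthogonal (S : set E) p r : S `<=` H -> hspan S p -> H r ->
  (forall s, S s -> d s r = 0) -> d p r = 0.
Proof.
move=> SH [Hp pS] Hr rS; apply/eqP; rewrite -normr_le0.
apply/ler_addgt0Pr => e e0; rewrite add0r.
(* Approximating [p] within [e / (nrm r + 1)] by a combination orthogonal to [r] gives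
   [|d p r| <= e]; adding 1 avoids a division by zero for null [r]. *)
have r1 : 0 < nrm r + 1 by rewrite ltr_wpDl// sqrtr_ge0.
have [n [b [q [qS pe]]]] := pS _ (divr_gt0 e0 r1).
have Hq : H (\sum_(k < n) b k *: q k).
  by apply: (hilb_sum PH) => k; apply: (hilbZ PH); exact: SH.
have -> : d p r = d (p - \sum_(k < n) b k *: q k) r.
  rewrite (dotBl PH)// (dot_suml PH)//; last first.
    by move=> k; apply: (hilbZ PH); exact: SH.
  rewrite big1 ?subr0// => k _.
  by rewrite (dotZl PH) ?rS ?mulr0//; exact: SH.
apply: (le_trans (dot_cauchy_schwarz PH (hilbB PH Hp Hq) Hr)).
rewrite -[leRHS](divfK (lt0r_neq0 r1)) ler_pM ?sqrtr_ge0// ?ltW//.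
by rewrite ltrDl.
Qed.

Variable e : nat -> E.
Hypothesis He : forall k, H (e k).
Hypothesis HC : dot_complete H d.
Hypothesis ON : forall j k, d (e j) (e k) = (j == k)%:R.

Definition psum (a : nat -> R) n : E := \sum_(k < n) a k *: e k.

(** A relation and not a function, because the sum of a series is determined only up to a null
    vector ([is_sum_uniq]). *)
Definition is_sum (a : nat -> R) (q : E) : Prop :=
  H q /\ nrm (psum a n - q) @[n --> \oo] --> 0.

Lemma psum_in a n : H (psum a n).
Proof. by apply: (hilb_sum PH) => k; exact: (hilbZ PH). Qed.

Lemma psumS a n : psum a n.+1 = psum a n + a n *: e n.
Proof. by rewrite /psum big_ord_recr. Qed.

Lemma psum_nat a n : psum a n = \sum_(0 <= k < n) a k *: e k.
Proof. by rewrite big_mkord. Qed.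

Lemma dot_psum_basis a n k : d (psum a n) (e k) = if (k < n)%N then a k else 0.
Proof.
elim: n => [|n IH]; first by rewrite /psum big_ord0 (dot0l PH).
rewrite psumS (dotDl PH)//; [|exact: psum_in|exact: (hilbZ PH)].
rewrite IH (dotZl PH)// ON ltnS [(k <= n)%N]leq_eqVlt eq_sym.
by case: eqVneq => [->|_] /=; rewrite ?ltnn ?add0r ?mulr1// mulr0 addr0.
Qed.

Lemma dot_psum a p n : H p -> d (psum a n) p = \sum_(k < n) a k * d (e k) p.
Proof.
move=> Hp; rewrite (dot_suml PH)//; last by move=> k; exact: (hilbZ PH).
by apply: eq_bigr => k _; rewrite (dotZl PH).
Qed.

Lemma nrm2_psum a n : d (psum a n) (psum a n) = \sum_(k < n) a k ^+ 2.
Proof.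
rewrite dot_psum; last exact: psum_in.
apply: eq_bigr => k _; rewrite (hilbC PH) ?dot_psum_basis ?ltn_ord//.
exact: psum_in.
Qed.

Lemma is_sum_in a q : is_sum a q -> H q. Proof. by case. Qed.

Lemma is_sum_dot a q r : is_sum a q -> H r ->
  \sum_(k < n) a k * d (e k) r @[n --> \oo] --> d q r.
Proof.
move=> [Hq aq] Hr; under eq_fun do rewrite -dot_psum//.
by apply: (cvg_nrm_dot PH) => // n; exact: psum_in.
Qed.

Lemma is_sum_coef a q k : is_sum a q -> d q (e k) = a k.
Proof.
move=> aq; have /cvg_lim <- // := is_sum_dot aq (He k).
apply/cvg_lim => //; apply: cvg_near_cst; exists k.+1 => // n /= kn.
by rewrite -dot_psum// dot_psum_basis kn.
Qed.

Lemma is_sum_norm a q : is_sum a q ->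
  \sum_(k < n) a k ^+ 2 @[n --> \oo] --> d q q.
Proof.
move=> [Hq aq]; under eq_fun do rewrite -nrm2_psum -(nrm2E PH (psum_in _ _)).
rewrite -(nrm2E PH Hq).
have := cvg_nrm PH (psum_in a) Hq aq.
by move=> h; rewrite expr2; under eq_fun do rewrite expr2; exact: cvgM.
Qed.

Lemma is_sum_le_norm a q n : is_sum a q -> \sum_(k < n) a k ^+ 2 <= d q q.
Proof.
move=> aq; have := is_sum_norm aq; move=> /[dup] h /cvg_lim <- //.
apply: limr_ge; first by apply/cvg_ex; eexists; exact: h.
exists n => // m /= nm.
rewrite -!(big_mkord predT (fun k => a k ^+ 2)) (big_cat_nat (n := n) (p := m))//=.
by rewrite lerDl sumr_ge0// => k _; exact: sqr_ge0.
Qed.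

(** Expand the nonnegative square of [p] minus the partial sum of its own Fourier series. *)
Lemma bessel p n : H p -> \sum_(k < n) d p (e k) ^+ 2 <= d p p.
Proof.
move=> Hp; pose a k := d p (e k); have Ha := psum_in a n.
have := hilb_ge0 PH (hilbB PH Hp Ha).
rewrite (dot_sqrB PH)// nrm2_psum (hilbC PH Hp Ha) dot_psum//.
rewrite (eq_bigr (fun k : 'I_n => a k ^+ 2)) => [h|k _]; last by rewrite (hilbC PH).
by rewrite -/a; lra.
Qed.

(** Riesz-Fischer: the squared distance between two partial sums is a difference of two terms of a
    bounded nondecreasing sequence, so the partial sums are Cauchy and completeness applies. *)
Lemma is_sum_exists (a : nat -> R) C : (forall n, \sum_(k < n) a k ^+ 2 <= C) ->
  exists q, is_sum a q.
Proof.
move=> aC; pose S n := \sum_(k < n) a k ^+ 2.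
have SS m n : (m <= n)%N -> S m <= S n.
  move=> mn; rewrite /S -!(big_mkord predT (fun k => a k ^+ 2)).
  rewrite (big_cat_nat (n := m) (p := n))//= lerDl.
  by rewrite sumr_ge0// => k _; exact: sqr_ge0.
have dS m n : (m <= n)%N -> d (psum a n - psum a m) (psum a n - psum a m) = S n - S m.
  move=> mn; rewrite (dot_sqrB PH) ?nrm2_psum; [|exact: psum_in..].
  rewrite (hilbC PH (psum_in _ _) (psum_in _ _)) dot_psum; last exact: psum_in.
  rewrite (eq_bigr (fun k : 'I_m => a k ^+ 2)) => [|k _]; last first.
    rewrite (hilbC PH) ?dot_psum_basis//; last exact: psum_in.
    by rewrite (leq_trans (ltn_ord _) mn).
  by rewrite /S; ring.
have /cvg_ex[l Sl] : cvgn S.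
  apply: nondecreasing_is_cvgn => //; exists C => _ [n _ <-]; exact: aC.
have [q Hq aq] : exists2 p, H p & nrm (psum a n - p) @[n --> \oo] --> 0.
  apply: (HC (psum_in a)) => eps eps0.
  have [N _ SN] := (@cvgrPdist_lt _ _ _ _ _ _ _).1 Sl (eps ^+ 2 / 2)
    (divr_gt0 (exprn_gt0 2 eps0) (ltr0Sn _ 1)).
  exists N; suff W m n : (N <= m)%N -> (m <= n)%N -> nrm (psum a n - psum a m) < eps.
    move=> m n Nm Nn; case: (leqP m n) => mn; last exact: W (ltnW mn).
    by rewrite (nrm_distC PH) ?W//; exact: psum_in.
  move=> Nm mn; rewrite dS// -(ltr_pXn2r (n := 2)) ?nnegrE ?sqrtr_ge0 ?ltW//.
  rewrite sqr_sqrtr ?subr_ge0 ?SS//.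
  have := SN _ Nm; have := SN _ (leq_trans Nm mn); rewrite !ltr_norml /=.
  by move=> /andP[+ _] /andP[_ +]; lra.
by exists q; split.
Qed.

Lemma is_sum_uniq a p q : is_sum a p -> is_sum a q -> nrm (p - q) = 0.
Proof.
move=> [Hp ap] [Hq aq]; exact: (nrm_cvg_uniq PH (psum_in a) Hp Hq ap aq).
Qed.

Lemma psum_lin t a b n :
  psum (fun k => t * a k + b k) n = t *: psum a n + psum b n.
Proof.
rewrite /psum scaler_sumr -big_split/=; apply: eq_bigr => k _.
by rewrite scalerDl scalerA.
Qed.

Lemma is_sum_lin t a b p q : is_sum a p -> is_sum b q ->
  is_sum (fun k => t * a k + b k) (t *: p + q).
Proof.
move=> [Hp ap] [Hq bq]; split; first exact: (hilb_lin PH).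
apply: (@cvg_dist_le _ _ _ _ _
    (fun n => `|t| * nrm (psum a n - p) + nrm (psum b n - q))).
  apply: nearW => n; rewrite subr0 ger0_norm ?sqrtr_ge0// psum_lin.
  rewrite opprD addrACA -scalerBr -(nrmZ PH); last exact: (hilbB PH (psum_in _ _)).
  apply: (ler_nrmD PH); last exact: (hilbB PH (psum_in _ _)).
  by apply: (hilbZ PH); exact: (hilbB PH (psum_in _ _)).
have -> : 0 = `|t| * 0 + 0 :> R by rewrite mulr0 addr0.
apply: cvgD => //.
by apply: cvgM => //; exact: cvg_cst.
Qed.

Lemma is_sum_null a p q : is_sum a p -> H q -> nrm (p - q) = 0 -> is_sum a q.
Proof.
move=> [Hp ap] Hq pq; split => //.
apply: (@cvg_dist_le _ _ _ _ _ (fun n => nrm (psum a n - p))) => //.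
apply: nearW => n; rewrite subr0 ger0_norm ?sqrtr_ge0//.
by have := ler_nrm_dist PH (psum_in a n) Hp Hq; rewrite pq addr0.
Qed.

Lemma is_sum_ext a b q : a =1 b -> is_sum a q -> is_sum b q.
Proof. by move=> /funext ->. Qed.

Lemma is_sum_fin a N : is_sum (fun k => if (k < N)%N then a k else 0) (psum a N).
Proof.
split; first exact: psum_in.
apply: cvg_near_cst; exists N => // n /= Nn.
rewrite (_ : psum _ n = psum a N) ?subrr ?(nrm0 PH)//.
rewrite !psum_nat (big_cat_nat (n := N) (p := n))//=.
rewrite [X in _ + X]big_nat_cond [X in _ + X]big1 ?addr0; last first.
  by move=> k; rewrite andbT leqNgt => /andP[/negbTE -> _]; rewrite scale0r.
by apply: eq_big_nat => k /andP[_ ->].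
Qed.

(** By Parseval, a multiplier bounded by [C] acts on Fourier coefficients with operator norm at most
    [C]. All estimates on the flow come from this. *)
Lemma is_sum_le a b p q C : 0 <= C -> (forall k, `|a k| <= C * `|b k|) ->
  is_sum a p -> is_sum b q -> nrm p <= C * nrm q.
Proof.
move=> C0 ab ap bq; rewrite -(@ler_pXn2r _ 2)// ?nnegrE ?mulr_ge0 ?sqrtr_ge0//.
rewrite exprMn (nrm2E PH (is_sum_in ap)) (nrm2E PH (is_sum_in bq)).
have := is_sum_norm ap => /[dup] h /cvg_lim <- //.
apply: limr_le; first by apply/cvg_ex; eexists; exact: h.
apply: nearW => n; apply: (@le_trans _ _ (C ^+ 2 * \sum_(k < n) b k ^+ 2)).
  rewrite mulr_sumr; apply: ler_sum => k _.
  rewrite -exprMn -(real_normK (num_real (a k))) -(real_normK (num_real (C * b k))).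
  by rewrite ler_pXn2r ?nnegrE// normrM (ger0_norm C0).
by apply: ler_wpM2l; [exact: sqr_ge0|exact: is_sum_le_norm].
Qed.

Lemma is_sum_exists_le a b q C : 0 <= C -> (forall k, `|a k| <= C * `|b k|) ->
  is_sum b q -> exists p, is_sum a p.
Proof.
move=> C0 ab bq; apply: (@is_sum_exists _ (C ^+ 2 * d q q)) => n.
apply: (@le_trans _ _ (C ^+ 2 * \sum_(k < n) b k ^+ 2)).
  rewrite mulr_sumr; apply: ler_sum => k _.
  rewrite -exprMn -(real_normK (num_real (a k))) -(real_normK (num_real (C * b k))).
  by rewrite ler_pXn2r ?nnegrE// normrM (ger0_norm C0).
by apply: ler_wpM2l; [exact: sqr_ge0|exact: is_sum_le_norm].
Qed.

Lemma is_sum_hspan (S : set E) a q : (forall k, S (e k)) -> is_sum a q -> hspan S q.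
Proof.
move=> Se [Hq aq]; split => // eps eps0.
have [N _ aN] := (@cvgrPdist_lt _ _ _ _ _ _ _).1 aq _ eps0.
exists N, (fun k => a k), (fun k => e k); split => //.
have := aN N (leqnn N); rewrite /= sub0r normrN ger0_norm ?sqrtr_ge0//.
by rewrite (nrm_distC PH)//; exact: psum_in.
Qed.

Lemma bessel_is_sum p : H p -> exists q, is_sum (fun k => d p (e k)) q.
Proof. by move=> Hp; apply: is_sum_exists => n; exact: bessel. Qed.

(** The sum [q] of the Fourier series of [p] is such that [q - p] is orthogonal to every [e k],
    hence to their closed span; as both [p] and [q] lie in that span, [q - p] is orthogonal to
    itself. *)
Lemma hspan_is_sum p : hspan [set q | exists k, q = e k] p ->
  is_sum (fun k => d p (e k)) p.
Proof.
move=> pS; have Hp := pS.1; have [q aq] := bessel_is_sum Hp.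
have Hq := is_sum_in aq; have Hpq := hilbB PH Hp Hq.
apply: (is_sum_null aq Hp).
have {}Hpq := hilbB PH Hq Hp.
have eqp s : [set q | exists k, q = e k] s -> d s (q - p) = 0.
  by move=> [k ->]; rewrite (hilbC PH)// (dotBl PH)// (is_sum_coef k aq) subrr.
have eH : [set q | exists k, q = e k] `<=` H by move=> _ [k ->].
rewrite (dotBl PH)// (hspan_orthogonal eH _ Hpq eqp); last first.
  by apply: (is_sum_hspan _ aq) => k; exists k.
by rewrite (hspan_orthogonal eH pS Hpq eqp) subrr sqrtr0.
Qed.

(** Dominated convergence for Fourier multipliers: the tail of [a] is small uniformly in [z] because
    the multipliers are at most 1, and the finite head tends to 0 term by term. *)
Lemma is_sum_cvg0 {Z : Type} (F : set_system Z) {FF : Filter F} (m : Z -> nat -> R)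
    a q (Q : Z -> E) : is_sum a q ->
  (forall k, m z k @[z --> F] --> 0) ->
  (\forall z \near F, (forall k, `|m z k| <= 1) /\ is_sum (fun k => m z k * a k) (Q z)) ->
  nrm (Q z) @[z --> F] --> 0.
Proof.
move=> aq m0 mQ; apply/cvgrPdist_lt => eps eps0.
have e2 : 0 < eps / 2 by rewrite divr_gt0.
have [N _ aN] := (@cvgrPdist_lt _ _ _ _ _ _ _).1 aq.2 _ e2.
have {aN} := aN N (leqnn N); rewrite /= sub0r normrN ger0_norm ?sqrtr_ge0// => aN.
have sN : nrm (psum (fun k => m z k * a k) N) @[z --> F] --> 0.
  have sum0 : \sum_(k < N) (m z k * a k) ^+ 2 @[z --> F] --> (\sum_(k < N) 0 : R).
    apply: cvg_big => [|k _]; first exact: add_continuous.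
    rewrite (_ : 0 = (0 * a k) * (0 * a k)); last first.
      by rewrite !mul0r.
    under eq_fun do rewrite expr2.
    by apply: cvgM; apply: cvgM => //; exact: cvg_cst.
  rewrite big1_eq in sum0; rewrite -[nbhs 0]/(nbhs (0 : R)) -sqrtr0.
  under eq_fun do rewrite nrm2_psum.
  exact: (continuous_cvg _ (@sqrt_continuous R 0) sum0).
have sN' := (@cvgrPdist_lt _ _ _ _ _ _ _).1 sN _ e2.
near=> z; have [mz Qz] : (forall k, `|m z k| <= 1) /\ is_sum (fun k => m z k * a k) (Q z).
  by near: z.
rewrite sub0r normrN ger0_norm ?sqrtr_ge0//.
have := is_sum_lin (-1) (is_sum_fin (fun k => m z k * a k) N) Qz.
have := is_sum_lin (-1) (is_sum_fin a N) aq.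
rewrite !scaleN1r ![- _ + _]addrC => tq tQ.
have Hm : H (psum (fun k => m z k * a k) N) by exact: psum_in.
have HQ := is_sum_in Qz.
have h1 := ler_nrmD PH (hilbB PH HQ Hm) Hm; rewrite subrK in h1.
apply: (le_lt_trans h1); rewrite [eps]splitr; apply: ltr_leD.
  apply: le_lt_trans (_ : _ <= nrm (q - psum a N)) _.
    rewrite -[leRHS]mul1r; apply: (is_sum_le _ _ tQ tq) => // k.
    rewrite !mulN1r mul1r; case: ifPn => _.
      by rewrite !addNr.
    by rewrite !oppr0 !add0r normrM ler_piMl.
  by rewrite (nrm_distC PH (is_sum_in aq) (psum_in _ _)).
suff : `|0 - nrm (psum (fun k => m z k * a k) N)| < eps / 2.
  by rewrite sub0r normrN ger0_norm ?sqrtr_ge0// => /ltW.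
near: z; exact: sN'.
Unshelve. all: by end_near. Qed.

End orthonormal.

(** * Square integrable functions on a measurable set *)

Section L2_theory.
Context d (T : measurableType d) (R : realType).
Variables (mu : {measure set T -> \bar R}) (D : set T).
Hypothesis mD : measurable D.
Implicit Types f g w : T -> R.
Local Notation L2 := (L2 mu D).
Local Notation norm2 := (norm2 mu D).

Lemma norm2E f : norm2 f = ((\int[mu]_(x in D) (f x ^+ 2)%:E) `^ 2^-1)%E.
Proof.
rewrite /Defs.norm2 unlock/=; congr (_ `^ _)%E.
rewrite [RHS]integral_mkcond; apply: eq_integral => x _.
rewrite /= powR_mulrn// real_normK ?num_real//.
by rewrite !patchE; case: ifPn => // _; rewrite expr0n.
Qed.

Lemma measurable_sqr f : measurable_fun D f ->
  measurable_fun D (EFin \o (fun x => f x ^+ 2 : R)).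
Proof. by move=> mf; apply/measurable_EFinP; exact: measurable_funX. Qed.

Lemma norm2_lty f : measurable_fun D f ->
  (norm2 f < +oo)%E = (\int[mu]_(x in D) (f x ^+ 2)%:E < +oo)%E.
Proof.
move=> mf; rewrite norm2E.
have : (0 <= \int[mu]_(x in D) (f x ^+ 2)%:E)%E.
  by apply: integral_ge0 => x _; rewrite lee_fin sqr_ge0.
case: (\int[mu]_(x in D) _)%E => [r| |]//=; first by rewrite !ltry.
by rewrite invr_eq0 pnatr_eq0/= ltxx.
Qed.

Lemma L2P f : L2 f <-> measurable_fun D f /\ (\int[mu]_(x in D) (f x ^+ 2)%:E < +oo)%E.
Proof.
split=> [/andP[]|[mf fy]].
  rewrite !inE/= => mf fy.
  have {}mf : measurable_fun D f by apply/(measurable_restrictT _ mD).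
  by split=> //; rewrite -norm2_lty.
apply/andP; rewrite !inE/=; split; first exact/(measurable_restrictT _ mD).
by rewrite /finite_norm; move: fy; rewrite -norm2_lty.
Qed.

Lemma L2_measurable f : L2 f -> measurable_fun D f.
Proof. by move=> /L2P[]. Qed.

Lemma norm2_L2 f : measurable_fun D f -> (norm2 f < +oo)%E -> L2 f.
Proof. by move=> mf; rewrite norm2_lty// => fy; exact/L2P. Qed.

Lemma L2_sqr_integrable f : L2 f -> mu.-integrable D (EFin \o (fun x => f x ^+ 2)).
Proof.
move=> /L2P[mf fy]; apply/integrableP; split; first exact: measurable_sqr.
by under eq_integral do rewrite /= ger0_norm ?sqr_ge0//.
Qed.

Lemma norm2_sqrt f : L2 f -> norm2 f = (Num.sqrt (\int[mu]_(x in D) (f x ^+ 2)))%:E.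
Proof.
move=> Lf; rewrite norm2E -(@fineK _ (\int[mu]_(x in D) _)%E); last first.
  exact: integrable_fin_num (L2_sqr_integrable Lf).
by rewrite poweR_EFin powR12_sqrt// fine_ge0// integral_ge0// => x _; rewrite lee_fin sqr_ge0.
Qed.

Lemma L2_dominated f g w : measurable_fun D w -> L2 f -> L2 g ->
  {ae mu, forall x, D x -> w x ^+ 2 <= f x ^+ 2 + g x ^+ 2} -> L2 w.
Proof.
move=> mw Lf Lg le_w; apply/L2P; split => //.
have [mf fy] := (L2P f).1 Lf; have [mg gy] := (L2P g).1 Lg.
apply: (@le_lt_trans _ _ (\int[mu]_(x in D) ((f x ^+ 2)%:E + (g x ^+ 2)%:E))%E).
  apply: ae_ge0_le_integral => //; first by move=> x _; rewrite lee_fin sqr_ge0.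
  - exact: measurable_sqr.
  - by move=> x _; rewrite -EFinD lee_fin addr_ge0 ?sqr_ge0.
  - by apply: emeasurable_funD; exact: measurable_sqr.
rewrite ge0_integralD//; try (by move=> x _; rewrite lee_fin sqr_ge0);
  try exact: measurable_sqr.
by rewrite lte_add_pinfty.
Qed.

Lemma L2_bmul M f w : measurable_fun D w ->
  {ae mu, forall x, D x -> `|w x| <= M} -> L2 f -> L2 (fun x => w x * f x).
Proof.
move=> mw wM Lf; have [mf fy] := (L2P f).1 Lf; apply/L2P; split.
  exact: measurable_funM.
apply: (@le_lt_trans _ _ (\int[mu]_(x in D) ((M ^+ 2)%:E * (f x ^+ 2)%:E))%E).
  apply: ae_ge0_le_integral => //; first by move=> x _; rewrite lee_fin sqr_ge0.
  - by apply: measurable_sqr; exact: measurable_funM.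
  - by move=> x _; rewrite -EFinM lee_fin mulr_ge0 ?sqr_ge0.
  - by apply: emeasurable_funM => //; exact: measurable_sqr.
  apply: filterS wM => x h Dx; rewrite -EFinM lee_fin exprMn ler_wpM2r ?sqr_ge0//.
  by rewrite -real_normK ?num_real// lerXn2r ?nnegrE// ?h// (le_trans _ (h Dx)).
rewrite ge0_integralZl//; [|exact: measurable_sqr|by move=> x _; rewrite lee_fin sqr_ge0|by rewrite lee_fin sqr_ge0].
by rewrite lte_mul_pinfty// lee_fin sqr_ge0.
Qed.

Lemma L2_0 : L2 0.
Proof.
apply/L2P; split; first exact: measurable_cst.
by under eq_integral do rewrite expr0n; rewrite integral0.
Qed.

Lemma L2_lin a f g : L2 f -> L2 g -> L2 (a *: f + g).
Proof.
move=> Lf Lg.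
have L2Z b h : L2 h -> L2 (b *: h).
  by move=> Lh; apply: (@L2_bmul `|b|) => //; exact: aeW.
have mfg : measurable_fun D (a *: f + g).
  apply: measurable_funD; last exact: L2_measurable.
  exact: L2_measurable (L2Z _ _ Lf).
apply: (L2_dominated mfg (L2Z (a * 2) _ Lf) (L2Z 2 _ Lg)).
apply: aeW => x _.
change ((a * f x + g x) ^+ 2 <= (a * 2 * f x) ^+ 2 + (2 * g x) ^+ 2).
rewrite -subr_ge0 [leRHS](_ : _ = (a * f x - g x) ^+ 2 + 2 * (a * f x) ^+ 2 + 2 * g x ^+ 2).
  apply: addr_ge0; [apply: addr_ge0; first exact: sqr_ge0|];
    by apply: mulr_ge0; rewrite ?ler0n ?sqr_ge0.
by ring.
Qed.

Lemma integrable_EFinD f g : mu.-integrable D (EFin \o f) ->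
  mu.-integrable D (EFin \o g) -> mu.-integrable D (EFin \o (fun x => f x + g x)).
Proof.
move=> fi gi; apply: (eq_integrable mD ((EFin \o f) \+ (EFin \o g))%E) => //.
exact: integrableD.
Qed.

Lemma integrable_EFinZ a f : mu.-integrable D (EFin \o f) ->
  mu.-integrable D (EFin \o (fun x => a * f x)).
Proof.
move=> fi; apply: (eq_integrable mD (fun x => a%:E * (EFin \o f) x)%E) => //.
exact: integrableZl.
Qed.

Lemma L2_mul_integrable f g : L2 f -> L2 g ->
  mu.-integrable D (EFin \o (fun x => f x * g x)).
Proof.
move=> Lf Lg; have mf := L2_measurable Lf; have mg := L2_measurable Lg.
apply: (@le_integrable _ _ _ _ _ mD _ (EFin \o (fun x => f x ^+ 2 + g x ^+ 2))).
- by apply/measurable_EFinP; exact: measurable_funM.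
- move=> x _ /=; rewrite lee_fin [leRHS]ger0_norm ?addr_ge0 ?sqr_ge0//.
  rewrite normrM -(real_normK (num_real (f x))) -(real_normK (num_real (g x))).
  rewrite -subr_ge0 (_ : _ - _ = (`|f x| - `|g x|) ^+ 2 + `|f x| * `|g x|); last by ring.
  by rewrite addr_ge0 ?sqr_ge0 ?mulr_ge0.
- by apply: integrable_EFinD; exact: L2_sqr_integrable.
Qed.

Definition dot2 f g : R := \int[mu]_(x in D) (f x * g x).

Lemma preinner_L2 : preinner L2 dot2.
Proof.
split.
- exact: L2_0.
- by move=> a f g; exact: L2_lin.
- by move=> f g _ _; apply: eq_Rintegral => x _; rewrite mulrC.
- move=> a f g h Lf Lg Lh; rewrite /dot2.
  rewrite -RintegralZl -?RintegralD//; try exact: L2_mul_integrable;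
    try by apply: integrable_EFinZ; exact: L2_mul_integrable.
  apply: eq_Rintegral => x _.
  by rewrite [(_ + _) x]/(a * f x + g x) mulrDl mulrA.
- by move=> f _; apply: Rintegral_ge0 => x _; rewrite -expr2 sqr_ge0.
Qed.

Lemma norm2_dot2 f : L2 f -> norm2 f = (Num.sqrt (dot2 f f))%:E.
Proof. by move=> /norm2_sqrt ->; congr (Num.sqrt _)%:E; apply: eq_Rintegral => x _; rewrite expr2. Qed.

Lemma dot2_null f : L2 f -> Num.sqrt (dot2 f f) = 0 -> f = cst 0 %[ae mu in D].
Proof.
move=> Lf f0; have mf := measurable_sqr (L2_measurable Lf).
have : (\int[mu]_(x in D) (f x ^+ 2)%:E = 0)%E.
  apply/eqP; rewrite -(@fineK _ (\int[mu]_(x in D) _)%E); last first.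
    exact: integrable_fin_num (L2_sqr_integrable Lf).
  rewrite eqe -[fine _]/(\int[mu]_(x in D) (f x ^+ 2)).
  have -> : \int[mu]_(x in D) (f x ^+ 2) = dot2 f f.
    by apply: eq_Rintegral => x _; rewrite expr2.
  by rewrite eq_le (hilb_ge0 preinner_L2)// -sqrtr_eq0 f0 eqxx.
rewrite (_ : (\int[mu]_(x in D) _)%E = \int[mu]_(x in D) `|(f x ^+ 2)%:E|)%E; last first.
  by apply: eq_integral => x _; rewrite /= ger0_norm ?sqr_ge0.
move=> /(ae_eq_integral_abs _ mD mf).
by apply: filterS => x h Dx; have [/eqP] := h Dx; rewrite sqrf_eq0 => /eqP.
Qed.

Lemma eq_dot2 f f' g g' : L2 f -> L2 f' -> L2 g -> L2 g' ->
  f = f' %[ae mu in D] -> g = g' %[ae mu in D] -> dot2 f g = dot2 f' g'.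
Proof.
move=> Lf Lf' Lg Lg' ff' gg'; congr fine; apply: ae_eq_integral => //.
- exact: measurable_int (L2_mul_integrable Lf Lg).
- exact: measurable_int (L2_mul_integrable Lf' Lg').
- by apply: filterS2 ff' gg' => x h1 h2 Dx; rewrite h1// h2.
Qed.

Lemma ae_eq_norm2 f g : f = g %[ae mu in D] -> L2 f -> L2 g -> norm2 f = norm2 g.
Proof. by move=> fg Lf Lg; rewrite !norm2_dot2// (eq_dot2 Lf Lg Lf Lg). Qed.

Lemma ae_eq_norm2_0 f : f = cst 0 %[ae mu in D] -> L2 f -> norm2 f = 0%E.
Proof.
move=> f0 Lf; rewrite (ae_eq_norm2 f0 Lf) ?norm2_dot2 ?(dot0l preinner_L2) ?sqrtr0//; exact: L2_0.
Qed.

End L2_theory.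

(** * Differentiation by quadratic remainders, and bump functions of one variable *)

Section derivative_criterion.
Context {R : realType}.

(** A remainder of order [h ^ 2] is what exact expansions of polynomials and the Taylor bound on the
    flow both deliver. *)
Lemma is_derive_quadratic (f : R -> R) (x a C e : R) : 0 < e ->
  (forall h, `|h| < e -> `|f (x + h) - f x - a * h| <= C * h ^+ 2) ->
  is_derive x 1 f a.
Proof.
move=> e0 fC.
have h : h^-1 *: (f (h *: 1 + x) - f x) @[h --> (0 : R)^'] --> a.
  apply: (@cvg_dist_le _ _ _ _ _ (fun h => `|C| * `|h|)).
    near=> h.
    have h0 : h != 0 by near: h; exact: nbhs_dnbhs_neq.
    have fh : `|f (x + h) - f x - a * h| <= C * h ^+ 2.
      by apply: fC; near: h; exact: dnbhs0_lt.
    rewrite [h *: 1]mulr1 [h + x]addrC.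
    rewrite (_ : _ - a = h^-1 * (f (x + h) - f x - a * h)); last first.
      by rewrite [RHS]mulrBr (mulrCA h^-1) mulVf// mulr1.
    rewrite normrM normfV ler_pdivrMl ?normr_gt0// mulrCA -expr2.
    apply: (le_trans fh); rewrite real_normK ?num_real//.
    by apply: ler_wpM2r; [exact: sqr_ge0|exact: ler_norm].
  apply: cvgZ0; have : `|h| @[h --> (0 : R)^'] --> `|0 : R|.
    by apply: cvg_norm; exact: nbhs_dnbhs.
  by rewrite (@normr0 _ R).
by apply: DeriveDef; [apply/cvg_ex; exists a|exact/cvg_lim].
Unshelve. all: by end_near. Qed.

(** The square of the positive part stays C^1 across 0, which yields compactly supported C^1
    functions by algebra alone; in each sign pattern the remainder is at most [h ^ 2]. *)
Lemma is_derive_sqr_pos (x : R) :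
  is_derive x 1 (fun y => Num.max 0 y ^+ 2) (2 * Num.max 0 x).
Proof.
apply: (@is_derive_quadratic _ _ _ 1 1) => // h _; rewrite mul1r.
rewrite ler_norml; rewrite /Num.max; case: ifPn; case: ifPn;
  rewrite -?leNgt => h1 h2; apply/andP; split; nra.
Qed.

Lemma continuous_max0 : continuous (fun x : R => Num.max 0 x).
Proof. by move=> x; apply: continuous_max; [exact: cvg_cst|exact: cvg_id]. Qed.

(** A C^1 function which, for [a < b], is positive exactly on the open interval from [a] to [b]. *)
Definition core (a b x : R) : R := Num.max 0 ((x - a) * (b - x)) ^+ 2.

(* As n tends to infinity, [hat a b n] increases to the indicator function of
   ]a, b[. *)
Definition hat (a b : R) (n : nat) (x : R) : R := 1 - (1 + n%:R * core a b x)^-1.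

Definition dcore (a b x : R) : R :=
  2 * Num.max 0 ((x - a) * (b - x)) * (a + b - 2 * x).

Definition dhat (a b : R) (n : nat) (x : R) : R :=
  (1 + n%:R * core a b x) ^- 2 * (n%:R * dcore a b x).

Lemma is_derive_core (a b x : R) : is_derive x 1 (core a b) (dcore a b x).
Proof.
have h : is_derive x (1 : R) (fun y => (y - a) * (b - y)) (a + b - 2 * x).
  apply: (@is_derive_quadratic _ _ _ 1 1) => // h _.
  rewrite (_ : _ - _ = - h ^+ 2); last by ring.
  by rewrite normrN mul1r ger0_norm ?sqr_ge0.
exact: (@is_derive1_comp _ (fun y => Num.max 0 y ^+ 2) _ _ _ _ (is_derive_sqr_pos _) h).
Qed.

Lemma core_ge0 a b x : 0 <= core a b x. Proof. exact: sqr_ge0. Qed.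

Lemma hat_den_gt0 a b (n : nat) x : 0 < 1 + n%:R * core a b x.
Proof. by rewrite ltr_pwDl// mulr_ge0// core_ge0. Qed.

Lemma is_derive_hat (a b : R) n (x : R) : is_derive x 1 (hat a b n) (dhat a b n x).
Proof.
have dc := is_derive_core a b x; have c0 := hat_den_gt0 a b n x.
have dd : is_derive x (1 : R) (fun y => 1 + n%:R * core a b y) (0 + n%:R * dcore a b x).
  by apply: is_deriveD; exact: is_deriveZ.
have := is_deriveB (is_derive_cst (1 : R) x 1) 
  (@is_deriveV _ (fun y => 1 + n%:R * core a b y) _ _ _ (lt0r_neq0 c0) dd).
move=> /is_derive_eq; apply.
by rewrite sub0r add0r scaleNr opprK.
Qed.

Lemma continuous_core a b : continuous (core a b).
Proof.
move=> x; have [d1 _] := is_derive_core a b x.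
exact/differentiable_continuous/derivable1_diffP.
Qed.

Lemma continuous_hat a b n : continuous (hat a b n).
Proof.
move=> x; have [d1 _] := is_derive_hat a b n x.
exact/differentiable_continuous/derivable1_diffP.
Qed.

Lemma continuous_dhat a b n : continuous (dhat a b n).
Proof.
move=> x; apply: cvgM; last first.
  apply: cvgM; first exact: cvg_cst.
  apply: cvgM.
    apply: cvgM; first exact: cvg_cst.
    apply: (@continuous_comp _ _ _ (fun y => (y - a) * (b - y)) (Num.max 0)).
      by apply: cvgM; apply: cvgB; (exact: cvg_cst || exact: cvg_id).
    exact: continuous_max0.
  apply: cvgB; first exact: cvg_cst.
  by apply: cvgM; [exact: cvg_cst|exact: cvg_id].
apply: cvgV; first by rewrite expf_neq0// gt_eqF// hat_den_gt0.
have h : (1 + n%:R * core a b y) @[y --> x] --> 1 + n%:R * core a b x.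
  apply: cvgD; first exact: cvg_cst.
  by apply: cvgM; [exact: cvg_cst|exact: continuous_core].
by rewrite expr2; under eq_fun do rewrite expr2; exact: cvgM.
Qed.

Lemma hat_ge0_le1 a b n x : 0 <= hat a b n x <= 1.
Proof.
have c0 := hat_den_gt0 a b n x; apply/andP; split.
  by rewrite subr_ge0 invf_le1// lerDl mulr_ge0// core_ge0.
by rewrite lerBlDr lerDl invr_ge0 ltW.
Qed.

Lemma hat_out a b n x : a < b -> ~~ (a < x < b) -> hat a b n x = 0.
Proof.
move=> ab xab; rewrite /hat /core; have -> : Num.max 0 ((x - a) * (b - x)) = 0.
  apply/max_idPl; rewrite leNgt; apply/negP => h; move/negP: xab; apply.
  by apply/andP; split; rewrite ltNge; apply/negP => h'; nra.
by rewrite expr0n mulr0 addr0 invr1 subrr.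
Qed.

Lemma hat_cvg a b x : a < b ->
  hat a b n x @[n --> \oo] --> ((a < x < b)%R%:R : R).
Proof.
move=> ab; have [xab|xab] := boolP (a < x < b); last first.
  by under eq_fun do rewrite hat_out//; exact: cvg_cst.
have c0 : 0 < core a b x.
  by have /andP[h1 h2] := xab; rewrite exprn_gt0// lt_max; apply/orP; right; nra.
rewrite /= -[X in _ --> X]subr0; apply: cvgB; first exact: cvg_cst.
apply/cvgrPdist_lt => e e0.
near=> n; rewrite sub0r normrN ger0_norm ?invr_ge0 ?ltW ?hat_den_gt0//.
rewrite invf_plt ?posrE ?hat_den_gt0// ltr_wpDl//.
rewrite -ltr_pdivrMr//; near: n; exact: nbhs_infty_gtr.
Unshelve. all: by end_near. Qed.

End derivative_criterion.

Notation mplane R := (measurableTypeR R * measurableTypeR R)%type (only parsing).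

(** * Boxes and open sets of the plane *)

Section plane_topology.
Context {R : realType}.
Implicit Types (a b c d : R) (O : set (R * R)).

Definition obox a b c d : set (R * R) := `]a, b[%classic `*` `]c, d[%classic.
Definition cbox a b c d : set (R * R) := `[a, b]%classic `*` `[c, d]%classic.

(** The closed box has to lie in [O]: it will be the compact support of test functions approximating
    the indicator of the open box. *)
Definition inner_box O (B : set (R * R)) : Prop := B = set0 \/
  exists a b c d, [/\ a < b, c < d, cbox a b c d `<=` O & B = obox a b c d].

Lemma subset_obox_cbox a b c d : obox a b c d `<=` cbox a b c d.
Proof.
by move=> p [] /=; rewrite !in_itv/= => /andP[/ltW ? /ltW ?] /andP[/ltW ? /ltW ?];
  split; rewrite /= in_itv/=; apply/andP.
Qed.

(** Boxes with rational ends are countable, and every point of [O] lies in such a box inside a ball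
    contained in [O]. Codes that name no admissible box are sent to the empty set. *)
Lemma open_bigcup_boxes O : open O ->
  exists2 F : nat -> set (R * R), (forall n, inner_box O (F n)) & O = \bigcup_n F n.
Proof.
move=> oO.
pose Q := (rat * rat * rat * rat)%type.
pose bx (q : Q) := obox (ratr q.1.1.1) (ratr q.1.1.2) (ratr q.1.2) (ratr q.2).
pose ok (q : Q) := [/\ ratr q.1.1.1 < ratr q.1.1.2 :> R, ratr q.1.2 < ratr q.2 :> R &
  cbox (ratr q.1.1.1) (ratr q.1.1.2) (ratr q.1.2) (ratr q.2) `<=` O].
exists (fun n => if unpickle n is Some q then if `[< ok q >] then bx q else set0 else set0).
  move=> n; case: unpickle => [q|]; last by left.
  case: asboolP => [[? ? ?]|_]; last by left.
  by right; exists (ratr q.1.1.1), (ratr q.1.1.2), (ratr q.1.2), (ratr q.2).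
apply/seteqP; split => [[x y] Oxy|p [n _]]; last first.
  case: unpickle => [q|//]; case: asboolP => [[_ _ h]|//] pq.
  exact/h/subset_obox_cbox.
have /nbhs_ballP[e /= e0 eO] : nbhs (x, y) O by exact: open_nbhs_nbhs.
have rat_near t : exists q q' : rat, [/\ t - e < ratr q, ratr q < t, t < ratr q' & ratr q' < t + e].
  have /rat_in_itvoo[q] : t - e < t by rewrite ltrBlDr ltrDl.
  have /rat_in_itvoo[q'] : t < t + e by rewrite ltrDl.
  by rewrite !in_itv/= => /andP[? ?] /andP[? ?]; exists q, q'.
have [qa [qb [a1 a2 b1 b2]]] := rat_near x.
have [qc [qd [c1 c2 d1 d2]]] := rat_near y.
have := pickleK ((qa, qb, qc, qd) : Q); move: (pickle _) => n qn.
exists n => //; rewrite qn.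
case: asboolP => [_|]; first by split; rewrite /= in_itv/=; apply/andP.
case; split => /=; [exact: lt_trans a2 b1|exact: lt_trans c2 d1|].
move=> [u v] [] /=; rewrite !in_itv/= => /andP[h1 h2] /andP[h3 h4]; apply: eO.
by split; rewrite /ball/= ltr_norml; apply/andP; split; lra.
Qed.

Lemma measurable_obox a b c d : measurable (obox a b c d : set (mplane R)).
Proof. by apply: measurableX; exact: measurable_itv. Qed.

Lemma measurable_open O : open O -> measurable (O : set (mplane R)).
Proof.
move=> /open_bigcup_boxes[F FO ->]; apply: bigcup_measurable => n _.
by have [->|[a [b [c [d [_ _ _ ->]]]]]] := FO n => //; exact: measurable_obox.
Qed.

(* Both sigma-algebras at play on the plane contain the open sets. *)
Lemma measurable_fun_continuous dT (T : measurableType dT) (i : T -> R * R)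
    (f : R * R -> R) :
  (forall O, open O -> measurable (i @^-1` O)) -> continuous f ->
  measurable_fun setT (f \o i).
Proof.
move=> mO cf; apply: (measurability _ (RGenOpens.measurableE R)).
move=> _ [_ [a [b ->] <-]]; rewrite setTI comp_preimage; apply: mO.
by move/continuousP : cf; apply; exact: interval_open.
Qed.

Lemma area_obox a b c d : a < b -> c < d ->
  area (obox a b c d) = ((b - a) * (d - c))%:E.
Proof.
move=> ab cd; rewrite /area /= product_measure1E//=; try exact: measurable_itv.
by rewrite !lebesgue_measure_itv/= !lte_fin ab cd.
Qed.

(** A nonempty open set contains a nondegenerate box. This is what makes the constant 1 nonzero in
    L^2. *)
Lemma area_open_gt0 O : open O -> O !=set0 -> (0 < area O)%E.
Proof.
move=> oO [p Op]; have [F FO OF] := open_bigcup_boxes oO.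
move: Op; rewrite {1}OF => -[n _ Fp].
have [F0|[a [b [c [d [ab cd h Fb]]]]]] := FO n; first by move: Fp; rewrite F0.
apply: (@lt_le_trans _ _ (area (obox a b c d))).
  by rewrite area_obox// lte_fin mulr_gt0// subr_gt0.
apply: le_measure; rewrite ?inE; [exact: measurable_obox|exact: measurable_open|].
exact: subset_trans (@subset_obox_cbox _ _ _ _) h.
Qed.

Lemma obox_setI a b c d a' b' c' d' : obox a b c d `&` obox a' b' c' d' =
  obox (Num.max a a') (Num.min b b') (Num.max c c') (Num.min d d').
Proof.
apply/seteqP; split => x; rewrite /obox/= !in_itv/= !lt_min !gt_max.
  by move=> [[/andP[-> ->] /andP[-> ->]] [/andP[-> ->] /andP[-> ->]]].
by move=> [/andP[/andP[-> ->] /andP[-> ->]] /andP[/andP[-> ->] /andP[-> ->]]].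
Qed.

End plane_topology.

(** * C^1 functions and test functions of the plane *)

Section test_functions.
Context {R : realType}.
Implicit Types (w v : R * R -> R) (x y : R) (p : R * R).

Lemma slice1E w x y :
  (fun h : R => h^-1 *: ((w \o shift (x, y)) (h *: e1) - w (x, y))) =
  (fun h : R => h^-1 *: (((fun s => w (s, y)) \o shift x) (h *: (1 : R)) - w (x, y))).
Proof.
apply/funext => h /=; congr (_ *: (w _ - _)).
by congr (_, _) => /=; rewrite [_ *: 0]mulr0 add0r.
Qed.

Lemma slice2E w x y :
  (fun h : R => h^-1 *: ((w \o shift (x, y)) (h *: e2) - w (x, y))) =
  (fun h : R => h^-1 *: (((fun s => w (x, s)) \o shift y) (h *: (1 : R)) - w (x, y))).
Proof.
apply/funext => h /=; congr (_ *: (w _ - _)).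
by congr (_, _) => /=; rewrite [_ *: 0]mulr0 add0r.
Qed.

Lemma derivable_slice1 w x y :
  derivable w (x, y) e1 = derivable (fun s => w (s, y)) x 1.
Proof. by rewrite /derivable slice1E. Qed.

Lemma derivable_slice2 w x y :
  derivable w (x, y) e2 = derivable (fun s => w (x, s)) y 1.
Proof. by rewrite /derivable slice2E. Qed.

Lemma derive_slice1 w x y : 'D_e1 w (x, y) = 'D_1 (fun s => w (s, y)) x.
Proof. by rewrite /derive slice1E. Qed.

Lemma derive_slice2 w x y : 'D_e2 w (x, y) = 'D_1 (fun s => w (x, s)) y.
Proof. by rewrite /derive slice2E. Qed.

Lemma C1_lin k w v : C1 w -> C1 v -> C1 (k *: w + v).
Proof.
move=> [w1 w2 cw1 cw2] [v1 v2 cv1 cv2].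
have dZ u e p : derivable u p e -> derivable (k *: u) p e by exact: derivableZ.
have D e p : derivable w p e -> derivable v p e ->
    'D_e (k *: w + v) p = k * 'D_e w p + 'D_e v p.
  by move=> we ve; rewrite deriveD ?deriveZ//; exact: dZ.
split; try by move=> p; apply: derivableD => //; exact: dZ.
- rewrite (_ : 'D_e1 _ = fun p => k * 'D_e1 w p + 'D_e1 v p); last first.
    by apply/funext => p; exact: D.
  move=> p; apply: cvgD; last exact: cv1.
  by apply: cvgM; [exact: cvg_cst|exact: cw1].
- rewrite (_ : 'D_e2 _ = fun p => k * 'D_e2 w p + 'D_e2 v p); last first.
    by apply/funext => p; exact: D.
  move=> p; apply: cvgD; last exact: cv2.
  by apply: cvgM; [exact: cvg_cst|exact: cw2].
Qed.

Lemma derive_lin e k w v p : derivable w p e -> derivable v p e ->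
  'D_e (k *: w + v) p = k * 'D_e w p + 'D_e v p.
Proof. by move=> we ve; rewrite deriveD ?deriveZ//; exact: derivableZ. Qed.

Lemma C1_cst k : C1 (cst k : R * R -> R).
Proof.
have D (e : R * R) : 'D_e (cst k : R * R -> R) = cst 0.
  by apply/funext => p; exact: derive_cst.
by split=> //; rewrite ?D; (exact: cst_continuous || move=> p; exact: derivable_cst).
Qed.

(** [C1] only speaks of the two partial derivatives. Move first along the second coordinate at the
    point itself, where differentiability of one slice suffices, then along the first coordinate,
    where the mean value theorem applies with a local bound on ['D_e1 w]. *)
Lemma C1_continuous w : C1 w -> continuous w.
Proof.
move=> [w1 w2 cw1 _] [x y].
have c2 : w (x, t) @[t --> y] --> w (x, y).
  have := w2 (x, y); rewrite derivable_slice2 => /derivable1_diffP.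
  by move=> /differentiable_continuous.
apply/cvgrPdist_lt => e e0.
have e2 : 0 < e / 2 by rewrite divr_gt0.
pose M := `|'D_e1 w (x, y)| + 1.
have M0 : 0 < M by rewrite ltr_wpDl.
have [r /= r0 rM] : exists2 r, 0 < r & forall p, ball (x, y) r p -> `|'D_e1 w p| <= M.
  have /cvgrPdist_lt/(_ _ ltr01)/nbhs_ballP[r /= r0 h] := cw1 (x, y).
  exists r => // p /h h1; rewrite /M -lerBlDl.
  apply: le_trans (ltW h1); rewrite distrC.
  by apply: le_trans (ler_dist_dist _ _); exact: ler_norm.
have /cvgrPdist_lt/(_ _ e2)/nbhs_ballP[r' /= r'0 hr'] := c2.
(* Within [r] the partial derivative is at most [M], within [r'] the vertical move costs less than
   [e / 2], and a horizontal move shorter than [e / (2 * M)] costs at most [e / 2]. *)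
pose s := Num.min (Num.min r r') (e / (2 * M)).
have s0 : 0 < s by rewrite !lt_min r0 r'0 divr_gt0// mulr_gt0.
have := nbhsx_ballx (x, y) s s0; apply: filterS => -[u t] [] /=.
rewrite /ball/= !lt_min => /andP[/andP[xur xur'] xuM] /andP[/andP[ytr ytr'] _].
have h2 : `|w (x, y) - w (x, t)| < e / 2 by apply: hr'.
suff h1 : `|w (x, t) - w (u, t)| <= M * `|x - u|.
  rewrite (_ : _ - _ = (w (x, y) - w (x, t)) + (w (x, t) - w (u, t))); last by ring.
  apply: (le_lt_trans (ler_normD _ _)); rewrite [e]splitr; apply: ltr_leD => //.
  apply: (le_trans h1); rewrite -ler_pdivlMl//.
  by apply: (le_trans (ltW xuM)); rewrite invfM; lra.
have dw q : is_derive q (1 : R) (fun s => w (s, t)) ('D_e1 w (q, t)).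
  by apply: DeriveDef; rewrite -?derivable_slice1 ?derive_slice1.
have cw q : {for q, continuous (fun s => w (s, t))}.
  by apply/differentiable_continuous/derivable1_diffP; case: (dw q).
have W x1 x2 : x1 <= x2 -> (forall q, x1 <= q <= x2 -> `|x - q| < r) ->
    `|w (x2, t) - w (x1, t)| <= M * (x2 - x1).
  move=> x12 xr.
  have [q qI ->] := MVT_segment x12 (fun q _ => dw q) (continuous_subspaceT cw).
  rewrite normrM (ger0_norm (_ : 0 <= x2 - x1)) ?subr_ge0//.
  apply: ler_wpM2r; first by rewrite subr_ge0.
  by apply: rM; split; [rewrite /ball/=; apply: xr; rewrite in_itv/= in qI|].
have [xu|/ltW ux] := leP x u.
  rewrite distrC (ler0_norm (_ : x - u <= 0)) ?subr_le0// opprB; apply: W => // q /andP[h3 h4].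
  by rewrite ler0_norm ?subr_le0// opprB (le_lt_trans _ xur)// ler0_norm ?subr_le0// opprB lerD2r.
rewrite (ger0_norm (_ : 0 <= x - u)) ?subr_ge0//; apply: W => // q /andP[h3 h4].
by rewrite ger0_norm ?subr_ge0// (le_lt_trans _ xur)// ger0_norm ?subr_ge0// lerD2l lerN2.
Qed.

Definition hat2 a b c d n : R * R -> R := fun p => hat a b n p.1 * hat c d n p.2.

(** Each factor vanishes outside its open interval, so the closed box is a compact set off which the
    product is zero. *)
Lemma hat2_test (G : graetz_data R) a b c d n : a < b -> c < d ->
  cbox a b c d `<=` Om G -> test_function G (hat2 a b c d n).
Proof.
move=> ab cd GK; split; last first.
  exists (cbox a b c d); split => //.
    by apply: compact_setX; exact: segment_compact.
  move=> p pK; rewrite /hat2; have [h1|h1] := boolP (a < p.1 < b); last first.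
    by rewrite hat_out// mul0r.
  rewrite [X in _ * X]hat_out ?mulr0//; apply/negP => h2; apply: pK.
  move: h1 h2 => /andP[/ltW ? /ltW ?] /andP[/ltW ? /ltW ?].
  by split; rewrite /= in_itv/=; apply/andP.
have d1 p : is_derive p.1 (1 : R) (fun s => hat2 a b c d n (s, p.2))
    (hat c d n p.2 * dhat a b n p.1).
  have := is_deriveZ (hat c d n p.2) (is_derive_hat a b n p.1).
  by rewrite (_ : _ \*: _ = fun s => hat2 a b c d n (s, p.2))//;
    apply/funext => s; rewrite /hat2/= mulrC.
have d2 p : is_derive p.2 (1 : R) (fun s => hat2 a b c d n (p.1, s))
    (hat a b n p.1 * dhat c d n p.2).
  by have := is_deriveZ (hat a b n p.1) (is_derive_hat c d n p.2).
have cf (f : R -> R) : continuous f -> continuous (fun p : R * R => f p.1).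
  by move=> cf [u t]; apply: (@continuous_comp _ _ _ fst f); [exact: cvg_fst|exact: cf].
have cs (f : R -> R) : continuous f -> continuous (fun p : R * R => f p.2).
  by move=> cs [u t]; apply: (@continuous_comp _ _ _ snd f); [exact: cvg_snd|exact: cs].
split.
- by move=> [x y]; rewrite derivable_slice1; have [] := d1 (x, y).
- by move=> [x y]; rewrite derivable_slice2; have [] := d2 (x, y).
- rewrite (_ : 'D_e1 _ = fun p => hat c d n p.2 * dhat a b n p.1); last first.
    by apply/funext => -[x y]; rewrite derive_slice1; have [] := d1 (x, y).
  move=> p; apply: cvgM; [exact: (cs _ (@continuous_hat _ c d n))|].
  exact: (cf _ (@continuous_dhat _ a b n)).
- rewrite (_ : 'D_e2 _ = fun p => hat a b n p.1 * dhat c d n p.2); last first.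
    by apply/funext => -[x y]; rewrite derive_slice2; have [] := d2 (x, y).
  move=> p; apply: cvgM; [exact: (cf _ (@continuous_hat _ a b n))|].
  exact: (cs _ (@continuous_dhat _ c d n)).
Qed.

End test_functions.

(** * The fundamental lemma of the calculus of variations *)

Section dynkin_integral.
Context d (T : measurableType d) (R : realType).
Variables (mu : {measure set T -> \bar R}) (D : set T) (f : T -> \bar R).
Hypotheses (mD : measurable D) (fi : mu.-integrable D f).
Local Open Scope ereal_scope.

(** For an integrable [f] of integral zero, the sets over whose preimage the integral vanishes form
    a Dynkin system, so a generating family stable under intersection suffices. The map [i] allows
    the argument to run on each coordinate and then on the plane. *)
Lemma dynkin_integral d' (T' : measurableType d') (i : T -> T') (G : set (set T')) :
  measurable_fun setT i -> @measurable _ T' = <<s G >> -> setI_closed G ->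
  \int[mu]_(x in D) f x = 0 ->
  (forall A, G A -> \int[mu]_(x in D `&` i @^-1` A) f x = 0) ->
  forall A, measurable A -> \int[mu]_(x in D `&` i @^-1` A) f x = 0.
Proof.
move=> mi mG GI f0 Gf A mA.
have miA B : measurable B -> measurable (i @^-1` B).
  by move=> mB; rewrite -[_ @^-1` _]setTI; exact: mi.
apply: (@dynkin_induction _ T' G (fun A => \int[mu]_(x in D `&` i @^-1` A) f x = 0)) => //.
- by rewrite preimage_setT setIT.
- move=> B mB fB; move: f0; rewrite -[D in LHS](setUIDK D (i @^-1` B)).
  rewrite integral_setU//.
  + by rewrite fB add0e -setDE.
  + exact: measurableI (miA _ mB).
  + exact: measurableD (miA _ mB).
  + by rewrite setUIDK; exact: measurable_int fi.
  + by apply/disj_setPS => x [[_ Bx] [_ nBx]].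
- move=> F mF tF Fn0; rewrite preimage_bigcup setI_bigcupr integral_bigcup.
  + by rewrite eseries0// => k _ _; exact: Fn0.
  + apply/trivIsetP => j k _ _ jk; rewrite setIACA setIid -preimage_setI.
    by move/trivIsetP : tF => /(_ j k Logic.I Logic.I jk) ->; rewrite preimage_set0 setI0.
  + by move=> k; apply: measurableI => //; exact: miA.
  + apply: (integrableS _ _ _ fi) => //.
      by apply: bigcup_measurable => k _; apply: measurableI => //; exact: miA.
    by apply: bigcup_sub => k _; exact: subIsetl.
- by rewrite -mG.
Qed.

End dynkin_integral.

Section finite_measure_L2.
Context d (T : measurableType d) (R : realType).
Variables (mu : {measure set T -> \bar R}) (D : set T).
Hypotheses (mD : measurable D) (muD : (mu D < +oo)%E).

Lemma L2_bounded (f : T -> R) M : measurable_fun D f ->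
  (forall x, D x -> `|f x| <= M) -> L2 mu D f.
Proof.
move=> mf fM; apply/(L2P _ mD); split => //.
apply: (@le_lt_trans _ _ (\int[mu]_(x in D) (M ^+ 2)%:E)%E).
  apply: ge0_le_integral => //.
  - by move=> x _; rewrite lee_fin sqr_ge0.
  - exact: measurable_sqr.
  - move=> x Dx; rewrite lee_fin -real_normK ?num_real// lerXn2r ?nnegrE ?fM//.
    exact: le_trans (fM x Dx).
by rewrite integral_cst// lte_mul_pinfty// lee_fin sqr_ge0.
Qed.

Lemma L2_cst k : L2 mu D (cst k).
Proof. by apply: (@L2_bounded _ `|k|) => // x _; rewrite lexx. Qed.

Lemma L2_integrable (f : T -> R) : L2 mu D f -> mu.-integrable D (EFin \o f).
Proof.
move=> Lf; have := L2_mul_integrable mD Lf (L2_cst 1).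
by apply: eq_integrable => // x _ /=; rewrite mulr1.
Qed.

End finite_measure_L2.

Section fundamental_lemma.
Context {R : realType} (G : graetz_data R).
Hypotheses (openG : open (Om G)) (areaG : (area (Om G) < +oo)%E).
Local Notation Om := (Om G).
Local Notation mu := (@area R).
Let mOm : measurable (Om : set (mplane R)) := measurable_open openG.

Lemma continuous_measurable_plane (f : R * R -> R) (D : set (mplane R)) :
  measurable D -> continuous f -> measurable_fun D (f : mplane R -> R).
Proof.
move=> mD cf; apply: measurable_funS (@measurable_fun_continuous _ _ (mplane R) id f _ cf) => //.
by move=> O oO; exact: measurable_open.
Qed.

Lemma continuous_compact_support_bounded (v : R * R -> R) K :
  continuous v -> compact K -> (forall x, ~ K x -> v x = 0) ->
  exists M, forall x, `|v x| <= M.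
Proof.
move=> cv cK v0; have [M [_ MK]] := compact_bounded (continuous_compact
  (continuous_subspaceT cv) cK).
exists (Num.max 0 (M + 1)) => x; have [Kx|/v0 ->] := pselect (K x); last first.
  by rewrite normr0 le_max lexx.
by rewrite le_max; apply/orP; right; apply: (MK (M + 1)); rewrite ?ltrDl//; exists x.
Qed.

Lemma test_L2 v : test_function G v -> L2 mu Om v.
Proof.
move=> [C1v [K [cK _ vK]]]; have cv := C1_continuous C1v.
have [M vM] := continuous_compact_support_bounded cv cK vK.
by apply: (L2_bounded mOm areaG (M := M)) => //; exact: continuous_measurable_plane.
Qed.

Lemma test_derive_out (v : R * R -> R) (e : R * R) (K : set (R * R)) (x : R * R) : compact K -> (forall x, ~ K x -> v x = 0) -> ~ K x ->
  'D_e v x = 0 :> R.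
Proof.
move=> cK vK Kx.
have oK : open (~` K).
  by apply: closed_openC; apply: compact_closed => //; exact: norm_hausdorff.
have : nbhs x (~` K) by exact: open_nbhs_nbhs.
move=> nK; rewrite -(@derive_cst _ _ _ (0 : R) x e).
by apply: near_eq_derive; apply: filterS nK => y /vK ->.
Qed.

Lemma test_derive_L2 v : test_function G v ->
  L2 mu Om ('D_e1 v) /\ L2 mu Om ('D_e2 v).
Proof.
move=> [[_ _ cv1 cv2] [K [cK _ vK]]].
have [M1 vM1] := continuous_compact_support_bounded cv1 cK
  (fun x => @test_derive_out v e1 K x cK vK).
have [M2 vM2] := continuous_compact_support_bounded cv2 cK
  (fun x => @test_derive_out v e2 K x cK vK).
by split; [apply: (L2_bounded mOm areaG (M := M1))|apply: (L2_bounded mOm areaG (M := M2))];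
  move=> //; exact: continuous_measurable_plane.
Qed.

Variable f : R * R -> R.
Hypothesis Lf : L2 mu Om f.
Hypothesis f0 : forall v, test_function G v -> \int[mu]_(x in Om) (f x * v x) = 0.
Let fi : mu.-integrable Om (EFin \o f) := L2_integrable mOm areaG Lf.

(** Dominated convergence along the test functions [hat2], which tend to the indicator of the box
    and stay between 0 and 1. *)
Let integral_inner_box a b c d : a < b -> c < d -> cbox a b c d `<=` Om ->
  (\int[mu]_(x in obox a b c d) (f x)%:E = 0)%E.
Proof.
move=> ab cd sub.
have mv n := L2_measurable mOm (test_L2 (hat2_test n ab cd sub)).
have mf := L2_measurable mOm Lf.
have mfv n : measurable_fun (Om : set (mplane R)) (fun x : mplane R => (f x * hat2 a b c d n x)%:E : \bar R).
  by apply/measurable_EFinP; exact: measurable_funM.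
have mfi : measurable_fun (Om : set (mplane R)) (fun x : mplane R => (f x * \1_(obox a b c d) x)%:E : \bar R).
  apply/measurable_EFinP; apply: measurable_funM => //.
  by apply: measurable_indic; exact: measurable_obox.
have [|||||_ _] := @dominated_convergence _ _ _ mu Om mOm
  (fun n x => (f x * hat2 a b c d n x)%:E)
  (fun x => (f x * \1_(obox a b c d) x)%:E) (fun x => `|(f x)%:E|%E).
- exact: mfv.
- exact: mfi.
- apply: aeW => x _; apply/fine_cvgP; split; first exact: nearW.
  rewrite /comp/=; apply: cvgM; first exact: cvg_cst.
  rewrite /hat2 indicE (_ : (x \in obox a b c d) = (a < x.1 < b) && (c < x.2 < d)).
    by rewrite -mulnb natrM; apply: cvgM; exact: hat_cvg.
  by apply/idP/idP; rewrite inE /obox/= !in_itv/=; [move=> [-> ->]|move/andP].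
- exact: integrable_abse.
- apply: aeW => x n _; rewrite /= lee_fin normrM ler_piMr// /hat2.
  have /andP[h1 h2] := hat_ge0_le1 a b n x.1; have /andP[h3 h4] := hat_ge0_le1 c d n x.2.
  by rewrite ger0_norm ?mulr_ge0// mulr_ile1.
rewrite (_ : (fun n => _) = cst 0%E) => [h|].
  have : (\int[mu]_(x in Om) (f x * \1_(obox a b c d) x)%:E = 0)%E.
    by apply: (cvg_unique _ h); [exact: ereal_hausdorff|exact: cvg_cst].
  move=> <-; rewrite -[in LHS](setIidr (subset_trans (@subset_obox_cbox _ a b c d) sub)).
  rewrite integral_mkcondr; apply: eq_integral => x _.
  by rewrite /= patchE indicE; case: ifPn => _; rewrite ?mulr1 ?mulr0.
apply/funext => n /=; have tv := @hat2_test _ G a b c d n ab cd sub.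
rewrite -[LHS]fineK ?[fine _]f0//.
by apply: integrable_fin_num => //; exact: L2_mul_integrable (test_L2 tv).
Qed.

Let itv_setI : setI_closed (@RGenOpens.G R).
Proof.
move=> _ _ [a [b ->]] [c [d ->]]; exists (Num.max a c), (Num.min b d).
apply/seteqP; split => x /=; rewrite !in_itv/= lt_min gt_max.
  by move=> [/andP[-> ->] /andP[-> ->]].
by move=> /andP[/andP[-> ->] /andP[-> ->]].
Qed.

(** Three Dynkin arguments inside one box: the first side becomes an arbitrary Borel set while the
    second stays an interval, then the second side does, and finally the rectangles so obtained
    generate the product sigma-algebra. Intersections of boxes are boxes, possibly empty, which
    starts the process. *)
Let integral_obox0 a b c d : a < b -> c < d -> cbox a b c d `<=` Om ->
  forall E, measurable (E : set (mplane R)) ->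
  (\int[mu]_(x in obox a b c d `&` E) (f x)%:E = 0)%E.
Proof.
move=> ab cd sub.
have mQ : measurable (obox a b c d : set (mplane R)) by exact: measurable_obox.
have fiS (A : set (mplane R)) : measurable A -> mu.-integrable (obox a b c d `&` A) (EFin \o f).
  move=> mA; apply: (integrableS mOm _ _ fi); first exact: measurableI.
  by apply: subset_trans sub; apply: subset_trans (@subset_obox_cbox _ _ _ _ _); exact: subIsetl.
have fQ : mu.-integrable (obox a b c d) (EFin \o f).
  by rewrite -[obox _ _ _ _]setIT; exact: fiS.
have boxes a' b' c' d' : (\int[mu]_(x in obox a b c d `&` obox a' b' c' d') (f x)%:E = 0)%E.
  rewrite obox_setI; set A := Num.max a a'; set B := Num.min b b'.
  set C := Num.max c c'; set D := Num.min d d'.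
  have [AB|AB] := ltP A B; last first.
    rewrite (_ : obox A B C D = set0) ?integral_set0//.
    by apply/seteqP; split => // x [] /=; rewrite in_itv/= => /andP[h1 h2];
      have := lt_trans h1 h2; rewrite ltNge AB.
  have [CD|CD] := ltP C D; last first.
    rewrite (_ : obox A B C D = set0) ?integral_set0//.
    by apply/seteqP; split => // x [] _ /=; rewrite in_itv/= => /andP[h1 h2];
      have := lt_trans h1 h2; rewrite ltNge CD.
  apply: integral_inner_box => //; apply: subset_trans sub => x [] /=; rewrite !in_itv/=.
  rewrite !ge_max !le_min => /andP[/andP[h1 _] /andP[h2 _]] /andP[/andP[h3 _] /andP[h4 _]].
  by split; rewrite /= in_itv/=; apply/andP.
have oboxE (I J : set R) : I `*` J = (snd @^-1` J) `&` (fst @^-1` I) :> set (R * R).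
  by apply/seteqP; split => x [].
have iT : (\int[mu]_(x in obox a b c d) (f x)%:E = 0)%E.
  by have := boxes a b c d; rewrite setIid.
have step1 (A : set (measurableTypeR R)) c' d' : measurable A ->
    (\int[mu]_(x in obox a b c d `&` (A `*` `]c', d'[%classic)) (f x)%:E = 0)%E.
  rewrite oboxE setIA; move: A; have mJ : measurable (snd @^-1` `]c', d'[%classic : set (mplane R)).
    by rewrite -[_ @^-1` _]setTI; apply: measurable_snd => //; exact: measurable_itv.
  have h a' b' : (\int[mu]_(x in obox a b c d `&` snd @^-1` `]c', d'[%classic `&` fst @^-1` `]a', b'[%classic)
      (f x)%:E = 0)%E.
    by rewrite -setIA -oboxE; exact: boxes.
  apply: (@dynkin_integral _ _ _ mu _ _ _ _ _ _ fst (@RGenOpens.G R)) => //.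
  + exact: measurableI.
  + exact: fiS.
  + exact: RGenOpens.measurableE.
  + have := h a b; rewrite (_ : _ `&` _ = obox a b c d `&` snd @^-1` `]c', d'[%classic)//.
    by apply/seteqP; split => [x [[]]|x [[? ?] ?]].
  + by move=> _ [a' [b' ->]]; exact: h.
have step2 (A B : set (measurableTypeR R)) : measurable A -> measurable B ->
    (\int[mu]_(x in obox a b c d `&` (A `*` B)) (f x)%:E = 0)%E.
  move=> mA; rewrite oboxE setIC -setIA setIC; move: B.
  have mIA : measurable (fst @^-1` A : set (mplane R)).
    by rewrite -[_ @^-1` _]setTI; apply: measurable_fst.
  have h c' d' : (\int[mu]_(x in (fst @^-1` A `&` obox a b c d) `&` snd @^-1` `]c', d'[%classic)
      (f x)%:E = 0)%E.
    by rewrite setIC setIA setIC -oboxE; exact: step1.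
  apply: (@dynkin_integral _ _ _ mu _ _ _ _ _ _ snd (@RGenOpens.G R)) => //.
  + exact: measurableI.
  + by rewrite setIC; exact: fiS.
  + exact: RGenOpens.measurableE.
  + have := h c d; rewrite (_ : _ `&` _ = fst @^-1` A `&` obox a b c d)//.
    by apply/seteqP; split => [x [[]]|x [? [? ?]]].
  + by move=> _ [c' [d' ->]]; exact: h.
move=> E mE; have := @dynkin_integral _ _ _ mu _ _ mQ fQ _ (mplane R) id
  [set A `*` B | A in measurable & B in measurable].
apply => //.
- exact: measurable_prod_measurableType.
- move=> _ _ [A mA [B mB <-]] [A' mA' [B' mB' <-]]; rewrite -setXI.
  exists (A `&` A'); first exact: measurableI.
  by exists (B `&` B') => //; exact: measurableI.
- by move=> _ [A mA [B mB <-]]; exact: step2.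
Qed.

(** On each of the countably many boxes that fill [Om] the integral of [f] over every measurable
    subset is zero, so [f] vanishes almost everywhere there; a countable union of null sets is
    null. *)
Lemma fundamental_lemma : f = cst 0 %[ae mu in Om].
Proof.
have [F FO OmF] := open_bigcup_boxes openG.
have : forall n, {ae mu, forall x, F n x -> f x = 0}.
  move=> n; have [->|[a [b [c [d [ab cd sub FE]]]]]] := FO n; first exact: aeW.
  have mQ : measurable (F n : set (mplane R)) by rewrite FE; exact: measurable_obox.
  have FOm : F n `<=` Om.
    by rewrite FE; apply: subset_trans sub; exact: subset_obox_cbox.
  have fQ : mu.-integrable (F n) (EFin \o f) by apply: (integrableS mOm _ _ fi).
  have := @integral_ae_eq _ _ _ mu (F n) mQ (cst 0%E) (EFin \o f) fQ.
  move=> /(_ (measurable_cst _)).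
  have h E : E `<=` F n -> measurable (E : set (mplane R)) ->
      (\int[mu]_(x in E) (EFin \o f) x = \int[mu]_(x in E) (cst 0 x))%E.
    move=> EF mE; rewrite integral0.
    have := integral_obox0 ab cd sub mE; rewrite -FE setIidr//.
  move=> /(_ h); apply: filterS => x h1 Fx.
  by have [] := h1 Fx.
move=> /ae_foralln; apply: filterS => x h; rewrite {1}OmF => -[n _ Fx].
exact: h Fx.
Qed.

End fundamental_lemma.

(** * Integrals of derivatives of test functions *)

Section test_function_integral.
Context {R : realType} (G : graetz_data R).
Hypotheses (openG : open (Om G)) (areaG : (area (Om G) < +oo)%E).
Local Notation Om := (Om G).
Let mOm : measurable (Om : set (mplane R)) := measurable_open openG.

Lemma integral_derive_compact (g dg : R -> R) (M : R) : 0 < M ->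
  (forall x : R, is_derive x 1 g (dg x)) -> continuous dg ->
  (forall x, M <= `|x| -> g x = 0) -> (forall x, M < `|x| -> dg x = 0) ->
  (\int[lebesgue_measure]_x (dg x)%:E = 0)%E.
Proof.
move=> M0 dgP cdg g0 dg0; have mM : - M < M by lra.
have cg x : {for x, continuous g}.
  by apply/differentiable_continuous/derivable1_diffP; case: (dgP x).
rewrite (_ : (\int[_]_x _)%E = \int[lebesgue_measure]_(x in `[(- M)%R, M]) (dg x)%:E)%E; last first.
  rewrite [RHS]integral_mkcond; apply: eq_integral => x _; rewrite patchE.
  case: ifPn => // /negP; rewrite inE /= in_itv/= => /negP.
  by rewrite -ler_norml -ltNge => /dg0 ->; exact: erefl.
transitivity ((g M)%:E - (g (- M))%:E)%E; last first.
  by rewrite !g0 ?subee// ?normrN ger0_norm// ltW.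
apply: (continuous_FTC2 mM (F := g)).
- exact: continuous_subspaceT.
- split; [by move=> x _; case: (dgP x)|by apply: cvg_at_right_filter; exact: cg|].
  by apply: cvg_at_left_filter; exact: cg.
- by move=> x _; rewrite derive1E; case: (dgP x).
Qed.

Let support_bound (v : R * R -> R) : test_function G v -> exists M : R, 0 < M /\
  forall x y, M <= `|x| \/ M <= `|y| ->
  [/\ v (x, y) = 0, 'D_e1 v (x, y) = 0 & 'D_e2 v (x, y) = 0].
Proof.
move=> [_ [K [cK _ vK]]]; have [M [_ MK]] := compact_bounded cK.
exists (Num.max 1 (M + 2)); split; first by rewrite lt_max ltr01.
move=> x y xy; suff nK : ~ K (x, y).
  by split; [exact: vK|exact: test_derive_out vK nK|exact: test_derive_out vK nK].
move=> Kxy; have M1 : M < M + 1 by rewrite ltrDl.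
have := MK (M + 1) M1 _ Kxy; rewrite /= prod_normE /= ge_max => /andP[h1 h2].
by case: xy; rewrite ge_max => /andP[_ h]; lra.
Qed.

Let integral_Om_plane (f : R * R -> R) : (forall p, ~ Om p -> f p = 0) ->
  (\int[area]_(p in Om) (f p)%:E = \int[area]_p (f p)%:E)%E.
Proof.
move=> f0; rewrite [LHS]integral_mkcond; apply: eq_integral => p _.
by rewrite patchE; case: ifPn => // /negP; rewrite inE => /f0 ->; exact: erefl.
Qed.

Let integrable_Om_plane (f : R * R -> R) : (forall p, ~ Om p -> f p = 0) ->
  L2 area Om f -> area.-integrable setT (EFin \o f).
Proof.
move=> f0 Lf; have := L2_integrable mOm areaG Lf.
rewrite (integrable_mkcond _ mOm); apply: eq_integrable => // p _.
by rewrite patchE; case: ifPn => // /negP; rewrite inE => /f0 /= ->; exact: erefl.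
Qed.

(** Extend by zero to the plane and, by Fubini, integrate first in the direction of the derivative:
    each inner integral is a difference of two values outside the support. This gives constants a
    null weak gradient. *)
Lemma integral_derive_test v : test_function G v ->
  \int[area]_(p in Om) ('D_e1 v p) = 0 /\ \int[area]_(p in Om) ('D_e2 v p) = 0.
Proof.
move=> tv; have [L1 L2] := test_derive_L2 openG areaG tv.
have [M [M0 vM]] := support_bound tv.
have [[d1 d2 c1 c2] [K [cK KOm vK]]] := tv.
have out (e p : R * R) : ~ Om p -> 'D_e v p = 0.
  move=> Op; have := @test_derive_out R v e K p cK vK; by apply => /KOm.
split; rewrite /Rintegral integral_Om_plane; try exact: out.
- rewrite /area -integral21_prod_meas1; last exact: (integrable_Om_plane (out e1) L1).
  rewrite (_ : (\int[_]_x _)%E = 0%E)//; apply: integral0_eq => y _; rewrite /fubini_G.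
  apply: (@integral_derive_compact (fun x => v (x, y)) (fun x => 'D_e1 v (x, y)) M) => //.
  + by move=> x; apply: DeriveDef; rewrite -?derivable_slice1 ?derive_slice1.
  + move=> x; apply: (@continuous_comp _ _ _ (fun x => (x, y)) ('D_e1 v)); last exact: c1.
    by apply: (@cvg_pair _ _ _ _ (nbhs x) (nbhs y)); [exact: cvg_id|exact: cvg_cst].
  + by move=> x xM; have [] := vM x y (or_introl xM).
  + by move=> x /ltW xM; have [] := vM x y (or_introl xM).
- rewrite /area -integral12_prod_meas1; last exact: (integrable_Om_plane (out e2) L2).
  rewrite (_ : (\int[_]_x _)%E = 0%E)//; apply: integral0_eq => x _; rewrite /fubini_F.
  apply: (@integral_derive_compact (fun y => v (x, y)) (fun y => 'D_e2 v (x, y)) M) => //.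
  + by move=> y; apply: DeriveDef; rewrite -?derivable_slice2 ?derive_slice2.
  + move=> y; apply: (@continuous_comp _ _ _ (fun y => (x, y)) ('D_e2 v)); last exact: c2.
    by apply: (@cvg_pair _ _ _ _ (nbhs x) (nbhs y)); [exact: cvg_cst|exact: cvg_id].
  + by move=> y yM; have [] := vM x y (or_intror yM).
  + by move=> y /ltW yM; have [] := vM x y (or_intror yM).
Qed.

End test_function_integral.

(** * Borel sets are measurable for the one-dimensional Hausdorff measure *)

Section hausdorff1_metric.
Context {R : realType}.
Implicit Types (A B X : set (R * R)) (x y : R * R) (d : R).
Local Open Scope ereal_scope.

Lemma diam_ge0 A : 0 <= diam A.
Proof. by apply: ereal_sup_ubound; left. Qed.

Lemma diam_set0 : diam (set0 : set (R * R)) = 0.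
Proof. rewrite /diam set0X image_set0 setU0; exact: ereal_sup1. Qed.

Lemma edist_le_diam A x y : A x -> A y -> (Defs.edist x y)%:E <= diam A.
Proof. by move=> Ax Ay; apply: ereal_sup_ubound; right; exists (x, y). Qed.

Lemma diam_le A (c : \bar R) : 0 <= c ->
  (forall x y, A x -> A y -> (Defs.edist x y)%:E <= c) -> diam A <= c.
Proof.
move=> c0 Ac; apply: ge_ereal_sup => _ [->//|[[x y] [/= Ax Ay] <-]]; exact: Ac.
Qed.

Lemma le_diam A B : A `<=` B -> diam A <= diam B.
Proof.
move=> AB; apply: diam_le => [|x y Ax Ay]; first exact: diam_ge0.
by apply: edist_le_diam; exact: AB.
Qed.

Lemma hausdorff1_pre_ge0 d A : 0 <= hausdorff1_pre d A.
Proof.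
apply: le_ereal_inf_tmp => _ [F _ <-]; apply: nneseries_ge0 => k _ _; exact: diam_ge0.
Qed.

Lemma hausdorff1_pre_le d A : (0 < d)%R -> hausdorff1_pre d A <= hausdorff1 A.
Proof. by move=> d0; apply: ereal_sup_ubound; exists d. Qed.

Lemma hausdorff1_pre_anti d d' A : (d <= d')%R ->
  hausdorff1_pre d' A <= hausdorff1_pre d A.
Proof.
move=> dd'; apply: le_ereal_inf_tmp => _ [F [AF Fd] <-]; apply: ereal_inf_lbound.
by exists F => //; split => // k; apply: (le_trans (Fd k)); rewrite lee_fin.
Qed.

(** A set of diameter at most [d < d0] cannot meet both [A] and [B], so a fine cover of the union
    splits into a cover of [A] and a cover of [B] without counting any piece twice. *)
Lemma hausdorff1_pre_separated A B d d0 : (d < d0)%R ->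
  (forall x y, A x -> B y -> (d0 <= Defs.edist x y)%R) ->
  hausdorff1_pre d A + hausdorff1_pre d B <= hausdorff1_pre d (A `|` B).
Proof.
move=> dd0 sep; apply: le_ereal_inf_tmp => _ [F [ABF Fd] <-].
have cover C : C `<=` A `|` B -> hausdorff1_pre d C <= \sum_(k <oo) diam (F k `&` C).
  move=> CAB; apply: ereal_inf_lbound; exists (fun k => F k `&` C) => //; split.
    by move=> x Cx; have [k _ Fk] := ABF x (CAB x Cx); exists k.
  by move=> k; apply: le_trans (Fd k); apply: le_diam; exact: subIsetl.
apply: (le_trans (leeD (cover A (@subsetUl _ _ _)) (cover B (@subsetUr _ _ _)))).
rewrite -nneseriesD; try by move=> *; exact: diam_ge0.
apply: lee_nneseries => [k _ _|k _]; first by rewrite adde_ge0// diam_ge0.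
have [->|/set0P[x [Fx Ax]]] := eqVneq (F k `&` A) set0.
  by rewrite diam_set0 add0e; apply: le_diam; exact: subIsetl.
have [->|/set0P[y [Fy By]]] := eqVneq (F k `&` B) set0.
  by rewrite diam_set0 adde0; apply: le_diam; exact: subIsetl.
have := le_trans (edist_le_diam Fx Fy) (Fd k); rewrite lee_fin leNgt.
by rewrite (lt_le_trans dd0)// sep.
Qed.

Lemma hausdorff1_separated A B d0 : (0 < d0)%R ->
  (forall x y, A x -> B y -> (d0 <= Defs.edist x y)%R) ->
  hausdorff1 A + hausdorff1 B <= hausdorff1 (A `|` B).
Proof.
move=> d00 sep; have [->|ABy] := eqVneq (hausdorff1 (A `|` B)) +oo; first exact: leey.
have ABfin : hausdorff1 (A `|` B) \is a fin_num.
  by rewrite ge0_fin_numE ?hausdorff1_ge0// ltey.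
have Bfin : hausdorff1 B \is a fin_num.
  rewrite ge0_fin_numE ?hausdorff1_ge0//; apply: (@le_lt_trans _ _ (hausdorff1 (A `|` B))).
    by apply: le_hausdorff1; exact: subsetUr.
  by rewrite ltey.
rewrite -leeBrDr//; apply: ge_ereal_sup => _ [d1 /= d10 <-]; rewrite leeBrDr//.
have d1fin : hausdorff1_pre d1 A \is a fin_num.
  rewrite ge0_fin_numE ?hausdorff1_pre_ge0//.
  apply: (@le_lt_trans _ _ (hausdorff1 (A `|` B))); last by rewrite ltey.
  apply: (le_trans (hausdorff1_pre_le _ d10)).
  by apply: le_hausdorff1; exact: subsetUl.
rewrite addeC -leeBrDr//; apply: ge_ereal_sup => _ [d2 /= d20 <-]; rewrite leeBrDr//.
(* One mesh at least as fine as [d1] and [d2], and below the distance [d0] of the two sets. *)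
pose d := (Num.min (Num.min d1 d2) (d0 / 2))%R.
have d_gt0 : (0 < d)%R by rewrite !lt_min d10 d20 divr_gt0.
have dd1 : (d <= d1)%R by rewrite /d !ge_min lexx.
have dd2 : (d <= d2)%R by rewrite /d !ge_min lexx orbT.
have dd0 : (d < d0)%R.
  by apply: (@le_lt_trans _ _ (d0 / 2)%R); [rewrite /d ge_min lexx orbT|lra].
apply: (@le_trans _ _ (hausdorff1_pre d B + hausdorff1_pre d A)).
  by apply: leeD; exact: hausdorff1_pre_anti.
rewrite addeC; apply: (le_trans (hausdorff1_pre_separated dd0 sep)).
exact: hausdorff1_pre_le.
Qed.

(* Caratheodory's criterion for metric outer measures, with slices of a function
   that is 1-Lipschitz for the Euclidean distance. *)
Lemma caratheodory_sublevel (u : R * R -> R) :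
  (forall x y, `|u x - u y| <= Defs.edist x y)%R ->
  hausdorff1.-caratheodory [set x | (u x <= 0)%R].
Proof.
move=> uL; set A := [set x | _]; pose mu := @hausdorff1 R.
have sepU B C (s t : R) : (t < s)%R -> (forall x, B x -> s <= u x)%R ->
    (forall x, C x -> u x <= t)%R -> mu B + mu C <= mu (B `|` C).
  move=> ts Bs Ct; apply: (@hausdorff1_separated _ _ (s - t)); first by rewrite subr_gt0.
  move=> x y Bx Cy; apply: le_trans (uL x y); apply: le_trans (ler_norm _).
  by apply: lerB; [exact: Bs|exact: Ct].
apply: le_caratheodory_measurable => X.
have [Xy|Xy] := eqVneq (mu X) +oo.
  by rewrite -[leRHS]/(mu X) Xy leey.
have Xfin : mu X \is a fin_num by rewrite ge0_fin_numE ?hausdorff1_ge0// ltey.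
pose inv (n : nat) : R := (n%:R^-1)%R.
have inv_gt0 n : (0 < n)%N -> (0 < inv n)%R by move=> n0; rewrite invr_gt0 ltr0n.
have inv_lt n m : (0 < n)%N -> (n < m)%N -> (inv m < inv n)%R.
  by move=> n0 nm; rewrite ltf_pV2 ?posrE ?ltr0n ?ltr_nat// (ltn_trans n0).
(* [S k] exhausts the part of [X] outside [A], and the shell [T j] lies between the levels
   [1 / (j + 2)] and [1 / (j + 1)]. The aim is that the measures of the shells are summable, so that
   what [S k] misses outside [A] becomes negligible. *)
pose S k := X `&` [set x | inv k.+1 <= u x]%R.
pose T j := X `&` [set x | inv j.+2 <= u x <= inv j.+1]%R.
have AS k : mu (X `&` A) + mu (S k) <= mu X.
  rewrite addeC; apply: le_trans (sepU _ _ (inv k.+1) 0%R _ _ _) _.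
  - exact: inv_gt0.
  - by move=> x [].
  - by move=> x [].
  - by apply: le_hausdorff1 => x [] [].
(* Neighbouring shells touch, but shells of one parity [o] are at positive distance and their
   measures add up to at most that of [X]. Each parity contributes one [mu X] to the bound
   [sumT]. *)
have partial o n : \sum_(j < n) mu (T (2 * j + o)%N) <=
    mu (if n is 0 then set0 else X `&` [set x | inv (2 * n + o)%N <= u x]%R).
  elim: n => [|n IH]; first by rewrite big_ord0 hausdorff1_ge0.
  rewrite big_ord_recr/=; apply: (le_trans (leeD2r _ IH)).
  case: n {IH} => [|n].
    rewrite [mu set0]hausdorff1_0 add0e; apply: le_hausdorff1 => x [Xx] /=.
    by rewrite muln0 add0n muln1 add2n => /andP[].
  apply: le_trans (sepU _ _ (inv (2 * n.+1 + o)%N) (inv (2 * n.+1 + o).+1%N) _ _ _) _.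
  - by apply: inv_lt; rewrite ?mulnS ?addSn.
  - by move=> x [].
  - by move=> x [_ /= /andP[]].
  - apply: le_hausdorff1 => x [] [Xx] /=.
      move=> h; split => //=; apply: le_trans h; apply: ltW; apply: inv_lt.
        by rewrite mulnS.
      by rewrite ltn_add2r ltn_pmul2l.
    by move=> /andP[h _]; split => //=; rewrite (mulnS 2 n.+1).
have partial_le o n : \sum_(j < n) mu (T (2 * j + o)%N) <= mu X.
  apply: (le_trans (partial o n)); apply: le_hausdorff1.
  by case: n => // n x [].
have sumT : \sum_(j <oo) mu (T j) <= mu X + mu X.
  apply: lime_le; first by apply: is_cvg_nneseries => *; exact: hausdorff1_ge0.
  apply: nearW => n; apply: (@le_trans _ _ (\sum_(j < 2 * n) mu (T j))).
    rewrite big_mkord -!(big_mkord predT (mu \o T)) (big_cat_nat (n := n) (p := 2 * n))//=.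
      by rewrite leeDl// sume_ge0// => *; exact: hausdorff1_ge0.
    by rewrite leq_pmull.
  rewrite (_ : \sum_(j < 2 * n) _ =
    \sum_(j < n) mu (T (2 * j + 0)%N) + \sum_(j < n) mu (T (2 * j + 1)%N)).
    by apply: leeD; exact: partial_le.
  rewrite -big_split/=; elim: n => [|n IH]; first by rewrite !big_ord0.
  have -> : (2 * n.+1 = (2 * n).+2)%N by rewrite mulnS.
  by rewrite !big_ord_recr/= IH addn0 addn1 -addeA.
have tail0 : \sum_(N <= j <oo) mu (T j) @[N --> \oo] --> 0.
  apply: nneseries_tail_cvg => [|k _]; last exact: hausdorff1_ge0.
  by apply: (le_lt_trans sumT); rewrite lte_add_pinfty// ltey.
have AC k : mu (X `&` ~` A) <= mu (S k) + \sum_(k <= j <oo) mu (T j).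
  have sub : X `&` ~` A `<=` S k `|` \bigcup_(j in ~` `I_k) T j.
    move=> x [Xx /= /negP]; rewrite -ltNge => ux.
    have [kx|xk] := leP (inv k.+1) (u x); [by left|right].
    have u0 : (0 <= (u x)^-1)%R by rewrite invr_ge0 ltW.
    (* The integer part [m] of [1 / u x] places [u x] between [1 / (m + 1)] and [1 / m], that is, in
       the shell of index [m - 1], which is at least [k]. *)
    have := truncn_itv u0; set m := Num.truncn _ => /andP[m1 m2].
    have km : (k < m)%N.
      by rewrite /m truncn_ge_nat// -[leLHS]invrK lef_pV2 ?posrE ?invr_gt0 ?ltr0n// ltW.
    exists m.-1; first by apply/negP; rewrite -leqNgt -ltnS prednK// (leq_ltn_trans _ km).
    split => //=; rewrite prednK ?(leq_ltn_trans _ km)//; apply/andP; split.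
      by rewrite invf_ple ?posrE ?ltr0n// ltW.
    by rewrite /inv -[leLHS]invrK lef_pV2 ?posrE ?invr_gt0 ?ltr0n// (leq_ltn_trans _ km).
  apply: (le_trans (le_hausdorff1 sub)).
  have := outer_measureU2 (@hausdorff1_outer R) (S k) (\bigcup_(j in ~` `I_k) T j).
  move=> /le_trans; apply; apply: leeD2l.
  exact: (outer_measure_sigma_subadditive_tail (@hausdorff1_outer R)).
apply/lee_addgt0Pr => e e0.
have [k _ /(_ k (leqnn k))] : \forall N \near \oo, \sum_(N <= j <oo) mu (T j) <= e%:E.
  have /fine_cvgP[f1 /cvgrPdist_lt/(_ _ e0) f2] := tail0.
  near=> N; rewrite -(@fineK _ (\sum_(N <= j <oo) _)); last by near: N.
  rewrite lee_fin ltW//; have : (`|0 - fine (\sum_(N <= j <oo) mu (T j))%E| < e)%R by near: N.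
  by rewrite sub0r normrN; apply: le_lt_trans; exact: ler_norm.
move=> ke; apply: (@le_trans _ _ (mu (X `&` A) + (mu (S k) + \sum_(k <= j <oo) mu (T j)))).
  by apply: leeD2l; exact: AC.
by rewrite addeA; apply: leeD.
Unshelve. all: by end_near. Qed.

Lemma le_hausdorff1_translate A p : hausdorff1 [set x | A (x + p)%R] <= hausdorff1 A.
Proof.
apply: ge_ereal_sup => _ [d d0 <-].
apply: le_trans (hausdorff1_pre_le A d0); apply: le_ereal_inf_tmp => _ [F [AF Fd] <-].
have dF k : diam [set x | F k (x + p)%R] <= diam (F k).
  apply: diam_le => [|x y Fx Fy]; first exact: diam_ge0.
  have -> : Defs.edist x y = Defs.edist (x + p)%R (y + p)%R.
    by rewrite /Defs.edist/=; congr (Num.sqrt (_ ^+ 2 + _ ^+ 2)); lra.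
  exact: edist_le_diam.
apply: (@le_trans _ _ (\sum_(k <oo) diam [set x | F k (x + p)%R])).
  apply: ereal_inf_lbound; exists (fun k => [set x | F k (x + p)%R]) => //; split.
    by move=> x /AF[k _ Fk]; exists k.
  by move=> k; exact: le_trans (dF k) (Fd k).
by apply: lee_nneseries => [k _ _|k _]; [exact: diam_ge0|exact: dF].
Qed.

End hausdorff1_metric.

Notation bplane R := (caratheodory_type (@hausdorff1_outer R)) (only parsing).

Section borel_caratheodory.
Context {R : realType}.

Lemma le_edist1 (x y : R * R) : `|x.1 - y.1| <= Defs.edist x y.
Proof. by rewrite -sqrtr_sqr ler_wsqrtr// lerDl sqr_ge0. Qed.

Lemma le_edist2 (x y : R * R) : `|x.2 - y.2| <= Defs.edist x y.
Proof. by rewrite -sqrtr_sqr ler_wsqrtr// lerDr sqr_ge0. Qed.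

(** A box is an intersection of four half planes, and affine functions of one coordinate with slope
    1 or -1 are 1-Lipschitz. *)
Lemma measurable_obox_arclength (a b c d : R) :
  measurable (obox a b c d : set (bplane R)).
Proof.
have half (u : R * R -> R) : (forall x y, `|u x - u y| <= Defs.edist x y) ->
    measurable ([set x | 0 < u x] : set (bplane R)).
  move=> uL; rewrite (_ : [set x | _] = ~` [set x | u x <= 0]).
    by apply: measurableC; exact: caratheodory_sublevel.
  by apply/seteqP; split => x /=; rewrite ltNge => /negP.
rewrite (_ : obox a b c d = [set x | 0 < x.1 - a] `&` [set x | 0 < b - x.1] `&`
    ([set x | 0 < x.2 - c] `&` [set x | 0 < d - x.2])); last first.
  apply/seteqP; split => x; rewrite /obox/= !in_itv/= !subr_gt0.
    by move=> [/andP[-> ->] /andP[-> ->]].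
  by move=> [[-> ->] [-> ->]].
apply: measurableI; apply: measurableI; apply: half => x y.
- by rewrite opprB addrA subrK le_edist1.
- rewrite (_ : _ - _ = y.1 - x.1); last by lra.
  by rewrite distrC le_edist1.
- by rewrite opprB addrA subrK le_edist2.
- rewrite (_ : _ - _ = y.2 - x.2); last by lra.
  by rewrite distrC le_edist2.
Qed.

Lemma continuous_measurable_arclength (f : R * R -> R) (D : set (bplane R)) :
  measurable D -> continuous f -> measurable_fun D (f : bplane R -> R).
Proof.
move=> mD cf.
apply: measurable_funS (@measurable_fun_continuous _ _ (bplane R) id f _ cf) => //.
move=> O /open_bigcup_boxes[F FO ->]; apply: bigcup_measurable => n _.
have [->|[a [b [c [d [_ _ _ ->]]]]]] := FO n; first exact: measurable0.
exact: measurable_obox_arclength.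
Qed.

End borel_caratheodory.

(** * Almost everywhere equality, L^2 limits and weighted products *)

Section almost_everywhere.
Context d (T : measurableType d) (R : realType) (mu : {measure set T -> \bar R}).

Lemma aeS (P Q : T -> Prop) : {ae mu, forall x, P x} -> (forall x, P x -> Q x) ->
  {ae mu, forall x, Q x}.
Proof. by move=> aP PQ; apply: filterS aP. Qed.

Lemma aeS2 (P Q S : T -> Prop) : {ae mu, forall x, P x} -> {ae mu, forall x, Q x} ->
  (forall x, P x -> Q x -> S x) -> {ae mu, forall x, S x}.
Proof. by move=> aP aQ PQS; apply: filterS2 aP aQ. Qed.

Lemma ae_eq_refl_in (D : set T) (f : T -> R) : f = f %[ae mu in D].
Proof. exact: aeW. Qed.

Lemma ae_eq_sym_in (D : set T) (f g : T -> R) : f = g %[ae mu in D] -> g = f %[ae mu in D].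
Proof. by move=> fg; apply: aeS fg _ => x h Dx; rewrite h. Qed.

Lemma ae_eq_trans_in (D : set T) (f g h : T -> R) : f = g %[ae mu in D] ->
  g = h %[ae mu in D] -> f = h %[ae mu in D].
Proof. by move=> fg gh; apply: aeS2 fg gh _ => x h1 h2 Dx; rewrite h1// h2. Qed.

Lemma ae_sub0 (D : set T) (f g : T -> R) : f - g = cst 0 %[ae mu in D] ->
  f = g %[ae mu in D].
Proof.
move=> fg; apply: aeS fg _ => x h Dx; apply/eqP; rewrite -subr_eq0; apply/eqP.
exact: h Dx.
Qed.

End almost_everywhere.

Section L2_convergence.
Context d (T : measurableType d) (R : realType).
Variables (mu : {measure set T -> \bar R}) (D : set T).
Hypothesis mD : measurable D.
Implicit Types f g w : T -> R.
Local Notation L2 := (L2 mu D).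
Local Notation norm2 := (norm2 mu D).

(** The L^2 norm as a real number. It is meaningful on [L2] only, where it agrees with [norm2]; a
    function outside [L2] may well be given a finite value. *)
Definition n2 f : R := Num.sqrt (dot2 mu D f f).

Lemma norm2_n2 f : L2 f -> norm2 f = (n2 f)%:E.
Proof. exact: norm2_dot2. Qed.

Lemma n2_ge0 f : 0 <= n2 f. Proof. exact: sqrtr_ge0. Qed.

Lemma norm2_cvg0 {Z : Type} (F : set_system Z) {FF : Filter F} (u : Z -> T -> R) :
  (\forall z \near F, measurable_fun D (u z)) ->
  norm2 (u z) @[z --> F] --> 0%E ->
  (\forall z \near F, L2 (u z)) /\ n2 (u z) @[z --> F] --> 0.
Proof.
move=> mu_ /fine_cvgP[fin u0].
have Lu : \forall z \near F, L2 (u z).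
  by apply: filterS2 mu_ fin => z mz; rewrite fin_numE => /andP[_ fz]; apply: norm2_L2;
    rewrite // ltey.
split=> //; apply: cvg_trans u0; apply: near_eq_cvg.
by apply: filterS Lu => z Lz; rewrite /= norm2_n2.
Qed.

Lemma n2_cvg0 {Z : Type} (F : set_system Z) {FF : Filter F} (u : Z -> T -> R) :
  (\forall z \near F, L2 (u z)) -> n2 (u z) @[z --> F] --> 0 ->
  norm2 (u z) @[z --> F] --> 0%E.
Proof.
move=> Lu u0; apply/fine_cvgP; split.
  by apply: filterS Lu => z Lz; rewrite norm2_n2.
apply: cvg_trans u0; apply: near_eq_cvg.
by apply: filterS Lu => z Lz; rewrite /= norm2_n2.
Qed.

Lemma ae_eq_norm2_measurable f g : measurable_fun D f -> measurable_fun D g ->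
  f = g %[ae mu in D] -> norm2 f = norm2 g.
Proof.
move=> mf mg fg; rewrite !norm2E//; congr (_ `^ _)%E; apply: ae_eq_integral => //.
- exact: measurable_sqr.
- exact: measurable_sqr.
- by apply: filterS fg => x h Dx; rewrite h.
Qed.

Lemma ae_eq_n2 f g : L2 f -> L2 g -> f = g %[ae mu in D] -> n2 f = n2 g.
Proof. by move=> Lf Lg fg; congr Num.sqrt; exact: eq_dot2. Qed.

Lemma L2B f g : L2 f -> L2 g -> L2 (f - g).
Proof. exact: (hilbB (preinner_L2 mu mD)). Qed.

Lemma L2D f g : L2 f -> L2 g -> L2 (f + g).
Proof. exact: (hilbD (preinner_L2 mu mD)). Qed.

Lemma L2Z k f : L2 f -> L2 (k *: f).
Proof. exact: (hilbZ (preinner_L2 mu mD)). Qed.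

Lemma ler_n2D f g : L2 f -> L2 g -> n2 (f + g) <= n2 f + n2 g.
Proof. exact: (ler_nrmD (preinner_L2 mu mD)). Qed.

Lemma n2Z k f : L2 f -> n2 (k *: f) = `|k| * n2 f.
Proof. exact: (nrmZ (preinner_L2 mu mD)). Qed.

Lemma ler_n2_dist f g h : L2 f -> L2 g -> L2 h -> n2 (f - h) <= n2 (f - g) + n2 (g - h).
Proof. exact: (ler_nrm_dist (preinner_L2 mu mD)). Qed.

Lemma n2_distC f g : L2 f -> L2 g -> n2 (f - g) = n2 (g - f).
Proof. exact: (nrm_distC (preinner_L2 mu mD)). Qed.

Lemma n2_null f : L2 f -> n2 f = 0 -> f = cst 0 %[ae mu in D].
Proof. exact: dot2_null. Qed.

Lemma norm2_lin_cvg0 {Z : Type} (F : set_system Z) {FF : Filter F} a (u v : Z -> T -> R) f g :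
  L2 f -> L2 g -> (\forall z \near F, L2 (u z)) -> (\forall z \near F, L2 (v z)) ->
  n2 (u z - f) @[z --> F] --> 0 -> n2 (v z - g) @[z --> F] --> 0 ->
  norm2 (a *: u z + v z - (a *: f + g)) @[z --> F] --> 0%E.
Proof.
move=> Lf Lg Lu Lv uf vg; apply: n2_cvg0.
  by apply: filterS2 Lu Lv => z h1 h2; apply: L2B; exact: L2_lin.
apply: (@cvg_dist_le _ _ _ _ _ (fun z => `|a| * n2 (u z - f) + n2 (v z - g))).
  apply: filterS2 Lu Lv => z h1 h2; rewrite subr0 ger0_norm ?n2_ge0//.
  rewrite opprD addrACA -scalerBr -n2Z; last exact: L2B.
  by apply: ler_n2D; [apply: L2Z|]; exact: L2B.
rewrite -[X in _ --> X]addr0; apply: cvgD => //; exact: cvgZ0.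
Qed.

(** The common form of the integrals against [c], [sigma], [a] and [h]. The first three weights are
    nonnegative and give semi-inner products; [h] has no sign and only gives a bounded symmetric
    form. *)
Definition wdot w f g : R := \int[mu]_(x in D) (w x * f x * g x).

Variables (w : T -> R) (M : R).
Hypotheses (mw : measurable_fun D w) (wM : {ae mu, forall x, D x -> `|w x| <= M}).

Lemma wdot_dot2 f g : wdot w f g = dot2 mu D (fun x => w x * f x) g.
Proof. by []. Qed.

Lemma L2_weight f : L2 f -> L2 (fun x => w x * f x).
Proof. exact: (L2_bmul mD mw wM). Qed.

Lemma wdot_integrable f g : L2 f -> L2 g ->
  mu.-integrable D (EFin \o (fun x => w x * f x * g x)).
Proof. by move=> Lf Lg; exact: L2_mul_integrable (L2_weight Lf) Lg. Qed.

Lemma wdot_lin a f g h : L2 f -> L2 g -> L2 h ->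
  wdot w (a *: f + g) h = a * wdot w f h + wdot w g h.
Proof.
move=> Lf Lg Lh; rewrite !wdot_dot2.
rewrite -(hilb_dotl (preinner_L2 mu mD)) //; try exact: L2_weight.
apply: eq_Rintegral => x _; congr (_ * _).
by rewrite -[RHS]/(a * (w x * f x) + w x * g x) -[(_ + _) x]/(a * f x + g x); ring.
Qed.

Lemma wdotC f g : wdot w f g = wdot w g f.
Proof. by apply: eq_Rintegral => x _; rewrite mulrAC. Qed.

Lemma eq_wdot f f' g g' : L2 f -> L2 f' -> L2 g -> L2 g' ->
  f = f' %[ae mu in D] -> g = g' %[ae mu in D] -> wdot w f g = wdot w f' g'.
Proof.
move=> Lf Lf' Lg Lg' ff' gg'; rewrite !wdot_dot2; apply: eq_dot2 => //; try exact: L2_weight.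
by apply: filterS ff' => x h Dx; rewrite h.
Qed.

Lemma wdot_bound f g : 0 <= M -> L2 f -> L2 g -> `|wdot w f g| <= M * n2 f * n2 g.
Proof.
move=> M0 Lf Lg; rewrite wdot_dot2.
apply: (le_trans (dot_cauchy_schwarz (preinner_L2 mu mD) (L2_weight Lf) Lg)).
apply: ler_wpM2r; first exact: n2_ge0.
rewrite -[M]ger0_norm// -sqrtr_sqr -sqrtrM ?sqr_ge0//; apply: ler_wsqrtr.
rewrite /dot2 -RintegralZl//; last exact: L2_mul_integrable.
rewrite /Rintegral fine_le ?integrable_fin_num//.
- by apply: L2_mul_integrable => //; exact: L2_weight.
- by apply: integrable_EFinZ => //; exact: L2_mul_integrable.
apply: ae_ge0_le_integral => //.
- by move=> x _; rewrite lee_fin -expr2 sqr_ge0.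
- by apply: (measurable_int _ (L2_mul_integrable mD (L2_weight Lf) (L2_weight Lf))).
- by move=> x _; rewrite lee_fin -expr2 mulr_ge0 ?sqr_ge0.
- by apply: (measurable_int _ (integrable_EFinZ mD _ (L2_mul_integrable mD Lf Lf))).
apply: filterS wM => x h Dx; rewrite lee_fin.
rewrite (_ : _ * _ = w x ^+ 2 * (f x * f x)); last by ring.
rewrite ler_wpM2r// -?expr2 ?sqr_ge0// -real_normK ?num_real//.
by rewrite lerXn2r ?nnegrE ?h.
Qed.

Hypothesis w0 : {ae mu, forall x, D x -> 0 <= w x}.

Lemma wdot_ge0 f : L2 f -> 0 <= wdot w f f.
Proof.
move=> Lf; rewrite /wdot /Rintegral.
(* The weight is nonnegative only almost everywhere, whereas positivity of the integral is proved
   pointwise; its positive part gives the same integral. *)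
rewrite (@ae_eq_integral _ _ _ mu D (fun x => (Num.max 0 (w x) * f x * f x)%:E))//.
- apply: fine_ge0; apply: integral_ge0 => x _.
  by rewrite lee_fin -mulrA mulr_ge0 -?expr2 ?sqr_ge0// le_max lexx.
- by apply: (measurable_int _ (wdot_integrable Lf Lf)).
- apply/measurable_EFinP; have mf := L2_measurable mD Lf.
  apply: measurable_funM => //; apply: measurable_funM => //.
  exact: measurable_maxr.
- by apply: filterS w0 => x h Dx; rewrite max_r// h.
Qed.

Lemma preinner_wdot : preinner L2 (wdot w).
Proof.
split.
- exact: L2_0.
- by move=> a f g; exact: L2_lin.
- by move=> f g _ _; exact: wdotC.
- by move=> a f g h; exact: wdot_lin.
- exact: wdot_ge0.
Qed.

Lemma wdot_lower m f : 0 < m -> {ae mu, forall x, D x -> m <= w x} -> L2 f ->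
  m * n2 f ^+ 2 <= wdot w f f.
Proof.
move=> m0 mw_ Lf; rewrite (nrm2E (preinner_L2 mu mD) Lf) /dot2.
rewrite -RintegralZl//; last exact: L2_mul_integrable.
rewrite /wdot /Rintegral fine_le ?integrable_fin_num//.
- by apply: integrable_EFinZ => //; exact: L2_mul_integrable.
- exact: wdot_integrable.
rewrite [leRHS](@ae_eq_integral _ _ _ mu D (fun x => (Num.max 0 (w x) * f x * f x)%:E))//.
- apply: ae_ge0_le_integral => //.
  + by move=> x _; rewrite lee_fin mulr_ge0 ?(ltW m0)// -expr2 sqr_ge0.
  + by apply: (measurable_int _ (integrable_EFinZ mD _ (L2_mul_integrable mD Lf Lf))).
  + by move=> x _; rewrite lee_fin -mulrA mulr_ge0 -?expr2 ?sqr_ge0// le_max lexx.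
  + apply/measurable_EFinP; have mf := L2_measurable mD Lf.
    apply: measurable_funM => //; apply: measurable_funM => //.
    exact: measurable_maxr.
  + apply: filterS mw_ => x h Dx; rewrite lee_fin -mulrA ler_wpM2r -?expr2 ?sqr_ge0//.
    by rewrite le_max h// orbT.
- by apply: (measurable_int _ (wdot_integrable Lf Lf)).
- apply/measurable_EFinP; have mf := L2_measurable mD Lf.
  apply: measurable_funM => //; apply: measurable_funM => //.
  exact: measurable_maxr.
- by apply: filterS w0 => x h Dx; rewrite max_r// h.
Qed.

End L2_convergence.

(** * Weak gradients *)

Section gradients_traces.
Context {R : realType} (G : graetz_data R) (setting : graetz_setting G).
Local Notation fn := (R * R -> R).
Local Notation Om := (Om G).
Local Notation bdry := (bdry G).
Local Notation nO := (n2 (@area R) Om).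
Local Notation nB := (n2 (@arclength R) bdry).
Implicit Types (s v w g : fn) (p q : fn * fn).

Lemma Om_measurable : measurable (Om : set (mplane R)).
Proof. exact: measurable_open (Om_open setting). Qed.
Local Notation mOm := Om_measurable.

Lemma GD_measurable : measurable (GD G : set (bplane R)).
Proof. by have [] := boundary_measurable setting. Qed.

Lemma GR_measurable : measurable (GR G : set (bplane R)).
Proof. by have [] := boundary_measurable setting. Qed.

Lemma bdry_measurable : measurable (bdry : set (bplane R)).
Proof.
rewrite -(boundary_parts setting); have [? ? ? ?] := boundary_measurable setting.
by apply: measurableU => //; apply: measurableU => //; apply: measurableU.
Qed.
Local Notation mB := bdry_measurable.

Lemma C1_measurable_Om w : C1 w ->
  [/\ measurable_fun (Om : set (mplane R)) (w : mplane R -> R),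
      measurable_fun (Om : set (mplane R)) ('D_e1 w : mplane R -> R),
      measurable_fun (Om : set (mplane R)) ('D_e2 w : mplane R -> R) &
      measurable_fun (bdry : set (bplane R)) (w : bplane R -> R)].
Proof.
move=> C1w; have cw := C1_continuous C1w; have [_ _ c1 c2] := C1w.
split; [exact: continuous_measurable_plane mOm cw|exact: continuous_measurable_plane mOm c1
  |exact: continuous_measurable_plane mOm c2|exact: continuous_measurable_arclength mB cw].
Qed.

(** The difference of two weak gradients integrates to zero against all test functions, so the
    fundamental lemma applies to each component. *)
Lemma weak_grad_uniq s p q : weak_grad G s p -> weak_grad G s q ->
  p.1 = q.1 %[ae area in Om] /\ p.2 = q.2 %[ae area in Om].
Proof.
move=> [Lp1 Lp2 hp] [Lq1 Lq2 hq].
have PI := preinner_L2 (@area R) mOm.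
have W (f g : fn) : L2 area Om f -> L2 area Om g ->
    (forall v, test_function G v -> dot2 area Om f v = dot2 area Om g v) ->
    f = g %[ae area in Om].
  move=> Lf Lg fg; have := @fundamental_lemma _ G (Om_open setting) (Om_area setting) (f - g).
  move=> /(_ (L2B mOm Lf Lg)) h.
  apply: ae_sub0; apply: h => v tv; have Lv := test_L2 (Om_open setting) (Om_area setting) tv.
  by rewrite -[LHS]/(dot2 area Om (f - g) v) (dotBl PI)// fg// subrr.
split; apply: W => // v tv.
  by have [h1 _] := hp v tv; have [h2 _] := hq v tv; apply: oppr_inj; rewrite -h1 h2.
by have [_ h1] := hp v tv; have [_ h2] := hq v tv; apply: oppr_inj; rewrite -h1 h2.
Qed.

Lemma H1_weak_grad s : H1 G s -> weak_grad G s (grad G s).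
Proof. by move=> [_ [p sp]]; exact: (@xgetPex _ 0 [set p | weak_grad G s p]) (ex_intro _ p sp). Qed.

Lemma weak_grad_ae s p : weak_grad G s p ->
  (grad G s).1 = p.1 %[ae area in Om] /\ (grad G s).2 = p.2 %[ae area in Om].
Proof.
move=> sp; apply: (weak_grad_uniq _ sp).
exact: (@xgetPex _ 0 [set p | weak_grad G s p]) (ex_intro _ p sp).
Qed.

Lemma weak_grad_lin a s v p q : L2 area Om s -> L2 area Om v ->
  weak_grad G s p -> weak_grad G v q -> weak_grad G (a *: s + v) (a *: p + q).
Proof.
move=> Ls Lv [Lp1 Lp2 hp] [Lq1 Lq2 hq].
have PI := preinner_L2 (@area R) mOm.
split; [exact: (L2_lin mOm _ Lp1 Lq1)|exact: (L2_lin mOm _ Lp2 Lq2)|move=> u tu].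
have Lu := test_L2 (Om_open setting) (Om_area setting) tu.
have [Lu1 Lu2] := test_derive_L2 (Om_open setting) (Om_area setting) tu.
have [hp1 hp2] := hp u tu; have [hq1 hq2] := hq u tu.
have {}hp1 : dot2 area Om s ('D_e1 u) = - dot2 area Om p.1 u := hp1.
have {}hp2 : dot2 area Om s ('D_e2 u) = - dot2 area Om p.2 u := hp2.
have {}hq1 : dot2 area Om v ('D_e1 u) = - dot2 area Om q.1 u := hq1.
have {}hq2 : dot2 area Om v ('D_e2 u) = - dot2 area Om q.2 u := hq2.
split.
- rewrite -[LHS]/(dot2 area Om (a *: s + v) ('D_e1 u)).
  rewrite -[X in - X]/(dot2 area Om (a *: p.1 + q.1) u) !(hilb_dotl PI)//.
  by rewrite hp1 hq1 opprD mulrN.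
- rewrite -[LHS]/(dot2 area Om (a *: s + v) ('D_e2 u)).
  rewrite -[X in - X]/(dot2 area Om (a *: p.2 + q.2) u) !(hilb_dotl PI)//.
  by rewrite hp2 hq2 opprD mulrN.
Qed.

Lemma weak_grad0 : weak_grad G 0 0.
Proof.
have PI := preinner_L2 (@area R) mOm.
split; [exact: (L2_0 _ mOm)|exact: (L2_0 _ mOm)|move=> u tu].
have Lu := test_L2 (Om_open setting) (Om_area setting) tu.
have [Lu1 Lu2] := test_derive_L2 (Om_open setting) (Om_area setting) tu.
rewrite -[X in - X]/(dot2 area Om 0 u) (dot0l PI)// oppr0.
by split; [exact: (dot0l PI Lu1)|exact: (dot0l PI Lu2)].
Qed.

Lemma H1_0 : H1 G 0.
Proof. by split; [exact: (L2_0 _ mOm)|exists 0; exact: weak_grad0]. Qed.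

Lemma H1_lin a s v : H1 G s -> H1 G v -> H1 G (a *: s + v).
Proof.
move=> Hs Hv; split; first exact: (L2_lin mOm _ Hs.1 Hv.1).
exists (a *: grad G s + grad G v); apply: weak_grad_lin; try exact: H1_weak_grad.
  exact: Hs.1.
exact: Hv.1.
Qed.

Lemma L2_grad1 s : H1 G s -> L2 area Om (grad G s).1.
Proof. by move=> /H1_weak_grad[]. Qed.

Lemma L2_grad2 s : H1 G s -> L2 area Om (grad G s).2.
Proof. by move=> /H1_weak_grad[]. Qed.

Lemma grad_lin a s v : H1 G s -> H1 G v ->
  (grad G (a *: s + v)).1 = a *: (grad G s).1 + (grad G v).1 %[ae area in Om] /\
  (grad G (a *: s + v)).2 = a *: (grad G s).2 + (grad G v).2 %[ae area in Om].
Proof.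
move=> Hs Hv; apply: (@weak_grad_ae _ (a *: grad G s + grad G v)).
by apply: weak_grad_lin Hs.1 Hv.1 _ _; exact: H1_weak_grad.
Qed.

(** Stated as an equality of predicates: the choice made in [grad] then returns the very same pair
    for functions that agree almost everywhere ([ae_eq_grad]). *)
Lemma weak_grad_ae_eq s s' : L2 area Om s -> L2 area Om s' ->
  s = s' %[ae area in Om] -> weak_grad G s = weak_grad G s'.
Proof.
have W t t' p : L2 area Om t -> L2 area Om t' ->
    t = t' %[ae area in Om] -> weak_grad G t p -> weak_grad G t' p.
  move=> Lt Lt' tt' [Lp1 Lp2 hp]; split => // u tu.
  have [Lu1 Lu2] := test_derive_L2 (Om_open setting) (Om_area setting) tu.
  have [<- <-] := hp u tu.
  by split; apply: (eq_dot2 mOm) => //; (exact: ae_eq_sym_in || exact: ae_eq_refl_in).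
move=> Ls Ls' ss'; apply/funext => p; apply/propext; split; first exact: W.
by apply: W => //; exact: ae_eq_sym_in.
Qed.

Lemma ae_eq_grad s s' : L2 area Om s -> L2 area Om s' ->
  s = s' %[ae area in Om] -> grad G s = grad G s'.
Proof. by move=> Ls Ls' /(weak_grad_ae_eq Ls Ls') E; rewrite /grad E. Qed.

Lemma ae_eq_H1 s s' : L2 area Om s -> L2 area Om s' ->
  s = s' %[ae area in Om] -> H1 G s -> H1 G s'.
Proof.
move=> Ls Ls' /(weak_grad_ae_eq Ls Ls') E [_ [p sp]]; split => //.
by exists p; rewrite -E.
Qed.

(** As for gradients, the two predicates [is_trace] coincide, so the chosen traces are equal and not
    merely equal almost everywhere. *)
Lemma ae_eq_trace s s' : L2 area Om s -> L2 area Om s' ->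
  s = s' %[ae area in Om] -> trace G s = trace G s'.
Proof.
have W t t' g : L2 area Om t -> L2 area Om t' ->
    t = t' %[ae area in Om] -> is_trace G t g -> is_trace G t' g.
  move=> Lt Lt' tt' [Lg [w_ [C1w w0 w1 w2 wb]]]; split; first exact: Lg.
  exists w_; split; [exact: C1w| |..|exact: wb].
  - have E n : norm2 area Om (w_ n - t') = norm2 area Om (w_ n - t).
      have [mw _ _ _] := C1_measurable_Om (C1w n).
      apply: (ae_eq_norm2_measurable mOm).
      + exact: (measurable_funB mw (L2_measurable mOm Lt')).
      + exact: (measurable_funB mw (L2_measurable mOm Lt)).
      + apply: aeS tt' _ => x h Ox.
        by rewrite -[LHS]/(w_ n x - t' x) -[RHS]/(w_ n x - t x) h.
    by under eq_fun do rewrite E.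
  - by rewrite -(ae_eq_grad Lt Lt' tt').
  - by rewrite -(ae_eq_grad Lt Lt' tt').
move=> Ls Ls' ss'; suff E : is_trace G s = is_trace G s' by rewrite /trace E.
apply/funext => g; apply/propext.
by split; [exact: (W _ _ _ Ls Ls' ss')|exact: (W _ _ _ Ls' Ls (ae_eq_sym_in ss'))].
Qed.

(* The convergence of the approximations of a trace, in terms of real norms. *)
Lemma is_trace_approx s g : H1 G s -> is_trace G s g -> exists w_ : nat -> fn,
  [/\ forall n, C1 (w_ n),
      \forall n \near \oo, [/\ L2 area Om (w_ n), L2 area Om ('D_e1 (w_ n)),
        L2 area Om ('D_e2 (w_ n)) & L2 arclength bdry (w_ n)],
      nO (w_ n - s) @[n --> \oo] --> 0,
      nO ('D_e1 (w_ n) - (grad G s).1) @[n --> \oo] --> 0 &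
      nO ('D_e2 (w_ n) - (grad G s).2) @[n --> \oo] --> 0 /\
      nB (w_ n - g) @[n --> \oo] --> 0].
Proof.
move=> Hs [Lg [w_ [C1w w0 w1 w2 wb]]]; exists w_.
have mw n := C1_measurable_Om (C1w n).
have [[Ls L1] L2'] := (Hs.1, L2_grad1 Hs, L2_grad2 Hs).
have [|L0n c0] := norm2_cvg0 mOm _ w0.
  apply: nearW => n; have [m0 _ _ _] := mw n.
  exact: (measurable_funB m0 (L2_measurable mOm Ls)).
have [|L1n c1] := norm2_cvg0 mOm _ w1.
  apply: nearW => n; have [_ m1 _ _] := mw n.
  exact: (measurable_funB m1 (L2_measurable mOm L1)).
have [|L2n c2] := norm2_cvg0 mOm _ w2.
  apply: nearW => n; have [_ _ m2 _] := mw n.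
  exact: (measurable_funB m2 (L2_measurable mOm L2')).
have [|Lbn cb] := norm2_cvg0 mB _ wb.
  apply: nearW => n; have [_ _ _ mb] := mw n.
  exact: (measurable_funB mb (L2_measurable mB Lg)).
split => //; near=> n.
have h0 : L2 area Om (w_ n - s) by near: n.
have h1 : L2 area Om ('D_e1 (w_ n) - (grad G s).1) by near: n.
have h2 : L2 area Om ('D_e2 (w_ n) - (grad G s).2) by near: n.
have hb : L2 arclength bdry (w_ n - g) by near: n.
split.
- by rewrite -(subrK s (w_ n)); exact: (L2D mOm).
- by rewrite -(subrK (grad G s).1 ('D_e1 (w_ n))); exact: (L2D mOm).
- by rewrite -(subrK (grad G s).2 ('D_e2 (w_ n))); exact: (L2D mOm).
- by rewrite -(subrK g (w_ n)); exact: (L2D mB).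
Unshelve. all: by end_near. Qed.

End gradients_traces.

(** * Traces and the space [V] *)

Section space_V.
Context {R : realType} (G : graetz_data R) (setting : graetz_setting G).
Local Notation fn := (R * R -> R).
Local Notation Om := (Om G).
Local Notation bdry := (bdry G).
Local Notation nO := (n2 (@area R) Om).
Local Notation nB := (n2 (@arclength R) bdry).
Implicit Types (s v w g : fn) (p q : fn * fn).
Local Notation mOm := (Om_measurable setting).
Local Notation mB := (bdry_measurable setting).

(** The inequality assumed for C^1 functions passes to the limit along the approximations that
    define a trace. *)
Lemma trace_bound : exists2 K : R, 0 < K & forall s g, H1 G s -> is_trace G s g ->
  nB g <= K * (nO s + nO (grad G s).1 + nO (grad G s).2).
Proof.
have [_ [K K0 hK]] := traces_exist setting; exists K => // s g Hs sg.
have sum3 (a b c a' b' c' ea eb ec : R) : a <= ea + a' -> b <= eb + b' -> c <= ec + c' ->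
    a + b + c <= a' + b' + c' + (ea + eb + ec) by lra.
have [w_ [C1w Lw c0 c1 [c2 cb]]] := is_trace_approx setting Hs sg.
have Lg := sg.1; have Ls := Hs.1; have L1 := L2_grad1 Hs; have L2 := L2_grad2 Hs.
apply: (@ler_cvg0 _ _ \oo _ _ _ (fun n => K * (nO (w_ n - s) +
  nO ('D_e1 (w_ n) - (grad G s).1) + nO ('D_e2 (w_ n) - (grad G s).2)) + nB (w_ n - g))).
  apply: filterS Lw => n [Lw0 Lw1 Lw2 Lwb].
  have := hK _ (C1w n); rewrite !norm2_n2// ?(bdry_measurable setting)//; try exact: mOm; try exact: mB.
  rewrite -!EFinD -EFinM lee_fin => hn.
  have h0 := ler_n2D mOm (L2B mOm Lw0 Ls) Ls; rewrite subrK in h0.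
  have h1 := ler_n2D mOm (L2B mOm Lw1 L1) L1; rewrite subrK in h1.
  have h2 := ler_n2D mOm (L2B mOm Lw2 L2) L2; rewrite subrK in h2.
  have := ler_n2D mB (L2B mB Lg Lwb) Lwb; rewrite subrK (n2_distC mB Lg Lwb) => hg.
  apply: (le_trans hg); rewrite [leLHS]addrC [leRHS]addrA lerD2r -mulrDr.
  apply: (le_trans hn); apply: ler_wpM2l; first exact: ltW.
  exact: sum3 h0 h1 h2.
rewrite -[X in _ --> X]addr0; apply: cvgD => //; apply: cvgZ0.
by rewrite -[X in _ --> X]addr0 -[X in _ --> X + _]addr0; apply: cvgD => //; apply: cvgD.
Qed.

Lemma is_trace_lin a s v g h : H1 G s -> H1 G v -> is_trace G s g -> is_trace G v h ->
  is_trace G (a *: s + v) (a *: g + h).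
Proof.
move=> Hs Hv sg vh.
have [w_ [C1w Lw c0 c1 [c2 cb]]] := is_trace_approx setting Hs sg.
have [u_ [C1u Lu d0 d1 [d2 db]]] := is_trace_approx setting Hv vh.
have Lg := sg.1; have Lh := vh.1.
have Ls := Hs.1; have L1 := L2_grad1 Hs; have L2 := L2_grad2 Hs.
have Lv := Hv.1; have M1 := L2_grad1 Hv; have M2 := L2_grad2 Hv.
have Lw0 : \forall n \near \oo, Defs.L2 area Om (w_ n) by apply: filterS Lw => n [].
have Lw1 : \forall n \near \oo, Defs.L2 area Om ('D_e1 (w_ n)) by apply: filterS Lw => n [].
have Lw2 : \forall n \near \oo, Defs.L2 area Om ('D_e2 (w_ n)) by apply: filterS Lw => n [].
have Lwb : \forall n \near \oo, Defs.L2 arclength bdry (w_ n) by apply: filterS Lw => n [].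
have Lu0 : \forall n \near \oo, Defs.L2 area Om (u_ n) by apply: filterS Lu => n [].
have Lu1 : \forall n \near \oo, Defs.L2 area Om ('D_e1 (u_ n)) by apply: filterS Lu => n [].
have Lu2 : \forall n \near \oo, Defs.L2 area Om ('D_e2 (u_ n)) by apply: filterS Lu => n [].
have Lub : \forall n \near \oo, Defs.L2 arclength bdry (u_ n) by apply: filterS Lu => n [].
have [gl1 gl2] := grad_lin setting a Hs Hv.
have HL := H1_lin setting a Hs Hv.
split; first exact: (L2_lin mB).
exists (fun n => a *: w_ n + u_ n); split.
- by move=> n; exact: C1_lin.
- exact: (norm2_lin_cvg0 mOm a Ls Lv Lw0 Lu0 c0 d0).
- have -> : (fun n => norm2 area Om ('D_e1 (a *: w_ n + u_ n) - (grad G (a *: s + v)).1)) =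
      fun n => norm2 area Om (a *: 'D_e1 (w_ n) + 'D_e1 (u_ n) - (a *: (grad G s).1 + (grad G v).1)).
    apply/funext => n; have [w1 _ cw1 _] := C1w n; have [u1 _ cu1 _] := C1u n.
    rewrite (_ : 'D_e1 (a *: w_ n + u_ n) = a *: 'D_e1 (w_ n) + 'D_e1 (u_ n)); last first.
      by apply/funext => x; exact: derive_lin.
    have [_ m1 _ _] := C1_measurable_Om setting (C1w n).
    have [_ m2 _ _] := C1_measurable_Om setting (C1u n).
    have m3 := measurable_funD (measurable_funM (measurable_cst a) m1) m2.
    apply: (ae_eq_norm2_measurable mOm).
    + exact: (measurable_funB m3 (L2_measurable mOm (L2_grad1 HL))).
    + exact: (measurable_funB m3 (L2_measurable mOm (L2_lin mOm a L1 M1))).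
    + apply: aeS gl1 _ => x h1 Ox.
      by rewrite -[LHS]/(_ x - _ x) -[RHS]/(_ x - _ x) h1.
  exact: (norm2_lin_cvg0 mOm a L1 M1 Lw1 Lu1 c1 d1).
- have -> : (fun n => norm2 area Om ('D_e2 (a *: w_ n + u_ n) - (grad G (a *: s + v)).2)) =
      fun n => norm2 area Om (a *: 'D_e2 (w_ n) + 'D_e2 (u_ n) - (a *: (grad G s).2 + (grad G v).2)).
    apply/funext => n; have [_ w1 _ cw1] := C1w n; have [_ u1 _ cu1] := C1u n.
    rewrite (_ : 'D_e2 (a *: w_ n + u_ n) = a *: 'D_e2 (w_ n) + 'D_e2 (u_ n)); last first.
      by apply/funext => x; exact: derive_lin.
    have [_ _ m1 _] := C1_measurable_Om setting (C1w n).
    have [_ _ m2 _] := C1_measurable_Om setting (C1u n).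
    have m3 := measurable_funD (measurable_funM (measurable_cst a) m1) m2.
    apply: (ae_eq_norm2_measurable mOm).
    + exact: (measurable_funB m3 (L2_measurable mOm (L2_grad2 HL))).
    + exact: (measurable_funB m3 (L2_measurable mOm (L2_lin mOm a L2 M2))).
    + apply: aeS gl2 _ => x h1 Ox.
      by rewrite -[LHS]/(_ x - _ x) -[RHS]/(_ x - _ x) h1.
  exact: (norm2_lin_cvg0 mOm a L2 M2 Lw2 Lu2 c2 d2).
- exact: (norm2_lin_cvg0 mB a Lg Lh Lwb Lub cb db).
Qed.

Lemma trace_is_trace s : H1 G s -> is_trace G s (trace G s).
Proof.
move=> Hs; have [g sg] := (traces_exist setting).1 s Hs.
exact: (@xgetPex _ 0 [set g | is_trace G s g]) (ex_intro _ g sg).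
Qed.

Lemma L2_trace s : H1 G s -> L2 arclength bdry (trace G s).
Proof. by move=> /trace_is_trace[]. Qed.

Lemma ae_eq_nO0 s : H1 G s -> s = cst 0 %[ae area in Om] ->
  nO s + nO (grad G s).1 + nO (grad G s).2 = 0.
Proof.
move=> Hs s0; have L0 := L2_0 (@area R) mOm.
have n0 (f : fn) : L2 area Om f -> f = cst 0 %[ae area in Om] -> nO f = 0.
  move=> Lf /(ae_eq_n2 mOm Lf L0) ->.
  exact: (nrm0 (preinner_L2 (@area R) mOm)).
have [g1 g2] := weak_grad_ae setting (weak_grad0 setting).
rewrite (ae_eq_grad setting Hs.1 L0 s0) (n0 s Hs.1 s0).
have -> : nO (grad G 0).1 = 0 by exact: n0 (L2_grad1 (H1_0 setting)) g1.
by rewrite (_ : nO (grad G 0).2 = 0) ?addr0//; exact: n0 (L2_grad2 (H1_0 setting)) g2.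
Qed.

(** The difference of two traces of [s] is a trace of the null function [s - s], and [trace_bound]
    makes it null. *)
Lemma trace_uniq s g h : H1 G s -> is_trace G s g -> is_trace G s h ->
  g = h %[ae arclength in bdry].
Proof.
move=> Hs sg sh; have [K K0 hK] := trace_bound.
have HL := H1_lin setting (-1) Hs Hs.
have := hK _ _ HL (is_trace_lin (-1) Hs Hs sh sg).
rewrite ae_eq_nO0//; last first.
  by rewrite scaleN1r addNr; exact: ae_eq_refl_in.
rewrite mulr0 scaleN1r addrC => h0; apply: ae_sub0; apply: (n2_null mB).
  exact: (L2B mB sg.1 sh.1).
by apply/eqP; rewrite eq_le h0 n2_ge0.
Qed.

Lemma trace_lin a s v : H1 G s -> H1 G v ->
  trace G (a *: s + v) = a *: trace G s + trace G v %[ae arclength in bdry].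
Proof.
move=> Hs Hv; have HL := H1_lin setting a Hs Hv.
apply: (trace_uniq HL); first exact: trace_is_trace.
by apply: is_trace_lin => //; exact: trace_is_trace.
Qed.

Lemma GD_bdry : GD G `<=` bdry.
Proof. by rewrite -(boundary_parts setting) => x; left; left; right. Qed.

Lemma GR_bdry : GR G `<=` bdry.
Proof. by rewrite -(boundary_parts setting) => x; left; right. Qed.

Lemma GP_bdry : GP G `<=` bdry.
Proof. by rewrite -(boundary_parts setting) => x; right. Qed.

Lemma null_ae (Z : set (R * R)) (P : R * R -> Prop) : hausdorff1 Z = 0%E ->
  (forall x, ~ Z x -> P x) -> {ae arclength, forall x, P x}.
Proof.
move=> Z0 ZP; exists Z; split; [|exact: Z0|].
  apply: le_caratheodory_measurable => X.
  rewrite (_ : hausdorff1_outer (X `&` Z) = 0%E) ?add0e.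
    by apply: le_outer_measure; exact: subIsetl.
  apply/eqP; rewrite eq_le outer_measure_ge0 andbT -Z0.
  by apply: (le_outer_measure (@hausdorff1_outer R)); exact: subIsetr.
by move=> x /= Px; apply: contrapT => /ZP.
Qed.

(* Twin points differ by one of finitely many translations, which preserve the
   Hausdorff measure. *)
Lemma le_hausdorff1_twin : exists k : nat, forall N : set (R * R),
  (hausdorff1 [set x | GP G x /\ N (twin G x)] <= k%:R%:E * hausdorff1 N)%E.
Proof.
have [periods _ hper] := twin_periodic setting; exists (size periods) => N.
apply: (@le_trans _ _ (hausdorff1 (\big[setU/set0]_(p <- periods) [set x | N (x + p)]))).
  apply: le_hausdorff1 => x [/hper[_ _ per] Nx]; rewrite -bigcup_seq.
  by exists (twin G x - x) => //=; rewrite addrC subrK.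
elim: periods {hper} => [|p s IH]; first by rewrite big_nil mul0e hausdorff1_0.
rewrite big_cons; apply: (le_trans (outer_measureU2 (@hausdorff1_outer R) _ _)).
rewrite -natr1 EFinD ge0_muleDl ?lee_fin// mul1e addeC.
by apply: leeD; [exact: IH|exact: le_hausdorff1_translate].
Qed.

(** The preimage of a null set under [twin] is null ([le_hausdorff1_twin]). Hence periodicity does
    not depend on which representative of the trace was chosen. *)
Lemma ae_twin (P : R * R -> Prop) : {ae arclength, forall x, bdry x -> P x} ->
  {ae arclength, forall x, GP G x -> P (twin G x)}.
Proof.
move=> [N [mN N0 PN]]; have [k hk] := le_hausdorff1_twin.
apply: (@null_ae [set x | GP G x /\ N (twin G x)]).
  apply/eqP; rewrite eq_le hausdorff1_ge0 andbT; apply: (le_trans (hk N)).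
  by rewrite (_ : hausdorff1 N = 0%E) ?mule0//; exact: N0.
move=> x nx Px; apply: contrapT => nP; apply: nx; split; first exact: Px.
apply: PN => /= h; apply: nP; apply: h; apply: GP_bdry.
by have [periods _ hper] := twin_periodic setting; have [] := hper x Px.
Qed.

Lemma V_H1 s : V G s -> H1 G s. Proof. by case. Qed.

Lemma V_L2 s : V G s -> L2 area Om s. Proof. by move=> /V_H1[]. Qed.

Lemma ae_bdry_sub (D : set (R * R)) (P : R * R -> Prop) : D `<=` bdry ->
  {ae arclength, forall x, bdry x -> P x} -> {ae arclength, forall x, D x -> P x}.
Proof. by move=> Db h; apply: aeS h _ => x h1 /Db. Qed.

Lemma V_lin a s v : V G s -> V G v -> V G (a *: s + v).
Proof.
move=> [Hs sD sP] [Hv vD vP]; have tl := trace_lin a Hs Hv.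
split; first exact: H1_lin.
- have h := ae_bdry_sub GD_bdry tl; have h' := aeS2 sD vD (fun x h1 h2 => conj h1 h2).
  apply: aeS2 h h' _ => x h1 [h2 h3] Dx; rewrite h1//.
  by rewrite -[LHS]/(a * trace G s x + trace G v x) h2// h3//= mulr0 addr0.
- have h := ae_bdry_sub GP_bdry tl; have h' := ae_twin tl.
  have h'' := aeS2 sP vP (fun x h1 h2 => conj h1 h2).
  apply: aeS2 (aeS2 h h' (fun x h1 h2 => conj h1 h2)) h'' _ => x [h1 h2] [h3 h4] Px.
  rewrite (h1 Px) -[RHS]/(a * trace G s x + trace G v x) -(h3 Px) -(h4 Px).
  exact: (h2 Px).
Qed.

Lemma V0 : V G 0.
Proof.
have H0 := H1_0 setting; split => //.
(* The trace of 0 is a chosen function that need not be literally 0; writing 0 as [-1 * 0 + 0],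
   linearity makes it vanish almost everywhere. *)
- have := ae_bdry_sub GD_bdry (trace_lin (-1) H0 H0).
  rewrite scaleN1r addNr => h; apply: aeS h _ => x h1 Dx; rewrite h1//.
  by rewrite -[LHS]/(-1 * trace G 0 x + trace G 0 x) mulN1r addNr.
- have tl := trace_lin (-1) H0 H0.
  have := ae_twin tl; have := ae_bdry_sub GP_bdry tl.
  rewrite !(scaleN1r (0 : fn)) !(addNr (0 : fn)) => h h'; apply: aeS2 h h' _ => x h1 h2 Px.
  have e1 : trace G 0 x = 0.
    by rewrite (h1 Px) -[LHS]/(-1 * trace G 0 x + trace G 0 x) mulN1r addNr.
  have e2 : trace G 0 (twin G x) = 0.
    by rewrite (h2 Px) -[LHS]/(-1 * trace G 0 (twin G x) + trace G 0 (twin G x)) mulN1r addNr.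
  exact: etrans e2 (esym e1).
Qed.

Lemma ae_eq_V s s' : L2 area Om s -> L2 area Om s' -> s = s' %[ae area in Om] ->
  V G s -> V G s'.
Proof.
move=> Ls Ls' ss' [Hs sD sP]; have E := ae_eq_trace setting Ls Ls' ss'.
by split; [exact: (ae_eq_H1 setting Ls Ls' ss' Hs)|rewrite -E; exact: sD|rewrite -E; exact: sP].
Qed.

End space_V.

(** * Restriction to a subset, and Chebyshev's inequality *)

Section restriction.
Context d (T : measurableType d) (R : realType).
Variables (mu : {measure set T -> \bar R}) (A D : set T).
Hypotheses (mA : measurable A) (mD : measurable D) (AD : A `<=` D).

Lemma L2_subset f : L2 mu D f -> L2 mu A f.
Proof.
move=> /(L2P _ mD)[mf fy]; apply/(L2P _ mA).
have mfA : measurable_fun A f by exact: measurable_funS mf.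
split=> //; apply: le_lt_trans fy; apply: ge0_subset_integral => //.
  exact: measurable_sqr.
by move=> x _; rewrite lee_fin sqr_ge0.
Qed.

Lemma n2_subset f : L2 mu D f -> n2 mu A f <= n2 mu D f.
Proof.
move=> Lf; have LA := L2_subset Lf; have iD := L2_mul_integrable mD Lf Lf.
have iA := L2_mul_integrable mA LA LA.
apply: ler_wsqrtr; apply: fine_le; [exact: integrable_fin_num iA|exact: integrable_fin_num iD|].
apply: ge0_subset_integral => //; first exact: measurable_int iD.
by move=> x _; rewrite lee_fin -expr2 sqr_ge0.
Qed.

Lemma L2_chebyshev f (e : R) : 0 < e -> L2 mu D f ->
  (mu (D `&` [set x | (e <= `|f x|)%R]) <= (e ^- 2 * n2 mu D f ^+ 2)%:E)%E.
Proof.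
move=> e0 Lf; have ms := measurable_sqr (L2_measurable mD Lf).
have := @le_integral_abse _ _ _ mu D mD _ (e ^+ 2) ms (exprn_gt0 2 e0).
have -> : (\int[mu]_(x in D) `|(EFin \o (fun x => f x ^+ 2)%R) x| = (n2 mu D f ^+ 2)%:E)%E.
  rewrite (nrm2E (preinner_L2 mu mD) Lf) /dot2 /Rintegral fineK; last first.
    exact: integrable_fin_num (L2_mul_integrable mD Lf Lf).
  by apply: eq_integral => x _; rewrite /= ger0_norm ?sqr_ge0// expr2.
rewrite (_ : [set x | _] = [set x | (e <= `|f x|)%R]); last first.
  by apply/seteqP; split => x /=; rewrite lee_fin normrX ler_pXn2r ?nnegrE// ltW.
by move=> h; rewrite EFinM lee_pdivlMl ?exprn_gt0.
Qed.

End restriction.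

(** * The scalar products of [H] and of [L^2 x H] *)

Section inner_products.
Local Opaque grad trace wdot.
Context {R : realType} (G : graetz_data R) (setting : graetz_setting G).
Local Notation fn := (R * R -> R).
Local Notation Om := (Om G).
Local Notation bdry := (bdry G).
Local Notation nO := (n2 (@area R) Om).
Local Notation nB := (n2 (@arclength R) bdry).
Implicit Types (s v w g u : fn) (p q : fn * fn).
Local Notation mOm := (Om_measurable setting).
Local Notation mB := (bdry_measurable setting).
Local Notation mGR := (GR_measurable setting).

Lemma positive_bounded_weight w : positive_bounded G w -> exists m M : R,
  [/\ 0 < m, 0 < M, measurable_fun (Om : set (mplane R)) w,
      {ae area, forall x, Om x -> `|w x| <= M} &
      {ae area, forall x, Om x -> m <= w x}].
Proof.
move=> [mw [m [M [m0 mM]]]]; exists m, (Num.max 1 M); split => //.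
- by rewrite lt_max ltr01.
- apply: aeS mM _ => x h Ox; have /andP[h1 h2] := h Ox.
  by rewrite ger0_norm ?(le_trans (ltW m0))// le_max h2 orbT.
- by apply: aeS mM _ => x h Ox; have /andP[] := h Ox.
Qed.

Definition c_weight := positive_bounded_weight (c_bounded setting).
Definition s_weight := positive_bounded_weight (sigma_bounded setting).

Lemma h_weight : exists M : R, [/\ 0 < M,
  measurable_fun (Om : set (mplane R)) (hh G) &
  {ae area, forall x, Om x -> `|hh G x| <= M}].
Proof.
have [mh [M hM]] := h_bounded setting; exists (Num.max 1 M); split => //.
  by rewrite lt_max ltr01.
by apply: aeS hM _ => x h Ox; rewrite le_max h ?orbT.
Qed.

Lemma a_weight : exists M : R, [/\ 0 < M,
  measurable_fun (GR G : set (bplane R)) (aa G),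
  {ae arclength, forall x, GR G x -> `|aa G x| <= M} &
  {ae arclength, forall x, GR G x -> 0 <= aa G x}].
Proof.
have [ma [M aM]] := a_bounded setting; exists (Num.max 1 M); split => //.
- by rewrite lt_max ltr01.
- apply: aeS aM _ => x h Ox; have /andP[h1 h2] := h Ox.
  by rewrite (ger0_norm (ltW h1)) le_max h2 orbT.
- by apply: aeS aM _ => x h Ox; have /andP[/ltW] := h Ox.
Qed.

Definition ipc u v : R := wdot area Om (cc G) u v.
Definition iph u v : R := wdot area Om (hh G) u v.
Definition ips u v : R := wdot area Om (sg G) u v.
Definition ipa u v : R := wdot arclength (GR G) (aa G) u v.
(** The scalar product of [H], split into three weighted L^2 products so that linearity and
    positivity are inherited from [wdot]. It is also minus the weak form of [div (sigma grad s)]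
    with the Robin condition built in. *)
Definition dH s v : R := ips (grad G s).1 (grad G v).1 + ips (grad G s).2 (grad G v).2
  + ipa (trace G s) (trace G v).

Lemma preinner_ipc : preinner (L2 area Om) ipc.
Proof.
have [m [M [m0 M0 mw wM mw']]] := c_weight; apply: (preinner_wdot mOm mw wM).
by apply: aeS mw' _ => x h Ox; apply: le_trans (h Ox); exact: ltW.
Qed.

Lemma preinner_ips : preinner (L2 area Om) ips.
Proof.
have [m [M [m0 M0 mw wM mw']]] := s_weight; apply: (preinner_wdot mOm mw wM).
by apply: aeS mw' _ => x h Ox; apply: le_trans (h Ox); exact: ltW.
Qed.

Lemma preinner_ipa : preinner (L2 arclength (GR G)) ipa.
Proof. by have [M [M0 mw wM w0]] := a_weight; exact: (preinner_wdot mGR mw wM w0). Qed.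

Lemma iph_lin a u v w : L2 area Om u -> L2 area Om v -> L2 area Om w ->
  iph (a *: u + v) w = a * iph u w + iph v w.
Proof. by have [M [M0 mw wM]] := h_weight; exact: (wdot_lin mOm mw wM). Qed.

Lemma iphC u v : iph u v = iph v u. Proof. exact: wdotC. Qed.

Lemma iph_bound : exists2 K : R, 0 < K & forall u v, L2 area Om u -> L2 area Om v ->
  `|iph u v| <= K * nO u * nO v.
Proof.
have [M [M0 mw wM]] := h_weight; exists M => // u v Lu Lv.
exact: (wdot_bound mOm mw wM (ltW M0) Lu Lv).
Qed.

Lemma ipc_lower : exists2 K : R, 0 < K & forall u, L2 area Om u ->
  nO u <= K * Num.sqrt (ipc u u).
Proof.
have [m [M [m0 M0 mw wM mw']]] := c_weight; exists (Num.sqrt m)^-1.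
  by rewrite invr_gt0 sqrtr_gt0.
move=> u Lu; rewrite ler_pdivlMl ?sqrtr_gt0//.
have c0 : {ae area, forall x, Om x -> 0 <= cc G x}.
  by apply: aeS mw' _ => x h Ox; apply: le_trans (h Ox); exact: ltW.
have := wdot_lower mOm mw wM c0 m0 mw' Lu => h.
have := ler_wsqrtr h; rewrite sqrtrM ?(ltW m0)// sqrtr_sqr ger0_norm//.
exact: n2_ge0.
Qed.

Lemma ipc_upper : exists2 K : R, 0 < K & forall u, L2 area Om u ->
  Num.sqrt (ipc u u) <= K * nO u.
Proof.
have [m [M [m0 M0 mw wM mw']]] := c_weight; exists (Num.sqrt M).
  by rewrite sqrtr_gt0.
move=> u Lu; have := wdot_bound mOm mw wM (ltW M0) Lu Lu.
rewrite -mulrA -expr2 => h; have := ler_wsqrtr (le_trans (ler_norm _) h).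
by rewrite sqrtrM ?(ltW M0)// sqrtr_sqr ger0_norm//; exact: n2_ge0.
Qed.

Lemma ips_lower : exists2 K : R, 0 < K & forall u, L2 area Om u ->
  nO u <= K * Num.sqrt (ips u u).
Proof.
have [m [M [m0 M0 mw wM mw']]] := s_weight; exists (Num.sqrt m)^-1.
  by rewrite invr_gt0 sqrtr_gt0.
move=> u Lu; rewrite ler_pdivlMl ?sqrtr_gt0//.
have c0 : {ae area, forall x, Om x -> 0 <= sg G x}.
  by apply: aeS mw' _ => x h Ox; apply: le_trans (h Ox); exact: ltW.
have := wdot_lower mOm mw wM c0 m0 mw' Lu => h.
have := ler_wsqrtr h; rewrite sqrtrM ?(ltW m0)// sqrtr_sqr ger0_norm//.
exact: n2_ge0.
Qed.

Lemma ips_upper : exists2 K : R, 0 < K & forall u, L2 area Om u -> ips u u <= K * nO u ^+ 2.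
Proof.
have [m [M [m0 M0 mw wM mw']]] := s_weight; exists M => // u Lu.
have := wdot_bound mOm mw wM (ltW M0) Lu Lu.
by rewrite -mulrA -expr2 => h; exact: le_trans (ler_norm _) h.
Qed.

Lemma ipa_upper : exists2 K : R, 0 < K & forall g, L2 arclength bdry g ->
  ipa g g <= K * nB g ^+ 2.
Proof.
have [M [M0 mw wM w0]] := a_weight; exists M => // g Lg.
have Lg' := L2_subset mGR mB (GR_bdry setting) Lg.
have := wdot_bound mGR mw wM (ltW M0) Lg' Lg'.
rewrite -mulrA -expr2 => h; apply: le_trans (ler_norm _) _; apply: (le_trans h).
rewrite ler_pM2l// ler_pXn2r ?nnegrE ?n2_ge0//.
exact: (n2_subset mGR mB (@GR_bdry _ _ setting) Lg).
Qed.

Lemma L2_trace_GR s : H1 G s -> L2 arclength (GR G) (trace G s).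
Proof.
move=> Hs; apply: (L2_subset mGR mB (GR_bdry setting)).
exact: L2_trace.
Qed.

Lemma dH_lin a s v w : V G s -> V G v -> V G w ->
  dH (a *: s + v) w = a * dH s w + dH v w.
Proof.
move=> /V_H1 Hs /V_H1 Hv /V_H1 Hw; have HL := H1_lin setting a Hs Hv.
have [g1 g2] := grad_lin setting a Hs Hv; have tl := trace_lin setting a Hs Hv.
have tGR := ae_bdry_sub (GR_bdry setting) tl.
have [m [M [m0 M0 mw wM mw']]] := s_weight; have [N [N0 mn nN n0]] := a_weight.
have e1 : ips (grad G (a *: s + v)).1 (grad G w).1 =
    ips (a *: (grad G s).1 + (grad G v).1) (grad G w).1.
  apply: (eq_wdot mOm mw wM (L2_grad1 HL) (L2_lin mOm a (L2_grad1 Hs) (L2_grad1 Hv))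
    (L2_grad1 Hw) (L2_grad1 Hw) g1); exact: ae_eq_refl_in.
have e2 : ips (grad G (a *: s + v)).2 (grad G w).2 =
    ips (a *: (grad G s).2 + (grad G v).2) (grad G w).2.
  apply: (eq_wdot mOm mw wM (L2_grad2 HL) (L2_lin mOm a (L2_grad2 Hs) (L2_grad2 Hv))
    (L2_grad2 Hw) (L2_grad2 Hw) g2); exact: ae_eq_refl_in.
have e3 : ipa (trace G (a *: s + v)) (trace G w) = ipa (a *: trace G s + trace G v) (trace G w).
  apply: (eq_wdot mGR mn nN (L2_trace_GR HL) (L2_lin mGR a (L2_trace_GR Hs) (L2_trace_GR Hv))
    (L2_trace_GR Hw) (L2_trace_GR Hw) tGR); exact: ae_eq_refl_in.
rewrite (hilb_dotl preinner_ips _ (L2_grad1 Hs) (L2_grad1 Hv) (L2_grad1 Hw)) in e1.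
rewrite (hilb_dotl preinner_ips _ (L2_grad2 Hs) (L2_grad2 Hv) (L2_grad2 Hw)) in e2.
rewrite (hilb_dotl preinner_ipa _ (L2_trace_GR Hs) (L2_trace_GR Hv) (L2_trace_GR Hw)) in e3.
have E (x1 x2 x3 y1 y2 y3 : R) : (a * x1 + y1) + (a * x2 + y2) + (a * x3 + y3) =
    a * (x1 + x2 + x3) + (y1 + y2 + y3) by ring.
exact: etrans (congr2 +%R (congr2 +%R e1 e2) e3) (E _ _ _ _ _ _).
Qed.

Lemma preinner_V : preinner (V G) dH.
Proof.
split.
- exact: V0.
- by move=> a s v; exact: V_lin.
- move=> s v _ _.
  have e1 : ips (grad G s).1 (grad G v).1 = ips (grad G v).1 (grad G s).1 by exact: wdotC.
  have e2 : ips (grad G s).2 (grad G v).2 = ips (grad G v).2 (grad G s).2 by exact: wdotC.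
  have e3 : ipa (trace G s) (trace G v) = ipa (trace G v) (trace G s) by exact: wdotC.
  have S (x1 x2 x3 y1 y2 y3 : R) : x1 = y1 -> x2 = y2 -> x3 = y3 ->
    x1 + x2 + x3 = y1 + y2 + y3 by move=> -> -> ->.
  have E := S _ _ _ _ _ _ e1 e2 e3; exact E.
- exact: dH_lin.
- move=> s /V_H1 Hs; rewrite /dH; apply: addr_ge0; first apply: addr_ge0.
  + exact: (hilb_ge0 preinner_ips (L2_grad1 Hs)).
  + exact: (hilb_ge0 preinner_ips (L2_grad2 Hs)).
  + exact: (hilb_ge0 preinner_ipa (L2_trace_GR Hs)).
Qed.

Lemma int_dot_grad s v : H1 G s -> H1 G v ->
  area.-integrable Om (EFin \o dot_grad G s v) /\
  \int[area]_(x in Om) dot_grad G s v x =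
  ips (grad G s).1 (grad G v).1 + ips (grad G s).2 (grad G v).2.
Proof.
move=> Hs Hv; have [m [M [m0 M0 mw wM mw']]] := s_weight.
have i1 := wdot_integrable mOm mw wM (L2_grad1 Hs) (L2_grad1 Hv).
have i2 := wdot_integrable mOm mw wM (L2_grad2 Hs) (L2_grad2 Hv).
have E : dot_grad G s v = fun x => sg G x * (grad G s).1 x * (grad G v).1 x +
    sg G x * (grad G s).2 x * (grad G v).2 x.
  by apply/funext => x; rewrite /dot_grad mulrDr !mulrA.
by rewrite E; split; [exact: (integrable_EFinD mOm i1 i2)|rewrite (RintegralD mOm i1 i2)].
Qed.

Lemma dotE p q : HH G p -> HH G q -> dot G p q = ipc p.1 q.1 + dH p.2 q.2.
Proof.
move=> [Lp Vp] [Lq Vq]; have [m [M [m0 M0 mw wM mw']]] := c_weight.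
have [i2 E] := int_dot_grad (V_H1 Vp) (V_H1 Vq).
have i1 := wdot_integrable mOm mw wM Lp Lq.
by rewrite /dot (RintegralD mOm i1 i2) E -addrA.
Qed.

Lemma HH_lin a p q : HH G p -> HH G q -> HH G (a *: p + q).
Proof.
move=> [Lp Vp] [Lq Vq]; split; [exact: (L2_lin mOm a Lp Lq)|exact: (V_lin setting a Vp Vq)].
Qed.

Local Opaque dH ipc dot.

Lemma preinner_HH : preinner (HH G) (dot G).
Proof.
split.
- by split; [exact: (L2_0 _ mOm)|exact: (V0 setting)].
- by move=> a p q; exact: HH_lin.
- move=> p q Hp Hq; rewrite (dotE Hp Hq) (dotE Hq Hp) (hilbC preinner_ipc Hp.1 Hq.1).
  by rewrite (hilbC preinner_V Hp.2 Hq.2).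
- move=> a p q r Hp Hq Hr; rewrite (dotE Hp Hr) (dotE Hq Hr) (dotE (HH_lin a Hp Hq) Hr).
  rewrite (hilb_dotl preinner_ipc a Hp.1 Hq.1 Hr.1) (hilb_dotl preinner_V a Hp.2 Hq.2 Hr.2).
  have E (x y z t : R) : a * x + y + (a * z + t) = a * (x + z) + (y + t) by ring.
  exact: E.
- move=> p Hp; rewrite (dotE Hp Hp); apply: addr_ge0.
    exact: (hilb_ge0 preinner_ipc Hp.1).
  exact: (hilb_ge0 preinner_V Hp.2).
Qed.

Lemma HH_complete : dot_complete (HH G) (dot G).
Proof. exact: (HH_hilbert setting).2. Qed.

Lemma HH_left u : L2 area Om u -> HH G (u, 0).
Proof. by move=> Lu; split; [exact: Lu|exact: (V0 setting)]. Qed.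

Lemma HH_right s : V G s -> HH G (0, s).
Proof. by move=> Vs; split; [exact: (L2_0 _ mOm)|exact: Vs]. Qed.

Lemma dot_left u q : L2 area Om u -> HH G q -> dot G (u, 0) q = ipc u q.1.
Proof.
move=> Lu Hq; rewrite (dotE (HH_left Lu) Hq).
by rewrite (dot0l preinner_V Hq.2) addr0.
Qed.

Lemma dot_right s q : V G s -> HH G q -> dot G (0, s) q = dH s q.2.
Proof.
move=> Vs Hq; rewrite (dotE (HH_right Vs) Hq).
by rewrite (dot0l preinner_ipc Hq.1) add0r.
Qed.

Lemma normHH_left u : L2 area Om u -> normHH G (u, 0) = Num.sqrt (ipc u u).
Proof. by move=> Lu; rewrite /normHH (dot_left Lu (HH_left Lu)). Qed.

Lemma normHH_right s : V G s -> normHH G (0, s) = Num.sqrt (dH s s).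
Proof. by move=> Vs; rewrite /normHH (dot_right Vs (HH_right Vs)). Qed.

Lemma le_normHH1 p : HH G p -> Num.sqrt (ipc p.1 p.1) <= normHH G p.
Proof.
move=> Hp; apply: ler_wsqrtr; rewrite (dotE Hp Hp) lerDl.
exact: (hilb_ge0 preinner_V Hp.2).
Qed.

Lemma le_normHH2 p : HH G p -> Num.sqrt (dH p.2 p.2) <= normHH G p.
Proof.
move=> Hp; apply: ler_wsqrtr; rewrite (dotE Hp Hp) lerDr.
exact: (hilb_ge0 preinner_ipc Hp.1).
Qed.

Lemma HH_decomp_null p : HH G p -> normHH G p = 0 ->
  p.1 = cst 0 %[ae area in Om] /\ Num.sqrt (dH p.2 p.2) = 0.
Proof.
move=> Hp p0; split.
  have [K K0 hK] := ipc_lower; apply: (n2_null mOm Hp.1).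
  apply/eqP; rewrite eq_le n2_ge0 andbT; apply: (le_trans (hK _ Hp.1)).
  have := le_normHH1 Hp; rewrite p0 => h.
  by rewrite pmulr_rle0.
by apply/eqP; rewrite eq_le sqrtr_ge0 andbT -p0; exact: le_normHH2.
Qed.

(** The point where definiteness of the Hilbert space of classes enters: a null vector is 0 almost
    everywhere in its first component, and 0 or a constant in its second. *)
Lemma HH_null_eqHH p : HH G p -> normHH G p = 0 -> eqHH G p 0.
Proof.
move=> Hp p0; apply: (HH_hilbert setting).1 => //.
by apply/eqP; rewrite eq_le (hilb_ge0 preinner_HH Hp) andbT -sqrtr_eq0; apply/eqP.
Qed.

Lemma V_null_eqV s : V G s -> Num.sqrt (dH s s) = 0 -> eqV G s 0.
Proof.
move=> Vs s0; have := HH_null_eqHH (HH_right Vs).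
by rewrite (normHH_right Vs) => /(_ s0)[].
Qed.

End inner_products.

(** * Closedness of the gradient and of the boundary conditions *)

Section closability.
Local Opaque grad trace wdot dH ipc ips ipa iph dot.
Context {R : realType} (G : graetz_data R) (setting : graetz_setting G).
Local Notation fn := (R * R -> R).
Local Notation Om := (Om G).
Local Notation bdry := (bdry G).
Local Notation nO := (n2 (@area R) Om).
Local Notation nB := (n2 (@arclength R) bdry).
Implicit Types (s v w g u : fn) (p q : fn * fn).
Local Notation mOm := (Om_measurable setting).
Local Notation mB := (bdry_measurable setting).
Local Notation mGR := (GR_measurable setting).

Lemma dot2_cvg (u_ : nat -> fn) u w : (forall n, L2 area Om (u_ n)) -> L2 area Om u ->
  L2 area Om w -> nO (u_ n - u) @[n --> \oo] --> 0 ->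
  dot2 area Om (u_ n) w @[n --> \oo] --> dot2 area Om u w.
Proof. exact: (cvg_nrm_dot (preinner_L2 (@area R) mOm)). Qed.

Lemma weak_grad_cvg (s_ : nat -> fn) g p : (forall n, H1 G (s_ n)) -> L2 area Om g ->
  L2 area Om p.1 -> L2 area Om p.2 -> nO (s_ n - g) @[n --> \oo] --> 0 ->
  nO ((grad G (s_ n)).1 - p.1) @[n --> \oo] --> 0 ->
  nO ((grad G (s_ n)).2 - p.2) @[n --> \oo] --> 0 -> weak_grad G g p.
Proof.
move=> Hs Lg Lp1 Lp2 sg s1 s2; split=> // v tv.
have Lv := test_L2 (Om_open setting) (Om_area setting) tv.
have [Lv1 Lv2] := test_derive_L2 (Om_open setting) (Om_area setting) tv.
have Ls n : L2 area Om (s_ n) by have [] := Hs n.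
have G1 n := L2_grad1 (Hs n); have G2 n := L2_grad2 (Hs n).
have E1 n : dot2 area Om (s_ n) ('D_e1 v) = - dot2 area Om (grad G (s_ n)).1 v.
  by have [_ _ /(_ v tv)[]] := H1_weak_grad (Hs n).
have E2 n : dot2 area Om (s_ n) ('D_e2 v) = - dot2 area Om (grad G (s_ n)).2 v.
  by have [_ _ /(_ v tv)[]] := H1_weak_grad (Hs n).
have c1 := dot2_cvg Ls Lg Lv1 sg; have c2 := dot2_cvg Ls Lg Lv2 sg.
have d1 : - dot2 area Om (grad G (s_ n)).1 v @[n --> \oo] --> - dot2 area Om p.1 v.
  by apply: cvgN; exact: (dot2_cvg G1 Lp1 Lv s1).
have d2 : - dot2 area Om (grad G (s_ n)).2 v @[n --> \oo] --> - dot2 area Om p.2 v.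
  by apply: cvgN; exact: (dot2_cvg G2 Lp2 Lv s2).
have F1 : (fun n => dot2 area Om (s_ n) ('D_e1 v)) = (fun n => - dot2 area Om (grad G (s_ n)).1 v).
  by apply/funext.
have F2 : (fun n => dot2 area Om (s_ n) ('D_e2 v)) = (fun n => - dot2 area Om (grad G (s_ n)).2 v).
  by apply/funext.
rewrite F1 in c1; rewrite F2 in c2.
have e1 : dot2 area Om g ('D_e1 v) = - dot2 area Om p.1 v.
  exact: (cvg_unique (@Rhausdorff R) c1 d1).
have e2 : dot2 area Om g ('D_e2 v) = - dot2 area Om p.2 v.
  exact: (cvg_unique (@Rhausdorff R) c2 d2).
by split; [exact: e1|exact: e2].
Qed.

Lemma trace_cvg (s_ : nat -> fn) g : (forall n, H1 G (s_ n)) -> H1 G g ->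
  nO (s_ n - g) @[n --> \oo] --> 0 ->
  nO ((grad G (s_ n)).1 - (grad G g).1) @[n --> \oo] --> 0 ->
  nO ((grad G (s_ n)).2 - (grad G g).2) @[n --> \oo] --> 0 ->
  nB (trace G (s_ n) - trace G g) @[n --> \oo] --> 0.
Proof.
move=> Hs Hg sg s1 s2; have [K K0 hK] := trace_bound setting.
apply: (@cvg_dist_le _ _ _ _ _ (fun n => K * (nO (s_ n - g) +
  nO ((grad G (s_ n)).1 - (grad G g).1) + nO ((grad G (s_ n)).2 - (grad G g).2)))).
  apply: nearW => n; rewrite subr0 (ger0_norm (n2_ge0 _ _ _)).
  have HL := H1_lin setting (-1) Hg (Hs n).
  have := hK _ _ HL (is_trace_lin setting (-1) Hg (Hs n)
    (trace_is_trace setting Hg) (trace_is_trace setting (Hs n))).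
  have [g1 g2] := grad_lin setting (-1) Hg (Hs n).
  rewrite (ae_eq_n2 mOm (L2_grad1 HL) (L2_lin mOm (-1) (L2_grad1 Hg) (L2_grad1 (Hs n))) g1).
  rewrite (ae_eq_n2 mOm (L2_grad2 HL) (L2_lin mOm (-1) (L2_grad2 Hg) (L2_grad2 (Hs n))) g2).
  have E (a b : fn) : -1 *: a + b = b - a by rewrite scaleN1r addrC.
  by rewrite !E.
apply: cvgZ0; rewrite -[X in _ --> X]addr0 -[X in _ --> X + _]addr0.
by apply: cvgD => //; apply: cvgD.
Qed.

Lemma eq0_of_trace_cvg (D : set (R * R)) (mD : measurable (D : set (bplane R)))
    (f_ : nat -> fn) f : D `<=` bdry ->
  (forall n, L2 arclength bdry (f_ n)) -> L2 arclength bdry f ->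
  nB (f_ n - f) @[n --> \oo] --> 0 ->
  (forall n, f_ n = cst 0 %[ae arclength in D]) -> f = cst 0 %[ae arclength in D].
Proof.
move=> Db Lf_ Lf ff f0; have LfD := L2_subset mD mB Db Lf.
apply: (n2_null mD LfD); apply/eqP; rewrite eq_le n2_ge0 andbT.
apply: (ler_cvg0 _ ff); apply: nearW => n; rewrite add0r.
apply: le_trans (n2_subset mD mB Db (L2B mB (Lf_ n) Lf)).
rewrite (n2_distC mD (L2_subset mD mB Db (Lf_ n)) LfD) le_eqVlt; apply/orP; left; apply/eqP.
apply: (ae_eq_n2 mD LfD (L2B mD LfD (L2_subset mD mB Db (Lf_ n)))).
by apply: aeS (f0 n) _ => x h Dx; rewrite -[RHS]/(f x - f_ n x) h// subr0.
Qed.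

(** Where [f] and its twin value differ by at least [e], the function [f_ n - f] is at least [e / 2]
    at the point or at its twin, outside a null set. Chebyshev bounds the measure of the first set,
    and the comparison of measures under [twin] bounds that of the second. *)
Lemma periodic_of_trace_cvg (f_ : nat -> fn) f :
  (forall n, L2 arclength bdry (f_ n)) -> L2 arclength bdry f ->
  nB (f_ n - f) @[n --> \oo] --> 0 ->
  (forall n, f_ n \o twin G = f_ n %[ae arclength in GP G]) ->
  f \o twin G = f %[ae arclength in GP G].
Proof.
move=> Lf_ Lf ff fP; have [k hk] := le_hausdorff1_twin setting.
pose bad (e : R) := [set x | GP G x /\ e <= `|f (twin G x) - f x|].
have bad0 e : 0 < e -> hausdorff1 (bad e) = 0%E.
  move=> e0; have e2 : 0 < e / 2 by rewrite divr_gt0.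
  apply/eqP; rewrite eq_le hausdorff1_ge0 andbT.
  (* Chebyshev's constant, counted once for the point and [k] times for its twin. *)
  pose C : R := (k%:R + 1) * (e / 2) ^- 2.
  have H n : (hausdorff1 (bad e) <= (C * nB (f_ n - f) ^+ 2)%:E)%E.
    have [Z [mZ Z0 PZ]] := fP n.
    pose A := bdry `&` [set x | e / 2 <= `|(f_ n - f) x|].
    have hA : (hausdorff1 A <= ((e / 2) ^- 2 * nB (f_ n - f) ^+ 2)%:E)%E.
      exact: (L2_chebyshev mB e2 (L2B mB (Lf_ n) Lf)).
    have sub : bad e `<=` Z `|` (A `|` [set x | GP G x /\ A (twin G x)]).
      move=> x [Px ex]; have [Zx|nZx] := pselect (Z x); [by left|right].
      have tE : f_ n (twin G x) = f_ n x.
        by apply: contrapT => nE; apply: nZx; apply: PZ => /= h; apply: nE; exact: h.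
      have Ptx : GP G (twin G x).
        by have [periods _ hper] := twin_periodic setting; have [] := hper x Px.
      have [h1|h1] := leP (e / 2) `|f_ n x - f x|.
        by left; split => //; exact: (GP_bdry setting).
      right; split => //; split; first exact: (GP_bdry setting).
      rewrite /= -[(_ - _) _]/(f_ n (twin G x) - f (twin G x)) tE distrC.
      have := ler_normD (f (twin G x) - f_ n x) (f_ n x - f x).
      rewrite addrA subrK; lra.
    apply: (le_trans (le_hausdorff1 sub)).
    apply: (le_trans (outer_measureU2 (@hausdorff1_outer R) _ _)).
    rewrite (_ : hausdorff1_outer Z = 0%E) ?add0e; last exact: Z0.
    apply: (le_trans (outer_measureU2 (@hausdorff1_outer R) _ _)).
    apply: (le_trans (leeD hA (le_trans (hk A) (lee_wpmul2l _ hA)))); first by rewrite lee_fin.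
    by rewrite -EFinM -EFinD lee_fin /C -mulrA mulrDl mul1r addrC.
  have c0 : C * nB (f_ n - f) ^+ 2 @[n --> \oo] --> 0.
    apply: cvgZ0; rewrite -(mulr0 (0 : R)); under eq_fun do rewrite expr2.
    exact: cvgM.
  have h0 : hausdorff1 (bad e) \is a fin_num.
    by rewrite ge0_fin_numE ?hausdorff1_ge0// (le_lt_trans (H 0))// ltry.
  rewrite -(fineK h0) lee_fin; apply: (ler_cvg0 _ c0); apply: nearW => n.
  by rewrite add0r -lee_fin (fineK h0).
(* Failure of periodicity is failure at some level [1 / (n + 1)], so countably many null sets cover
   it. *)
apply: (@null_ae _ (\bigcup_n bad n.+1%:R^-1)).
  apply/eqP; rewrite eq_le hausdorff1_ge0 andbT.
  apply: (le_trans (hausdorff1_sigma_subadditive _)).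
  by rewrite eseries0// => n _ _; apply: bad0; rewrite invr_gt0.
move=> x nx Px; apply/eqP; rewrite -subr_eq0 -normr_le0 leNgt; apply/negP => h.
apply: nx; have : (`|f (twin G x) - f x|)^-1 < (Num.bound (`|f (twin G x) - f x|)^-1)%:R.
  by apply: archi_boundP; rewrite invr_ge0 ltW.
set n := Num.bound _ => hn; exists n => //; split => //.
rewrite invf_ple ?posrE// ltW// (lt_trans hn)// ltr_nat//.
Qed.

Lemma subE_lin (a b : fn) : a - b = -1 *: b + a.
Proof. by rewrite scaleN1r addrC. Qed.

Lemma V_sub s v : V G s -> V G v -> V G (s - v).
Proof. by move=> Vs Vv; exact: (hilbB (preinner_V setting) Vs Vv). Qed.

Lemma n2_grad_sub s v : H1 G s -> H1 G v ->
  [/\ nO (grad G (s - v)).1 = nO ((grad G s).1 - (grad G v).1),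
      nO (grad G (s - v)).2 = nO ((grad G s).2 - (grad G v).2) &
      nB (trace G (s - v)) = nB (trace G s - trace G v)].
Proof.
move=> Hs Hv; have HL := H1_lin setting (-1) Hv Hs; rewrite !subE_lin.
have [g1 g2] := grad_lin setting (-1) Hv Hs; have tl := trace_lin setting (-1) Hv Hs.
split.
- exact: (ae_eq_n2 mOm (L2_grad1 HL) (L2_lin mOm (-1) (L2_grad1 Hv) (L2_grad1 Hs)) g1).
- exact: (ae_eq_n2 mOm (L2_grad2 HL) (L2_lin mOm (-1) (L2_grad2 Hv) (L2_grad2 Hs)) g2).
- apply: (ae_eq_n2 mB (L2_trace setting HL) _ tl).
  exact: (L2_lin mB (-1) (L2_trace setting Hv) (L2_trace setting Hs)).
Qed.

Lemma dH_lower : exists2 K : R, 0 < K & forall s, V G s ->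
  nO (grad G s).1 <= K * Num.sqrt (dH G s s) /\
  nO (grad G s).2 <= K * Num.sqrt (dH G s s).
Proof.
have [K K0 hK] := ips_lower setting; exists K => // s Vs; have Hs := V_H1 Vs.
have a0 := hilb_ge0 (preinner_ips setting) (L2_grad1 Hs).
have b0 := hilb_ge0 (preinner_ips setting) (L2_grad2 Hs).
have c0 := hilb_ge0 (preinner_ipa setting) (L2_trace_GR setting Hs).
have E : dH G s s = ips G (grad G s).1 (grad G s).1 + ips G (grad G s).2 (grad G s).2 +
  ipa G (trace G s) (trace G s) by [].
split.
- apply: (le_trans (hK _ (L2_grad1 Hs))); rewrite (ler_pM2l K0); apply: ler_wsqrtr.
  by rewrite E -addrA lerDl addr_ge0.
- apply: (le_trans (hK _ (L2_grad2 Hs))); rewrite (ler_pM2l K0); apply: ler_wsqrtr.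
  by rewrite E addrAC lerDr addr_ge0.
Qed.

Lemma dH_upper : exists2 K : R, 0 < K & forall s, V G s ->
  Num.sqrt (dH G s s) <= K * (nO (grad G s).1 + nO (grad G s).2 + nB (trace G s)).
Proof.
have [K K0 hK] := ips_upper setting; have [L L0 hL] := ipa_upper setting.
exists (Num.sqrt (K + L)); first by rewrite sqrtr_gt0 addr_gt0.
move=> s Vs; have Hs := V_H1 Vs.
have a1 := hK _ (L2_grad1 Hs); have b1 := hK _ (L2_grad2 Hs).
have c1 := hL _ (L2_trace setting Hs).
have E : dH G s s = ips G (grad G s).1 (grad G s).1 + ips G (grad G s).2 (grad G s).2 +
  ipa G (trace G s) (trace G s) by [].
have W (A B C x y z : R) : 0 <= x -> 0 <= y -> 0 <= z -> A <= K * x ^+ 2 -> B <= K * y ^+ 2 ->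
    C <= L * z ^+ 2 -> A + B + C <= (K + L) * (x + y + z) ^+ 2.
  move=> x0 y0 z0 h1 h2 h3.
  apply: (@le_trans _ _ (K * x ^+ 2 + K * y ^+ 2 + L * z ^+ 2)).
    by apply: lerD => //; exact: lerD.
  have e : 0 <= 2 * (x * y + y * z + x * z) by rewrite mulr_ge0 ?ler0n ?addr_ge0 ?mulr_ge0.
  rewrite -subr_ge0 (_ : _ - _ = (K + L) * (2 * (x * y + y * z + x * z)) +
    K * z ^+ 2 + L * (x ^+ 2 + y ^+ 2)); last by ring.
  by rewrite !addr_ge0// ?mulr_ge0 ?addr_ge0 ?sqr_ge0 ?(ltW K0) ?(ltW L0) ?mulr_ge0.
have h := W _ _ _ _ _ _ (n2_ge0 _ _ _) (n2_ge0 _ _ _) (n2_ge0 _ _ _) a1 b1 c1.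
rewrite E; apply: (le_trans (ler_wsqrtr h)).
rewrite sqrtrM ?addr_ge0 ?(ltW K0) ?(ltW L0)// sqrtr_sqr ger0_norm//.
by rewrite !addr_ge0// n2_ge0.
Qed.

(** If elements of [V] converge in L^2 to [g] and for [dH] to [t], the gradients converge in L^2 to
    those of [t], which are then the weak gradients of [g]; traces follow by [trace_bound] and keep
    the boundary conditions. So the L^2 limit represents the limit in [H], which is what turns
    convergence of pairs into an identity between components. *)
Lemma closable (s_ : nat -> fn) g t : (forall n, V G (s_ n)) -> L2 area Om g -> V G t ->
  nO (s_ n - g) @[n --> \oo] --> 0 ->
  Num.sqrt (dH G (s_ n - t) (s_ n - t)) @[n --> \oo] --> 0 ->
  V G g /\ Num.sqrt (dH G (g - t) (g - t)) = 0.
Proof.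
move=> Vs Lg Vt sg st; have Hs n := V_H1 (Vs n); have Ht := V_H1 Vt.
have [K K0 hK] := dH_lower.
have c1 : nO ((grad G (s_ n)).1 - (grad G t).1) @[n --> \oo] --> 0.
  apply: (cvg_dist_le _ (cvgZ0 K st)); apply: nearW => n.
  rewrite subr0 (ger0_norm (n2_ge0 _ _ _)).
  by have [<- _ _] := n2_grad_sub (Hs n) Ht; have [] := hK _ (V_sub (Vs n) Vt).
have c2 : nO ((grad G (s_ n)).2 - (grad G t).2) @[n --> \oo] --> 0.
  apply: (cvg_dist_le _ (cvgZ0 K st)); apply: nearW => n.
  rewrite subr0 (ger0_norm (n2_ge0 _ _ _)).
  by have [_ <- _] := n2_grad_sub (Hs n) Ht; have [] := hK _ (V_sub (Vs n) Vt).
have wg := weak_grad_cvg Hs Lg (L2_grad1 Ht) (L2_grad2 Ht) sg c1 c2.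
have Hg : H1 G g by split => //; exists (grad G t).
have [g1 g2] := weak_grad_ae setting wg.
have d1 : nO ((grad G (s_ n)).1 - (grad G g).1) @[n --> \oo] --> 0.
  apply: (cvg_dist_le _ c1); apply: nearW => n.
  rewrite subr0 (ger0_norm (n2_ge0 _ _ _)) le_eqVlt; apply/orP; left; apply/eqP.
  apply: (ae_eq_n2 mOm (L2B mOm (L2_grad1 (Hs n)) (L2_grad1 Hg))
    (L2B mOm (L2_grad1 (Hs n)) (L2_grad1 Ht))).
  by apply: aeS g1 _ => x h Ox; rewrite -[LHS]/(_ x - _ x) -[RHS]/(_ x - _ x) h.
have d2 : nO ((grad G (s_ n)).2 - (grad G g).2) @[n --> \oo] --> 0.
  apply: (cvg_dist_le _ c2); apply: nearW => n.
  rewrite subr0 (ger0_norm (n2_ge0 _ _ _)) le_eqVlt; apply/orP; left; apply/eqP.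
  apply: (ae_eq_n2 mOm (L2B mOm (L2_grad2 (Hs n)) (L2_grad2 Hg))
    (L2B mOm (L2_grad2 (Hs n)) (L2_grad2 Ht))).
  by apply: aeS g2 _ => x h Ox; rewrite -[LHS]/(_ x - _ x) -[RHS]/(_ x - _ x) h.
have dt := trace_cvg Hs Hg sg d1 d2.
have Lt_ n := L2_trace setting (Hs n); have Lt := L2_trace setting Hg.
have Vg : V G g.
  split; first exact: Hg.
  - apply: (eq0_of_trace_cvg (GD_measurable setting) (@GD_bdry _ _ setting) Lt_ Lt dt).
    by move=> n; have [] := Vs n.
  - by apply: (periodic_of_trace_cvg Lt_ Lt dt) => n; have [] := Vs n.
split; first exact: Vg.
apply/eqP; rewrite eq_le sqrtr_ge0 andbT; have [L L0 hL] := dH_upper.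
apply: (@ler_cvg0 _ _ \oo _ _ _ (fun n => L * (nO ((grad G (s_ n)).1 - (grad G g).1) +
  nO ((grad G (s_ n)).2 - (grad G g).2) + nB (trace G (s_ n) - trace G g)) +
  Num.sqrt (dH G (s_ n - t) (s_ n - t)))).
  apply: nearW => n; rewrite add0r.
  have of_eq (x y : R) : x = y -> x <= y by move=> ->.
  have h := ler_nrm_dist (preinner_V setting) Vg (Vs n) Vt.
  have hE := of_eq _ _ (nrm_distC (preinner_V setting) Vg (Vs n)).
  have [e1 e2 e3] := n2_grad_sub (Hs n) Hg.
  have h1 := hL _ (V_sub (Vs n) Vg); rewrite e1 e2 e3 in h1.
  exact: le_trans h (lerD (le_trans hE h1) (lexx _)).
rewrite -[X in _ --> X]addr0; apply: cvgD => //; apply: cvgZ0.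
rewrite -[X in _ --> X]addr0 -[X in _ --> X + _]addr0.
by apply: cvgD => //; apply: cvgD.
Qed.

End closability.

(** * Constants, and the weak form of the eigenvector equation *)

Section constants_eigenvectors.
Context {R : realType} (G : graetz_data R) (setting : graetz_setting G).
Local Notation fn := (R * R -> R).
Local Notation Om := (Om G).
Local Notation bdry := (bdry G).
Local Notation nO := (n2 (@area R) Om).
Local Notation nB := (n2 (@arclength R) bdry).
Implicit Types (s v w g u : fn) (p q : fn * fn).
Local Notation mOm := (Om_measurable setting).
Local Notation mB := (bdry_measurable setting).

Lemma L2_Om_cst k : L2 area Om (cst k).
Proof. exact: (L2_cst mOm (Om_area setting)). Qed.

Lemma weak_grad_cst k : weak_grad G (cst k) 0.
Proof.
split; [exact: (L2_0 _ mOm)|exact: (L2_0 _ mOm)|move=> v tv].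
have [Lv1 Lv2] := test_derive_L2 (Om_open setting) (Om_area setting) tv.
have Lv := test_L2 (Om_open setting) (Om_area setting) tv.
have [i1 i2] := integral_derive_test (Om_open setting) (Om_area setting) tv.
have I1 := L2_integrable mOm (Om_area setting) Lv1.
have I2 := L2_integrable mOm (Om_area setting) Lv2.
have z := dot0l (preinner_L2 (@area R) mOm) Lv.
rewrite (RintegralZl _ mOm I1) (RintegralZl _ mOm I2) i1 i2 mulr0.
by split; apply/esym/eqP; rewrite oppr_eq0; apply/eqP; exact: z.
Qed.

Lemma H1_cst k : H1 G (cst k).
Proof. by split; [exact: L2_Om_cst|exists 0; exact: weak_grad_cst]. Qed.

(** The trace inequality for the C^1 function [cst k] bounds its boundary norm by its norm on [Om],
    finite because the area is. In particular the boundary has finite length. *)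
Lemma L2_bdry_cst k : L2 arclength bdry (cst k).
Proof.
apply: (norm2_L2 mB); first exact: measurable_cst.
have [_ [K K0 hK]] := traces_exist setting.
apply: (le_lt_trans (hK _ (C1_cst k))).
have D (e : R * R) : 'D_e (cst k : fn) = cst 0 by apply/funext => x; exact: derive_cst.
rewrite !D (norm2_n2 mOm (L2_Om_cst k)) (norm2_n2 mOm (L2_Om_cst 0)).
by rewrite -!EFinD -EFinM ltry.
Qed.

Lemma is_trace_cst k : is_trace G (cst k) (cst k).
Proof.
split; first exact: L2_bdry_cst.
exists (fun=> cst k).
have D (e : R * R) : 'D_e (cst k : fn) = cst 0 by apply/funext => x; exact: derive_cst.
have [g1 g2] := weak_grad_ae setting (weak_grad_cst k).
have z (d : measure_display) (T : measurableType d) (mu : {measure set T -> \bar R})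
    (E : set T) (mE : measurable E) (f : T -> R) : f = cst 0 %[ae mu in E] ->
    Defs.L2 mu E f -> norm2 mu E f @[n --> \oo] --> 0%E.
  move=> f0 Lf; rewrite (ae_eq_norm2_0 mE f0 Lf); exact: cvg_cst.
split.
- by move=> n; exact: C1_cst.
- by apply: (z _ _ _ _ mOm); rewrite subrr; [exact: ae_eq_refl_in|exact: (L2_0 _ mOm)].
- rewrite D; apply: (z _ _ _ _ mOm); last first.
    exact: (L2B mOm (L2_Om_cst 0) (L2_grad1 (H1_cst k))).
  by apply: aeS g1 _ => x h Ox; rewrite -[LHS]/(0 - (grad G (cst k)).1 x) h// subr0.
- rewrite D; apply: (z _ _ _ _ mOm); last first.
    exact: (L2B mOm (L2_Om_cst 0) (L2_grad2 (H1_cst k))).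
  by apply: aeS g2 _ => x h Ox; rewrite -[LHS]/(0 - (grad G (cst k)).2 x) h// subr0.
- by apply: (z _ _ _ _ mB); rewrite subrr; [exact: ae_eq_refl_in|exact: (L2_0 _ mB)].
Qed.

Lemma uncontrolled_empty : ~ controlled G -> GD G = set0 /\ GR G = set0.
Proof.
by move=> nc; split; apply/seteqP; split => // x h; apply: nc; exists x; [left|right].
Qed.

Lemma V_cst k : ~ controlled G -> V G (cst k).
Proof.
move=> /uncontrolled_empty[D0 R0].
have tk := trace_uniq setting (H1_cst k) (trace_is_trace setting (H1_cst k)) (is_trace_cst k).
split; first exact: H1_cst.
- by rewrite D0; apply: aeW => x [].
- have h := ae_twin setting tk; have h' := ae_bdry_sub (@GP_bdry _ _ setting) tk.
  by apply: aeS2 h h' _ => x h1 h2 Px; exact: etrans (h1 Px) (esym (h2 Px)).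
Qed.

Lemma dH_cst k v : ~ controlled G -> V G v -> dH G (cst k) v = 0.
Proof.
move=> nc Vv; have [_ R0] := uncontrolled_empty nc; have Hv := V_H1 Vv.
have [g1 g2] := weak_grad_ae setting (weak_grad_cst k).
have [m [M [m0 M0 mw wM mw']]] := s_weight setting.
have L0 := L2_0 (@area R) mOm; have Hk := H1_cst k.
have e1 : ips G (grad G (cst k)).1 (grad G v).1 = ips G 0 (grad G v).1.
  by apply: (eq_wdot mOm mw wM (L2_grad1 Hk) L0 (L2_grad1 Hv) (L2_grad1 Hv) g1);
    exact: ae_eq_refl_in.
have e2 : ips G (grad G (cst k)).2 (grad G v).2 = ips G 0 (grad G v).2.
  by apply: (eq_wdot mOm mw wM (L2_grad2 Hk) L0 (L2_grad2 Hv) (L2_grad2 Hv) g2);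
    exact: ae_eq_refl_in.
rewrite (dot0l (preinner_ips setting) (L2_grad1 Hv)) in e1.
rewrite (dot0l (preinner_ips setting) (L2_grad2 Hv)) in e2.
have e3 : ipa G (trace G (cst k)) (trace G v) = 0.
  by rewrite /ipa /wdot R0 Rintegral_set0.
by rewrite /dH e1 e2 e3 !addr0.
Qed.

(** Green's formula: [normal_flux] is defined as the integral of the divergence against [v] plus the
    gradient term, and the lateral conditions equate it with minus the Robin term. *)
Lemma normal_fluxE s v : V G s -> V G v -> (exists f, is_div G s f) -> lateral_flux G s ->
  dH G s v = - dot2 area Om (div_sigma_grad G s) v.
Proof.
move=> Vs Vv [f sf] lat; have := lat v Vv.
have Ldiv : L2 area Om (div_sigma_grad G s).
  by have [] := @xgetPex _ 0 [set f | is_div G s f] (ex_intro _ f sf).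
have [i2 E] := int_dot_grad setting (V_H1 Vs) (V_H1 Vv).
have i1 := L2_mul_integrable mOm Ldiv (V_L2 Vv).
rewrite /normal_flux (RintegralD mOm i1 i2) E => h.
have lin (a b c d : R) : a + (b + c) = - d -> b + c + d = - a by lra.
exact: lin h.
Qed.

Lemma div_ae s f : is_div G s f -> div_sigma_grad G s = f %[ae area in Om].
Proof.
move=> sf; have sd : is_div G s (div_sigma_grad G s).
  exact: (@xgetPex _ 0 [set f | is_div G s f]) (ex_intro _ f sf).
have [Lf hf] := sf; have [Ld hd] := sd; apply: ae_sub0.
apply: (fundamental_lemma (Om_open setting) (Om_area setting) (L2B mOm Ld Lf)) => v tv.
have Lv := test_L2 (Om_open setting) (Om_area setting) tv.
have e := dotBl (preinner_L2 (@area R) mOm) Ld Lf Lv.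
apply: (etrans e); apply/eqP; rewrite subr_eq0; apply/eqP; apply: oppr_inj.
exact: etrans (esym (hd v tv)) (hf v tv).
Qed.

Lemma inv_Delta_h_eq s v : is_inv_Delta_h G s -> V G v -> dH G s v = - iph G (cst 1) v.
Proof.
move=> [Vs sd lat] Vv; rewrite (normal_fluxE Vs Vv (ex_intro _ _ sd) lat); congr (- _).
have Ldiv : L2 area Om (div_sigma_grad G s).
  by have [] := @xgetPex _ 0 [set f | is_div G s f] (ex_intro _ _ sd).
apply: (etrans (eq_dot2 mOm Ldiv sd.1 (V_L2 Vv) (V_L2 Vv) (div_ae sd) (ae_eq_refl_in _ _ _))).
by apply: eq_Rintegral => x _; rewrite /= mulr1.
Qed.

Section spectrum.
Variables (lam : int -> R) (U : int -> fn) (s0 : fn).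
Hypothesis basis : eigenbasis G lam U s0.

Lemma lam_neq0 i : i != 0 -> lam i != 0.
Proof.
have ord := eigenvalue_order basis; case: i => [[//|n]|n] _.
  by have [h _ _ _] := ord n; rewrite gt_eqF.
by have [_ _ h _] := ord n; rewrite lt_eqF// NegzE.
Qed.

Lemma V_eigen i : i != 0 -> V G (U i).
Proof. by move=> /(eigenvector basis)[[]]. Qed.

Lemma HH_eigen i : i != 0 -> HH G (phi lam U i).
Proof. by move=> /(eigenvector basis)[[]]. Qed.

(** The first component of the eigenvector equation gives the divergence of [sigma grad s] as
    [h U i - lam i * c U i]; testing it against [v] gives the identity. It trades the product of [H]
    for L^2 products, which is what makes the modes of a solution differentiable. *)
Lemma eigen_eq i v : i != 0 -> V G v ->
  dH G ((lam i)^-1 *: U i) v = lam i * ipc G (U i) v - iph G (U i) v.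
Proof.
move=> i0 Vv; have [[[LU Vs] VU [f sf] lat] [eA _]] := eigenvector basis i0.
rewrite (normal_fluxE Vs Vv (ex_intro _ f sf) lat).
set s := (lam i)^-1 *: U i; set D := div_sigma_grad G s.
have Ldiv : L2 area Om D.
  by have [] := @xgetPex _ 0 [set f | is_div G s f] (ex_intro _ f sf).
have [m [M [m0 M0 mc cM mc']]] := c_weight setting; have [N [N0 mh hN]] := h_weight setting.
have Lc := L2_weight mOm mc cM LU; have Lh := L2_weight mOm mh hN LU.
have PI := preinner_L2 (@area R) mOm.
(* The eigenvector equation solved for the divergence; dividing by [cc] is harmless where it is
   bounded below by [m]. *)
have DE : D = (- lam i) *: (fun x => cc G x * U i x) + (fun x => hh G x * U i x) %[ae area in Om].
  apply: aeS2 eA mc' _ => x h1 h2 Ox; have c0 : cc G x != 0.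
    by rewrite gt_eqF// (lt_le_trans m0)// h2.
  have := h1 Ox; rewrite /opA /phi /= -/s -/D.
  rewrite -[(lam i *: U i) x]/(lam i * U i x) => h3.
  rewrite -[RHS]/(- lam i * (cc G x * U i x) + hh G x * U i x).
  have -> : D x = hh G x * U i x - cc G x * ((cc G x)^-1 * hh G x * U i x - (cc G x)^-1 * D x).
    by field.
  by rewrite h3; ring.
have e := eq_dot2 mOm Ldiv (L2_lin mOm (- lam i) Lc Lh) (V_L2 Vv) (V_L2 Vv) DE (ae_eq_refl_in _ _ _).
rewrite e (hilb_dotl PI (- lam i) Lc Lh (V_L2 Vv)) opprD mulNr opprK; congr (_ * _ - _).
Qed.

Lemma eigen_dH i v : i != 0 -> V G v ->
  dH G (U i) v = lam i * (lam i * ipc G (U i) v - iph G (U i) v).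
Proof.
move=> i0 Vv; rewrite -(eigen_eq i0 Vv) (dotZl (preinner_V setting) _ (V_eigen i0) Vv).
by rewrite mulrA divff ?mul1r// lam_neq0.
Qed.

End spectrum.

End constants_eigenvectors.

Lemma eq_dH {R : realType} (G : graetz_data R) (setting : graetz_setting G)
    (s t v : R * R -> R) : V G s -> V G t -> s = t %[ae area in Om G] ->
  dH G s v = dH G t v.
Proof.
move=> Vs Vt st; have Es := ae_eq_grad setting (V_L2 Vs) (V_L2 Vt) st.
have Et := ae_eq_trace setting (V_L2 Vs) (V_L2 Vt) st.
by rewrite /dH Es Et.
Qed.

(** * The projection pi_- and the operator B_- *)

Section projection.
Local Opaque grad trace wdot dH ipc ips ipa iph dot.
Context {R : realType} (G : graetz_data R) (setting : graetz_setting G).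
Local Notation fn := (R * R -> R).
Local Notation Om := (Om G).
Variables (lam : int -> R) (U : int -> fn) (s0 : fn).
Hypothesis basis : eigenbasis G lam U s0.
Implicit Types (p q r : fn * fn).
Local Notation PI := (preinner_HH setting).
Local Notation nH := (normHH G).

Definition em (k : nat) : fn * fn := phi lam U (- k.+1%:Z).
Definition ep (k : nat) : fn * fn := phi lam U k.+1%:Z.
Local Notation msum := (is_sum (HH G) (dot G) em).

Lemma negz_neq0 (k : nat) : - k.+1%:Z != 0 :> int.
Proof. by rewrite oppr_eq0. Qed.

Lemma posz_neq0 (k : nat) : k.+1%:Z != 0 :> int.
Proof. by []. Qed.

Lemma em_HH k : HH G (em k).
Proof. exact: (HH_eigen basis (negz_neq0 k)). Qed.

Lemma ep_HH k : HH G (ep k).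
Proof. exact: (HH_eigen basis (posz_neq0 k)). Qed.

Lemma em_orthonormal j k : dot G (em j) (em k) = (j == k)%:R.
Proof.
rewrite (eigenvector_orthonormal basis (negz_neq0 j) (negz_neq0 k)).
by rewrite eqr_opp eqz_nat eqSS.
Qed.

Lemma ep_orthonormal j k : dot G (ep j) (ep k) = (j == k)%:R.
Proof.
rewrite (eigenvector_orthonormal basis (posz_neq0 j) (posz_neq0 k)).
by rewrite eqz_nat eqSS.
Qed.

Lemma em_ep j k : dot G (em j) (ep k) = 0.
Proof. by rewrite (eigenvector_orthonormal basis (negz_neq0 j) (posz_neq0 k)). Qed.

Lemma int_cases (i : int) : i != 0 ->
  (exists k : nat, i = - k.+1%:Z) \/ (exists k : nat, i = k.+1%:Z).
Proof. by case: i => [[//|k]|k] _; [right|left]; exists k; rewrite ?NegzE. Qed.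

Lemma RminusE : Rminus G lam U = hspan (HH G) (dot G) [set q | exists k, q = em k].
Proof.
rewrite /Rminus /hspan /cspan; congr [set p | _ /\ _].
have -> : [set q | exists2 i : int, i < 0 & q = phi lam U i] = [set q | exists k, q = em k].
  apply/seteqP; split => q /=; last by move=> [k ->]; exists (- k.+1%:Z).
  move=> [i i0 ->]; have [|[k ->]|[k ik]] := @int_cases i; first by rewrite lt_eqF.
    by exists k.
  by rewrite ik in i0.
by [].
Qed.

Lemma Rminus_HH p : Rminus G lam U p -> HH G p. Proof. by case. Qed.

Lemma Rminus_sum p : Rminus G lam U p -> msum (fun k => dot G p (em k)) p.
Proof.
rewrite RminusE => h.
exact: (hspan_is_sum PI em_HH (HH_complete setting) em_orthonormal h).
Qed.

Lemma sum_Rminus a p : msum a p -> Rminus G lam U p.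
Proof. by rewrite RminusE => ap; apply: (is_sum_hspan PI em_HH _ ap) => k; exists k. Qed.

Lemma sum_coef a p k : msum a p -> dot G p (em k) = a k.
Proof. exact: (is_sum_coef PI em_HH em_orthonormal). Qed.

Lemma sum_dot0 a p r : msum a p -> HH G r -> (forall k, dot G (em k) r = 0) -> dot G p r = 0.
Proof.
move=> ap Hr er; have c := is_sum_dot PI em_HH ap Hr.
apply: (cvg_unique (@Rhausdorff R) c).
rewrite (_ : (fun n => _) = cst 0); first exact: cvg_cst.
by apply/funext => n; rewrite big1// => k _; rewrite er mulr0.
Qed.

(** The Fourier series on [em] sums to an orthogonal projection, so the choice in [pi_minus] is not
    the default value. From here on the projection is handled through its coefficients. *)
Lemma pi_minusP p : HH G p -> Rminus G lam U (pi_minus G lam U p) /\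
  forall k, dot G (pi_minus G lam U p) (em k) = dot G p (em k).
Proof.
move=> Hp; have [q pq] := bessel_is_sum PI em_HH (HH_complete setting) em_orthonormal Hp.
have Rq := sum_Rminus pq; have Hq := Rminus_HH Rq.
have ex : exists q, [set q | Rminus G lam U q /\
    forall r, Rminus G lam U r -> dot G (p - q) r = 0] q.
  exists q; split => // r Rr; have Hr := Rminus_HH Rr.
  rewrite (hilbC PI (hilbB PI Hp Hq) Hr).
  apply: (sum_dot0 (Rminus_sum Rr) (hilbB PI Hp Hq)) => k.
  rewrite (dotBr PI Hp Hq (em_HH k)) (hilbC PI (em_HH k) Hq) (sum_coef k pq).
  by rewrite (hilbC PI (em_HH k) Hp) subrr.
have [Rpi hpi] : [set q | Rminus G lam U q /\
    forall r, Rminus G lam U r -> dot G (p - q) r = 0] (pi_minus G lam U p).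
  exact: xgetPex ex.
split=> [|k]; first exact: Rpi.
have Rk : Rminus G lam U (em k).
  rewrite RminusE; split; first exact: em_HH.
  move=> e e0; exists 1%N, (fun=> 1), (fun=> em k); split; first by move=> _; exists k.
  by rewrite big_ord1 scale1r subrr (nrm0 PI).
have := hpi _ Rk; rewrite (dotBl PI Hp (Rminus_HH Rpi) (em_HH k)) => /eqP.
rewrite subr_eq0 => /eqP h; exact (esym h).
Qed.

Local Opaque pi_minus.

Lemma pi_minus_sum p : HH G p -> msum (fun k => dot G p (em k)) (pi_minus G lam U p).
Proof.
move=> Hp; have [Rp pk] := pi_minusP Hp.
by apply: is_sum_ext (Rminus_sum Rp) => k; exact: pk.
Qed.

Lemma pi_minus_id p : Rminus G lam U p -> nH (pi_minus G lam U p - p) = 0.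
Proof.
move=> Rp; exact: (is_sum_uniq PI em_HH (pi_minus_sum (Rminus_HH Rp)) (Rminus_sum Rp)).
Qed.

Lemma pi_minus_le p : HH G p -> nH (pi_minus G lam U p) <= nH p.
Proof.
move=> Hp; have [Rp pk] := pi_minusP Hp; have Hpi := Rminus_HH Rp.
have E : dot G (pi_minus G lam U p) (pi_minus G lam U p) = dot G p (pi_minus G lam U p).
  apply/eqP; rewrite -subr_eq0 -(dotBl PI Hpi Hp Hpi); apply/eqP.
  rewrite (hilbC PI (hilbB PI Hpi Hp) Hpi).
  apply: (sum_dot0 (Rminus_sum Rp) (hilbB PI Hpi Hp)) => k.
  rewrite (dotBr PI Hpi Hp (em_HH k)) (hilbC PI (em_HH k) Hpi) (hilbC PI (em_HH k) Hp).
  by rewrite pk subrr.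
exact: (nrm_le_of_dot PI Hp Hpi E).
Qed.

Lemma Pproj_HH p : HH G p -> HH G (Pproj p).
Proof. by move=> Hp; exact: (HH_left setting Hp.1). Qed.

Lemma dot_Pproj p q : HH G p -> HH G q -> dot G (Pproj p) q = ipc G p.1 q.1.
Proof. by move=> Hp Hq; exact: (dot_left setting Hp.1 Hq). Qed.

Lemma nH_Pproj p : HH G p -> nH (Pproj p) = Num.sqrt (ipc G p.1 p.1).
Proof. by move=> Hp; exact: (normHH_left setting Hp.1). Qed.

(** [eqHH] allows the second components to differ by a constant when the constants are not
    controlled, and there [dH] annihilates constants. *)
Lemma eqHH_dot p q r : HH G p -> HH G q -> HH G r -> eqHH G p q -> dot G p r = dot G q r.
Proof.
move=> Hp Hq Hr [e1 [ec enc]]; rewrite (dotE setting Hp Hr) (dotE setting Hq Hr).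
have [m [M [m0 M0 mc cM mc']]] := c_weight setting; have mOm := Om_measurable setting.
have -> : ipc G p.1 r.1 = ipc G q.1 r.1.
  apply: (eq_wdot mOm mc cM Hp.1 Hq.1 Hr.1 Hr.1 _ (ae_eq_refl_in _ _ _)).
  exact: e1.
have W s t : V G s -> V G t -> s = t %[ae area in Om] -> dH G s r.2 = dH G t r.2.
  by move=> Vs Vt st; exact: (eq_dH setting r.2 Vs Vt st).
have F : dH G p.2 r.2 = dH G q.2 r.2.
  have [c|nc] := pselect (controlled G); first exact: (W _ _ Hp.2 Hq.2 (ec c)).
  have [k qk] := enc nc; have Vk := V_cst setting k nc.
  apply: (etrans (W _ _ Hp.2 (hilbD (preinner_V setting) Hq.2 Vk) qk)).
  apply: (etrans (dotDl (preinner_V setting) Hq.2 Vk Hr.2)).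
  rewrite (dH_cst setting k nc Hr.2); exact: addr0.
exact: congr1 _ F.
Qed.

Hypothesis invertible : compression_invertible G lam U.

Lemma compression_coef p k : Rminus G lam U p ->
  dot G (compression G lam U p) (em k) = dot G (Pproj p) (em k).
Proof.
move=> Rp; have Hp := Rminus_HH Rp; have [Rpi _] := pi_minusP Hp.
have Hpi := Rminus_HH Rpi; have [_ ->] := pi_minusP (Pproj_HH Hpi).
rewrite (dot_Pproj Hpi (em_HH k)) (dot_Pproj Hp (em_HH k)).
apply/eqP; rewrite -subr_eq0 -(dotBl (preinner_ipc setting) Hpi.1 Hp.1 (em_HH k).1); apply/eqP.
apply: (dot_null_l (preinner_ipc setting)); first exact: (hilbB PI Hpi Hp).1.
  exact: (em_HH k).1.
apply/eqP; rewrite eq_le sqrtr_ge0 andbT.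
have := le_normHH1 setting (hilbB PI Hpi Hp).
by rewrite (pi_minus_id Rp).
Qed.

(** On the range of pi_- the compression of [p] is the projection of [(p.1, 0)] up to a null vector,
    and projecting does not increase the norm. The lower bound on the compression thus bounds [p] by
    its first component alone. *)
Lemma Rminus_lower : exists2 K : R, 0 < K & forall p, Rminus G lam U p ->
  nH p <= K * Num.sqrt (ipc G p.1 p.1).
Proof.
have [_ [k k0 hk]] := invertible; exists k^-1; first by rewrite invr_gt0.
move=> p Rp; have Hp := Rminus_HH Rp; have [Rpi _] := pi_minusP Hp.
have Hpi := Rminus_HH Rpi.
rewrite ler_pdivlMl//; apply: (le_trans (hk p Rp)).
apply: (le_trans (pi_minus_le (Pproj_HH Hpi))).
rewrite -(nH_Pproj Hp).
have E : nH (Pproj (pi_minus G lam U p) - Pproj p) = 0.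
  have -> : Pproj (pi_minus G lam U p) - Pproj p = Pproj (pi_minus G lam U p - p).
    by rewrite /Pproj; congr (_, _); rewrite /= subrr.
  rewrite (nH_Pproj (hilbB PI Hpi Hp)); apply/eqP; rewrite eq_le sqrtr_ge0 andbT.
  by have := le_normHH1 setting (hilbB PI Hpi Hp); rewrite (pi_minus_id Rp).
have := nrm_null_eq PI (Pproj_HH Hpi) (Pproj_HH Hp) E => e.
have of_eq (x y : R) : x = y -> x <= y by move=> ->.
exact: of_eq e.
Qed.

(** The compression of [p - q] has only zero coefficients on [em], so it is null, and so is [p - q]
    by the lower bound. *)
Lemma Rminus_uniq p q : Rminus G lam U p -> Rminus G lam U q ->
  (forall k, dot G (Pproj p) (em k) = dot G (Pproj q) (em k)) -> nH (p - q) = 0.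
Proof.
move=> Rp Rq pq; have [_ [k k0 hk]] := invertible.
have Hp := Rminus_HH Rp; have Hq := Rminus_HH Rq.
have E a b : (- 1 : R) *: a + b = b - a :> fn * fn by rewrite scaleN1r addrC.
have Rpq : Rminus G lam U (p - q).
  have := is_sum_lin PI em_HH (-1) (Rminus_sum Rq) (Rminus_sum Rp).
  by rewrite E => h; exact: sum_Rminus h.
have z j : dot G (compression G lam U (p - q)) (em j) = 0.
  rewrite (compression_coef j Rpq) (dot_Pproj (Rminus_HH Rpq) (em_HH j)).
  have h := pq j; rewrite (dot_Pproj Hp (em_HH j)) (dot_Pproj Hq (em_HH j)) in h.
  apply: (etrans (dotBl (preinner_ipc setting) Hp.1 Hq.1 (em_HH j).1)).
  by rewrite h subrr.
have [Rpi _] := pi_minusP (Rminus_HH Rpq).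
have [Rc _] := pi_minusP (Pproj_HH (Rminus_HH Rpi)).
have Hc := Rminus_HH Rc.
have c0 : nH (compression G lam U (p - q)) = 0.
  have zc : dot G (compression G lam U (p - q)) (compression G lam U (p - q)) = 0.
    apply: (sum_dot0 (Rminus_sum Rc) Hc) => j.
    exact: etrans (hilbC PI (em_HH j) Hc) (z j).
  exact: etrans (congr1 Num.sqrt zc) (sqrtr0 _).
have F (x y : R) : k * x <= y -> y = 0 -> 0 <= x -> x = 0.
  by move=> xy y0 x0; apply/eqP; rewrite eq_le x0 -(pmulr_rle0 _ k0) -y0 xy.
exact: F (hk _ Rpq) c0 (sqrtr_ge0 _).
Qed.

(** The working characterisation of [B_-]: its value lies in the range of pi_-, and replacing [p] by
    [P B_- p] changes no coefficient on the negative modes. *)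
Lemma BminusP p : HH G p -> Rminus G lam U (Bminus G lam U p) /\
  forall k, dot G (Pproj (Bminus G lam U p)) (em k) = dot G p (em k).
Proof.
move=> Hp; have [Rpi pik] := pi_minusP Hp; have Hpi := Rminus_HH Rpi.
have [p' Rp' ep'] := invertible.1 _ Rpi.
have [Rinv Einv] : [set p' | Rminus G lam U p' /\
    eqHH G (compression G lam U p') (pi_minus G lam U p)]
    (inv_compression G lam U (pi_minus G lam U p)).
  by apply: xgetPex; exists p'.
set r := inv_compression G lam U _ in Rinv Einv.
have Hr := Rminus_HH Rinv; have [RB _] := pi_minusP Hr; split=> [|k]; first exact: RB.
have HB := Rminus_HH RB.
have [Rpr _] := pi_minusP Hr; have [Rc _] := pi_minusP (Pproj_HH (Rminus_HH Rpr)).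
have e := eqHH_dot (Rminus_HH Rc) Hpi (em_HH k) Einv.
rewrite -(pik k) -e (compression_coef k Rinv).
rewrite (dot_Pproj HB (em_HH k)) (dot_Pproj Hr (em_HH k)).
apply/eqP; rewrite -subr_eq0 -(dotBl (preinner_ipc setting) HB.1 Hr.1 (em_HH k).1); apply/eqP.
apply: (dot_null_l (preinner_ipc setting)); first exact: (hilbB PI HB Hr).1.
  exact: (em_HH k).1.
apply/eqP; rewrite eq_le sqrtr_ge0 andbT.
have := le_normHH1 setting (hilbB PI HB Hr).
by rewrite (pi_minus_id Rinv).
Qed.

End projection.

(** * Bounds on exponentials, and the flow of an abstract negative diagonal operator *)

Lemma expR_taylor2 {R : realType} (x : R) : `|expR x - 1 - x| <= x ^+ 2 * expR `|x|.
Proof.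
have h1 := expR_ge1Dx x; have h2 := expR_ge1Dx (- x).
(* The inequality [1 - x <= expR (- x)] multiplied by [expR x]. It reduces the remainder to
   [x * (expR x - 1)]. *)
have h3 : expR x - 1 <= x * expR x.
  have : (1 - x) * expR x <= 1.
    by rewrite -[leRHS](expRxMexpNx_1 x) mulrC ler_pM2l ?expR_gt0.
  lra.
rewrite ger0_norm; last by lra.
apply: (@le_trans _ _ (x * (expR x - 1))); first lra.
have [x0|x0] := leP 0 x.
  by rewrite ger0_norm// expr2 -mulrA ler_wpM2l.
apply: (@le_trans _ _ (x ^+ 2)); first by rewrite expr2 ler_nM2l//; lra.
by rewrite ler_peMr ?sqr_ge0// -expR0 ler_expR.
Qed.

(** Smoothing by exponential decay: [|x| * expR (x * c) <= 1 / c], raised to the power [j]. The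
    slice [c = z / (j + 1)] leaves the decay [expR (x * z)] stronger than [j] such factors, and
    makes sense also for [j = 0]. *)
Lemma pow_expR_bound {R : realType} j (z : R) : 0 < z ->
  exists2 C, 0 < C & forall x, x <= 0 -> `|x ^+ j * expR (x * z)| <= C.
Proof.
move=> z0; pose c := z / j.+1%:R; have c0 : 0 < c by rewrite divr_gt0.
exists (c^-1 ^+ j); first by rewrite exprn_gt0// invr_gt0.
move=> x x0; rewrite normrM normrX (ger0_norm (expR_ge0 _)).
have xz : expR (x * z) <= expR (x * c) ^+ j.
  rewrite -expRM_natl ler_expR /c (_ : j%:R * _ = x * z * (j%:R / j.+1%:R)); last by ring.
  have xz0 : x * z <= 0 by rewrite mulr_le0_ge0// ltW.
  have j1 : j%:R / j.+1%:R <= 1 :> R by rewrite ler_pdivrMr// mul1r ler_nat.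
  have : 0 <= (1 - j%:R / j.+1%:R) * - (x * z) by rewrite mulr_ge0 ?subr_ge0 ?oppr_ge0.
  have F (a b : R) : 0 <= (1 - b) * - a -> a <= a * b by lra.
  exact: F.
apply: (@le_trans _ _ (`|x| ^+ j * expR (x * c) ^+ j)).
  by rewrite ler_wpM2l// exprn_ge0.
rewrite -exprMn lerXn2r ?nnegrE ?mulr_ge0 ?expR_ge0 ?invr_ge0 ?(ltW c0)//.
have h : `|x| * c <= expR (`|x| * c).
  by apply: le_trans (expR_ge1Dx _); rewrite lerDr.
rewrite -(ler_pM2r c0) mulVf ?gt_eqF// -[leRHS](expRxMexpNx_1 (`|x| * c)) mulrAC.
by rewrite ler0_norm// mulNr opprK ler_wpM2r ?expR_ge0// -mulNr -(ler0_norm x0).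
Qed.

Section semigroup.
Context {R : realType} {E : lmodType R} (H : set E) (d : E -> E -> R).
Hypothesis PH : preinner H d.
Variable e : nat -> E.
Hypothesis He : forall k, H (e k).
Hypothesis HC : dot_complete H d.
Hypothesis ON : forall j k, d (e j) (e k) = (j == k)%:R.
Variables (mu : nat -> R) (m : R).
Hypotheses (mu_le : forall k, mu k <= m) (m0 : m < 0).
Local Notation nrm p := (Num.sqrt (d p p)).
Local Notation msum := (is_sum H d e).

(** The [j]-th derivative in [z] of the semigroup applied to the vector of coefficients [b]. It is a
    chosen sum because for [j > 0] the series need not converge at [z = 0], and because [b] is not
    always known to be square summable. *)
Definition flow j b z : E :=
  xget 0 [set q | msum (fun k => mu k ^+ j * expR (mu k * z) * b k) q].

Let mu0 k : mu k <= 0. Proof. exact: le_trans (mu_le k) (ltW m0). Qed.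

Lemma flowP j b p z : msum b p -> 0 < z ->
  msum (fun k => mu k ^+ j * expR (mu k * z) * b k) (flow j b z).
Proof.
move=> bp z0; have [C C0 hC] := pow_expR_bound j z0.
apply: (@xgetPex _ 0 [set q | msum (fun k => mu k ^+ j * expR (mu k * z) * b k) q]).
apply: (is_sum_exists_le PH He HC ON (ltW C0) _ bp) => k.
by rewrite normrM ler_wpM2r// hC.
Qed.

Let expR_mu_le z k : 0 <= z -> expR (mu k * z) <= expR (m * z).
Proof. by move=> z0; rewrite ler_expR ler_wpM2r. Qed.

Let expR_m_le1 z : 0 <= z -> expR (m * z) <= 1.
Proof. by move=> z0; rewrite -expR0 ler_expR mulr_le0_ge0// ltW. Qed.

Lemma flow0P b p z : msum b p -> 0 <= z ->
  msum (fun k => expR (mu k * z) * b k) (flow 0 b z).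
Proof.
move=> bp z0.
have [|q hq] := @is_sum_exists_le _ _ _ _ PH _ He HC ON (fun k => expR (mu k * z) * b k) _ _ 1 ler01 _ bp.
  move=> k; rewrite normrM ler_wpM2r// ger0_norm ?expR_ge0//.
  by apply: le_trans (expR_mu_le k z0) (expR_m_le1 z0).
have : msum (fun k => mu k ^+ 0 * expR (mu k * z) * b k) (flow 0 b z).
  apply: (@xgetPex _ 0 [set q | msum (fun k => mu k ^+ 0 * expR (mu k * z) * b k) q]).
  by exists q; apply: is_sum_ext hq => k; rewrite expr0 mul1r.
by apply: is_sum_ext => k; rewrite expr0 mul1r.
Qed.

Lemma flow0_le b p z : msum b p -> 0 <= z -> nrm (flow 0 b z) <= expR (m * z) * nrm p.
Proof.
move=> bp z0; apply: (is_sum_le PH He ON (expR_ge0 _) _ (flow0P bp z0) bp) => k.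
by rewrite normrM ler_wpM2r// ger0_norm ?expR_ge0// expR_mu_le.
Qed.

(** The multipliers [expR (mu k * z) - 1] are bounded by 1 and tend to 0 for each [k], as
    [is_sum_cvg0] requires. *)
Lemma flow0_cvg b p : msum b p -> nrm (flow 0 b z - p) @[z --> 0^'+] --> 0.
Proof.
move=> bp; have subE (x y : E) : x - y = -1 *: y + x by rewrite scaleN1r addrC.
apply: (@is_sum_cvg0 R E H d PH e He ON R (0^'+) _ (fun z k => expR (mu k * z) - 1) b p (fun z => flow 0 b z - p) bp).
  move=> k; rewrite -[X in _ --> X](subrr 1); apply: cvgB; last exact: cvg_cst.
  apply: cvg_at_right_filter.
  have : expR (mu k * z) @[z --> (0:R)] --> expR (mu k * 0).
    apply: (@continuous_comp _ _ _ (fun z => mu k * z) expR); first exact: mulrl_continuous.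
    exact: continuous_expR.
  by rewrite mulr0 expR0.
near=> z; have z0 : 0 <= z by near: z; exact: nbhs_right_ge.
split=> [k|].
  have h0 := expR_gt0 (mu k * z); have h1 := le_trans (expR_mu_le k z0) (expR_m_le1 z0).
  by rewrite ler_norml; apply/andP; split; lra.
rewrite subE; apply: is_sum_ext (is_sum_lin PH He (-1) bp (flow0P bp z0)) => k.
by rewrite mulrBl mul1r mulN1r addrC.
Unshelve. all: by end_near. Qed.

(** Taylor's formula mode by mode. The remainder [(mu t)^2 * expR |mu t|] uses up at most half of
    the decay [expR (mu z)] since [|t| <= z / 2], and what is left, [mu^(j+2) * expR (mu z / 2)], is
    bounded uniformly in the mode. *)
Lemma flow_taylor j b p z : msum b p -> 0 < z -> exists2 C, 0 < C &
  forall t, `|t| <= z / 2 ->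
    nrm (flow j b (z + t) - flow j b z - t *: flow j.+1 b z) <= C * t ^+ 2.
Proof.
move=> bp z0; have z2 : 0 < z / 2 by rewrite divr_gt0.
have [C C0 hC] := pow_expR_bound j.+2 z2.
exists (C * (nrm p + 1)); first by rewrite mulr_gt0// ltr_wpDl ?sqrtr_ge0.
move=> t tz; have zt : 0 < z + t by have := ler_norm (- t); rewrite normrN; lra.
have h := is_sum_lin PH He (-1) (flowP j bp z0) (flowP j bp zt).
have h2 := is_sum_lin PH He (- t) (flowP j.+1 bp z0) h.
have subE (x y w : E) : - t *: x + (-1 *: y + w) = w - y - t *: x.
  by rewrite scaleN1r scaleNr addrC [- y + w]addrC.
rewrite subE in h2.
have C' : 0 <= C * t ^+ 2 by rewrite mulr_ge0 ?sqr_ge0// ltW.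
apply: (@le_trans _ _ (C * t ^+ 2 * nrm p)); last first.
  by rewrite -mulrA -mulrA ler_pM2l// [t ^+ 2 * _]mulrC ler_wpM2r ?sqr_ge0// lerDl.
apply: (is_sum_le PH He ON C' _ h2 bp) => k.
have -> : - t * (mu k ^+ j.+1 * expR (mu k * z) * b k) +
  (-1 * (mu k ^+ j * expR (mu k * z) * b k) + mu k ^+ j * expR (mu k * (z + t)) * b k) =
  mu k ^+ j * expR (mu k * z) * (expR (mu k * t) - 1 - mu k * t) * b k.
  by rewrite mulrDr expRD exprS; ring.
rewrite normrM ler_wpM2r// normrM.
apply: (@le_trans _ _ (`|mu k ^+ j * expR (mu k * z)| * ((mu k * t) ^+ 2 * expR `|mu k * t|))).
  by rewrite ler_wpM2l// expR_taylor2.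
have F2 (x a s y : R) : x * (a * s * y) = x * a * y * s by ring.
rewrite exprMn F2 ler_wpM2r ?sqr_ge0//.
apply: le_trans (hC _ (mu0 k)).
rewrite -[mu k ^+ 2]real_normK ?num_real//.
rewrite [X in _ <= X]normrM normrX -[in X in _ <= X]addn2 exprD.
rewrite !normrM !(ger0_norm (expR_ge0 _)) normrX.
have e1 : expR (mu k * z) * expR (`|mu k| * `|t|) <= expR (mu k * (z / 2)).
  rewrite -expRD ler_expR (ler0_norm (mu0 k)).
  have := ler_wnM2l (mu0 k) tz; rewrite mulNr; lra.
have F (x y u v w : R) : 0 <= x -> 0 <= y -> u * v <= w -> x * u * y * v <= x * y * w.
  move=> x0 y0 uv; rewrite (_ : x * u * y * v = x * y * (u * v)); last by ring.
  by rewrite ler_wpM2l// mulr_ge0.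
by apply: F; rewrite ?exprn_ge0.
Qed.

Lemma flow_cvg j b p z : msum b p -> 0 < z ->
  nrm (flow j b y - flow j b z) @[y --> z] --> 0.
Proof.
move=> bp z0; have z2 : 0 < z / 2 by rewrite divr_gt0.
have [C C0 hC] := flow_taylor j bp z0.
have Hf i y : 0 < y -> H (flow i b y) by move=> y0; have [] := flowP i bp y0.
apply: (@cvg_dist_le _ _ _ _ _ (fun y => C * (y - z) ^+ 2 + `|y - z| * nrm (flow j.+1 b z))).
  near=> y; have yz : `|y - z| <= z / 2.
    by rewrite distrC; near: y; apply: cvgr_dist_le => //; exact: cvg_id.
  have y0 : 0 < y by have := ler_norm (z - y); rewrite distrC; lra.
  rewrite subr0 ger0_norm ?sqrtr_ge0//.
  have h := hC _ yz; rewrite [z + _]addrC subrK in h.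
  have Hyz : H (flow j b y - flow j b z) by apply: (hilbB PH); exact: Hf.
  have Ht : H ((y - z) *: flow j.+1 b z) by apply: (hilbZ PH); exact: Hf.
  rewrite -(nrmZ PH _ (Hf _ _ z0)).
  rewrite -[X in d X _](subrK ((y - z) *: flow j.+1 b z)).
  rewrite -[X in d _ X](subrK ((y - z) *: flow j.+1 b z)).
  apply: (le_trans (ler_nrmD PH (hilbB PH Hyz Ht) Ht)).
  by rewrite lerD2r.
have c0 : y - z @[y --> z] --> (0 : R).
  by rewrite -[X in _ --> X](subrr z); apply: cvgB; [exact: cvg_id|exact: cvg_cst].
have l : `|y - z| @[y --> z] --> (0 : R).
  by rewrite -(@normr0 R R); exact: cvg_norm.
have E0 : C * (0 * 0) + 0 * nrm (flow j.+1 b z) = 0 by rewrite !mul0r mulr0 addr0.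
rewrite -[X in _ --> X]E0; apply: cvgD; last by apply: cvgM => //; exact: cvg_cst.
apply: cvgM; first exact: cvg_cst.
by under eq_fun do rewrite expr2; exact: cvgM.
Unshelve. all: by end_near. Qed.

Lemma flow_is_derive j b p (z : R) r : msum b p -> 0 < z -> H r ->
  is_derive z 1 (fun y => d (flow j b y) r) (d (flow j.+1 b z) r).
Proof.
move=> bp z0 Hr; have z2 : 0 < z / 2 by rewrite divr_gt0.
have [C C0 hC] := flow_taylor j bp z0.
have Hf i y : 0 < y -> H (flow i b y) by move=> y0; have [] := flowP i bp y0.
apply: (@is_derive_quadratic _ _ _ _ (C * nrm r) (z / 2)) => // t tz.
have zt : 0 < z + t by have := ler_norm (- t); rewrite normrN; lra.
rewrite -(dotBl PH (Hf _ _ zt) (Hf _ _ z0) Hr) mulrC -(dotZl PH _ (Hf _ _ z0) Hr).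
have Hyz : H (flow j b (z + t) - flow j b z) by apply: (hilbB PH); exact: Hf.
have Ht : H (t *: flow j.+1 b z) by apply: (hilbZ PH); exact: Hf.
rewrite -(dotBl PH Hyz Ht Hr).
apply: (le_trans (dot_cauchy_schwarz PH (hilbB PH Hyz Ht) Hr)).
by rewrite mulrAC ler_wpM2r ?sqrtr_ge0// hC// ltW.
Qed.

End semigroup.

(** * Series of eigenvectors and the action of the operator on them *)

Section eigenfamily.
Local Opaque grad trace wdot dH ipc ips ipa iph dot pi_minus.
Context {R : realType} (G : graetz_data R) (setting : graetz_setting G).
Local Notation fn := (R * R -> R).
Local Notation Om := (Om G).
Local Notation nO := (n2 (@area R) Om).
Variables (lam : int -> R) (U : int -> fn) (s0 : fn).
Hypothesis basis : eigenbasis G lam U s0.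
Variable idx : nat -> int.
Hypothesis idx0 : forall k, idx k != 0.
Implicit Types (p q r psi chi : fn * fn) (a : nat -> R).
Local Notation PI := (preinner_HH setting).
Local Notation e := (fun k => phi lam U (idx k)).
Local Notation mu := (fun k => lam (idx k)).
Local Notation msum := (is_sum (HH G) (dot G) e).

Let He k : HH G (e k). Proof. exact: (HH_eigen basis (idx0 k)). Qed.

Lemma psum_fst a n : (psum e a n).1 = \sum_(k < n) a k *: U (idx k).
Proof.
elim: n => [|n IH]; first by rewrite /psum !big_ord0.
by rewrite psumS big_ord_recr -IH.
Qed.

Lemma psum_snd a n :
  (psum e (fun k => mu k * a k) n).2 = \sum_(k < n) a k *: U (idx k).
Proof.
elim: n => [|n IH]; first by rewrite /psum !big_ord0.
rewrite psumS big_ord_recr -IH; congr (_ + _).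
rewrite -[LHS]/((lam (idx n) * a n) *: ((lam (idx n))^-1 *: U (idx n))).
by rewrite scalerA mulrAC divff ?mul1r// (lam_neq0 basis).
Qed.

Lemma nO_fst_le : exists2 K : R, 0 < K & forall p, HH G p -> nO p.1 <= K * normHH G p.
Proof.
have [K K0 hK] := ipc_lower setting; exists K => //.
move=> p Hp; apply: (le_trans (hK _ Hp.1)); rewrite ler_pM2l//.
exact: (le_normHH1 setting Hp).
Qed.

Lemma fst_cvg {Z : Type} (F : set_system Z) {FF : Filter F} (p_ : Z -> fn * fn) :
  (\forall z \near F, HH G (p_ z)) -> normHH G (p_ z) @[z --> F] --> 0 ->
  nO (p_ z).1 @[z --> F] --> 0.
Proof.
move=> Hp p0; have [K K0 hK] := nO_fst_le.
apply: (@cvg_dist_le _ _ _ _ _ (fun z => K * normHH G (p_ z))).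
  apply: filterS Hp => z Hz; rewrite subr0 ger0_norm; last exact: n2_ge0.
  exact: hK.
by rewrite -[X in _ --> X](mulr0 K); apply: cvgM => //; exact: cvg_cst.
Qed.

Lemma snd_cvg {Z : Type} (F : set_system Z) {FF : Filter F} (p_ : Z -> fn * fn) :
  (\forall z \near F, HH G (p_ z)) -> normHH G (p_ z) @[z --> F] --> 0 ->
  Num.sqrt (dH G (p_ z).2 (p_ z).2) @[z --> F] --> 0.
Proof.
move=> Hp p0; apply: (@cvg_dist_le _ _ _ _ _ (fun z => normHH G (p_ z))); last exact: p0.
apply: filterS Hp => z Hz; rewrite subr0 ger0_norm; last exact: sqrtr_ge0.
exact: (le_normHH2 setting Hz).
Qed.

Lemma sum_graph a psi chi : msum a psi -> msum (fun k => mu k * a k) chi ->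
  V G psi.1 /\ Num.sqrt (dH G (psi.1 - chi.2) (psi.1 - chi.2)) = 0.
Proof.
move=> [Hpsi apsi] [Hchi achi].
have Pn b n := psum_in PI He b n.
apply: (closable setting (s_ := fun n => (psum e a n).1)).
- move=> n; rewrite psum_fst; apply: (hilb_sum (preinner_V setting)) => k.
  exact: (hilbZ (preinner_V setting) _ (V_eigen basis (idx0 k))).
- exact: Hpsi.1.
- exact: Hchi.2.
- apply: (@fst_cvg _ _ _ (fun n => psum e a n - psi) _ apsi).
  apply: nearW => n; exact: (hilbB PI (Pn a n) Hpsi).
- have h := @snd_cvg _ _ _ (fun n => psum e (fun k => mu k * a k) n - chi) _ achi.
  rewrite (_ : (fun n => _) = fun n => Num.sqrt
    (dH G (psum e (fun k => mu k * a k) n - chi).2 (psum e (fun k => mu k * a k) n - chi).2)).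
    apply: h; apply: nearW => n; exact: (hilbB PI (Pn _ n) Hchi).
  by apply/funext => n; rewrite psum_fst -psum_snd.
Qed.

Lemma dot_fst p v : HH G p -> L2 area Om v -> dot G p (v, 0) = ipc G p.1 v.
Proof.
move=> Hp Lv; apply: (etrans (hilbC PI Hp (HH_left setting Lv))).
apply: (etrans (dot_left setting Lv Hp)).
exact: (hilbC (preinner_ipc setting) Lv Hp.1).
Qed.

Lemma dot_snd p v : HH G p -> V G v -> dot G p (0, v) = dH G p.2 v.
Proof.
move=> Hp Vv; apply: (etrans (hilbC PI Hp (HH_right setting Vv))).
apply: (etrans (dot_right setting Vv Hp)).
exact: (hilbC (preinner_V setting) Vv Hp.2).
Qed.

(** The first component of the image [chi] of [psi], tested against [v]: it holds for each
    eigenvector by [eigen_eq], for partial sums by linearity, and for sums because every term is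
    continuous for the norm of [HH]. *)
Lemma sum_eq a psi chi v : msum a psi -> msum (fun k => mu k * a k) chi -> V G v ->
  ipc G chi.1 v = iph G psi.1 v + dH G psi.2 v.
Proof.
move=> [Hpsi apsi] [Hchi achi] Vv; have Lv := V_L2 Vv.
have Pn b n := psum_in PI He b n.
have PC := preinner_ipc setting; have PV := preinner_V setting.
have c1 : ipc G (psum e (fun k => mu k * a k) n).1 v @[n --> \oo] --> ipc G chi.1 v.
  rewrite -(dot_fst Hchi Lv) (_ : (fun n => _) = fun n => dot G (psum e (fun k => mu k * a k) n) (v, 0)).
    exact: (cvg_nrm_dot PI (fun n => Pn _ n) Hchi (HH_left setting Lv) achi).
  by apply/funext => n; exact: esym (dot_fst (Pn _ n) Lv).
have c2 : dH G (psum e a n).2 v @[n --> \oo] --> dH G psi.2 v.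
  rewrite -(dot_snd Hpsi Vv) (_ : (fun n => _) = fun n => dot G (psum e a n) (0, v)).
    exact: (cvg_nrm_dot PI (fun n => Pn _ n) Hpsi (HH_right setting Vv) apsi).
  by apply/funext => n; exact: esym (dot_snd (Pn _ n) Vv).
have subE (x y : fn) : x - y = -1 *: y + x by rewrite scaleN1r addrC.
have c3 : iph G (psum e a n).1 v @[n --> \oo] --> iph G psi.1 v.
  have [K K0 hK] := iph_bound setting.
  apply: (@cvg_dist_le _ _ _ _ _ (fun n => K * nO (psum e a n - psi).1 * nO v)).
    apply: nearW => n.
    have E : iph G (psum e a n).1 v - iph G psi.1 v = iph G ((psum e a n).1 - psi.1) v.
      rewrite subE (iph_lin setting _ Hpsi.1 (Pn a n).1 Lv); have F (x y : R) : x - y = -1 * y + x by ring.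
      exact: F.
    rewrite E; apply: hK; last exact: Lv.
    exact: (hilbB PI (Pn a n) Hpsi).1.
  have h := @fst_cvg _ _ _ (fun n => psum e a n - psi) _ apsi.
  rewrite -[X in _ --> X](mul0r (nO v)) -(mulr0 K).
  apply: cvgM; last exact: cvg_cst.
  apply: cvgM; first exact: cvg_cst.
  by apply: h; apply: nearW => n; exact: (hilbB PI (Pn a n) Hpsi).
apply: (cvg_unique (@Rhausdorff R) c1).
rewrite (_ : (fun n => _) = fun n => iph G (psum e a n).1 v + dH G (psum e a n).2 v).
  exact: cvgD c3 c2.
apply/funext; elim=> [|n IH].
  rewrite /psum !big_ord0 (dot0l PC Lv) (dot0l PV Vv) addr0.
  have := iph_lin setting 1 (L2_0 _ (Om_measurable setting)) (L2_0 _ (Om_measurable setting)) Lv.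
  have F (x y : R) : x = 1 * y + y -> x = y -> 0 = y by move=> -> ; rewrite mul1r => /eqP; rewrite -subr_eq0 addrK => /eqP ->.
  by move=> h; apply: (F _ _ h); rewrite scale1r addr0.
have S b m : psum e b m.+1 = b m *: e m + psum e b m by rewrite psumS addrC.
rewrite !S.
have h1 := hilb_dotl PC (lam (idx n) * a n) (He n).1 (Pn (fun k => mu k * a k) n).1 Lv.
have h2 := iph_lin setting (a n) (He n).1 (Pn a n).1 Lv.
have h3 := dH_lin setting (a n) (He n).2 (Pn a n).2 Vv.
have h4 := eigen_eq setting basis (idx0 n) Vv.
apply: (etrans h1); rewrite [ipc G (psum _ _ _).1 v]IH.
apply: etrans (esym (congr2 _ h2 h3)).
rewrite [in RHS]/phi /=.
have F (l x A B C D E : R) : C = l * A - B -> l * x * A + (D + E) = x * B + D + (x * C + E).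
  by move=> ->; ring.
exact: (F _ _ _ _ _ _ _ h4).
Qed.

End eigenfamily.

(** * Decay at infinity, and the flow of the negative modes *)

Lemma cvg_invr_pinfty {R : realType} : z^-1 @[z --> +oo] --> (0 : R).
Proof.
apply/cvgrPdist_lt => e e0; near=> z.
have z0 : 0 < z by near: z; exact: nbhs_pinfty_gt.
have ez : e^-1 < z by near: z; apply: nbhs_pinfty_gt; exact: num_real.
by rewrite sub0r normrN gtr0_norm ?invr_gt0// -(invrK e) ltf_pV2 ?posrE ?invr_gt0.
Unshelve. all: by end_near. Qed.

Lemma expR_decay {R : realType} (m : R) : m < 0 ->
  expR (m * z) @[z --> +oo] --> 0 /\ z * expR (m * z) @[z --> +oo] --> 0.
Proof.
move=> m0; have mN : 0 < - m by rewrite oppr_gt0.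
have B j : exists2 C, 0 < C & forall z, 0 < z -> z ^+ j * expR (m * z) <= C.
  have [C C0 hC] := pow_expR_bound j mN; exists C => // z z0.
  have := hC (- z); rewrite oppr_le0 (ltW z0) => /(_ isT).
  by rewrite mulrNN normrM normrX normrN (gtr0_norm z0) (ger0_norm (expR_ge0 _)) [z * m]mulrC.
have D (f : R -> R) C : (forall z, 0 < z -> 0 <= f z) ->
    (forall z, 0 < z -> f z * z <= C) -> f z @[z --> +oo] --> 0.
  move=> f0 fC; apply: (@cvg_dist_le _ _ _ _ _ (fun z => C * z^-1)).
    near=> z; have z0 : 0 < z by near: z; exact: nbhs_pinfty_gt.
    by rewrite subr0 ger0_norm ?f0// ler_pdivlMr// fC.
  rewrite -(mulr0 C); apply: cvgM; [exact: cvg_cst|exact: cvg_invr_pinfty].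
have [C1 _ h1] := B 1%N; have [C2 _ h2] := B 2%N; split.
  apply: (D _ C1) => z z0; first exact: expR_ge0.
  by rewrite mulrC; exact: h1.
apply: (D _ C2) => z z0; first by rewrite mulr_ge0 ?expR_ge0// ltW.
by rewrite mulrAC; exact: h2.
Unshelve. all: by end_near. Qed.

Lemma is_derive_ext {R : realType} (f g : R -> R) (x a b : R) : f = g -> a = b ->
  is_derive x 1 f a -> is_derive x 1 g b.
Proof. by move=> -> ->. Qed.

Section ae_arith.
Context d (T : measurableType d) (R : realType) (mu : {measure set T -> \bar R}).

Lemma ae_of_eq (D : set T) (f g : T -> R) : f = g -> f = g %[ae mu in D].
Proof. by move=> ->; exact: ae_eq_refl_in. Qed.

Lemma ae_eqD (D : set T) (f f' g g' : T -> R) : f = f' %[ae mu in D] ->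
  g = g' %[ae mu in D] -> f + g = f' + g' %[ae mu in D].
Proof.
move=> ff' gg'; apply: aeS2 ff' gg' _ => x h1 h2 Dx.
exact: (congr2 (fun x y : R => x + y) (h1 Dx) (h2 Dx)).
Qed.

Lemma ae_eqB (D : set T) (f f' g g' : T -> R) : f = f' %[ae mu in D] ->
  g = g' %[ae mu in D] -> f - g = f' - g' %[ae mu in D].
Proof.
move=> ff' gg'; apply: aeS2 ff' gg' _ => x h1 h2 Dx.
exact: (congr2 (fun x y : R => x - y) (h1 Dx) (h2 Dx)).
Qed.

Lemma ae_eqZ (D : set T) k (f f' : T -> R) : f = f' %[ae mu in D] ->
  k *: f = k *: f' %[ae mu in D].
Proof.
move=> ff'; apply: aeS ff' _ => x h1 Dx; exact: (congr1 (fun x : R => k * x) (h1 Dx)).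
Qed.
End ae_arith.

Section preinner_null.
Context {R : realType} {E : lmodType R} (H : set E) (d : E -> E -> R).
Hypothesis PH : preinner H d.
Local Notation nrm p := (Num.sqrt (d p p)).

Lemma nrm_null_sub p p' q q' : H p -> H p' -> H q -> H q' ->
  nrm (p - p') = 0 -> nrm (q - q') = 0 -> nrm (p - q) = nrm (p' - q').
Proof.
move=> Hp Hp' Hq Hq' pp qq.
apply: (nrm_null_eq PH (hilbB PH Hp Hq) (hilbB PH Hp' Hq')).
have -> : p - q - (p' - q') = (p - p') - (q - q') by rewrite !opprB addrACA [RHS]addrACA [- q - p']addrC.
have h := ler_nrmD PH (hilbB PH Hp Hp') (hilbN PH (hilbB PH Hq Hq')).
rewrite (nrmN PH (hilbB PH Hq Hq')) pp qq addr0 in h.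
by apply/eqP; rewrite eq_le h sqrtr_ge0.
Qed.
End preinner_null.

Section integrals.
Context {R : realType} (G : graetz_data R).

Lemma int_ipc (u v : R * R -> R) :
  \int[area]_(x in Om G) (cc G x * u x * v x) = ipc G u v.
Proof. by []. Qed.

Lemma int_iph (u v : R * R -> R) :
  \int[area]_(x in Om G) (hh G x * u x * v x) = iph G u v.
Proof. by []. Qed.

End integrals.

Section heat_flow.
Local Opaque grad trace wdot dH ipc ips ipa iph dot pi_minus.
Context {R : realType} (G : graetz_data R) (setting : graetz_setting G).
Local Notation fn := (R * R -> R).
Local Notation Om := (Om G).
Local Notation nO := (n2 (@area R) Om).
Variables (lam : int -> R) (U : int -> fn) (s0 : fn).
Hypothesis basis : eigenbasis G lam U s0.
Implicit Types (p q r psi chi : fn * fn).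
Local Notation PI := (preinner_HH setting).
Local Notation PV := (preinner_V setting).
Local Notation PC := (preinner_ipc setting).
Local Notation nH := (normHH G).
Local Notation nV s := (Num.sqrt (dH G s s)).
Local Notation mOm := (Om_measurable setting).
Local Notation mu := (fun k : nat => lam (- k.+1%:Z)).
Local Notation msum := (is_sum (HH G) (dot G) (em lam U)).
Local Notation He := (em_HH basis).
Local Notation ON := (em_orthonormal basis).
Local Notation HC := (HH_complete setting).

Lemma mu_neg k : lam (- k.+1%:Z) < 0.
Proof. by have [] := eigenvalue_order basis k. Qed.

Lemma mu_le k : lam (- k.+1%:Z) <= lam (- 1%:Z).
Proof.
elim: k => [//|k IH]; apply: le_trans IH.
by have [] := eigenvalue_order basis k.
Qed.

Definition hflow (b : nat -> R) j z : fn * fn := flow (HH G) (dot G) (em lam U) mu j b z.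

Section one_flow.
Variables (b : nat -> R) (psi : fn * fn).
Hypothesis bpsi : msum b psi.
Local Notation F := (hflow b).

Lemma hflowP j z : 0 < z ->
  msum (fun k => mu k ^+ j * expR (mu k * z) * b k) (F j z).
Proof.
move=> z0; exact: (flowP PI He HC ON mu_le (mu_neg 0) j bpsi z0).
Qed.

(** Valid for every [z] and [j]: if the series has no sum, the choice returns its default 0, which
    is in [HH]. *)
Lemma hflow_HH j z : HH G (F j z).
Proof.
have [h|h] := pselect (exists q, msum (fun k => mu k ^+ j * expR (mu k * z) * b k) q).
  have := @xgetPex _ 0 [set q | msum (fun k => mu k ^+ j * expR (mu k * z) * b k) q] h.
  by case.
rewrite /hflow /flow; case: xgetP => [q _ [Hq _]|_]; first exact: Hq.
exact: (hilb0 PI).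
Qed.

Lemma hflow0_le z : 0 <= z -> nH (F 0 z) <= expR (lam (- 1%:Z) * z) * nH psi.
Proof. exact: (flow0_le PI He HC ON mu_le (mu_neg 0) bpsi). Qed.

Lemma hflow0_cvg : nH (F 0 z - psi) @[z --> 0^'+] --> 0.
Proof. exact: (flow0_cvg PI He HC ON mu_le (mu_neg 0) bpsi). Qed.

Lemma hflow0_init : nH (F 0 0 - psi) = 0.
Proof.
have h := flow0P PI He HC ON mu_le (mu_neg 0) bpsi (lexx 0).
apply: (is_sum_uniq PI He h); apply: is_sum_ext bpsi => k.
by rewrite mulr0 expR0 mul1r.
Qed.

Lemma hflow_graph j z : 0 < z ->
  V G (F j z).1 /\ nV ((F j z).1 - (F j.+1 z).2) = 0.
Proof.
move=> z0; apply: (sum_graph setting basis (fun k => negz_neq0 k) (hflowP j z0)).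
apply: is_sum_ext (hflowP j.+1 z0) => k; have X (x y w : R) : x ^+ j.+1 * y * w = x * (x ^+ j * y * w) by rewrite exprS; ring.
exact: X.
Qed.

Lemma hflow_eq j z v : 0 < z -> V G v ->
  ipc G (F j.+1 z).1 v = iph G (F j z).1 v + dH G (F j z).2 v.
Proof.
move=> z0 Vv; apply: (sum_eq setting basis (fun k => negz_neq0 k) (hflowP j z0) _ Vv).
apply: is_sum_ext (hflowP j.+1 z0) => k; have X (x y w : R) : x ^+ j.+1 * y * w = x * (x ^+ j * y * w) by rewrite exprS; ring.
exact: X.
Qed.

Lemma hflow_taylor j z : 0 < z -> exists2 C, 0 < C & forall t, `|t| <= z / 2 ->
  nH (F j (z + t) - F j z - t *: F j.+1 z) <= C * t ^+ 2.
Proof. exact: (flow_taylor PI He HC ON mu_le (mu_neg 0) j bpsi). Qed.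

Lemma hflow_cvg j z : 0 < z -> nH (F j y - F j z) @[y --> z] --> 0.
Proof. exact: (flow_cvg PI He HC ON mu_le (mu_neg 0) j bpsi). Qed.

Lemma hflow_derive j (z : R) (v : fn) : 0 < z -> L2 area Om v ->
  is_derive z 1 (fun y => ipc G (F j y).1 v) (ipc G (F j.+1 z).1 v).
Proof.
move=> z0 Lv; have Hv := HH_left setting Lv.
have h := flow_is_derive PI He HC ON mu_le (mu_neg 0) j bpsi z0 Hv.
have E : (fun y : R => dot G (F j y) (v, 0)) = (fun y => ipc G (F j y).1 v).
  apply/funext => y; exact: (dot_fst setting (hflow_HH j y) Lv).
exact: (is_derive_ext E (dot_fst setting (hflow_HH j.+1 z) Lv) h).
Qed.

Lemma nO_hflow0_cvg : nO (F 0 z).1 @[z --> +oo] --> 0.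
Proof.
have [d0 _] := expR_decay (mu_neg 0).
apply: (fst_cvg setting); first by apply: nearW => z; exact: hflow_HH.
apply: (@cvg_dist_le _ _ _ _ _ (fun z => expR (lam (- 1%:Z) * z) * nH psi)).
  near=> z; have z0 : 0 <= z by near: z; exact: nbhs_pinfty_ge.
  rewrite subr0 ger0_norm; last exact: sqrtr_ge0.
  exact: hflow0_le.
rewrite -(mul0r (nH psi)); apply: cvgM; [exact: d0|exact: cvg_cst].
Unshelve. all: by end_near. Qed.

End one_flow.
End heat_flow.

Lemma nrm_null_trans {R : realType} {E : lmodType R} (H : set E) (d : E -> E -> R)
    (PH : preinner H d) p q r : H p -> H q -> H r ->
  Num.sqrt (d (p - q) (p - q)) = 0 -> Num.sqrt (d (q - r) (q - r)) = 0 ->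
  Num.sqrt (d (p - r) (p - r)) = 0.
Proof.
move=> Hp Hq Hr pq qr; have h := ler_nrm_dist PH Hp Hq Hr.
rewrite pq qr addr0 in h.
by apply/eqP; rewrite eq_le h sqrtr_ge0.
Qed.

Lemma cvg_norm_dnbhs0 {R : realType} : `|t| @[t --> (0 : R)^'] --> (0 : R).
Proof.
apply/cvgrPdist_lt => eps e0; near=> t; rewrite sub0r normrN normr_id.
by near: t; exact: dnbhs0_lt.
Unshelve. all: by end_near. Qed.

Lemma cvg_near_ext {R : realType} {Z : Type} (F : set_system Z) {FF : Filter F}
    (f g : Z -> R) (l : R) : (\forall z \near F, f z = g z) ->
  f z @[z --> F] --> l -> g z @[z --> F] --> l.
Proof.
move=> fg /cvgrPdist_lt fl; apply/cvgrPdist_lt => e e0.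
by apply: filterS2 fg (fl e e0) => z ->.
Qed.

Lemma eq0_of_le_add {R : realFieldType} (x y w : R) :
  w <= x + y -> x = 0 -> y = 0 -> 0 <= w -> w = 0.
Proof. by move=> h1 h2 h3 h4; lra. Qed.

Lemma addr_gt0_half {R : realFieldType} (z t : R) : 0 < z -> `|t| <= z / 2 -> 0 < z + t.
Proof. by move=> z0; have := ler_norm (- t); rewrite normrN; lra. Qed.

(** * Decaying flow plus drift solves the equation *)

Section mild.
Local Opaque grad trace wdot dH ipc ips ipa iph dot pi_minus hflow n2.
Context {R : realType} (G : graetz_data R) (setting : graetz_setting G).
Local Notation fn := (R * R -> R).
Local Notation Om := (Om G).
Local Notation nO := (n2 (@area R) Om).
Variables (lam : int -> R) (U : int -> fn) (s0 : fn).
Hypothesis basis : eigenbasis G lam U s0.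
Implicit Types (p q r chi : fn * fn).
Local Notation PI := (preinner_HH setting).
Local Notation PV := (preinner_V setting).
Local Notation PC := (preinner_ipc setting).
Local Notation nH := (normHH G).
Local Notation nV s := (Num.sqrt (dH G s s)).
Local Notation mOm := (Om_measurable setting).
Local Notation msum := (is_sum (HH G) (dot G) (em lam U)).

(* The non-decaying part g + k z of a solution: sigma-harmonic up to k h. *)
Definition drift (g : fn) (k : R) : Prop :=
  [/\ V G g, k = 0 \/ ~ controlled G &
      forall v, V G v -> dH G g v = - (k * iph G (cst 1) v)].

(** Either the slope is zero or constants are null in [H], so the term [k * z] is invisible to [dH]
    in both cases. *)
Lemma drift_cst g k z : drift g k -> V G (cst (k * z)) /\
  forall v, V G v -> dH G (cst (k * z)) v = 0.
Proof.
move=> [_ [->|nc] _].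
  rewrite mul0r; split; first exact: (V0 setting).
  by move=> v Vv; exact: (dot0l PV Vv).
split; first exact: (V_cst setting).
by move=> v Vv; exact: (dH_cst setting).
Qed.

Lemma nV_null_ae s t : V G s -> V G t -> s = t %[ae area in Om] -> nV (s - t) = 0.
Proof.
move=> Vs Vt st; have e := eq_dH setting (s - t) Vs Vt st.
have h : dH G (s - t) (s - t) = 0.
  apply: (etrans (dotBl PV Vs Vt (V_sub setting Vs Vt))).
  by rewrite e subrr.
exact: etrans (congr1 Num.sqrt h) (sqrtr0 _).
Qed.

Variables (b : nat -> R) (psi : fn * fn) (g : fn) (k : R).
Hypotheses (bpsi : msum b psi) (gk : drift g k).
Local Notation F := (hflow G lam U b).

(** The first component of the flow is used rather than the second component of its derivative: it
    makes sense in L^2 down to [z = 0], and it is not blurred by constants. *)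
Definition mild (T : R -> fn) : Prop := forall z, 0 <= z ->
  L2 area Om (T z) /\ T z = (F 0 z).1 + (g + cst (k * z)) %[ae area in Om].

Variable T : R -> fn.
Hypothesis mT : mild T.
Let dT z : fn := (F 1 z).1 + cst k.
Let Vg : V G g. Proof. by case: gk. Qed.
Let FH j z : HH G (F j z). Proof. exact: (hflow_HH setting). Qed.

Lemma mild_V z : 0 < z -> V G (T z).
Proof.
move=> z0; have [LT eT] := mT (ltW z0); have [V0z _] := hflow_graph setting basis bpsi 0 z0.
have [Vk _] := drift_cst z gk.
have VD := hilbD PV V0z (hilbD PV Vg Vk).
exact: (ae_eq_V setting (V_L2 VD) LT (ae_eq_sym_in eT) VD).
Qed.

(** In [H] the first component of the flow equals the second component of its derivative, and
    [k * z] is null. Continuity in [H] and the weak equation both go through this expression. *)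
Lemma mild_dH z : 0 < z -> nV (T z - ((F 1 z).2 + g)) = 0.
Proof.
move=> z0; have [LT eT] := mT (ltW z0); have [V0z g0] := hflow_graph setting basis bpsi 0 z0.
have [Vk dk] := drift_cst z gk; have VT := mild_V z0.
have Vgk := hilbD PV Vg Vk.
have VD := hilbD PV V0z Vgk.
have VE := hilbD PV (FH 1 z).2 Vg.
apply: (nrm_null_trans PV VT VD VE (nV_null_ae VT VD eT)).
have -> : (F 0 z).1 + (g + cst (k * z)) - ((F 1 z).2 + g) =
   ((F 0 z).1 - (F 1 z).2) + cst (k * z).
  rewrite opprD addrACA; congr (_ + _); rewrite addrAC addrN; exact: add0r.
have Vd := V_sub setting V0z (FH 1 z).2.
have h := ler_nrmD PV Vd Vk.
have k0 : nV (cst (k * z)) = 0 by exact: etrans (congr1 Num.sqrt (dk _ Vk)) (sqrtr0 _).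
exact: (eq0_of_le_add h g0 k0 (sqrtr_ge0 _)).
Qed.

Let subE (y z : R) : 0 <= y -> 0 <= z ->
  T y - T z = (F 0 y - F 0 z).1 + cst (k * (y - z)) %[ae area in Om].
Proof.
move=> y0 z0; have [_ ey] := mT y0; have [_ ez] := mT z0.
apply: (ae_eq_trans_in (ae_eqB ey ez)).
apply: ae_of_eq; apply/funext => x.
have X (a c d e f : R) : a + (c + k * e) - (d + (c + k * f)) = a - d + k * (e - f) by ring.
exact: X.
Qed.

Let LF j z : L2 area Om (F j z).1. Proof. exact: (FH j z).1. Qed.
Let Lk c : L2 area Om (cst c). Proof. exact: (L2_Om_cst setting). Qed.

(** For the flow part the equation is [hflow_eq] at order 1. For the drift, the derivative [k]
    contributes [k] times the integral of [h v] through the transport term, and the gradient of [g]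
    contributes the opposite by definition of [drift]. *)
Lemma mild_equation : solves_equation G T dT.
Proof.
move=> z z0; have z2 : 0 < z / 2 by rewrite divr_gt0.
have LT y : 0 < y -> L2 area Om (T y) by move=> y0; exact: (mT (ltW y0)).1.
split.
- split; [exact: (L2D mOm (LF 1 z) (Lk k))|exact: mild_V].
- have [C C0 hC] := hflow_taylor setting basis bpsi 0 z0.
  (* The increment quotient minus the derivative, lifted to the flow in [HH]; the drift is affine in
     [z] and contributes nothing to it. *)
  pose p_ t := t^-1 *: (F 0 (z + t) - F 0 z - t *: F 1 z).
  have Hp t : HH G (p_ t).
    exact: (hilbZ PI _ (hilbB PI (hilbB PI (FH 0 _) (FH 0 _)) (hilbZ PI _ (FH 1 _)))).
  have np : nH (p_ t) @[t --> 0^'] --> 0.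
    apply: (@cvg_dist_le _ _ _ _ _ (fun t => C * `|t|)).
      near=> t; have t0 : t != 0 by near: t; exact: nbhs_dnbhs_neq.
      have tz : `|t| <= z / 2.
        near: t; apply: dnbhs0_le; exact: z2.
      rewrite subr0 ger0_norm; last exact: sqrtr_ge0.
      have h := hC t tz.
      have HD := hilbB PI (hilbB PI (FH 0 (z + t)) (FH 0 z)) (hilbZ PI t (FH 1 z)).
      have e := nrmZ PI t^-1 HD.
      have X (x y : R) : x = `|t^-1| * y -> y <= C * t ^+ 2 -> x <= C * `|t|.
        move=> -> yC; rewrite normfV ler_pdivrMl ?normr_gt0//.
        by rewrite mulrCA -expr2 real_normK ?num_real.
      exact: (X _ _ e h).
    rewrite -[X in _ --> X](mulr0 C); apply: cvgM; first exact: cvg_cst.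
    exact: cvg_norm_dnbhs0.
  have fp : nO (p_ t).1 @[t --> 0^'] --> 0.
    by apply: (fst_cvg setting _ np); exact: nearW.
  have near1 : \forall t \near 0^',
      L2 area Om (t^-1 *: (T (z + t) - T z) - dT z) /\
      nO (t^-1 *: (T (z + t) - T z) - dT z) = nO (p_ t).1.
    near=> t; have t0 : t != 0 by near: t; exact: nbhs_dnbhs_neq.
    have tz : `|t| <= z / 2.
      near: t; apply: dnbhs0_le; exact: z2.
    have zt : 0 < z + t by exact: addr_gt0_half tz.
    have LL : L2 area Om (t^-1 *: (T (z + t) - T z) - dT z).
      apply: (L2B mOm); last exact: (L2D mOm (LF 1 z) (Lk k)).
      exact: (L2Z mOm _ (L2B mOm (LT _ zt) (LT _ z0))).
    split; first exact: LL.
    apply: (ae_eq_n2 mOm LL (Hp t).1).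
    apply: (ae_eq_trans_in (ae_eqB (ae_eqZ t^-1 (subE (ltW zt) (ltW z0))) (ae_eq_refl_in _ _ _))).
    apply: ae_of_eq; apply/funext => x.
    have X (a c d : R) : t^-1 * (a - c + k * (z + t - z)) - (d + k) = t^-1 * (a - c - t * d).
      by field.
    exact: X.
  apply: (n2_cvg0 mOm); first by apply: filterS near1 => t [].
  have near2 : \forall t \near 0^', nO (p_ t).1 = nO (t^-1 *: (T (z + t) - T z) - dT z).
    by apply: filterS near1 => t [_ e]; exact: esym e.
  refine (@cvg_near_ext R _ (0^') _ (fun t => nO (p_ t).1)
    (fun t => nO (t^-1 *: (T (z + t) - T z) - dT z)) 0 near2 fp).
- have E y : dT y - dT z = (F 1 y - F 1 z).1.
    apply/funext => x; have X (a c : R) : a + k - (c + k) = a - c by ring.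
    exact: X.
  apply: (n2_cvg0 mOm).
    apply: nearW => y; rewrite E; exact: (hilbB PI (FH 1 y) (FH 1 z)).1.
  under eq_fun do rewrite E.
  apply: (fst_cvg setting (p_ := fun y => F 1 y - F 1 z)).
    by apply: nearW => y; exact: (hilbB PI (FH 1 y) (FH 1 z)).
  exact: (hflow_cvg setting basis bpsi 1 z0).
- have sc : nV (F 1 y - F 1 z).2 @[y --> z] --> 0.
    apply: (snd_cvg setting (p_ := fun y => F 1 y - F 1 z)).
      apply: nearW => y; exact: (hilbB PI (FH 1 y) (FH 1 z)).
    exact: (hflow_cvg setting basis bpsi 1 z0).
  apply: (@cvg_near_ext R _ (nbhs z) _ _ (fun y => nH (0, T y - T z)) 0 _ sc); near=> y.
  have y0 : 0 < y by near: y; exact: lt_nbhsr.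
  have VTy := mild_V y0; have VTz := mild_V z0.
  have Vy := hilbD PV (FH 1 y).2 Vg; have Vz := hilbD PV (FH 1 z).2 Vg.
  have e := nrm_null_sub PV VTy Vy VTz Vz (mild_dH y0) (mild_dH z0).
  have e' : (F 1 y).2 + g - ((F 1 z).2 + g) = (F 1 y - F 1 z).2.
    apply/funext => x; have X (a c d : R) : a + d - (c + d) = a - c by ring.
    exact: X.
  rewrite e' in e.
  apply: (etrans (esym e)).
  have e2 := normHH_right setting (V_sub setting VTy VTz).
  rewrite -e2; congr (normHH G (_, _)); apply/funext => x; exact: esym (subr0 0).
- move=> v Vv; have Lv := V_L2 Vv.
  rewrite (_ : (fun y => _) = fun y => ipc G (F 1 y).1 v + k * ipc G (cst 1) v); last first.
    apply/funext => y; apply: (etrans (int_ipc _ _ _)).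
    have X : dT y = k *: cst 1 + (F 1 y).1.
      apply/funext => x; have X (a : R) : a + k = k * 1 + a by ring.
      exact: X.
    rewrite X; apply: (etrans (hilb_dotl PC k (Lk 1) (LF 1 y) Lv)); exact: addrC.
  have -> : \int[area]_(x in Om) (hh G x * dT z x * v x) + dot G (0, T z) (0, v) =
      ipc G (F 2 z).1 v + 0.
    rewrite (int_iph G (dT z) v).
    have X : dT z = k *: cst 1 + (F 1 z).1.
      apply/funext => x; have X (a : R) : a + k = k * 1 + a by ring.
      exact: X.
    rewrite X; have e1 := iph_lin setting k (Lk 1) (LF 1 z) Lv.
    have e2 := dot_right setting (mild_V z0) (HH_right setting Vv).
    have e3 := hflow_eq setting basis bpsi 1 z0 Vv.
    have e4 : dH G (T z) v = dH G ((F 1 z).2 + g) v.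
      have VTz := mild_V z0; have Vz := hilbD PV (FH 1 z).2 Vg.
      exact: (dot_null_eql PV VTz Vz Vv (mild_dH z0)).
    have e5 := dotDl PV (FH 1 z).2 Vg Vv.
    have [_ _ e6] := gk; have {}e6 := e6 v Vv.
    have Y (a1 a2 a3 a4 a5 a6 a7 a8 : R) : a1 = k * a2 + a3 -> a4 = a5 -> a6 = a3 + a7 ->
       a5 = a7 + a8 -> a8 = - (k * a2) -> a1 + a4 = a6 + 0 by move=> -> -> -> -> ->; ring.
    exact: (Y _ _ _ _ _ _ _ _ e1 e2 e3 (etrans e4 e5) e6).
  apply: is_deriveD; exact: (hflow_derive setting basis bpsi 1 z0 Lv).
Unshelve. all: by end_near. Qed.

End mild.

(** * Behaviour of these functions at the inlet and at infinity *)

Section mild_limits.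
Local Opaque grad trace wdot dH ipc ips ipa iph dot pi_minus hflow n2.
Context {R : realType} (G : graetz_data R) (setting : graetz_setting G).
Local Notation fn := (R * R -> R).
Local Notation Om := (Om G).
Local Notation nO := (n2 (@area R) Om).
Variables (lam : int -> R) (U : int -> fn) (s0 : fn).
Hypothesis basis : eigenbasis G lam U s0.
Implicit Types (p q r chi : fn * fn).
Local Notation PI := (preinner_HH setting).
Local Notation PV := (preinner_V setting).
Local Notation nH := (normHH G).
Local Notation mOm := (Om_measurable setting).
Local Notation msum := (is_sum (HH G) (dot G) (em lam U)).
Variables (b : nat -> R) (psi : fn * fn) (g : fn) (k : R).
Hypotheses (bpsi : msum b psi) (Lg : L2 area Om g).
Local Notation F := (hflow G lam U b).
Variable T : R -> fn.
Hypothesis mT : mild G lam U b g k T.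
Let FH j z : HH G (F j z). Proof. exact: (hflow_HH setting). Qed.
Let LF j z : L2 area Om (F j z).1. Proof. exact: (FH j z).1. Qed.
Let Lk c : L2 area Om (cst c). Proof. exact: (L2_Om_cst setting). Qed.

Lemma nO_cst c : nO (cst c) = `|c| * nO (cst 1).
Proof.
rewrite -(n2Z mOm c (Lk 1)); congr (n2 _ _ _).
apply/funext => x; exact: esym (mulr1 c).
Qed.

Lemma mild_asymp : norm2 area Om (T z - (g + cst (k * z))) @[z --> +oo] --> 0%E.
Proof.
have near1 : \forall z \near +oo, L2 area Om (T z - (g + cst (k * z))) /\
    nO (F 0 z).1 = nO (T z - (g + cst (k * z))).
  near=> z; have z0 : 0 <= z by near: z; exact: nbhs_pinfty_ge.
  have [LT eT] := mT z0.
  have LL := L2B mOm LT (L2D mOm Lg (Lk (k * z))).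
  split; first exact: LL.
  apply: (ae_eq_n2 mOm (LF 0 z) LL); apply: ae_eq_sym_in.
  apply: (ae_eq_trans_in (ae_eqB eT (ae_eq_refl_in _ _ _))).
  apply: ae_of_eq; exact: addrK.
apply: (n2_cvg0 mOm); first by apply: filterS near1 => z [].
have near2 : \forall z \near +oo, nO (F 0 z).1 = nO (T z - (g + cst (k * z))).
  by apply: filterS near1 => z [].
exact: (cvg_near_ext near2 (nO_hflow0_cvg setting basis bpsi)).
Unshelve. all: by end_near. Qed.

Lemma mild_init : T 0 = psi.1 + g %[ae area in Om].
Proof.
have [_ eT] := mT (lexx 0); apply: (ae_eq_trans_in eT); apply: ae_eqD.
  have Hpsi := is_sum_in bpsi.
  have [h _] := HH_decomp_null setting (hilbB PI (FH 0 0) Hpsi) (hflow0_init setting basis bpsi).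
  exact: ae_sub0 h.
apply: ae_of_eq; apply/funext => x; have X (a : R) : a + k * 0 = a by ring.
exact: X.
Qed.

Lemma mild_cont0 : norm2 area Om (T z - T 0) @[z --> 0^'+] --> 0%E.
Proof.
have Hpsi := is_sum_in bpsi.
have LT z : 0 <= z -> L2 area Om (T z) by move=> z0; exact: (mT z0).1.
have LD z : L2 area Om (F 0 z - psi).1 by exact: (hilbB PI (FH 0 z) Hpsi).1.
have f0 : nO (F 0 z - psi).1 @[z --> 0^'+] --> 0.
  apply: (fst_cvg setting _ (hflow0_cvg setting basis bpsi)).
  apply: nearW => z; exact: (hilbB PI (FH 0 z) Hpsi).
apply: (n2_cvg0 mOm).
  near=> z; have z0 : 0 <= z by near: z; exact: nbhs_right_ge.
  exact: (L2B mOm (LT _ z0) (LT _ (lexx 0))).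
apply: (@cvg_dist_le _ _ _ _ _ (fun z => nO (F 0 z - psi).1 + z * (`|k| * nO (cst 1)))).
  near=> z; have z0 : 0 <= z by near: z; exact: nbhs_right_ge.
  rewrite subr0 ger0_norm; last exact: n2_ge0.
  have [_ eT] := mT z0; have LL := L2B mOm (LT _ z0) (LT _ (lexx 0)).
  have e : nO (T z - T 0) = nO ((F 0 z - psi).1 + cst (k * z)).
    apply: (ae_eq_n2 mOm LL (L2D mOm (LD z) (Lk _))).
    apply: (ae_eq_trans_in (ae_eqB eT mild_init)).
    apply: ae_of_eq; apply/funext => x.
    have X (a c d e : R) : a + (c + d) - (e + c) = a - e + d by ring.
    exact: X.
  rewrite e; apply: (le_trans (ler_n2D mOm (LD z) (Lk _))).
  rewrite (nO_cst (k * z)) normrM (ger0_norm z0).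
  have X (a c d w : R) : a + c * w * d <= a + w * (c * d) by rewrite [c * w]mulrC mulrA.
  exact: X.
rewrite -[X in _ --> X]addr0; apply: cvgD; first exact: f0.
rewrite -[X in _ --> X](mul0r (`|k| * nO (cst 1))); apply: cvgM; last exact: cvg_cst.
exact: cvg_at_right_filter cvg_id.
Unshelve. all: by end_near. Qed.

(** The flow is bounded and the drift is affine in [z]; linear growth is what yields subexponential
    growth next. *)
Lemma nO_mild_le : exists2 K : R, 0 < K & forall z, 0 <= z -> nO (T z) <= K * (1 + z).
Proof.
have [K K0 hK] := nO_fst_le setting.
have nk := n2_ge0 (@area R) Om (cst 1 : fn).
have ng := n2_ge0 (@area R) Om g.
have np : 0 <= nH psi by exact: sqrtr_ge0.
exists (K * nH psi + nO g + `|k| * nO (cst 1) + 1).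
  by rewrite ltr_wpDl// !addr_ge0// mulr_ge0// ltW.
move=> z z0; have [LT eT] := mT z0.
have Lr := L2D mOm Lg (Lk (k * z)).
rewrite (ae_eq_n2 mOm LT (L2D mOm (LF 0 z) Lr) eT).
apply: (le_trans (ler_n2D mOm (LF 0 z) Lr)).
have h1 := hK _ (FH 0 z); have h2 := ler_n2D mOm Lg (Lk (k * z)).
have h3 := hflow0_le setting basis bpsi z0.
rewrite (nO_cst (k * z)) normrM (ger0_norm z0) in h2.
have m1 : expR (lam (- 1%:Z) * z) <= 1.
  by rewrite -expR0 ler_expR mulr_le0_ge0// ltW// (mu_neg basis 0).
have X (a f p g' n q h E : R) : 0 < a -> f <= a * h -> h <= E * p -> E <= 1 -> 0 <= p ->
    0 <= g' -> 0 <= n -> 0 <= q ->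
    f + (g' + n * z * q) <= (a * p + g' + n * q + 1) * (1 + z).
  move=> a0 fa hE E1 p0 g0 n0 q0.
  have hp : h <= p by apply: (le_trans hE); rewrite ler_piMl.
  have fp : f <= a * p by apply: (le_trans fa); rewrite ler_pM2l.
  have ap : 0 <= a * p by rewrite mulr_ge0// ltW.
  have nq : 0 <= n * q by rewrite mulr_ge0.
  have apz := mulr_ge0 ap z0; have gz := mulr_ge0 g0 z0.
  rewrite (_ : (a * p + g' + n * q + 1) * (1 + z) =
    a * p + g' + n * z * q + (n * q + 1 + z + a * p * z + g' * z)); last by ring.
  rewrite addrA; apply: (@le_trans _ _ (a * p + g' + n * z * q)); first by rewrite !lerD2r.
  by rewrite lerDl !addr_ge0.
apply: le_trans (X _ _ _ _ _ _ _ _ K0 h1 h3 m1 np ng (normr_ge0 k) nk).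
by rewrite lerD2l.
Qed.

Lemma mild_subexponential : subexponential G T.
Proof.
move=> m m0; have [K K0 hK] := nO_mild_le.
have [d1 d2] : expR (- m * z) @[z --> +oo] --> 0 /\ z * expR (- m * z) @[z --> +oo] --> 0.
  by apply: expR_decay; rewrite oppr_lt0.
apply: (@cvg_trans _ ((nO (T z) * expR (- (m * z)))%:E @[z --> +oo])).
  apply: near_eq_cvg; near=> z; have z0 : 0 <= z by near: z; exact: nbhs_pinfty_ge.
  rewrite (norm2_n2 mOm (mT z0).1); exact: EFinM.
apply: cvg_EFin; first by near=> z.
apply: (@cvg_dist_le _ _ _ _ _ (fun z => K * (expR (- m * z) + z * expR (- m * z)))).
  near=> z; have z0 : 0 <= z by near: z; exact: nbhs_pinfty_ge.
  rewrite subr0 /= ger0_norm; last by rewrite mulr_ge0 ?expR_ge0 ?n2_ge0.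
  have X (a E : R) : 0 <= E -> a <= K * (1 + z) -> a * E <= K * (E + z * E).
    move=> E0 aK; rewrite (_ : K * (E + z * E) = K * (1 + z) * E); last by ring.
    exact: ler_wpM2r.
  rewrite -mulNr; exact: X (expR_ge0 _) (hK _ z0).
have -> : 0 = K * (0 + 0) :> R by rewrite addr0 mulr0.
apply: cvgM; [exact: cvg_cst|exact: cvgD].
Unshelve. all: by end_near. Qed.

End mild_limits.

(** * The series formula *)

Section given.
Local Opaque grad trace wdot dH ipc ips ipa iph dot pi_minus hflow n2.
Context {R : realType} (G : graetz_data R) (setting : graetz_setting G).
Local Notation fn := (R * R -> R).
Local Notation Om := (Om G).
Local Notation nO := (n2 (@area R) Om).
Variables (lam : int -> R) (U : int -> fn) (s0 : fn).
Hypothesis basis : eigenbasis G lam U s0.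
Hypothesis invertible : compression_invertible G lam U.
Local Notation PI := (preinner_HH setting).
Local Notation mOm := (Om_measurable setting).
Local Notation msum := (is_sum (HH G) (dot G) (em lam U)).
Variables (p : fn * fn) (Hp : HH G p).
Local Notation b := (fun k => dot G (Bminus G lam U p) (em lam U k)).

(** The partial sums of the formula are the first components of partial sums of the flow from
    [B_- p], and convergence in [HH] entails L^2 convergence of first components; L^2 limits are
    unique almost everywhere. *)
Lemma given_byE (g : fn) (k : R) (T : R -> fn) : L2 area Om g ->
  given_by G lam U p (fun z => g + cst (k * z)) T <-> mild G lam U b g k T.
Proof.
move=> Lg; have [RB _] := BminusP setting basis invertible Hp.
have bB := Rminus_sum setting basis RB.
pose F := hflow G lam U b.
have FH z : HH G (F 0 z) by exact: (hflow_HH setting).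
have E z n : \sum_(k < n) (expR (lam (- k.+1%:Z) * z) * dot G (Bminus G lam U p)
   (phi lam U (- k.+1%:Z))) *: U (- k.+1%:Z) =
   (psum (em lam U) (fun k => expR (lam (- k.+1%:Z) * z) * b k) n).1.
  exact: esym (psum_fst lam U (fun k => - k.+1%:Z) _ n).
have Pn z n : HH G (psum (em lam U) (fun k => expR (lam (- k.+1%:Z) * z) * b k) n).
  exact: (psum_in PI (em_HH basis) _ n).
have Fs z : 0 <= z -> msum (fun k => expR (lam (- k.+1%:Z) * z) * b k) (F 0 z).
  move=> z0; exact: (flow0P PI (em_HH basis) (HH_complete setting) (em_orthonormal basis)
    (mu_le basis) (mu_neg basis 0) bB z0).
have Lr z : L2 area Om (g + cst (k * z)) by exact: (L2D mOm Lg (L2_Om_cst setting _)).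
have c z : 0 <= z -> nO ((psum (em lam U) (fun k => expR (lam (- k.+1%:Z) * z) * b k) n).1
    - (F 0 z).1) @[n --> \oo] --> 0.
  move=> z0; apply: (fst_cvg setting (p_ := fun n => psum (em lam U)
     (fun k => expR (lam (- k.+1%:Z) * z) * b k) n - F 0 z) _ (Fs z z0).2).
  apply: nearW => n; exact: (hilbB PI (Pn z n) (FH z)).
split=> h z z0; have [LT hT] := h z z0; (split; first exact: LT).
- have L n : L2 area Om ((psum (em lam U) (fun k => expR (lam (- k.+1%:Z) * z) * b k) n).1
      + (g + cst (k * z)) - T z).
    exact: (L2B mOm (L2D mOm (Pn z n).1 (Lr z)) LT).
  have hT' : norm2 area Om ((psum (em lam U) (fun k => expR (lam (- k.+1%:Z) * z) * b k) n).1
      + (g + cst (k * z)) - T z) @[n --> \oo] --> 0%E.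
    by under eq_fun do rewrite -E; exact: hT.
  have [_ n0] : (\forall n \near \oo, L2 area Om
      ((psum (em lam U) (fun k => expR (lam (- k.+1%:Z) * z) * b k) n).1
      + (g + cst (k * z)) - T z)) /\
      nO ((psum (em lam U) (fun k => expR (lam (- k.+1%:Z) * z) * b k) n).1
      + (g + cst (k * z)) - T z) @[n --> \oo] --> 0.
    apply: (norm2_cvg0 mOm _ hT'); apply: nearW => n; exact: (L2_measurable mOm (L n)).
  have LL := L2B mOm LT (L2D mOm (FH z).1 (Lr z)).
  apply: ae_sub0; apply: (n2_null mOm LL).
  apply/eqP; rewrite eq_le (n2_ge0 _ _ _) andbT.
  have cc : nO ((psum (em lam U) (fun k => expR (lam (- k.+1%:Z) * z) * b k) n).1
      + (g + cst (k * z)) - T z) + nO ((psum (em lam U)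
     (fun k => expR (lam (- k.+1%:Z) * z) * b k) n).1 - (F 0 z).1) @[n --> \oo] --> 0.
    rewrite -[X in _ --> X]addr0; apply: cvgD; [exact: n0|exact: c].
  apply: (ler_cvg0 _ cc); apply: nearW => n; rewrite add0r.
  rewrite (n2_distC mOm LT (L2D mOm (FH z).1 (Lr z))).
  have X : (F 0 z).1 + (g + cst (k * z)) - T z =
     (psum (em lam U) (fun k => expR (lam (- k.+1%:Z) * z) * b k) n).1 + (g + cst (k * z)) - T z
    - ((psum (em lam U) (fun k => expR (lam (- k.+1%:Z) * z) * b k) n).1 - (F 0 z).1).
    apply/funext => x; have X (a d e f : R) : a + d - e = f + d - e - (f - a) by ring.
    exact: X.
  rewrite X.
  have h2 := ler_n2_dist mOm (L n) (L2_0 _ mOm) (L2B mOm (Pn z n).1 (FH z).1).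
  apply: (le_trans h2); rewrite subr0 lerD2l sub0r.
  rewrite -(scaleN1r (_ - _)) (n2Z mOm _ (L2B mOm (Pn z n).1 (FH z).1)).
  by rewrite normrN1 mul1r.
- apply: (n2_cvg0 mOm).
    apply: nearW => n; rewrite E; exact: (L2B mOm (L2D mOm (Pn z n).1 (Lr z)) LT).
  apply: cvg_near_ext (c z z0); apply: nearW => n; rewrite E.
  apply: (ae_eq_n2 mOm (L2B mOm (Pn z n).1 (FH z).1)).
    exact: (L2B mOm (L2D mOm (Pn z n).1 (Lr z)) LT).
  apply: ae_eq_sym_in; apply: (ae_eq_trans_in (ae_eqB (ae_eq_refl_in _ _ _) hT)).
  apply: ae_of_eq; apply/funext => x.
  have X (a d e : R) : a + d - (e + d) = a - e by ring.
  exact: X.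
Qed.

End given.

Lemma subr0_of_eq {V : zmodType} (x y : V) : x = y -> x - y = 0.
Proof. by move=> ->; exact: subrr. Qed.

Lemma ortho_arith {F : realDomainType} (kk a b d e f h : F) : h < 0 -> a = b -> b = d + e ->
  d = f -> f = kk * h -> e = 0 -> kk * a <= 0.
Proof.
move=> h0 -> -> -> -> ->; rewrite addr0 mulrA -expr2.
by rewrite mulr_ge0_le0 ?sqr_ge0// ltW.
Qed.

Lemma dot_kernel_arith {F : fieldType} (l a b c d f g t w : F) : l != 0 -> t = a + c ->
  d = - f -> c = d -> g = l * a - b -> g = 0 -> w = l^-1 * b -> f = w -> t = 0.
Proof.
move=> l0 -> -> -> -> h -> ->; have -> : b = l * a by apply/eqP; rewrite eq_sym -subr_eq0 h.
by rewrite mulrA mulVf// mul1r subrr.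
Qed.

Section complement.
Local Opaque grad trace wdot dH ipc ips ipa iph dot pi_minus hflow n2.
Context {R : realType} (G : graetz_data R) (setting : graetz_setting G).
Local Notation fn := (R * R -> R).
Local Notation Om := (Om G).
Local Notation nO := (n2 (@area R) Om).
Variables (lam : int -> R) (U : int -> fn) (s0 : fn).
Hypothesis basis : eigenbasis G lam U s0.
Implicit Types (p q r chi : fn * fn).
Local Notation PI := (preinner_HH setting).
Local Notation PV := (preinner_V setting).
Local Notation PC := (preinner_ipc setting).
Local Notation nH := (normHH G).
Local Notation nV s := (Num.sqrt (dH G s s)).
Local Notation mOm := (Om_measurable setting).
Let Lk c : L2 area Om (cst c). Proof. exact: (L2_Om_cst setting). Qed.

Lemma eq_ipc u u' v : L2 area Om u -> L2 area Om u' -> L2 area Om v ->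
  u = u' %[ae area in Om] -> ipc G u v = ipc G u' v.
Proof.
move=> Lu Lu' Lv uu'; have [m [M [m0 M0 mw wM mw']]] := c_weight setting.
exact: (eq_wdot mOm mw wM Lu Lu' Lv Lv uu' (ae_eq_refl_in _ _ _)).
Qed.

Lemma eq_iph u u' v : L2 area Om u -> L2 area Om u' -> L2 area Om v ->
  u = u' %[ae area in Om] -> iph G u v = iph G u' v.
Proof.
move=> Lu Lu' Lv uu'; have [M [M0 mw wM]] := h_weight setting.
exact: (eq_wdot mOm mw wM Lu Lu' Lv Lv uu' (ae_eq_refl_in _ _ _)).
Qed.

Lemma iph0 v : L2 area Om v -> iph G 0 v = 0.
Proof.
move=> Lv; have h := iph_lin setting 1 (L2_0 _ mOm) (L2_0 _ mOm) Lv.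
rewrite scaler0 addr0 mul1r in h.
have X (a : R) : a = a + a -> a = 0 by move=> e; apply: (addrI a); rewrite addr0.
exact: X h.
Qed.

Lemma iphZ k u v : L2 area Om u -> L2 area Om v -> iph G (k *: u) v = k * iph G u v.
Proof.
move=> Lu Lv; have h := iph_lin setting k Lu (L2_0 _ mOm) Lv.
rewrite addr0 (iph0 Lv) addr0 in h; exact: h.
Qed.

Lemma HH_kernel : balanced G -> HH G (cst 1, s0).
Proof.
by move=> bal; have [Vs _ _] := kernel_vector basis bal; split; [exact: Lk|exact: Vs].
Qed.

(** Symmetry of the operator, through weak forms: testing the eigenvector equation with 1 gives
    [lam i * (U i | 1) =] the integral of [h U i], and the product of [U i / lam i] with [s0] in [H]
    is minus that integral over [lam i]. *)
Lemma dot_kernel i : i != 0 -> balanced G -> dot G (phi lam U i) (cst 1, s0) = 0.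
Proof.
move=> i0 bal; have H0 := HH_kernel bal; have Hi := HH_eigen basis i0.
have K0 := kernel_vector basis bal; have nc := bal.1.
have V1 := V_cst setting 1 nc; have VU := V_eigen basis i0.
have Vl := hilbZ PV (lam i)^-1 VU.
have e1 : dot G (phi lam U i) (cst 1, s0) = ipc G (U i) (cst 1) + dH G ((lam i)^-1 *: U i) s0.
  exact: (dotE setting Hi H0).
have e2 := inv_Delta_h_eq setting K0 Vl.
have e3 : dH G ((lam i)^-1 *: U i) s0 = dH G s0 ((lam i)^-1 *: U i).
  exact: (hilbC PV Vl H0.2).
have e4 := eigen_eq setting basis i0 V1.
have e5 : dH G ((lam i)^-1 *: U i) (cst 1) = 0.
  exact: etrans (hilbC PV Vl V1) (dH_cst setting 1 nc Vl).
have e6 := iphZ (lam i)^-1 (V_L2 VU) (Lk 1).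
have e7 := iphC G (cst 1) ((lam i)^-1 *: U i).
exact: (dot_kernel_arith (lam_neq0 basis i0) e1 e2 e3 e4 e5 e6 e7).
Qed.

(** Subtracting from [p] its Fourier series on [ep] leaves a vector orthogonal to every spanning
    vector, hence null. *)
Lemma positive_part p : HH G p -> (forall k, dot G p (em lam U k) = 0) ->
  (balanced G -> dot G p (cst 1, s0) = 0) ->
  exists2 q, is_sum (HH G) (dot G) (ep lam U) (fun k => dot G p (ep lam U k)) q & nH (p - q) = 0.
Proof.
move=> Hp pm p0.
have [q aq] := bessel_is_sum PI (ep_HH basis) (HH_complete setting) (ep_orthonormal basis) Hp.
have Hq := is_sum_in aq; exists q; first exact: aq.
have Hpq := hilbB PI Hp Hq.
have q0 r : HH G r -> (forall k, dot G (ep lam U k) r = 0) -> dot G q r = 0.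
  move=> Hr er; have c := is_sum_dot PI (ep_HH basis) aq Hr.
  apply: (cvg_unique (@Rhausdorff R) c).
  rewrite (_ : (fun n => _) = cst 0); first exact: cvg_cst.
  by apply/funext => n; rewrite big1// => k _; rewrite er mulr0.
have z : dot G (p - q) (p - q) = 0.
  apply: (hspan_orthogonal PI _ (eigenvector_span basis Hpq) Hpq).
    move=> _ [[i i0 ->]|[bal ->]]; [exact: (HH_eigen basis i0)|exact: HH_kernel].
  move=> _ [[i i0 ->]|[bal ->]].
    have Hi := HH_eigen basis i0; apply: (etrans (hilbC PI Hi Hpq)).
    apply: (etrans (dotBl PI Hp Hq Hi)).
    have [[k ik]|[k ik]] := int_cases i0; rewrite ik.
      have e : dot G q (em lam U k) = 0.
        apply: (q0 (em lam U k) (em_HH basis k)) => j.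
        exact: etrans (hilbC PI (ep_HH basis j) (em_HH basis k)) (em_ep basis k j).
      exact: etrans (congr2 (fun x y : R => x - y) (pm k) e) (subrr 0).
    have e : dot G q (ep lam U k) = dot G p (ep lam U k).
      exact: (is_sum_coef PI (ep_HH basis) (ep_orthonormal basis) k aq).
    exact: subr0_of_eq (esym e).
  have H0 := HH_kernel bal; apply: (etrans (hilbC PI H0 Hpq)).
  apply: (etrans (dotBl PI Hp Hq H0)).
  have e : dot G q (cst 1, s0) = 0.
    apply: (q0 _ H0) => k; exact: (dot_kernel (posz_neq0 k) bal).
  exact: etrans (congr2 (fun x y : R => x - y) (p0 bal) e) (subrr 0).
exact: etrans (congr1 Num.sqrt z) (sqrtr0 _).
Qed.

Lemma lam_pos k : lam 1%:Z <= lam k.+1%:Z /\ 0 < lam k.+1%:Z.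
Proof.
elim: k => [|k [IH1 IH2]]; first by have [h _ _ _] := eigenvalue_order basis 0.
have [_ h _ _] := eigenvalue_order basis k.
by split; [exact: le_trans IH1 h|exact: lt_le_trans IH2 h].
Qed.

(** [(u, 0)] is a sum of positive modes. Its preimage [q'] under the operator has a first component
    that is null in [H], so the product of [q'] with [(u, 0)] is at most 0, while in coordinates it
    is a sum of terms [lam * square] with [lam > 0]. *)
Lemma ortho_Rminus_null u : L2 area Om u -> (forall k, ipc G u (em lam U k).1 = 0) ->
  (~ controlled G -> ipc G u (cst 1) = 0 \/ iph G (cst 1) (cst 1) < 0) ->
  u = cst 0 %[ae area in Om].
Proof.
move=> Lu um unc; have Hp := HH_left setting Lu.
have pm k : dot G (u, 0) (em lam U k) = 0.
  exact: etrans (dot_left setting Lu (em_HH basis k)) (um k).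
have bal0 : balanced G -> dot G (u, 0) (cst 1, s0) = 0.
  move=> bal; apply: (etrans (dot_left setting Lu (HH_kernel bal))).
  have [//|] := unc bal.1.
  have -> : iph G (cst 1) (cst 1) = \int[area]_(x in Om) hh G x.
    by rewrite -int_iph; apply: eq_Rintegral => x _; rewrite !mulr1.
  by rewrite bal.2 ltxx.
have [q aq pq] := positive_part Hp pm bal0.
set a := (fun k => dot G (u, 0) (ep lam U k)) in aq.
have Hq := is_sum_in aq.
have l1 := (lam_pos 0).2.
(* The coefficients of the preimage of [q] under the operator; the positive eigenvalues are bounded
   below by [lam 1], so they stay square summable. *)
pose c k := (lam k.+1%:Z)^-1 * a k.
have [q' cq'] : exists q', is_sum (HH G) (dot G) (ep lam U) c q'.
  apply: (is_sum_exists_le PI (ep_HH basis) (HH_complete setting) (ep_orthonormal basis)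
    (C := (lam 1%:Z)^-1) _ _ aq); first by rewrite invr_ge0 ltW.
  move=> k; have [h1 h2] := lam_pos k.
  rewrite normrM ler_wpM2r// gtr0_norm ?invr_gt0// lef_pV2//.
have lcq : is_sum (HH G) (dot G) (ep lam U) (fun k => lam k.+1%:Z * c k) q.
  apply: is_sum_ext aq => k; rewrite /c mulrA divff ?mul1r//.
  by rewrite gt_eqF// (lam_pos k).2.
have Hq' := is_sum_in cq'.
have [V1 d1] := sum_graph setting basis (fun k => posz_neq0 k) cq' lcq.
have [u1 u2] := HH_decomp_null setting (hilbB PI Hp Hq) pq.
have V0' := V0 setting; have Vq2 := Hq.2.
(* The first component of [q'] is the second component of its image [q], and that of [(u, 0)] is
   0. *)
have nq : nV (q'.1 - 0) = 0.
  apply: (nrm_null_trans PV V1 Vq2 V0' d1).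
  exact: (nrm_null_sym PV V0' Vq2 u2).
rewrite subr0 in nq; have [ec eu] := V_null_eqV setting V1 nq.
have uq : u = q.1 %[ae area in Om] by exact: ae_sub0 u1.
(* If [q'.1] is a constant [kk], the product is [kk * (u | 1)]. It vanishes when [u] is orthogonal
   to 1; otherwise [sum_eq] tested with 1 gives [(u | 1) = kk] times the integral of [h], so the
   product is [kk ^ 2] times a negative number. *)
have pos : ipc G q'.1 u <= 0.
  have [ctr|nc] := pselect (controlled G).
    have e : ipc G q'.1 u = 0.
      exact: etrans (eq_ipc Hq'.1 (L2_0 _ mOm) Lu (ec ctr)) (dot0l PC Lu).
    by rewrite e.
  have [kk ek] := eu nc; rewrite add0r in ek.
  have V1c := V_cst setting 1 nc.
  have X0 c' : (cst c' : fn) = c' *: cst 1 by apply/funext => x; exact: esym (mulr1 c').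
  have e2 : ipc G q'.1 u = kk * ipc G u (cst 1).
    rewrite (eq_ipc Hq'.1 (Lk kk) Lu ek) X0; apply: (etrans (dotZl PC kk (Lk 1) Lu)).
    exact: congr1 (hilbC PC (Lk 1) Lu).
  rewrite e2; have [->|hneg] := unc nc; first by rewrite mulr0.
  have e3 := eq_ipc Lu Hq.1 (Lk 1) uq.
  have e4 := sum_eq setting basis (fun k => posz_neq0 k) cq' lcq V1c.
  have e5 := eq_iph Hq'.1 (Lk kk) (Lk 1) ek.
  have e6 : iph G (cst kk) (cst 1) = kk * iph G (cst 1) (cst 1).
    rewrite X0; exact: iphZ.
  have e7 : dH G q'.2 (cst 1) = 0.
    exact: etrans (hilbC PV Hq'.2 V1c) (dH_cst setting 1 nc Hq'.2).
  exact: (ortho_arith hneg e3 e4 e5 e6 e7).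
have s1 := is_sum_dot PI (ep_HH basis) cq' Hp.
have s2 : \sum_(k < n) lam k.+1%:Z * c k ^+ 2 @[n --> \oo] --> dot G q' (u, 0).
  rewrite (_ : (fun n => _) = (fun n => \sum_(k < n) c k * dot G (ep lam U k) (u, 0))).
    exact: s1.
  apply/funext => n; apply: eq_bigr => k _.
  have e := hilbC PI (ep_HH basis k) Hp.
  have ak : a k = lam k.+1%:Z * c k.
    exact: esym (mulVKf (lt0r_neq0 (lam_pos k).2) (a k)).
  have X (l x y w : R) : w = y -> y = l * x -> l * x ^+ 2 = x * w by move=> -> ->; ring.
  exact: X e ak.
have s3 : dot G q' (u, 0) <= 0.
  have e := dot_fst setting Hq' Lu.
  by rewrite e.
have c0 k : c k = 0.
  have h : lam k.+1%:Z * c k ^+ 2 <= 0.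
    apply: le_trans s3; apply: (cvgr_to_ge s2); exists k.+1 => // n /= kn.
    rewrite (bigD1 (Ordinal kn))//= lerDl sumr_ge0// => j _.
    by rewrite mulr_ge0 ?sqr_ge0// ltW// (lam_pos j).2.
  apply/eqP; rewrite -sqrf_eq0 eq_le sqr_ge0 andbT.
  by rewrite pmulr_rle0 ?(lam_pos k).2 in h.
have q0 : nH (q - 0) = 0.
  apply: (is_sum_uniq PI (ep_HH basis) lcq); split; first exact: (hilb0 PI).
  rewrite (_ : (fun n => _) = cst 0); first exact: cvg_cst.
  apply/funext => n; rewrite subr0 /psum big1 ?(nrm0 PI)// => k _.
  by rewrite c0 mulr0 scale0r.
have z := nrm_null_trans PI Hp Hq (hilb0 PI) pq q0.
rewrite subr0 in z.
exact: (HH_decomp_null setting Hp z).1.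
Qed.

End complement.

(** * Monotonicity and derivatives of energies *)

Lemma derive_le0 {R : realType} (f df : R -> R) (a b : R) : a <= b ->
  (forall x, a <= x <= b -> is_derive x 1 f (df x) /\ df x <= 0) -> f b <= f a.
Proof.
rewrite le_eqVlt => /predU1P[->//|ab] fd.
have D x : x \in `]a, b[ -> is_derive x 1 f (df x).
  by rewrite in_itv /= => /andP[ax xb]; apply: (fd x _).1; rewrite !ltW.
have C : {within `[a, b], continuous f}.
  apply: derivable_within_continuous => x; rewrite in_itv /= => xab.
  by have [[]] := fd x xab.
have [c + E] := MVT ab D C.
rewrite in_itv /= => /andP[ac cb].
have dc : df c <= 0 by apply: (fd c _).2; rewrite !ltW.
by rewrite -subr_le0 E mulr_le0_ge0// subr_ge0 ltW.
Qed.

Lemma derive_eq0 {R : realType} (f : R -> R) (a b : R) : a <= b ->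
  (forall x, a <= x <= b -> is_derive x 1 f 0) -> f b = f a.
Proof.
move=> ab fd; apply/eqP; rewrite eq_le; apply/andP; split.
  by apply: (@derive_le0 _ f (fun=> 0)) => // x /fd.
rewrite -lerN2; apply: (@derive_le0 _ (- f) (fun=> 0)) => // x /fd h; split => //.
by rewrite -oppr0; exact: is_deriveN.
Qed.

Lemma is_derive_expR_lin {R : realType} (m x : R) :
  is_derive x 1 (fun y => expR (m * y)) (m * expR (m * x)).
Proof.
have h : is_derive x 1 (fun y : R => m * y) m.
  by rewrite -[X in is_derive _ _ _ X]mulr1; exact: is_deriveZ.
have h2 := is_derive1_comp (is_derive_expR (m * x)) h; rewrite mulrC in h2; exact: h2.
Qed.

Lemma is_derive_expR_mul {R : realType} (f : R -> R) (m x a b : R) :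
  is_derive x 1 f a -> b = (a + m * f x) * expR (m * x) ->
  is_derive x 1 (fun y => f y * expR (m * y)) b.
Proof.
move=> fa ->; have h := is_deriveM fa (is_derive_expR_lin m x).
have X (u v w : R) : (u + m * v) * w = v * (m * w) + w * u by ring.
by rewrite X; exact: h.
Qed.

(** Differentiability of [p] enters only as a quadratic bound on the remainder, so the chain rule
    for the square is obtained by expansion. *)
Lemma sqr_is_derive {R : realType} {E : lmodType R} (H : set E) (d : E -> E -> R)
    (PH : preinner H d) (p : R -> E) (p' r : E) (z C e : R) :
  0 < e -> 0 <= C -> (forall t, `|t| < e -> H (p (z + t))) -> H p' -> H r ->
  (forall t, `|t| < e -> Num.sqrt (d (p (z + t) - p z - t *: p') (p (z + t) - p z - t *: p'))
    <= C * t ^+ 2) ->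
  is_derive z 1 (fun y => d (p y - r) (p y - r)) (2 * d p' (p z - r)).
Proof.
move=> e0 C0 Hp Hp' Hr pC.
pose n x := Num.sqrt (d x x).
(* With [x = p z - r], increment [D] and remainder [rho], the error is [2 * d rho x + d D D]: the
   first term is at most [2 * C * t ^ 2 * n x], and [n D <= |t| * (n p' + C * e)]. *)
apply: (@is_derive_quadratic _ _ _ _ (2 * C * n (p z - r) + (n p' + C * e) ^+ 2) e e0) => t te.
have H0 : H (p z) by rewrite -[z]addr0; apply: Hp; rewrite normr0.
have Ht := Hp t te.
have Hx := hilbB PH H0 Hr.
have HD := hilbB PH Ht H0.
have Htp := hilbZ PH t Hp'.
have Hrho := hilbB PH HD Htp.
set D := p (z + t) - p z in HD Hrho *; set x := p z - r in Hx *.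
set rho := D - t *: p' in Hrho.
have -> : p (z + t) - r = x + D by rewrite /x /D [in RHS]addrC addrA subrK.
have e1 : d (x + D) (x + D) = d x x + 2 * d D x + d D D.
  by rewrite (dot_sqrD PH Hx HD) (hilbC PH Hx HD).
have e2 : d D x = t * d p' x + d rho x.
  by rewrite -(dotZl PH t Hp' Hx) -(dotDl PH Htp Hrho Hx) addrC subrK.
have rC : n rho <= C * t ^+ 2 := pC t te.
have h1 : `|d rho x| <= C * t ^+ 2 * n x.
  apply: (le_trans (dot_cauchy_schwarz PH Hrho Hx)).
  by rewrite ler_wpM2r ?sqrtr_ge0.
have h2 : n D <= `|t| * (n p' + C * e).
  have -> : D = t *: p' + rho by rewrite addrC subrK.
  apply: (le_trans (ler_nrmD PH Htp Hrho)).
  rewrite (nrmZ PH t Hp') mulrDr lerD2l (le_trans rC)//.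
  by rewrite -real_normK ?num_real// expr2 mulrCA !ler_wpM2l// ltW.
have h3 : d D D <= t ^+ 2 * (n p' + C * e) ^+ 2.
  rewrite -(nrm2E PH HD) -[t ^+ 2]real_normK ?num_real// -exprMn.
  rewrite lerXn2r ?nnegrE ?sqrtr_ge0// mulr_ge0//.
  by rewrite addr_ge0 ?sqrtr_ge0// mulr_ge0// ltW.
have h4 : 0 <= d D D := hilb_ge0 PH HD.
rewrite e1 e2.
have -> : d x x + 2 * (t * d p' x + d rho x) + d D D - d x x - 2 * d p' x * t =
  2 * d rho x + d D D by ring.
apply: (le_trans (ler_normD _ _)); rewrite (ger0_norm h4) normrM ger0_norm//.
have X (k u w q y : R) : k <= C * u * w -> y <= u * q -> 2 * k + y <= (2 * C * w + q) * u.
  move=> kC yq; rewrite (_ : _ * u = 2 * (C * u * w) + u * q); last by ring.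
  by rewrite lerD// ler_pM2l.
exact: X h1 h3.
Qed.

Lemma flow_energy_arith {F : realDomainType} (c d q a1 a2 a3 a4 a5 K e : F) :
  (* c : (F1|S-1), d : dH F0.2 S, q = iph 1 1 *)
  c = a1 - a2 -> a1 = a3 + d -> a2 = a4 -> a1 + d <= 0 -> 0 <= q ->
  a3 - a4 - (a4 - q) = a5 -> a5 <= K * e -> 2 * c <= K * e.
Proof. by move=> -> -> -> h1 h2 <- h3; lra. Qed.

Lemma iph_ipc_arith {F : rcfType} (K1 K2 i n c : F) : 0 <= K1 -> `|i| <= K1 * n * n ->
  n <= K2 * Num.sqrt c -> 0 <= n -> Num.sqrt c ^+ 2 = c -> i <= K1 * K2 ^+ 2 * c.
Proof.
move=> K10 h1 h2 n0 h3; apply: (le_trans (ler_norm _)); apply: (le_trans h1).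
rewrite -mulrA -expr2 -h3 -mulrA -exprMn ler_wpM2l// lerXn2r// nnegrE.
exact: le_trans n0 h2.
Qed.

Lemma dissip_arith {R : realType} (m z b x : R) : m < 0 ->
  x = m ^+ 1 * expR (m * z) * b -> m ^+ 0 * expR (m * z) * b * x <= 0.
Proof.
move=> m0 ->; rewrite (_ : _ * _ = m * (expR (m * z) * b) ^+ 2); last by ring.
by rewrite mulr_le0_ge0 ?sqr_ge0// ltW.
Qed.

Lemma le0_arith {F : realDomainType} (t a b c d : F) : t = a + c -> a = b -> d = c ->
  t <= 0 -> b + d <= 0.
Proof. by move=> -> -> ->. Qed.

(** * The defect [1 - (B_- Phi).1] *)

Section defect.
Local Opaque grad trace wdot dH ipc ips ipa iph dot pi_minus hflow n2 Bminus.
Context {R : realType} (G : graetz_data R) (setting : graetz_setting G).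
Local Notation fn := (R * R -> R).
Local Notation Om := (Om G).
Local Notation nO := (n2 (@area R) Om).
Variables (lam : int -> R) (U : int -> fn) (s0 : fn).
Hypothesis basis : eigenbasis G lam U s0.
Hypothesis invertible : compression_invertible G lam U.
Implicit Types (p q r chi : fn * fn).
Local Notation PI := (preinner_HH setting).
Local Notation PV := (preinner_V setting).
Local Notation PC := (preinner_ipc setting).
Local Notation nH := (normHH G).
Local Notation nV s := (Num.sqrt (dH G s s)).
Local Notation mOm := (Om_measurable setting).
Local Notation B := (Bminus G lam U).
Local Notation em := (em lam U).
Let Lk c : L2 area Om (cst c). Proof. exact: (L2_Om_cst setting). Qed.

Lemma ipc_em_perp u p : L2 area Om u -> (forall k, ipc G u (em k).1 = 0) ->
  Rminus G lam U p -> ipc G u p.1 = 0.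
Proof.
move=> Lu um Rp; have Hp := Rminus_HH Rp; have Hu := HH_left setting Lu.
have e : dot G p (u, 0) = 0.
  apply: (sum_dot0 setting basis (Rminus_sum setting basis Rp) Hu) => k.
  apply: (etrans (dot_fst setting (em_HH basis k) Lu)).
  exact: etrans (hilbC PC (em_HH basis k).1 Lu) (um k).
apply: (etrans (hilbC PC Lu Hp.1)).
exact: etrans (esym (dot_fst setting Hp Lu)) e.
Qed.

(** [P B_- (u, 0)] and [(u, 0)] have the same coefficients on negative modes, and these only see
    first components. *)
Lemma B_perp u k : L2 area Om u -> ipc G (u - (B (u, 0)).1) (em k).1 = 0.
Proof.
move=> Lu; have Hu := HH_left setting Lu; have [RB Bk] := BminusP setting basis invertible Hu.
have HB := Rminus_HH RB; have He := em_HH basis k.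
apply: (etrans (dotBl PC Lu HB.1 He.1)); apply: subr0_of_eq.
have e1 := dot_Pproj setting HB He; have e2 := dot_left setting Lu He.
exact: etrans (esym e2) (etrans (esym (Bk k)) e1).
Qed.

(** The first component of [Phi - P B_- Phi], whose second component is 0 ([defectE]); products with
    that vector are thus L^2 products with [defect]. *)
Definition defect : fn := cst 1 - (B (cst 1, 0)).1.

Lemma defectE : (cst 1 : fn, 0 : fn) - Pproj (B (cst 1, 0)) = (defect, 0).
Proof. by rewrite /Pproj; congr (_, _); apply/funext => x; exact: subr0. Qed.

Lemma B_Rminus u : L2 area Om u -> Rminus G lam U (B (u, 0)).
Proof. by move=> Lu; exact: (BminusP setting basis invertible (HH_left setting Lu)).1. Qed.

Lemma L2_defect : L2 area Om defect.
Proof. exact: (L2B mOm (Lk 1) (Rminus_HH (B_Rminus (Lk 1))).1). Qed.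

Lemma defect_perp p : Rminus G lam U p -> ipc G defect p.1 = 0.
Proof. by move=> Rp; apply: (ipc_em_perp L2_defect _ Rp) => k; exact: (B_perp k (Lk 1)). Qed.

(** 1 and [defect] differ by the first component of an element of the range of pi_-, to which
    [defect] is orthogonal. So the denominator of the formulas is the square of a norm. *)
Lemma defect_sqr : ipc G defect (cst 1) = ipc G defect defect.
Proof.
have RB := B_Rminus (Lk 1); have LB := (Rminus_HH RB).1.
have e := dotBr PC (Lk 1) LB L2_defect.
have e2 := defect_perp RB.
have X (a b c : R) : a = b - c -> c = 0 -> b = a by move=> -> ->; rewrite subr0.
exact: X e e2.
Qed.

Lemma nO_cst1_gt0 : 0 < nO (cst 1).
Proof.
have n0 := n2_ge0 (@area R) Om (cst 1 : fn); rewrite lt_neqAle n0 andbT eq_sym.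
apply/negP => /eqP h; have h1 := n2_null mOm (Lk 1) h.
have A0 := area_open_gt0 (Om_open setting) (Om_nonempty setting).
have hN : {ae area, forall x, ~ Om x}.
  by apply: aeS h1 _ => x h' Ox; have := h' Ox => /eqP; rewrite oner_eq0.
have N : area.-negligible Om by apply: negligibleS hN => x Ox; exact.
have A1 := (negligibleP area mOm).1 N.
by rewrite A1 ltxx in A0.
Qed.

Lemma iph_sub_cst u : L2 area Om u -> iph G u u - iph G u (cst 1) -
  (iph G u (cst 1) - iph G (cst 1) (cst 1)) = iph G (u - cst 1) (u - cst 1).
Proof.
move=> Lu; have subE (x y : fn) : x - y = -1 *: y + x by rewrite scaleN1r addrC.
have Ls := L2B mOm Lu (Lk 1).
have e1 := iph_lin setting (-1) (Lk 1) Lu Ls; have e2 := iph_lin setting (-1) (Lk 1) Lu Lu.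
have e3 := iph_lin setting (-1) (Lk 1) Lu (Lk 1); rewrite -subE in e1 e2 e3.
have c1 := iphC G (cst 1) (u - cst 1); have c2 := iphC G u (u - cst 1).
have c3 := iphC G u (cst 1).
have X (s a b c d e f g h : R) : s = - 1 * a + b -> c = - 1 * d + e -> f = - 1 * g + h ->
  a = f -> b = c -> h = d -> e - h - (h - g) = s by move=> -> -> -> -> -> ->; ring.
exact: (X _ _ _ _ _ _ _ _ _ e1 e2 e3 c1 c2 c3).
Qed.

(* If the defect 1 - (B_- Phi).1 vanished, the flow S started from B_- Phi would satisfy
   S(0) = 1, and |S(z) - 1|^2 would obey a Gronwall inequality forcing S = 1, while S decays. *)
Lemma defect_neq0 : ~ controlled G -> 0 <= iph G (cst 1) (cst 1) ->
  ipc G defect defect != 0.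
Proof.
move=> nc h0; apply/eqP => w0.
pose psi := B (cst 1, 0); have Rpsi : Rminus G lam U psi by exact: (B_Rminus (Lk 1)).
have Hpsi := Rminus_HH Rpsi; have bpsi := Rminus_sum setting basis Rpsi.
pose F := hflow G lam U (fun k => dot G psi (em k)).
have FH j z : HH G (F j z) by exact: (hflow_HH setting).
have Vc := V_cst setting 1 nc.
pose e z := ipc G ((F 0 z).1 - cst 1) ((F 0 z).1 - cst 1).
have L1 z : L2 area Om ((F 0 z).1 - cst 1) by exact: (L2B mOm (FH 0 z).1 (Lk 1)).
have e_ge0 z : 0 <= e z by exact: (hilb_ge0 PC (L1 z)).
(* The Gronwall constant: the form of [h] is bounded by the squared norm of weight [c]. *)
have [K K0 hK] : exists2 K, 0 < K & forall u, L2 area Om u -> iph G u u <= K * ipc G u u.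
  have [K1 K10 h1] := iph_bound setting; have [K2 K20 h2] := ipc_lower setting.
  exists (K1 * K2 ^+ 2); first by rewrite mulr_gt0// exprn_gt0.
  move=> u Lu; have i1 := h1 u u Lu Lu; have i2 := h2 u Lu.
  have i3 := nrm2E PC Lu; have n0 := n2_ge0 (@area R) Om u.
  exact: (iph_ipc_arith (ltW K10) i1 i2 n0 i3).
have de (z : R) : 0 < z -> is_derive z 1 e (2 * ipc G (F 1 z).1 ((F 0 z).1 - cst 1)).
  move=> z0; have [C C0 hC] := hflow_taylor setting basis bpsi 0 z0.
  have z2 : 0 < z / 2 by rewrite divr_gt0.
  apply: (sqr_is_derive (p := fun y => (F 0 y).1) PC z2 (ltW C0)).
  - move=> t _; exact: (FH 0 (z + t)).1.
  - exact: (FH 1 z).1.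
  - exact: (Lk 1).
  - move=> t tz; apply: le_trans (hC t (ltW tz)).
    exact: (le_normHH1 setting (hilbB PI (hilbB PI (FH 0 (z + t)) (FH 0 z)) (hilbZ PI t (FH 1 z)))).
(* With [S = (F 0 z).1], the weak equation tested with [S] and with 1, combined with the dissipation
   [a5], bounds the derivative by [(hS | S) - 2 (hS | 1)]. Adding the integral of [h], nonnegative
   by hypothesis, completes this to the form of [h] at [S - 1]. *)
have de_le (z : R) : 0 < z -> 2 * ipc G (F 1 z).1 ((F 0 z).1 - cst 1) <= K * e z.
  move=> z0; have [VS g0] := hflow_graph setting basis bpsi 0 z0.
  have S1 := hflow_eq setting basis bpsi 0 z0.
  have LS := (FH 0 z).1; have L1' := (FH 1 z).1.
  have a1 := dotBr PC LS (Lk 1) L1'.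
  have a2 := S1 _ VS.
  have a3 := S1 _ Vc.
  have a4 : dH G (F 0 z).2 (cst 1) = 0.
    exact: etrans (hilbC PV (FH 0 z).2 Vc) (dH_cst setting 1 nc (FH 0 z).2).
  rewrite a4 addr0 in a3.
  (* Dissipation: the left side is the product of the flow with its derivative, which in coordinates
     is a sum of squares times negative eigenvalues. *)
  have a5 : ipc G (F 1 z).1 (F 0 z).1 + dH G (F 0 z).2 (F 0 z).1 <= 0.
    have b1 : dH G (F 0 z).2 (F 0 z).1 = dH G (F 0 z).2 (F 1 z).2.
      apply: (etrans (hilbC PV (FH 0 z).2 VS)).
      apply: (etrans (dot_null_eql PV VS (FH 1 z).2 (FH 0 z).2 g0)).
      exact: (hilbC PV (FH 1 z).2 (FH 0 z).2).
    have b2 := dotE setting (FH 0 z) (FH 1 z).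
    have b3 := hilbC PC LS L1'.
    have b4 : dot G (F 0 z) (F 1 z) <= 0.
      have c0 := is_sum_dot PI (em_HH basis) (hflowP setting basis bpsi 0 z0) (FH 1 z).
      apply: (cvgr_to_le c0); apply: nearW => n; apply: sumr_le0 => k _.
      have c1 := is_sum_coef PI (em_HH basis) (em_orthonormal basis) k (hflowP setting basis bpsi 1 z0).
      have c2 := hilbC PI (em_HH basis k) (FH 1 z).
      exact: (dissip_arith (mu_neg basis k) (etrans c2 c1)).
    exact: (le0_arith b2 b3 b1 b4).
  have a6 := iph_sub_cst LS.
  have a7 := hK _ (L1 z).
  exact: (flow_energy_arith a1 a2 a3 a5 h0 a6 a7).
have e_cvg : e z @[z --> 0^'+] --> 0.
  have n1 : Num.sqrt (ipc G (psi.1 - cst 1) (psi.1 - cst 1)) = 0.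
    apply: (nrm_null_sym PC (Lk 1) Hpsi.1); exact: etrans (congr1 Num.sqrt w0) (sqrtr0 _).
  have n2e z : e z = ipc G (F 0 z - psi).1 (F 0 z - psi).1.
    have LD := (hilbB PI (FH 0 z) Hpsi).1.
    have n3 := nrm_null_sub PC (FH 0 z).1 (FH 0 z).1 (Lk 1) Hpsi.1.
    have z0 : Num.sqrt (ipc G ((F 0 z).1 - (F 0 z).1) ((F 0 z).1 - (F 0 z).1)) = 0.
      rewrite subrr; exact: (nrm0 PC).
    have z1 : Num.sqrt (ipc G (cst 1 - psi.1) (cst 1 - psi.1)) = 0.
      exact: etrans (congr1 Num.sqrt w0) (sqrtr0 _).
    have n4 := n3 z0 z1.
    exact: etrans (esym (nrm2E PC (L1 z)))
      (etrans (congr1 (fun x : R => x ^+ 2) n4) (nrm2E PC LD)).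
  have c0 := hflow0_cvg setting basis bpsi.
  apply: (@cvg_dist_le _ _ _ _ _ (fun z => nH (F 0 z - psi) * nH (F 0 z - psi))).
    apply: nearW => z; rewrite subr0 ger0_norm; last exact: e_ge0.
    have HD := hilbB PI (FH 0 z) Hpsi.
    rewrite n2e -(nrm2E PC HD.1) expr2.
    have l := le_normHH1 setting HD.
    by apply: ler_pM => //; exact: sqrtr_ge0.
  rewrite -[X in _ --> X](mulr0 (0:R)); exact: (cvgM c0 c0).
have e0 (z : R) : 0 < z -> e z = 0.
  move=> z0; apply/eqP; rewrite eq_le e_ge0 andbT.
  (* The energy times [expR (- K * z)] is nonincreasing on positive [z]; since the energy tends to 0
     at the inlet, it vanishes everywhere. *)
  have mono y : 0 < y -> y <= z -> e z * expR (- K * z) <= e y * expR (- K * y).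
    move=> y0 yz; apply: (@derive_le0 _ (fun x => e x * expR (- K * x)) (fun x =>
      (2 * ipc G (F 1 x).1 ((F 0 x).1 - cst 1) + - K * e x) * expR (- K * x)) _ _ yz).
    move=> x /andP[yx xz]; have x0 := lt_le_trans y0 yx.
    split; first exact: (is_derive_expR_mul (de x x0) erefl).
    rewrite mulr_le0_ge0 ?expR_ge0// mulNr subr_le0; exact: de_le.
  have h : e z * expR (- K * z) <= 0.
    apply: (ler_cvg0 _ e_cvg); near=> y.
    have y0 : 0 < y by near: y; exact: nbhs_right_gt.
    have yz : y <= z by near: y; exact: nbhs_right_le.
    rewrite add0r; apply: (le_trans (mono y y0 yz)).
    by rewrite ler_piMr// -expR0 ler_expR mulNr oppr_le0 mulr_ge0// ltW.
  by rewrite pmulr_lle0 ?expR_gt0 in h.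
have c1 : nO (F 0 z).1 @[z --> +oo] --> 0 := nO_hflow0_cvg setting basis bpsi.
have : nO (cst 1) <= 0.
  apply: (ler_cvg0 _ c1); near=> z; have z0 : 0 < z by near: z; exact: nbhs_pinfty_gt.
  have [K2 K20 h2] := ipc_lower setting.
  have n0 : nO ((F 0 z).1 - cst 1) = 0.
    apply/eqP; rewrite eq_le (n2_ge0 _ _ _) andbT; apply: (le_trans (h2 _ (L1 z))).
    have E : Num.sqrt (ipc G ((F 0 z).1 - cst 1) ((F 0 z).1 - cst 1)) = 0.
      exact: etrans (congr1 Num.sqrt (e0 z z0)) (sqrtr0 _).
    by rewrite E mulr0.
  have t := ler_n2_dist mOm (Lk 1) (FH 0 z).1 (L2_0 _ mOm).
  rewrite !subr0 (n2_distC mOm (Lk 1) (FH 0 z).1) n0 in t.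
  exact: t.
by rewrite leNgt nO_cst1_gt0.
Unshelve. all: by end_near. Qed.

End defect.

(** * Exclusion of exponential growth *)

Lemma no_growth_le {R : realType} (q l : R -> R) (m A : R) : 0 < m ->
  (forall z : R, 0 < z -> is_derive z 1 q (A * expR (m * z) - l z)) ->
  (\forall z \near +oo, `|q z| <= expR (m / 2 * z) /\ `|l z| <= expR (m / 2 * z)) ->
  A <= 0.
Proof.
move=> m0 dq [M [_ hM]]; have m2 : 0 < m / 2 by rewrite divr_gt0.
pose z1 := Num.max M 0 + 1.
have z10 : 0 < z1 by rewrite ltr_wpDl// le_max lexx orbT.
have z1M : M < z1 by rewrite (@le_lt_trans _ _ (Num.max M 0)) ?le_max ?lexx// ltrDl.
pose E x := expR (m * x); pose e x := expR (m / 2 * x).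
(* A primitive comparison: its derivative is [l - e], which is nonpositive far out. Hence
   [A / m * E] is at most a constant plus a multiple of [e], and dividing by [E], the square of [e],
   forces [A <= 0]. *)
pose f x := A / m * E x - (m / 2)^-1 * e x - q x.
have mono z : z1 <= z -> f z <= f z1.
  move=> z1z; apply: (@derive_le0 _ f (fun x => l x - e x) _ _ z1z) => x /andP[zx xz].
  have x0 := lt_le_trans z10 zx; have [_ lx] := hM _ (lt_le_trans z1M zx).
  split; last by rewrite subr_le0; exact: le_trans (ler_norm _) lx.
  have -> : l x - e x = (A / m * (m * E x) - (m / 2)^-1 * (m / 2 * e x)) - (A * E x - l x).
    by rewrite mulrA divfK ?gt_eqF// mulKf ?gt_eqF//; ring.
  apply: is_deriveB; last exact: dq.
  by apply: is_deriveB; apply: is_deriveZ; exact: is_derive_expR_lin.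
have mN : - m < 0 by rewrite oppr_lt0.
have mN2 : - (m / 2) < 0 by rewrite oppr_lt0.
have [d1 _] := expR_decay mN; have [d2 _] := expR_decay mN2.
have c : `|f z1| * expR (- m * z) + ((m / 2)^-1 + 1) * expR (- (m / 2) * z) @[z --> +oo] --> 0.
  have -> : 0 = `|f z1| * 0 + ((m / 2)^-1 + 1) * 0 :> R by rewrite !mulr0 addr0.
  by apply: cvgD; apply: cvgM => //; exact: cvg_cst.
suff : A / m <= 0 by rewrite pmulr_lle0 ?invr_gt0.
apply: (ler_cvg0 _ c); near=> z.
have zz : z1 <= z by near: z; apply: nbhs_pinfty_ge; exact: num_real.
have [qz _] := hM _ (lt_le_trans z1M zz).
have h := mono z zz; have h2 := ler_norm (f z1); have h3 := ler_norm (q z).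
have Ei : E z * expR (- m * z) = 1 by rewrite /E -expRD mulNr subrr expR0.
have ei : e z * expR (- m * z) = expR (- (m / 2) * z).
  by rewrite /e -expRD; congr expR; field.
have qe : q z <= e z := le_trans h3 qz.
have h4 : f z <= `|f z1| := le_trans h h2.
have key : A / m * E z <= `|f z1| + ((m / 2)^-1 + 1) * e z.
  have -> : A / m * E z = f z + (m / 2)^-1 * e z + q z.
    by rewrite /f; ring.
  by rewrite mulrDl mul1r addrA !lerD// lexx.
have X (a x y w w' u c0 : R) : x * y = 1 -> w * y = w' -> 0 <= y -> a * x <= u + c0 * w ->
    a <= u * y + c0 * w'.
  by move=> xy <- y0 h0; rewrite mulrA -mulrDl -[a]mulr1 -xy mulrA ler_wpM2r.
rewrite add0r; exact: X Ei ei (expR_ge0 _) key.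
Unshelve. all: by end_near. Qed.

Lemma no_growth {R : realType} (q l : R -> R) (m A : R) : 0 < m ->
  (forall z : R, 0 < z -> is_derive z 1 q (A * expR (m * z) - l z)) ->
  (\forall z \near +oo, `|q z| <= expR (m / 2 * z) /\ `|l z| <= expR (m / 2 * z)) ->
  A = 0.
Proof.
move=> m0 dq b; apply/eqP; rewrite eq_le (no_growth_le m0 dq b) -oppr_le0.
apply: (no_growth_le (q := - q) (l := - l) m0).
  move=> z z0; have -> : - A * expR (m * z) - (- l) z = - (A * expR (m * z) - l z).
    by rewrite mulNr opprB opprK addrC.
  exact: is_deriveN (dq z z0).
by apply: filterS b => z [h1 h2]; rewrite !normrN.
Qed.

(** * Inlets attained by the range of pi_- *)

Lemma lin_eq0 {F : fieldType} (t a b x : F) : x = t * a + b -> a = 0 -> b = 0 -> x = 0.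
Proof. by move=> -> -> ->; rewrite mulr0 addr0. Qed.

Lemma lin_cancel {F : fieldType} (t a b x D : F) : D != 0 -> x = - t * a + b -> a = D ->
  t = b / D -> x = 0.
Proof. by move=> D0 -> -> ->; rewrite mulNr divfK// addNr. Qed.

Lemma lin_solve {F : fieldType} (t b x D : F) : D != 0 -> x = - t * D + b -> x = 0 ->
  b = 0 -> t = 0.
Proof.
move=> D0 -> + b0; rewrite b0 addr0 mulNr => /eqP.
by rewrite oppr_eq0 mulf_eq0 (negbTE D0) orbF => /eqP.
Qed.

Section solutions.
Local Opaque grad trace wdot dH ipc ips ipa iph dot pi_minus hflow n2 Bminus.
Context {R : realType} (G : graetz_data R) (setting : graetz_setting G).
Local Notation fn := (R * R -> R).
Local Notation Om := (Om G).
Local Notation nO := (n2 (@area R) Om).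
Variables (lam : int -> R) (U : int -> fn) (s0 : fn).
Hypothesis basis : eigenbasis G lam U s0.
Hypothesis invertible : compression_invertible G lam U.
Implicit Types (p q r chi : fn * fn).
Local Notation PI := (preinner_HH setting).
Local Notation PV := (preinner_V setting).
Local Notation PC := (preinner_ipc setting).
Local Notation nH := (normHH G).
Local Notation nV s := (Num.sqrt (dH G s s)).
Local Notation mOm := (Om_measurable setting).
Local Notation B := (Bminus G lam U).
Local Notation em := (em lam U).
Local Notation msum := (is_sum (HH G) (dot G) em).
Local Notation defect := (defect G lam U).
Let Lk c : L2 area Om (cst c). Proof. exact: (L2_Om_cst setting). Qed.

(** The difference [v] is orthogonal to the negative modes. When [ortho_Rminus_null] does not apply
    at once, subtract the multiple of [defect] that makes it orthogonal to 1; then [v] is a multiple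
    of [defect], and also orthogonal to it because [u] is. *)
Lemma B_fix u : L2 area Om u -> (~ controlled G -> iph G (cst 1) (cst 1) < 0 \/
    (0 <= iph G (cst 1) (cst 1) /\ ipc G defect u = 0)) ->
  u = (B (u, 0)).1 %[ae area in Om].
Proof.
move=> Lu unc; have RB := B_Rminus setting basis invertible Lu.
have LB := (Rminus_HH RB).1; pose v : fn := u - (B (u, 0)).1.
have Lv : L2 area Om v by exact: (L2B mOm Lu LB).
have vm k : ipc G v (em k).1 = 0 by exact: (B_perp setting basis invertible k Lu).
apply: ae_sub0.
have [nch|ok] := pselect (~ controlled G /\ 0 <= iph G (cst 1) (cst 1)); last first.
  apply: (ortho_Rminus_null setting basis Lv vm) => nc; right.
  rewrite ltNge; apply/negP => h; exact: ok (conj nc h).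
have [nc h0] := nch; have [hlt|[_ du]] := unc nc; first by rewrite ltNge h0 in hlt.
have Ld := L2_defect setting basis invertible.
have D0 := defect_neq0 setting basis invertible nc h0.
have Dsq := defect_sqr setting basis invertible.
(* The denominator is the product of [defect] with 1 by [defect_sqr], so [v'] is orthogonal to 1. *)
pose t := ipc G v (cst 1) / ipc G defect defect.
pose v' : fn := - t *: defect + v.
have Lv' : L2 area Om v' by exact: (L2_lin mOm _ Ld Lv).
have lin w : L2 area Om w -> ipc G v' w = - t * ipc G defect w + ipc G v w.
  move=> Lw; exact: (hilb_dotl PC (- t) Ld Lv Lw).
have v'm k : ipc G v' (em k).1 = 0.
  have d0 : ipc G defect (em k).1 = 0 by exact: (B_perp setting basis invertible k (Lk 1)).
  exact: (lin_eq0 (lin _ (em_HH basis k).1) d0 (vm k)).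
have v'1 : ipc G v' (cst 1) = 0.
  exact: (lin_cancel D0 (lin _ (Lk 1)) Dsq erefl).
have z := ortho_Rminus_null setting basis Lv' v'm (fun _ => or_introl v'1).
have e1 : ipc G v' defect = 0.
  exact: etrans (eq_ipc setting Lv' (L2_0 _ mOm) Ld z) (dot0l PC Ld).
have e2 : ipc G v defect = 0.
  apply: (etrans (hilbC PC Lv Ld)); apply: (etrans (dotBr PC Lu LB Ld)).
  have dB := defect_perp setting basis invertible RB.
  exact: etrans (congr2 (fun x y : R => x - y) du dB) (subr0 0).
have t0 : t = 0.
  exact: (lin_solve D0 (lin _ Ld) e1 e2).
have vv : v' = v.
  rewrite /v' t0 oppr0 scale0r; exact: add0r.
rewrite vv in z; exact: z.
Qed.

(** Necessity of the orthogonality condition, and uniqueness of the starting vector: [psi] and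
    [B_- (u, 0)] have compressions with the same coefficients. *)
Lemma B_fix_conv u psi : L2 area Om u -> Rminus G lam U psi -> u = psi.1 %[ae area in Om] ->
  ipc G defect u = 0 /\ nH (psi - B (u, 0)) = 0.
Proof.
move=> Lu Rpsi upsi; have Hpsi := Rminus_HH Rpsi; have Hu := HH_left setting Lu.
have Ld := L2_defect setting basis invertible.
have [RB Bk] := BminusP setting basis invertible Hu; split.
  apply: (etrans (hilbC PC Ld Lu)).
  apply: (etrans (eq_ipc setting Lu Hpsi.1 Ld upsi)).
  apply: (etrans (hilbC PC Hpsi.1 Ld)).
  exact: (defect_perp setting basis invertible Rpsi).
apply: (Rminus_uniq setting basis invertible Rpsi RB) => k.
have He := em_HH basis k.
have e1 := dot_Pproj setting Hpsi He.
have e2 := eq_ipc setting Lu Hpsi.1 He.1 upsi.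
have e3 := dot_left setting Lu He.
exact: etrans e1 (etrans (esym e2) (etrans (esym e3) (esym (Bk k)))).
Qed.

(** The slope is nonzero only in the balanced case, where [s0] supplies exactly the divergence [h]
    needed by [drift]; otherwise only a constant survives, and none in the controlled case. *)
Lemma drift_std c k : (controlled G -> c = 0) -> (~ balanced G -> k = 0) ->
  drift G (cst c + k *: s0) k /\ L2 area Om (cst c + k *: s0).
Proof.
move=> hc hk.
have D : drift G (cst c + k *: s0) k; last by split=> //; exact: V_L2 (let: And3 h _ _ := D in h).
have [bal|nb] := pselect (balanced G).
  have K0 := kernel_vector basis bal; have [Vs _ _] := K0; have nc := bal.1.
  have Vc := V_cst setting c nc; have Vk := hilbZ PV k Vs.
  split; [exact: (hilbD PV Vc Vk)|by right|move=> v Vv].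
  have e1 := dotDl PV Vc Vk Vv; have e2 := dH_cst setting c nc Vv.
  have e3 := dotZl PV k Vs Vv; have e4 := inv_Delta_h_eq setting K0 Vv.
  rewrite e2 e3 e4 add0r mulrN in e1; exact: e1.
rewrite (hk nb) scale0r addr0.
have [ctr|nc] := pselect (controlled G).
  rewrite (hc ctr); split; [exact: (V0 setting)|by left|move=> v Vv].
  by rewrite mul0r oppr0; exact: (dot0l PV Vv).
split; [exact: V_cst|by left|move=> v Vv].
by rewrite mul0r oppr0; exact: dH_cst.
Qed.

Lemma mild_solution b psi g k T0 T : msum b psi -> drift G g k -> mild G lam U b g k T ->
  L2 area Om T0 -> T0 = psi.1 + g %[ae area in Om] -> solution G T0 T.
Proof.
move=> bpsi gk mT LT0 eT0; have Vg : V G g by case: gk.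
split.
- by move=> z z0; exact: (mT z z0).1.
- by eexists; exact: (mild_equation setting basis bpsi gk mT).
- exact: (mild_cont0 setting basis bpsi mT).
- apply: (ae_eq_trans_in (mild_init setting basis bpsi mT)); exact: ae_eq_sym_in.
- exact: (mild_subexponential setting basis bpsi (V_L2 Vg) mT).
Qed.

Lemma negative_part p : HH G p -> (forall k, dot G p (ep lam U k) = 0) ->
  (balanced G -> dot G p (cst 1, s0) = 0) -> msum (fun k => dot G p (em k)) p.
Proof.
move=> Hp pp p0.
have [q aq] := bessel_is_sum PI (em_HH basis) (HH_complete setting) (em_orthonormal basis) Hp.
have Hq := is_sum_in aq; have Hpq := hilbB PI Hp Hq.
have q0 r : HH G r -> (forall k, dot G (em k) r = 0) -> dot G q r = 0.
  move=> Hr er; exact: (sum_dot0 setting basis aq Hr er).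
have z : dot G (p - q) (p - q) = 0.
  apply: (hspan_orthogonal PI _ (eigenvector_span basis Hpq) Hpq).
    move=> _ [[i i0 ->]|[bal ->]]; [exact: (HH_eigen basis i0)|exact: (HH_kernel setting basis)].
  move=> _ [[i i0 ->]|[bal ->]].
    have Hi := HH_eigen basis i0; apply: (etrans (hilbC PI Hi Hpq)).
    apply: (etrans (dotBl PI Hp Hq Hi)); apply: subr0_of_eq.
    have [[k ik]|[k ik]] := int_cases i0; rewrite ik.
      exact: esym (is_sum_coef PI (em_HH basis) (em_orthonormal basis) k aq).
    apply: (etrans (pp k)); apply: esym; apply: (q0 (ep lam U k) (ep_HH basis k)) => j.
    exact: (em_ep basis j k).
  have H0 := HH_kernel setting basis bal; apply: (etrans (hilbC PI H0 Hpq)).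
  apply: (etrans (dotBl PI Hp Hq H0)); apply: subr0_of_eq.
  apply: (etrans (p0 bal)); apply: esym; apply: (q0 _ H0) => k.
  exact: (dot_kernel setting basis (negz_neq0 k) bal).
have n0 : nH (p - q) = 0 by exact: etrans (congr1 Num.sqrt z) (sqrtr0 _).
exact: (is_sum_null PI (em_HH basis) aq Hp (nrm_null_sym PI Hp Hq n0)).
Qed.

End solutions.

(** * The modes of a solution *)

Lemma mode_arith {F : fieldType} (l a b c d f g h s t u : F) :
  s = a + b -> b = c -> c = l * (l * d - f) -> d = g -> f = h -> t = l * u - a ->
  s + t = l * (u + (l * g - h)).
Proof. by move=> -> -> -> -> -> ->; ring. Qed.

Section structure.
Local Opaque grad trace wdot dH ipc ips ipa iph dot pi_minus hflow n2 Bminus.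
Context {R : realType} (G : graetz_data R) (setting : graetz_setting G).
Local Notation fn := (R * R -> R).
Local Notation Om := (Om G).
Local Notation nO := (n2 (@area R) Om).
Variables (lam : int -> R) (U : int -> fn) (s0 : fn).
Hypothesis basis : eigenbasis G lam U s0.
Implicit Types (p q r chi : fn * fn).
Local Notation PI := (preinner_HH setting).
Local Notation PV := (preinner_V setting).
Local Notation PC := (preinner_ipc setting).
Local Notation nH := (normHH G).
Local Notation nV s := (Num.sqrt (dH G s s)).
Local Notation mOm := (Om_measurable setting).
Let Lk c : L2 area Om (cst c). Proof. exact: (L2_Om_cst setting). Qed.

Variables (T dT : R -> fn).
Hypothesis eqT : solves_equation G T dT.

Lemma sol_LdT z : 0 < z -> L2 area Om (dT z). Proof. by move=> /eqT[[]]. Qed.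
Lemma sol_VT z : 0 < z -> V G (T z). Proof. by move=> /eqT[[]]. Qed.
Lemma sol_LT z : 0 < z -> L2 area Om (T z). Proof. by move=> /sol_VT; exact: V_L2. Qed.

Definition bounded_form (phi : fn -> R) : Prop :=
  (forall a u v, L2 area Om u -> L2 area Om v -> phi (a *: u + v) = a * phi u + phi v) /\
  exists2 K : R, 0 < K & forall u, L2 area Om u -> `|phi u| <= K * nO u.

Lemma ipc_bounded_form v : L2 area Om v -> bounded_form (fun u => ipc G u v).
Proof.
move=> Lv; split; first by move=> a u w Lu Lw; exact: (hilb_dotl PC a Lu Lw Lv).
have [K K0 hK] := ipc_upper setting.
exists (K * Num.sqrt (ipc G v v) + 1); first by rewrite ltr_wpDl// mulr_ge0 ?sqrtr_ge0// ltW.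
move=> u Lu; apply: (le_trans (dot_cauchy_schwarz PC Lu Lv)).
have n0 := n2_ge0 (@area R) Om u; have h := hK u Lu.
have X (a b c : R) : 0 <= b -> 0 <= c -> a <= K * c -> a * b <= (K * b + 1) * c.
  move=> b0 c0 ac; rewrite mulrDl mul1r -mulrA [b * c]mulrC mulrA.
  by apply: (@le_trans _ _ (K * c * b)); [exact: ler_wpM2r|rewrite lerDl].
exact: X (sqrtr_ge0 _) n0 h.
Qed.

Lemma iph_bounded_form v : L2 area Om v -> bounded_form (fun u => iph G u v).
Proof.
move=> Lv; split; first by move=> a u w Lu Lw; exact: (iph_lin setting a Lu Lw Lv).
have [K K0 hK] := iph_bound setting; have nv := n2_ge0 (@area R) Om v.
exists (K * nO v + 1); first by rewrite ltr_wpDl// mulr_ge0// ltW.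
move=> u Lu; apply: (le_trans (hK u v Lu Lv)); have n0 := n2_ge0 (@area R) Om u.
have X (b c : R) : 0 <= c -> K * c * b <= (K * b + 1) * c.
  by move=> c0; rewrite mulrDl mul1r mulrAC lerDl.
exact: X.
Qed.

Lemma bounded_form_lin a b f1 f2 : bounded_form f1 -> bounded_form f2 ->
  bounded_form (fun u => a * f1 u - b * f2 u).
Proof.
move=> [l1 [K1 K10 b1]] [l2 [K2 K20 b2]]; split.
  by move=> k u v Lu Lv; rewrite l1// l2//; ring.
exists (`|a| * K1 + `|b| * K2 + 1).
  by rewrite ltr_wpDl// addr_ge0// mulr_ge0// ltW.
move=> u Lu; apply: (le_trans (ler_normB _ _)); rewrite !normrM.
have n0 := n2_ge0 (@area R) Om u.
have h1 := ler_wpM2l (normr_ge0 a) (b1 u Lu); have h2 := ler_wpM2l (normr_ge0 b) (b2 u Lu).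
have X (x y c d s t n : R) : 0 <= n -> s <= x * (c * n) -> t <= y * (d * n) ->
    s + t <= (x * c + y * d + 1) * n.
  move=> n1 h3 h4; rewrite (_ : _ * n = x * (c * n) + y * (d * n) + n); last by ring.
  by rewrite -[leLHS]addr0 !lerD.
exact: X n0 h1 h2.
Qed.

(** The time derivative exists only in the L^2 sense, so it is transported through forms that are
    bounded for the L^2 norm. *)
Lemma sol_derive phi (z : R) : bounded_form phi -> 0 < z ->
  is_derive z 1 (fun y => phi (T y)) (phi (dT z)).
Proof.
move=> [lin [K K0 bK]] z0; have z2 : 0 < z / 2 by rewrite divr_gt0.
have [_ dq _ _ _] := eqT z0.
have pos t : `|t| <= z / 2 -> 0 < z + t by move=> h; exact: addr_gt0_half h.
have Lq t : `|t| <= z / 2 -> L2 area Om (t^-1 *: (T (z + t) - T z) - dT z).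
  move=> tz; apply: (L2B mOm); last exact: sol_LdT.
  exact: (L2Z mOm _ (L2B mOm (sol_LT (pos t tz)) (sol_LT z0))).
have [_ n0] : (\forall t \near 0^', L2 area Om (t^-1 *: (T (z + t) - T z) - dT z)) /\
    nO (t^-1 *: (T (z + t) - T z) - dT z) @[t --> 0^'] --> 0.
  apply: (norm2_cvg0 mOm _ dq); near=> t; have tz : `|t| <= z / 2.
    near: t; apply: dnbhs0_le; exact: z2.
  exact: (L2_measurable mOm (Lq t tz)).
have c : h^-1 *: (((fun y => phi (T y)) \o shift z) (h *: 1) - phi (T z))
    @[h --> 0^'] --> phi (dT z).
  apply: (@cvg_dist_le _ _ _ _ _ (fun t => K * nO (t^-1 *: (T (z + t) - T z) - dT z))).
    near=> t; have tz : `|t| <= z / 2.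
      near: t; apply: dnbhs0_le; exact: z2.
    have zt := pos t tz; have LTt := sol_LT zt; have LTz := sol_LT z0.
    have LD := sol_LdT z0.
    have e1 : t *: 1 + z = z + t by rewrite [t *: 1]mulr1 addrC.
    rewrite /= e1.
    have subE (x y : fn) : x - y = -1 *: y + x by rewrite scaleN1r addrC.
    have Ls := L2B mOm LTt LTz.
    have e2 := lin (-1) (T z) (T (z + t)) LTz LTt.
    have e3 := lin t^-1 (T (z + t) - T z) (-1 *: dT z) Ls (L2Z mOm _ LD).
    have e4 := lin (-1) (dT z) 0 LD (L2_0 _ mOm).
    have e5 := lin 0 0 0 (L2_0 _ mOm) (L2_0 _ mOm).
    rewrite -subE in e2; rewrite addr0 in e4; rewrite scaleN1r in e3 e4.
    rewrite scaler0 addr0 mul0r add0r in e5.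
    have h := bK _ (Lq t tz).
    have e6 := lin 1 0 0 (L2_0 _ mOm) (L2_0 _ mOm); rewrite scaler0 addr0 mul1r in e6.
    have X (a b c d e f s : R) : a = -1 * b + c -> d = s * a + e -> e = - 1 * f + 0 ->
        d = s * (c - b) - f by move=> -> -> ->; ring.
    have e7 : phi 0 = 0 by apply: (addrI (phi 0)); rewrite addr0 -e6.
    rewrite e7 in e4.
    have e8 := X _ _ _ _ _ _ _ e2 e3 e4.
    rewrite e8 in h; exact: h.
  rewrite -[X in _ --> X](mulr0 K); apply: cvgM; [exact: cvg_cst|exact: n0].
apply: DeriveDef; first exact: (cvgP _ c).
exact: (cvg_lim (@Rhausdorff R) c).
Unshelve. all: by end_near. Qed.

Lemma sol_weak v (z : R) : 0 < z -> V G v ->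
  is_derive z 1 (fun y => ipc G (dT y) v) (iph G (dT z) v + dH G (T z) v).
Proof.
move=> z0 Vv; have [_ _ _ _ w] := eqT z0; have h := w v Vv.
have e := dot_right setting (sol_VT z0) (HH_right setting Vv).
rewrite e in h; exact: h.
Qed.

(** By [eigen_eq], on [V] this is the product in [H] with [U i / lam i]. In this form it is bounded
    for the L^2 norm, hence differentiable along a solution and controlled by the growth condition,
    which is also stated in L^2. *)
Definition tail_form i (u : fn) : R := lam i * ipc G u (U i) - 1 * iph G u (U i).

Lemma tail_form_bounded i : i != 0 -> bounded_form (tail_form i).
Proof.
move=> i0; have LU := V_L2 (V_eigen basis i0).
exact: (bounded_form_lin (lam i) 1 (ipc_bounded_form LU) (iph_bounded_form LU)).
Qed.

Definition mode i (z : R) : R := ipc G (dT z) (U i) + tail_form i (T z).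

(** The weak equation tested with [U i] gives the derivative of the first term, and L^2
    differentiability that of the second; by [eigen_dH] the gradient term becomes
    [lam i * tail_form i (T z)] and the terms in [h] at [dT z] cancel. *)
Lemma mode_derive i (z : R) : i != 0 -> 0 < z -> is_derive z 1 (mode i) (lam i * mode i z).
Proof.
move=> i0 z0; have VU := V_eigen basis i0; have LU := V_L2 VU; have VTz := sol_VT z0.
have d := is_deriveD (sol_weak z0 VU) (sol_derive (tail_form_bounded i0) z0).
have e1 := hilbC PV VTz VU.
have e2 := eigen_dH setting basis i0 VTz.
have e3 := hilbC PC LU (V_L2 VTz).
have e4 := iphC G (U i) (T z).
have e5 : tail_form i (dT z) = lam i * ipc G (dT z) (U i) - iph G (dT z) (U i).
  by rewrite /tail_form mul1r.
have e6 := mode_arith erefl e1 e2 e3 e4 e5.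
have e7 : lam i * mode i z = lam i * (ipc G (dT z) (U i) + (lam i * ipc G (T z) (U i) - iph G (T z) (U i))).
  by rewrite /mode /tail_form mul1r.
rewrite e7 -e6; exact: d.
Qed.

Lemma mode_exp i : i != 0 -> exists A : R, forall z, 0 < z -> mode i z = A * expR (lam i * z).
Proof.
(* The amplitude is read at [z = 1], since the equation gives nothing at the inlet itself. *)
move=> i0; exists (mode i 1 * expR (- lam i * 1)).
have key a b : 0 < a -> a <= b -> mode i b * expR (- lam i * b) = mode i a * expR (- lam i * a).
  move=> a0 ab; apply: (@derive_eq0 _ (fun y => mode i y * expR (- lam i * y)) _ _ ab).
  move=> x /andP[ax _]; apply: (is_derive_expR_mul (mode_derive i0 (lt_le_trans a0 ax))).
  by rewrite mulNr subrr mul0r.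
move=> z z0; have [z1|z1] := leP 1 z.
  by rewrite -(key 1 z ltr01 z1) -mulrA -expRD mulNr addNr expR0 mulr1.
by rewrite (key z 1 z0 (ltW z1)) -mulrA -expRD mulNr addNr expR0 mulr1.
Qed.

Hypothesis subT : subexponential G T.

Lemma sol_growth (m K : R) : 0 < m -> 0 < K ->
  \forall z \near +oo, K * nO (T z) <= expR (m * z).
Proof.
move=> m0 K0; have h := subT m0.
have c : nO (T z) * expR (- (m * z)) @[z --> +oo] --> 0.
  apply: (cvg_near_ext _ (fine_cvg h)); near=> z.
  have z0 : 0 < z by near: z; exact: nbhs_pinfty_gt.
  rewrite /= (norm2_n2 mOm (sol_LT z0)); exact: erefl.
have Ki : 0 < K^-1 by rewrite invr_gt0.
have hh := (@cvgrPdist_lt _ _ _ _ _ _ _).1 c _ Ki; near=> z.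
have : `|0 - nO (T z) * expR (- (m * z))| < K^-1 by near: z; exact: hh.
rewrite sub0r normrN => h1; have h2 := le_trans (ler_norm _) (ltW h1).
by rewrite expRN ler_pdivrMr ?expR_gt0// ler_pdivlMl// in h2.
Unshelve. all: by end_near. Qed.

(** With [q = (T | U i)], the mode identity says [q' = A * expR (lam i * z)] minus a bounded form of
    [T]; both forms grow subexponentially, so [no_growth] gives [A = 0]. *)
Lemma positive_mode_eq0 k z : 0 < z -> mode k.+1%:Z z = 0.
Proof.
move=> z0; have i0 := posz_neq0 k; have [A hA] := mode_exp i0.
have [_ lp] := lam_pos basis k; have LU := V_L2 (V_eigen basis i0).
have bf1 := ipc_bounded_form LU; have bf2 := tail_form_bounded i0.
have A0 : A = 0.
  apply: (@no_growth _ (fun y => ipc G (T y) (U k.+1%:Z))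
    (fun y => tail_form k.+1%:Z (T y)) _ A lp).
    move=> y y0; have e := hA y y0.
    have X (a b c : R) : a + b = c -> a = c - b by move=> <-; rewrite addrK.
    rewrite -(X _ _ _ e); exact: (sol_derive bf1 y0).
  have [_ [K1 K10 b1]] := bf1; have [_ [K2 K20 b2]] := bf2.
  have l2 : 0 < lam k.+1%:Z / 2 by rewrite divr_gt0.
  near=> y; have y0 : 0 < y by near: y; exact: nbhs_pinfty_gt.
  have LTy := sol_LT y0; split.
    by apply: (le_trans (b1 _ LTy)); near: y; exact: sol_growth.
  by apply: (le_trans (b2 _ LTy)); near: y; exact: sol_growth.
by rewrite (hA z z0) A0 mul0r.
Unshelve. all: by end_near. Qed.

Lemma sol_HH z : 0 < z -> HH G (dT z, T z).
Proof. by move=> z0; split; [exact: sol_LdT|exact: sol_VT]. Qed.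

Lemma sol_coef i z : i != 0 -> 0 < z -> dot G (dT z, T z) (phi lam U i) = mode i z.
Proof.
move=> i0 z0; have VU := V_eigen basis i0; have LU := V_L2 VU; have VTz := sol_VT z0.
have Vl := hilbZ PV (lam i)^-1 VU.
apply: (etrans (dotE setting (sol_HH z0) (HH_eigen basis i0))).
have e1 : dH G (T z) ((lam i)^-1 *: U i) = dH G ((lam i)^-1 *: U i) (T z) := hilbC PV VTz Vl.
have e2 := eigen_eq setting basis i0 VTz.
have e3 := hilbC PC LU (V_L2 VTz).
have e4 := iphC G (U i) (T z).
have X (a b c d e f g : R) : b = c -> c = lam i * d - e -> d = f -> e = g ->
  a + b = a + (lam i * f - 1 * g) by move=> -> -> -> ->; rewrite mul1r.
exact: (X _ _ _ _ _ _ _ e1 e2 e3 e4).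
Qed.

(** The weak equation tested with 1: the flux term disappears because [dH] annihilates constants. In
    the balanced case this is the product of [(dT, T)] with the kernel vector. *)
Lemma kernel_mode_const a b : ~ controlled G -> 0 < a -> a <= b ->
  ipc G (dT b) (cst 1) - iph G (T b) (cst 1) = ipc G (dT a) (cst 1) - iph G (T a) (cst 1).
Proof.
move=> nc a0 ab; have V1 := V_cst setting 1 nc.
apply: (@derive_eq0 _ (fun y => ipc G (dT y) (cst 1) - iph G (T y) (cst 1)) _ _ ab).
move=> x /andP[ax _]; have x0 := lt_le_trans a0 ax.
have d := is_deriveB (sol_weak x0 V1) (sol_derive (iph_bounded_form (Lk 1)) x0).
have e : dH G (T x) (cst 1) = 0.
  exact: etrans (hilbC PV (sol_VT x0) V1) (dH_cst setting 1 nc (sol_VT x0)).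
rewrite e addr0 subrr in d; exact: d.
Qed.

End structure.

(** * Decomposition of a solution into decaying modes and the kernel *)

Section structure.
Local Opaque grad trace wdot dH ipc ips ipa iph dot pi_minus hflow n2 Bminus mode.
Context {R : realType} (G : graetz_data R) (setting : graetz_setting G).
Local Notation fn := (R * R -> R).
Local Notation Om := (Om G).
Local Notation nO := (n2 (@area R) Om).
Variables (lam : int -> R) (U : int -> fn) (s0 : fn).
Hypothesis basis : eigenbasis G lam U s0.
Hypothesis invertible : compression_invertible G lam U.
Implicit Types (p q r chi : fn * fn).
Local Notation PI := (preinner_HH setting).
Local Notation PV := (preinner_V setting).
Local Notation PC := (preinner_ipc setting).
Local Notation nH := (normHH G).
Local Notation nV s := (Num.sqrt (dH G s s)).
Local Notation mOm := (Om_measurable setting).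
Local Notation em := (em lam U).
Local Notation msum := (is_sum (HH G) (dot G) em).
Local Notation mu := (fun k : nat => lam (- k.+1%:Z)).
Let Lk c : L2 area Om (cst c). Proof. exact: (L2_Om_cst setting). Qed.

Variables (T dT : R -> fn).
Hypothesis eqT : solves_equation G T dT.
Hypothesis subT : subexponential G T.

(** Dividing coefficients by the eigenvalues keeps them square summable, as these stay away from 0.
    The constant covers [j = 0], which divides, and [j = 1], which does not. *)
Lemma sum_coefs_exist (beta : nat -> R) j z p :
  msum (fun k => mu k * (expR (mu k * z) * beta k)) p -> (j <= 1)%N ->
  msum (fun k => mu k ^+ j * expR (mu k * z) * beta k) (hflow G lam U beta j z).
Proof.
move=> bp j1; have m1 := mu_neg basis 0.
have ex : exists q, msum (fun k => mu k ^+ j * expR (mu k * z) * beta k) q.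
  apply: (is_sum_exists_le PI (em_HH basis) (HH_complete setting) (em_orthonormal basis)
    (C := `|mu 0%N|^-1 + 1) _ _ bp); first by rewrite addr_ge0 ?invr_ge0.
  move=> k; have mk := mu_neg basis k; have mk1 := mu_le basis k.
  rewrite -mulrA (normrM (mu k ^+ j)) (normrM (mu k)) normrX.
  have n0 : 0 < `|mu 0%N| by rewrite normr_gt0 lt_eqF.
  have nk : `|mu 0%N| <= `|mu k| by rewrite !ltr0_norm// lerN2.
  have X (a m t w : R) : 0 < m -> m <= t -> 0 <= w -> a = 1 \/ a = t -> a * w <= (m^-1 + 1) * (t * w).
    move=> m0 mt w0 [->|->]; rewrite mulrA ler_wpM2r// mulrDl mul1r.
      by rewrite ler_wpDr ?(le_trans (ltW m0) mt)// mulrC ler_pdivlMr// mul1r.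
    by rewrite lerDr mulr_ge0 ?invr_ge0 ?(le_trans (ltW m0) mt)// ltW.
  apply: X => //; case: j j1 => [_|[_|//]]; [by left; rewrite expr0|by right; rewrite expr1].
exact: (@xgetPex _ 0 [set q | msum (fun k => mu k ^+ j * expR (mu k * z) * beta k) q] ex).
Qed.

Lemma sol_decomposition : exists k beta, (~ balanced G -> k = 0) /\
  forall z, 0 < z -> [/\ V G (k *: s0), 
    msum (fun j => mu j * (expR (mu j * z) * beta j)) ((dT z, T z) - k *: (cst 1, s0)) &
    HH G (k *: (cst 1, s0))].
Proof.
pose phi0 : fn * fn := (cst 1, s0).
(* The coefficient on the kernel vector, evaluated at [z = 1]; it does not depend on [z] by
   [kernel_mode_const]. *)
pose k := if pselect (balanced G) then
  (ipc G (dT 1) (cst 1) - iph G (T 1) (cst 1)) / dot G phi0 phi0 else 0.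
have knb : ~ balanced G -> k = 0 by rewrite /k; case: pselect.
have kb : balanced G -> k = (ipc G (dT 1) (cst 1) - iph G (T 1) (cst 1)) / dot G phi0 phi0.
  by rewrite /k; case: pselect.
have Hk : HH G (k *: phi0).
  have [bal|nb] := pselect (balanced G); first exact: (hilbZ PI k (HH_kernel setting basis bal)).
  rewrite (knb nb) scale0r; exact: (hilb0 PI).
have dk i : i != 0 -> dot G (k *: phi0) (phi lam U i) = 0.
  move=> i0; have Hi := HH_eigen basis i0; apply: (etrans (hilbC PI Hk Hi)).
  have [bal|nb] := pselect (balanced G); last first.
    rewrite (knb nb) scale0r; apply: (etrans (hilbC PI Hi (hilb0 PI))); exact: (dot0l PI Hi).
  have H0 := HH_kernel setting basis bal.
  apply: (etrans (dotZr PI k H0 Hi)).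
  exact: etrans (congr1 (fun x => k * x) (dot_kernel setting basis i0 bal)) (mulr0 k).
have ex : forall j : nat, exists A : R, forall z, 0 < z ->
    mode G lam U T dT (- j.+1%:Z) z = A * expR (lam (- j.+1%:Z) * z).
  by move=> j; exact: (mode_exp setting basis eqT (negz_neq0 j)).
have [A hA] := choice ex.
(* [A j] is the amplitude of the mode in [(dT, T)]. Dividing by the eigenvalue passes to the flow
   whose derivative that is, and whose first component will be [T] itself. *)
exists k, (fun j => (mu j)^-1 * A j); split; first exact: knb.
move=> z z0; split; [exact: Hk.2| |exact: Hk].
have Hp := sol_HH eqT z0; have Hpk := hilbB PI Hp Hk.
have coef i : i != 0 -> dot G ((dT z, T z) - k *: phi0) (phi lam U i) = mode G lam U T dT i z.
  move=> i0; have Hi := HH_eigen basis i0; apply: (etrans (dotBl PI Hp Hk Hi)).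
  have e1 := sol_coef setting basis eqT i0 z0.
  exact: etrans (congr2 (fun x y : R => x - y) e1 (dk i i0)) (subr0 _).
have h : msum (fun j => dot G ((dT z, T z) - k *: phi0) (em j)) ((dT z, T z) - k *: phi0).
  apply: (negative_part setting basis Hpk).
    move=> j; apply: (etrans (coef _ (posz_neq0 j))).
    exact: (positive_mode_eq0 setting basis eqT subT j z0).
  move=> bal; have H0 := HH_kernel setting basis bal; have nc := bal.1.
  have V1 := V_cst setting 1 nc.
  apply: (etrans (dotBl PI Hp Hk H0)); apply: subr0_of_eq.
  apply: esym; apply: (etrans (dotZl PI k H0 H0)).
  have D0 : dot G phi0 phi0 != 0.
    have e1 := dotE setting H0 H0; have d0 := hilb_ge0 PV H0.2.
    have [K K0 hK] := ipc_lower setting.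
    have n0 := nO_cst1_gt0 setting.
    have i0 : 0 < ipc G (cst 1) (cst 1).
      rewrite lt_neqAle (hilb_ge0 PC (Lk 1)) andbT eq_sym; apply/negP => /eqP e0.
      have := hK _ (Lk 1); rewrite e0 sqrtr0 mulr0 leNgt n0.
      by [].
    have X (t a b : R) : t = a + b -> 0 < a -> 0 <= b -> t != 0.
      by move=> -> a0 b0; rewrite gt_eqF// ltr_wpDr.
    exact: X e1 i0 d0.
  have c1 : ipc G (dT z) (cst 1) - iph G (T z) (cst 1) = ipc G (dT 1) (cst 1) - iph G (T 1) (cst 1).
    have [z1|z1] := leP z 1.
      exact: esym (kernel_mode_const setting eqT nc z0 z1).
    exact: (kernel_mode_const setting eqT nc ltr01 (ltW z1)).
  have e2 : dot G (dT z, T z) phi0 = ipc G (dT z) (cst 1) + dH G (T z) s0.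
    exact: (dotE setting Hp H0).
  have e3 := hilbC PV Hp.2 H0.2.
  have e4 := inv_Delta_h_eq setting (kernel_vector basis bal) Hp.2.
  have e5 := iphC G (cst 1) (T z).
  rewrite (kb bal) (divfK D0).
  have Y (a b c d t f g : R) : t = b + c -> c = d -> d = - f -> f = g -> b - g = a -> a = t.
    by move=> -> -> -> -> ->.
  exact: (Y _ _ _ _ _ _ _ e2 e3 e4 e5 c1).
apply: is_sum_ext h => j; apply: (etrans (coef _ (negz_neq0 j))).
apply: (etrans (hA j z z0)).
have mj := lt_eqF (mu_neg basis j).
have X (m a e : R) : (m == 0) = false -> a * e = m * (e * (m^-1 * a)).
  by move=> m0; rewrite mulrCA mulVKf ?m0// mulrC.
exact: X mj.
Qed.

End structure.

(** * The part of a solution that [H] does not see *)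

Lemma kap_arith {F : fieldType} (d k a1 a2 b1 b2 r x1 x2 y1 y2 : F) : d != 0 ->
  a2 - b2 - k * d * y2 = a1 - b1 - k * d * y1 ->
  a1 = b1 + (r + x1 * d) -> a2 = b2 + (r + x2 * d) -> x2 - k * y2 = x1 - k * y1.
Proof.
move=> d0 + e1 e2; rewrite e1 e2 => h.
apply: (mulIf d0); apply: (addrI r).
have X (b x y : F) : b + (r + x * d) - b - k * d * y = r + (x - k * y) * d by ring.
by rewrite -(X b2) -(X b1).
Qed.

Section structure.
Local Opaque grad trace wdot dH ipc ips ipa iph dot pi_minus hflow n2 Bminus mode.
Context {R : realType} (G : graetz_data R) (setting : graetz_setting G).
Local Notation fn := (R * R -> R).
Local Notation Om := (Om G).
Local Notation nO := (n2 (@area R) Om).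
Variables (lam : int -> R) (U : int -> fn) (s0 : fn).
Hypothesis basis : eigenbasis G lam U s0.
Hypothesis invertible : compression_invertible G lam U.
Implicit Types (p q r chi : fn * fn).
Local Notation PI := (preinner_HH setting).
Local Notation PV := (preinner_V setting).
Local Notation PC := (preinner_ipc setting).
Local Notation nH := (normHH G).
Local Notation nV s := (Num.sqrt (dH G s s)).
Local Notation mOm := (Om_measurable setting).
Local Notation em := (em lam U).
Local Notation msum := (is_sum (HH G) (dot G) em).
Local Notation mu := (fun k : nat => lam (- k.+1%:Z)).
Let Lk c : L2 area Om (cst c). Proof. exact: (L2_Om_cst setting). Qed.

Variables (T dT : R -> fn).
Hypothesis eqT : solves_equation G T dT.
Hypothesis subT : subexponential G T.

Section decomposed.
Variables (k : R) (beta : nat -> R).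
Let P1 z : fn * fn := (dT z, T z) - k *: (cst 1, s0).
Hypothesis dec : forall z, 0 < z -> [/\ V G (k *: s0), 
    msum (fun j => mu j * (expR (mu j * z) * beta j)) (P1 z) & HH G (k *: (cst 1, s0))].
Local Notation F := (hflow G lam U beta).

Let FH z : HH G (F 0 z). Proof. exact: (hflow_HH setting). Qed.

Lemma dec_sum0 z : 0 < z -> msum (fun j => expR (mu j * z) * beta j) (F 0 z).
Proof.
move=> z0; have [_ h _] := dec z0.
apply: is_sum_ext (sum_coefs_exist setting basis h (leq0n 1)) => j.
by rewrite expr0 mul1r.
Qed.

(** The decomposition determines [T z] only as an element of [H], and [sum_graph] turns the second
    component into [(F 0 z).1]; an unknown constant [kap z] remains at each [z], null when the
    constants are controlled. *)
Lemma dec_kap : exists kap : R -> R, (controlled G -> forall z, kap z = 0) /\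
  forall z, 0 < z -> T z = (F 0 z).1 + (k *: s0 + cst (kap z)) %[ae area in Om].
Proof.
have ex : forall z, exists c : R, (controlled G -> c = 0) /\
    (0 < z -> T z = (F 0 z).1 + (k *: s0 + cst c) %[ae area in Om]).
  move=> z; have [z0|z0] := ltP 0 z; last by exists 0; split => // h; rewrite ltNge z0 in h.
  have [Vk h _] := dec z0.
  have [V1 n0] := sum_graph setting basis (fun j => negz_neq0 j) (dec_sum0 z0) h.
  have VT := sol_VT eqT z0.
  have VD : V G ((F 0 z).1 - (P1 z).2) by exact: (V_sub setting V1 (V_sub setting VT Vk)).
  have [ec en] := V_null_eqV setting VD n0.
  have [ctr|nc] := pselect (controlled G).
    exists 0; split => // _; apply: aeS (ec ctr) _ => x hx Ox.
    have X (a b c : R) : a - (b - c) = 0 -> b = a + (c + 0).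
      by move=> /eqP; rewrite subr_eq0 => /eqP ->; rewrite addr0 subrK.
    exact: X (hx Ox).
  have [c hc] := en nc; exists (- c); split => // _; apply: aeS hc _ => x hx Ox.
  have X (a b d : R) : a - (b - d) = 0 + c -> b = a + (d + - c).
    move=> h1; have -> : a = (b - d) + c by rewrite -[c]add0r -h1 addrC subrK.
    by rewrite addrACA subrr addr0 subrK.
  exact: X (hx Ox).
have [kap hkap] := choice ex.
exists kap; split => [ctr z|z z0]; first exact: (hkap z).1.
exact: (hkap z).2.
Qed.

(** Pair with 1 for the weight [cc]. The pairing of [T] minus the flow has derivative [k * (1 | 1)],
    because the first component of the decomposition says that [dT] is the derivative of the flow
    plus [k]; as [(1 | 1)] is nonzero, [kap] has slope [k]. *)
Lemma dec_kap_lin kap y1 y2 : ~ controlled G ->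
  (forall z, 0 < z -> T z = (F 0 z).1 + (k *: s0 + cst (kap z)) %[ae area in Om]) ->
  0 < y1 -> y1 <= y2 -> kap y2 - k * y2 = kap y1 - k * y1.
Proof.
(* [beta] is not yet known to be square summable, so the flow is restarted at [z0 > 0], where its
   coefficients [b0] are. *)
move=> nc hk y10 y12; pose z0 := y1 / 2.
have z00 : 0 < z0 by rewrite divr_gt0.
have zy : z0 < y1 by rewrite ltr_pdivrMr// ltr_pMr// ltr1n.
pose b0 j := expR (mu j * z0) * beta j.
have s0' : msum b0 (F 0 z0) := dec_sum0 z00.
have HH0 j t : HH G (hflow G lam U b0 j t) by exact: (hflow_HH setting).
have pos y : y1 <= y -> 0 < y - z0 /\ 0 < y.
  by move=> h; rewrite subr_gt0 (lt_le_trans zy h) (lt_le_trans y10 h).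
have Earith j y : expR (mu j * (y - z0)) * b0 j = expR (mu j * y) * beta j.
  by rewrite /b0 mulrA -expRD -mulrDr subrK.
have N0 y : y1 <= y -> nH (hflow G lam U b0 0 (y - z0) - F 0 y) = 0.
  move=> h; have [h1 h2] := pos y h.
  apply: (is_sum_uniq PI (em_HH basis) (hflowP setting basis s0' 0 h1)).
  apply: is_sum_ext (dec_sum0 h2) => j; rewrite expr0 mul1r; exact: esym (Earith j y).
have N1 y : y1 <= y -> nH (hflow G lam U b0 1 (y - z0) - P1 y) = 0.
  move=> h; have [h1 h2] := pos y h; have [_ h3 _] := dec h2.
  apply: (is_sum_uniq PI (em_HH basis) (hflowP setting basis s0' 1 h1)).
  apply: is_sum_ext h3 => j.
  have X (m e b E : R) : e * b = E -> m * E = m ^+ 1 * e * b.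
    by move=> <-; rewrite expr1 mulrA.
  exact: X (Earith j y).
have V1 := V_cst setting 1 nc.
pose d := ipc G (cst 1) (cst 1).
have null1 p q : HH G p -> HH G q -> nH (p - q) = 0 -> ipc G p.1 (cst 1) = ipc G q.1 (cst 1).
  move=> Hp Hq pq; apply: (etrans (esym (dot_fst setting Hp (Lk 1)))).
  apply: (etrans (dot_null_eql PI Hp Hq (HH_left setting (Lk 1)) pq)).
  exact: (dot_fst setting Hq (Lk 1)).
have const := @derive_eq0 _ (fun y => ipc G (T y) (cst 1) -
  ipc G (hflow G lam U b0 0 (y - z0)).1 (cst 1) - k * d * y) y1 y2 y12.
have val y : y1 <= y -> 0 < y -> ipc G (T y) (cst 1) =
    ipc G (hflow G lam U b0 0 (y - z0)).1 (cst 1) + (ipc G (k *: s0) (cst 1) + kap y * d).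
  move=> h y0; have [Vk _ _] := dec y0; have Lks := V_L2 Vk.
  have e1 := null1 _ _ (HH0 0 (y - z0)) (FH y) (N0 y h).
  have LR := L2D mOm Lks (Lk (kap y)).
  have e2 := eq_ipc setting (sol_LT eqT y0) (L2D mOm (FH y).1 LR) (Lk 1) (hk y y0).
  have e3 := dotDl PC (FH y).1 LR (Lk 1).
  have e4 := dotDl PC Lks (Lk (kap y)) (Lk 1).
  have X0 : (cst (kap y) : fn) = kap y *: cst 1 by apply/funext => x; exact: esym (mulr1 _).
  have e5 : ipc G (cst (kap y)) (cst 1) = kap y * d.
    rewrite X0; exact: (dotZl PC (kap y) (Lk 1) (Lk 1)).
  have X (t a b c w f g : R) : t = a -> a = b + c -> c = f + g -> w = b -> t = w + (f + g).
    by move=> -> -> -> ->.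
  rewrite -e5; exact: (X _ _ _ _ _ _ _ e2 e3 e4 e1).
have d0 : d != 0.
  have [K K0 hK] := ipc_lower setting; have n0 := nO_cst1_gt0 setting.
  apply/eqP => e0; have := hK _ (Lk 1).
  by rewrite [ipc G _ _]e0 sqrtr0 mulr0 leNgt n0.
have y20 := lt_le_trans y10 y12.
apply: (kap_arith d0 (const _) (val y1 (lexx _) y10) (val y2 y12 y20)).
move=> x /andP[h _]; have [h1 h2] := pos x h; have [_ _ Hk] := dec h2.
have D1 := sol_derive setting eqT (ipc_bounded_form setting (Lk 1)) h2.
have D2 := hflow_derive setting basis s0' 0 h1 (Lk 1).
have D3 : is_derive x 1 (fun y => y - z0) 1.
  by rewrite -[X in is_derive _ _ _ X](subr0 1); apply: is_deriveB.
have D4 := @is_derive1_comp _ (fun y => ipc G (hflow G lam U b0 0 y).1 (cst 1))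
  (fun y => y - z0) x _ _ D2 D3.
have D5 : is_derive x 1 (fun y : R => k * d * y) (k * d).
  by rewrite -[X in is_derive _ _ _ X]mulr1; exact: is_deriveZ.
have D := is_deriveB (is_deriveB D1 D4) D5.
have e1 := null1 _ _ (HH0 1 (x - z0)) (hilbB PI (sol_HH eqT h2) Hk) (N1 x h).
have e2 : ipc G (P1 x).1 (cst 1) = ipc G (dT x) (cst 1) - k * d.
  have f1 := dotBl PC (sol_LdT eqT h2) (L2Z mOm k (Lk 1)) (Lk 1).
  have f2 := dotZl PC k (Lk 1) (Lk 1).
  have X (a b c t : R) : t = a - b -> b = c -> t = a - c by move=> -> ->.
  exact: (X _ _ _ _ f1 f2).
have X (a b c : R) : b = a - c -> a - b * 1 - c = 0 by move=> ->; ring.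
have Z := X _ _ _ (etrans e1 e2).
rewrite Z in D; exact: D.
Qed.

Lemma dec_mild : (~ balanced G -> k = 0) -> exists c, (controlled G -> c = 0) /\
  forall z, 0 < z -> T z = (F 0 z).1 + (cst c + k *: s0 + cst (k * z)) %[ae area in Om].
Proof.
move=> kb; have [kap [kc hk]] := dec_kap.
exists (kap 1 - k * 1); split.
  move=> ctr; rewrite (kc ctr) (kb _) ?mul0r ?subrr// => -[nc _]; exact: nc ctr.
move=> z z0; have e : kap z = (kap 1 - k * 1) + k * z.
  have [ctr|nc] := pselect (controlled G).
    rewrite !(kc ctr) (kb _) ?mul0r ?subrr ?addr0// => -[nc _]; exact: nc ctr.
  have [z1|z1] := leP z 1.
    by rewrite (dec_kap_lin nc hk z0 z1) subrK.
  by rewrite -(dec_kap_lin nc hk ltr01 (ltW z1)) subrK.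
apply: (ae_eq_trans_in (hk z z0)); apply: ae_of_eq; rewrite e; apply/funext => x.
have X (a b c d : R) : a + (b + (c + d)) = a + (c + b + d) by ring.
exact: X.
Qed.

End decomposed.
End structure.

(** * The starting vector of the flow *)

Lemma cvg_expR_lin_at0 {R : realType} (m : R) : expR (m * z) @[z --> 0^'+] --> (1 : R).
Proof.
apply: cvg_at_right_filter; rewrite -[X in _ --> X](@expR0 R) -[X in _ --> expR X](mulr0 m).
apply: (@continuous_comp _ _ _ (fun z => m * z) expR); first exact: mulrl_continuous.
exact: continuous_expR.
Qed.

Section structure.
Local Opaque grad trace wdot dH ipc ips ipa iph dot pi_minus hflow n2 Bminus mode.
Context {R : realType} (G : graetz_data R) (setting : graetz_setting G).
Local Notation fn := (R * R -> R).
Local Notation Om := (Om G).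
Local Notation nO := (n2 (@area R) Om).
Variables (lam : int -> R) (U : int -> fn) (s0 : fn).
Hypothesis basis : eigenbasis G lam U s0.
Hypothesis invertible : compression_invertible G lam U.
Local Notation PI := (preinner_HH setting).
Local Notation nH := (normHH G).
Local Notation mOm := (Om_measurable setting).
Local Notation em := (em lam U).
Local Notation msum := (is_sum (HH G) (dot G) em).
Local Notation mu := (fun k : nat => lam (- k.+1%:Z)).
Let Lk c : L2 area Om (cst c). Proof. exact: (L2_Om_cst setting). Qed.

(* The lower bound on the compression controls the coefficients by T(z) near z = 0. *)
Lemma coefs_bounded T beta g k : (forall z, 0 <= z -> L2 area Om (T z)) ->
  norm2 area Om (T z - T 0) @[z --> 0^'+] --> 0%E -> L2 area Om g ->
  (forall z, 0 < z -> msum (fun j => expR (mu j * z) * beta j) (hflow G lam U beta 0 z)) ->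
  (forall z, 0 < z -> T z = (hflow G lam U beta 0 z).1 + (g + cst (k * z)) %[ae area in Om]) ->
  exists psi, msum beta psi.
Proof.
move=> LT T0 Lg sF TF; pose F := hflow G lam U beta.
have FH z : HH G (F 0 z) by exact: (hflow_HH setting).
have [_ n0] : (\forall z \near 0^'+, L2 area Om (T z - T 0)) /\
    nO (T z - T 0) @[z --> 0^'+] --> 0.
  apply: (norm2_cvg0 mOm _ T0); near=> z; apply: (L2_measurable mOm).
  have z0 : 0 <= z by near: z; exact: nbhs_right_ge.
  exact: (L2B mOm (LT _ z0) (LT _ (lexx 0))).
have [K1 K10 h1] := Rminus_lower setting basis invertible.
have [K2 K20 h2] := ipc_upper setting.
pose C := K1 * (K2 * (1 + nO (T 0) + (nO g + `|k| * nO (cst 1)))).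
have bound : \forall z \near 0^'+, nH (F 0 z) <= C.
  have hh := (@cvgrPdist_lt _ _ _ _ _ _ _).1 n0 _ ltr01.
  near=> z; have z0 : 0 < z by near: z; exact: nbhs_right_gt.
  have z1 : z <= 1 by near: z; exact: nbhs_right_le.
  have d1 : `|0 - nO (T z - T 0)| < 1 by near: z; exact: hh.
  have RF := sum_Rminus setting basis (sF z z0).
  have Lz := LT z (ltW z0); have L0 := LT 0 (lexx 0).
  have Lr := L2D mOm Lg (Lk (k * z)).
  have e1 : nO (F 0 z).1 = nO (T z - (g + cst (k * z))).
    apply: (ae_eq_n2 mOm (FH z).1 (L2B mOm Lz Lr)); apply: ae_eq_sym_in.
    apply: (ae_eq_trans_in (ae_eqB (TF z z0) (ae_eq_refl_in _ _ _))).
    apply: ae_of_eq; exact: addrK.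
  have e2 := ler_n2_dist mOm Lz (L2_0 _ mOm) Lr.
  have e3 := ler_n2_dist mOm Lz L0 (L2_0 _ mOm).
  have e4 : nO (0 - (g + cst (k * z))) = nO (g + cst (k * z)).
    rewrite (n2_distC mOm (L2_0 _ mOm) Lr); by rewrite subr0.
  have e5 := ler_n2D mOm Lg (Lk (k * z)).
  rewrite (nO_cst setting (k * z)) normrM (ger0_norm (ltW z0)) in e5.
  rewrite subr0 in e2; rewrite !subr0 in e3.
  apply: (le_trans (h1 _ RF)); rewrite /C ler_pM2l//.
  apply: (le_trans (h2 _ (FH z).1)); rewrite ler_pM2l//.
  have n1 := n2_ge0 (@area R) Om (cst 1 : fn).
  have dn : nO (T z - T 0) <= 1.
    by rewrite sub0r normrN in d1; exact: le_trans (ler_norm _) (ltW d1).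
  have X (a t b c d e f w m : R) : a = b -> b <= c + d -> c <= t + e -> d = f -> f <= w + `|k| * z * m ->
      t <= 1 -> 0 <= m -> a <= 1 + e + (w + `|k| * m).
    move=> -> q1 q2 q3 q4 q5 m0; apply: (le_trans q1); apply: lerD.
      by apply: (le_trans q2); rewrite lerD2r.
    rewrite q3; apply: (le_trans q4); rewrite lerD2l mulrAC ler_piMr// mulr_ge0//.
  exact: (X _ _ _ _ _ _ _ _ _ e1 e2 e3 e4 e5 dn n1).
apply: (is_sum_exists PI (em_HH basis) (HH_complete setting) (em_orthonormal basis) (C := C ^+ 2)) => n.
(* Each finite partial sum of squares is a limit of partial sums at [z > 0], which Bessel bounds by
   the square of the norm of the flow, at most [C ^ 2]. *)
have c : \sum_(j < n) (expR (mu j * z) * beta j) ^+ 2 @[z --> 0^'+] --> \sum_(j < n) beta j ^+ 2.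
  apply: cvg_big => [|j _]; first exact: add_continuous.
  have e := cvg_expR_lin_at0 (mu j).
  have h : expR (mu j * z) * beta j @[z --> 0^'+] --> beta j.
    by rewrite -[X in _ --> X]mul1r; apply: cvgM; [exact: e|exact: cvg_cst].
  under eq_fun do rewrite expr2; rewrite expr2; exact: (cvgM h h).
apply: (cvgr_to_le c); near=> z.
have z0 : 0 < z by near: z; exact: nbhs_right_gt.
have b : nH (F 0 z) <= C by near: z; exact: bound.
apply: (le_trans (is_sum_le_norm PI (em_HH basis) (em_orthonormal basis) n (sF z z0))).
have e := nrm2E PI (FH z); have p := sqrtr_ge0 (dot G (F 0 z) (F 0 z)).
have X (t d : R) : d ^+ 2 = t -> 0 <= d -> d <= C -> t <= C ^+ 2.
  by move=> <- d0 dC; rewrite lerXn2r// nnegrE// (le_trans d0).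
exact: X e p b.
Unshelve. all: by end_near. Qed.

Lemma sol_structure T0 T : solution G T0 T -> exists c k psi,
  [/\ controlled G -> c = 0, ~ balanced G -> k = 0, Rminus G lam U psi &
      mild G lam U (fun j => dot G psi (em j)) (cst c + k *: s0) k T].
Proof.
move=> [LT [dT eqT] cont init subT].
have [k [beta [kb dec]]] := sol_decomposition setting basis eqT subT.
have [c [cc hT]] := dec_mild setting basis eqT dec kb.
have [_ Lg] := drift_std setting basis cc kb.
have sF z (z0 : 0 < z) := dec_sum0 setting basis dec z0.
have [psi bpsi] := coefs_bounded LT cont Lg sF hT.
have Rpsi := sum_Rminus setting basis bpsi; have Hpsi := Rminus_HH Rpsi.
exists c, k, psi; split => //.
have -> : (fun j => dot G psi (em j)) = beta.
  by apply/funext => j; exact: (is_sum_coef PI (em_HH basis) (em_orthonormal basis) j bpsi).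
pose F := hflow G lam U beta.
have FH z : HH G (F 0 z) by exact: (hflow_HH setting).
(* Only [z = 0] is left: both sides are limits in L^2 from the right, so the norm of their
   difference is bounded by a quantity tending to 0. *)
move=> z; rewrite le_eqVlt => /predU1P[<-|z0]; last by split; [exact: LT (ltW z0)|exact: hT].
have L0 := LT 0 (lexx 0); split; first exact: L0.
set g : fn := cst c + k *: s0 in hT Lg *.
have Lg0 := L2D mOm Lg (Lk (k * 0)).
have LL := L2B mOm L0 (L2D mOm (FH 0).1 Lg0).
apply: ae_sub0; apply: (n2_null mOm LL).
apply/eqP; rewrite eq_le (n2_ge0 _ _ _) andbT.
have [_ n0] : (\forall z \near 0^'+, L2 area Om (T z - T 0)) /\
    nO (T z - T 0) @[z --> 0^'+] --> 0.
  apply: (norm2_cvg0 mOm _ cont); near=> y; apply: (L2_measurable mOm).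
  have y0 : 0 <= y by near: y; exact: nbhs_right_ge.
  exact: (L2B mOm (LT _ y0) L0).
have LD y : L2 area Om (F 0 y - psi).1 by exact: (hilbB PI (FH y) Hpsi).1.
have f0 : nO (F 0 y - psi).1 @[y --> 0^'+] --> 0.
  apply: (fst_cvg setting _ (hflow0_cvg setting basis bpsi)).
  apply: nearW => y; exact: (hilbB PI (FH y) Hpsi).
have F0 : (F 0 0).1 = psi.1 %[ae area in Om].
  have [h _] := HH_decomp_null setting (hilbB PI (FH 0) Hpsi) (hflow0_init setting basis bpsi).
  exact: ae_sub0 h.
have cz : nO (T y - T 0) + (nO (F 0 y - psi).1 + y * (`|k| * nO (cst 1))) @[y --> 0^'+] --> 0.
  rewrite -[X in _ --> X]addr0; apply: cvgD; first exact: n0.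
  rewrite -[X in _ --> X]addr0; apply: cvgD; first exact: f0.
  rewrite -[X in _ --> X](mul0r (`|k| * nO (cst 1))); apply: cvgM; last exact: cvg_cst.
  exact: cvg_at_right_filter cvg_id.
apply: (ler_cvg0 _ cz); near=> y; rewrite add0r.
have y0 : 0 < y by near: y; exact: nbhs_right_gt.
have Ly := LT y (ltW y0); have LyT := L2B mOm Ly L0.
have LE := L2D mOm (LD y) (Lk (k * y)).
have e : nO (T 0 - ((F 0 0).1 + (g + cst (k * 0)))) = nO ((F 0 y - psi).1 + cst (k * y) - (T y - T 0)).
  apply: (ae_eq_n2 mOm LL (L2B mOm LE LyT)).
  have h1 : T 0 - ((F 0 0).1 + (g + cst (k * 0))) = T 0 - (psi.1 + (g + cst (k * 0)))
      %[ae area in Om] := ae_eqB (ae_eq_refl_in _ _ _) (ae_eqD F0 (ae_eq_refl_in _ _ _)).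
  apply: (ae_eq_trans_in h1); apply: ae_eq_sym_in.
  have h2 : (F 0 y - psi).1 + cst (k * y) - (T y - T 0) =
      (F 0 y - psi).1 + cst (k * y) - ((F 0 y).1 + (g + cst (k * y)) - T 0) %[ae area in Om].
    exact: ae_eqB (ae_eq_refl_in _ _ _) (ae_eqB (hT y y0) (ae_eq_refl_in _ _ _)).
  apply: (ae_eq_trans_in h2); apply: ae_of_eq; apply/funext => x.
  have X (a b d t w : R) : a - b + k * w - (a + (d + k * w) - t) = t - (b + (d + k * 0)) by ring.
  exact: X.
rewrite e.
have t1 := ler_n2_dist mOm LE (L2_0 _ mOm) LyT.
have t2 := ler_n2D mOm (LD y) (Lk (k * y)).
rewrite (nO_cst setting (k * y)) normrM (ger0_norm (ltW y0)) in t2.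
have t3 := n2_distC mOm (L2_0 _ mOm) LyT; rewrite subr0 in t1; rewrite subr0 in t3.
have X (a b d s t w m : R) : a <= b + d -> b <= s + `|k| * w * m -> d = t -> a <= t + (s + w * (`|k| * m)).
  move=> q1 q2 q3; apply: (le_trans q1); rewrite q3 addrC lerD2l.
  by rewrite (_ : w * _ = `|k| * w * m)//; ring.
exact: (X _ _ _ _ _ _ _ t1 t2 t3).
Unshelve. all: by end_near. Qed.

End structure.

(** * Classification of the solutions *)

Section assembly.
Local Opaque grad trace wdot dH ipc ips ipa iph dot pi_minus hflow n2 Bminus mode defect.
Context {R : realType} (G : graetz_data R) (setting : graetz_setting G).
Local Notation fn := (R * R -> R).
Local Notation Om := (Om G).
Local Notation nO := (n2 (@area R) Om).
Variables (lam : int -> R) (U : int -> fn) (s0 T0 : fn).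
Hypothesis basis : eigenbasis G lam U s0.
Hypothesis invertible : compression_invertible G lam U.
Hypothesis LT0 : L2 area Om T0.
Local Notation PI := (preinner_HH setting).
Local Notation PC := (preinner_ipc setting).
Local Notation nH := (normHH G).
Local Notation mOm := (Om_measurable setting).
Local Notation em := (em lam U).
Local Notation B := (Bminus G lam U).
Local Notation defect := (defect G lam U).
Let Lk c : L2 area Om (cst c). Proof. exact: (L2_Om_cst setting). Qed.

Lemma int_hE : \int[area]_(x in Om) hh G x = iph G (cst 1) (cst 1).
Proof. by rewrite -int_iph; apply: eq_Rintegral => x _; rewrite !mulr1. Qed.

Lemma norm2_mul_cvg0 (f : R -> fn) (w : R -> R) : (\forall z \near +oo, L2 area Om (f z)) ->
  (norm2 area Om (f z) * (w z)%:E)%E @[z --> +oo] --> 0%E <->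
  nO (f z) * w z @[z --> +oo] --> 0.
Proof.
move=> Lf; have E : \forall z \near +oo,
    (norm2 area Om (f z) * (w z)%:E)%E = (nO (f z) * w z)%:E.
  by apply: filterS Lf => z Lz; rewrite (norm2_n2 mOm Lz) EFinM.
split=> h.
  apply: (cvg_near_ext _ (fine_cvg h)); apply: filterS E => z ez.
  by rewrite /= ez.
apply: (@cvg_trans _ ((nO (f z) * w z)%:E @[z --> +oo])).
  by apply: near_eq_cvg; apply: filterS E => z ->.
by apply: cvg_EFin; [near=> z|exact: h].
Unshelve. all: by end_near. Qed.

Definition rest c k : fn := cst c + k *: s0.
Definition sol_form c k (T : R -> fn) : Prop :=
  mild G lam U (fun j => dot G (B (T0 - rest c k, 0)) (em j)) (rest c k) k T.
(** The pairs for which the inlet minus [rest] is the first component of an element of the range of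
    pi_-; solutions correspond to them by the next lemmas. *)
Definition admissible c k : Prop :=
  [/\ controlled G -> c = 0, ~ balanced G -> k = 0 &
   ~ controlled G -> iph G (cst 1) (cst 1) < 0 \/
     (0 <= iph G (cst 1) (cst 1) /\ ipc G defect (T0 - rest c k) = 0)].

Lemma L2_rest c k : admissible c k -> L2 area Om (rest c k).
Proof. by move=> [cc kb _]; have [_] := drift_std setting basis cc kb. Qed.

Lemma L2_inlet c k : admissible c k -> L2 area Om (T0 - rest c k).
Proof. by move=> /L2_rest; exact: (L2B mOm LT0). Qed.

Lemma inlet_sum c k : admissible c k -> is_sum (HH G) (dot G) em
  (fun j => dot G (B (T0 - rest c k, 0)) (em j)) (B (T0 - rest c k, 0)).
Proof.
by move=> /L2_inlet Lu; exact: (Rminus_sum setting basis (B_Rminus setting basis invertible Lu)).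
Qed.

Lemma sol_form_solution c k T : admissible c k -> sol_form c k T -> solution G T0 T.
Proof.
move=> ad sT; have [cc kb h] := ad; have [gk Lg] := drift_std setting basis cc kb.
have Lu := L2_inlet ad; have fix_u := B_fix setting basis invertible Lu h.
apply: (mild_solution setting basis (inlet_sum ad) gk sT LT0).
have e : T0 - rest c k + rest c k = (B (T0 - rest c k, 0)).1 + rest c k %[ae area in Om].
  exact: (ae_eqD fix_u (ae_eq_refl_in _ _ _)).
apply: ae_eq_trans_in e; apply: ae_of_eq; exact: esym (subrK _ _).
Qed.

(** By [sol_structure] the inlet condition exhibits [T0 - rest c k] as the first component of [psi];
    [B_fix_conv] then gives admissibility and replaces [psi] by [B_- (T0 - rest c k, 0)]. *)
Lemma solution_sol_form T : solution G T0 T -> exists c k, admissible c k /\ sol_form c k T.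
Proof.
move=> sT; have [c [k [psi [cc kb Rpsi mT]]]] := sol_structure setting basis invertible sT.
have [_ _ _ init _] := sT.
have [gk Lg] := drift_std setting basis cc kb.
have Hpsi := Rminus_HH Rpsi; have bpsi := Rminus_sum setting basis Rpsi.
have m0 := mild_init setting basis bpsi mT.
have Lu : L2 area Om (T0 - rest c k) := L2B mOm LT0 Lg.
have upsi : T0 - rest c k = psi.1 %[ae area in Om].
  have e : T0 - rest c k = psi.1 + rest c k - rest c k %[ae area in Om].
    exact: (ae_eqB (ae_eq_trans_in (ae_eq_sym_in init) m0) (ae_eq_refl_in _ _ _)).
  apply: (ae_eq_trans_in e); apply: ae_of_eq; exact: addrK.
have [d0 n0] := B_fix_conv setting basis invertible Lu Rpsi upsi.
exists c, k; split.
  split=> // nc; have [h|h] := ltP (iph G (cst 1) (cst 1)) 0; first by left.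
  by right.
rewrite /sol_form; suff -> : (fun j => dot G (B (T0 - rest c k, 0)) (em j)) =
  (fun j => dot G psi (em j)) by exact: mT.
apply/funext => j; apply: esym.
have HB := Rminus_HH (B_Rminus setting basis invertible Lu).
exact: (dot_null_eql PI Hpsi HB (em_HH basis j) n0).
Qed.

Lemma sol_form_exists c k : admissible c k -> exists T, sol_form c k T.
Proof.
move=> ad; have Lg := L2_rest ad.
exists (fun z => (hflow G lam U (fun j => dot G (B (T0 - rest c k, 0)) (em j)) 0 z).1 +
  (rest c k + cst (k * z))) => z z0; split; last exact: ae_eq_refl_in.
have FH : HH G (hflow G lam U (fun j => dot G (B (T0 - rest c k, 0)) (em j)) 0 z).
  exact: (hflow_HH setting).
exact: (L2D mOm FH.1 (L2D mOm Lg (Lk _))).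
Qed.

Lemma sol_form_unique c k T T' : sol_form c k T -> sol_form c k T' ->
  forall z, 0 <= z -> T' z = T z %[ae area in Om].
Proof.
move=> sT sT' z z0; have [_ e] := sT z z0; have [_ e'] := sT' z z0.
exact: ae_eq_trans_in e' (ae_eq_sym_in e).
Qed.

Lemma given_by_sol_form c k p r T : admissible c k -> p = (T0 - rest c k, 0) ->
  (forall z, r z = rest c k + cst (k * z)) -> given_by G lam U p r T <-> sol_form c k T.
Proof.
move=> ad -> rE; have -> : r = fun z => rest c k + cst (k * z) by apply/funext.
exact: (given_byE setting basis invertible (HH_left setting (L2_inlet ad)) k T (L2_rest ad)).
Qed.

Lemma sol_form_asymp c k T : admissible c k -> sol_form c k T ->
  norm2 area Om (T z - (rest c k + cst (k * z))) @[z --> +oo] --> 0%E.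
Proof.
move=> ad sT; exact: (mild_asymp setting basis (inlet_sum ad) (L2_rest ad) sT).
Qed.

Lemma sol_form_LT c k T : sol_form c k T -> \forall z \near +oo, L2 area Om (T z).
Proof.
move=> sT; near=> z; have z0 : 0 <= z by near: z; exact: nbhs_pinfty_ge.
exact: (sT z z0).1.
Unshelve. all: by end_near. Qed.

Lemma asymp_real c k T : admissible c k -> sol_form c k T ->
  nO (T z - (rest c k + cst (k * z))) @[z --> +oo] --> 0.
Proof.
move=> ad sT; have Lg := L2_rest ad; have LT := sol_form_LT sT.
have [_ h] : (\forall z \near +oo, L2 area Om (T z - (rest c k + cst (k * z)))) /\
    nO (T z - (rest c k + cst (k * z))) @[z --> +oo] --> 0.
  apply: (norm2_cvg0 mOm _ (sol_form_asymp ad sT)); apply: filterS LT => z LTz.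
  exact: (L2_measurable mOm (L2B mOm LTz (L2D mOm Lg (Lk _)))).
exact: h.
Qed.

Lemma at_infinity_sol_form c T : admissible c 0 -> sol_form c 0 T -> at_infinity G T (cst c).
Proof.
move=> ad sT; have h := sol_form_asymp ad sT; rewrite /at_infinity.
rewrite (_ : (fun z => _) = (fun z => norm2 area Om (T z - (rest c 0 + cst (0 * z))))); first exact: h.
apply/funext => z; congr (norm2 _ _ _); apply/funext => x.
have X (t s : R) : t - c = t - (c + 0 * s + 0 * z) by ring.
exact: X.
Qed.

(** Two constant limits are at L^2 distance 0, and the constant 1 has positive norm because [Om] is
    open and nonempty. *)
Lemma at_infinity_unique T c c' : (\forall z \near +oo, L2 area Om (T z)) ->
  at_infinity G T (cst c) -> at_infinity G T (cst c') -> c = c'.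
Proof.
move=> LT h h'.
have N a : at_infinity G T (cst a) -> nO (T z - cst a) @[z --> +oo] --> 0.
  move=> ha; have [_ //] : (\forall z \near +oo, L2 area Om (T z - cst a)) /\
      nO (T z - cst a) @[z --> +oo] --> 0.
  apply: (norm2_cvg0 mOm _ ha); apply: filterS LT => z LTz.
  exact: (L2_measurable mOm (L2B mOm LTz (Lk a))).
have cc : nO (T z - cst c) + nO (T z - cst c') @[z --> +oo] --> 0.
  by rewrite -[X in _ --> X]addr0; apply: cvgD; exact: N.
have : nO (cst (c - c')) <= 0.
  apply: (ler_cvg0 _ cc); near=> z; rewrite add0r.
  have LTz : L2 area Om (T z) by near: z; exact: LT.
  have t := ler_n2_dist mOm (Lk c) LTz (Lk c').
  rewrite (n2_distC mOm (Lk c) LTz) in t; exact: t.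
rewrite (nO_cst setting) pmulr_lle0 ?(nO_cst1_gt0 setting)//.
by rewrite normr_le0 subr_eq0 => /eqP.
Unshelve. all: by end_near. Qed.

(** Up to terms that are bounded at infinity, the norm of [T z] is that of [cst (k * z)]; dividing
    by [z] leaves [|k|] times the norm of 1. *)
Lemma sublinear_slope c k T : admissible c k -> sol_form c k T -> sublinear G T -> k = 0.
Proof.
move=> ad sT sub; have Lg := L2_rest ad; have LT := sol_form_LT sT.
have s1 := (norm2_mul_cvg0 _ LT).1 sub; have s2 := asymp_real ad sT.
have cz := @cvg_invr_pinfty R.
have c1 : nO (T z) * z^-1 + (nO (T z - (rest c k + cst (k * z))) + nO (rest c k)) * z^-1
    @[z --> +oo] --> 0.
  have -> : 0 = 0 + (0 + nO (rest c k)) * 0 :> R by rewrite mulr0 addr0.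
  apply: cvgD; first exact: s1.
  apply: cvgM; last exact: cz.
  by apply: cvgD; [exact: s2|exact: cvg_cst].
have : `|k| * nO (cst 1) <= 0.
  apply: (ler_cvg0 _ c1); near=> z; rewrite add0r.
  have z0 : 0 < z by near: z; exact: nbhs_pinfty_gt.
  have LTz : L2 area Om (T z) by near: z; exact: LT.
  have LD := L2B mOm LTz (L2D mOm Lg (Lk (k * z))).
  have e : (cst (k * z) : fn) = T z - (T z - (rest c k + cst (k * z))) - rest c k.
    apply/funext => x; have X (a t : R) : k * z = t - (t - (a + k * z)) - a by ring.
    exact: X.
  have LDD := L2B mOm LTz LD.
  have t1 := ler_n2_dist mOm LDD (L2_0 _ mOm) Lg.
  have t2 := ler_n2_dist mOm LTz (L2_0 _ mOm) LD.
  rewrite -e (nO_cst setting (k * z)) normrM (gtr0_norm z0) in t1.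
  have t3 := n2_distC mOm (L2_0 _ mOm) LD; have t4 := n2_distC mOm (L2_0 _ mOm) Lg.
  rewrite subr0 in t1; rewrite subr0 in t2; rewrite subr0 in t3; rewrite subr0 in t4.
  have X (a b d f m g w h : R) : `|k| * z * m <= a + g -> a <= d + b -> b = f -> g = w ->
      `|k| * m <= d * z^-1 + (f + w) * z^-1.
    move=> q1 q2 q3 q4; rewrite -mulrDl ler_pdivlMr// mulrAC; apply: (le_trans q1).
    by rewrite addrA q4 lerD2r -q3.
  exact: (X _ _ _ _ _ _ _ 0 t1 t2 t3 t4).
by rewrite pmulr_lle0 ?(nO_cst1_gt0 setting)// normr_le0 => /eqP.
Unshelve. all: by end_near. Qed.

Lemma sublinear_remainder c k T : admissible c k -> sol_form c k T ->
  sublinear G (fun z => T z - (cst (k * z) + (k *: s0 + cst c))).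
Proof.
move=> ad sT; have Lg := L2_rest ad; have LT := sol_form_LT sT.
have E z : T z - (cst (k * z) + (k *: s0 + cst c)) = T z - (rest c k + cst (k * z)).
  apply/funext => x; have X (t a b d : R) : t - (a + (b + d)) = t - (d + b + a) by ring.
  exact: X.
apply/(norm2_mul_cvg0 (f := fun z => T z - (cst (k * z) + (k *: s0 + cst c)))).
  apply: filterS LT => z LTz; rewrite E; exact: (L2B mOm LTz (L2D mOm Lg (Lk _))).
under eq_fun do rewrite E.
have -> : 0 = 0 * 0 :> R by rewrite mulr0.
by apply: cvgM; [exact: (asymp_real ad sT)|exact: cvg_invr_pinfty].
Qed.

Lemma defect_dot u : L2 area Om u ->
  dot G ((cst 1, 0) - Pproj (B (cst 1, 0))) (u, 0) = ipc G defect u.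
Proof.
move=> Lu; rewrite defectE.
exact: (dot_left setting (L2_defect setting basis invertible) (HH_left setting Lu)).
Qed.

Lemma denom_neq0 : ~ controlled G -> 0 <= iph G (cst 1) (cst 1) ->
  dot G ((cst 1, 0) - Pproj (B (cst 1, 0))) (cst 1, 0) != 0.
Proof.
move=> nc h0; rewrite (defect_dot (Lk 1)) (defect_sqr setting basis invertible).
exact: (defect_neq0 setting basis invertible nc h0).
Qed.

(** Orthogonality to [defect] is one linear equation in [c], solvable because its coefficient is the
    nonzero denominator. *)
Lemma defect_rest v c : L2 area Om v -> ~ controlled G -> 0 <= iph G (cst 1) (cst 1) ->
  ipc G defect (v - cst c) = 0 <->
  c = dot G ((cst 1, 0) - Pproj (B (cst 1, 0))) (v, 0) *
    (dot G ((cst 1, 0) - Pproj (B (cst 1, 0))) (cst 1, 0))^-1.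
Proof.
move=> Lv nc h0; have D0 := denom_neq0 nc h0; have Ld := L2_defect setting basis invertible.
rewrite (defect_dot (Lk 1)) in D0 *; rewrite (defect_dot Lv).
have e1 := dotBr PC Lv (Lk c) Ld.
have X0 : (cst c : fn) = c *: cst 1 by apply/funext => x; exact: esym (mulr1 _).
have e2 : ipc G defect (cst c) = c * ipc G defect (cst 1).
  rewrite X0; exact: (dotZr PC c (Lk 1) Ld).
have X (t a b d : R) : d != 0 -> t = a - b -> b = c * d -> t = 0 <-> c = a * d^-1.
  move=> d0 -> ->; split=> [/eqP|->]; last by rewrite divfK// subrr.
  by rewrite subr_eq0 => /eqP ->; rewrite mulfK.
exact: X D0 e1 e2.
Qed.

End assembly.

Theorem proposition6 (R : realType) (G : graetz_data R)
    (lam : int -> R) (U : int -> plane R -> R) (s0 T0 : plane R -> R)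
    (setting : graetz_setting G) (basis : eigenbasis G lam U s0)
    (invertible : compression_invertible G lam U)
    (phiD_HH : HH G (T0, 0)) :
  let phiD : (plane R -> R) * (plane R -> R) := (T0, 0) in
  let Phi : (plane R -> R) * (plane R -> R) := (cst 1, 0) in
  let B := Bminus G lam U in
  let int_h := \int[area]_(x in Om G) hh G x in
  let denom := dot G (Phi - Pproj (B Phi)) Phi in
  [/\ (* a *)
      controlled G ->
        exists T, [/\ ae_unique G (solution G T0) T,
                      given_by G lam U phiD (fun=> 0) T &
                      at_infinity G T 0],
      (* b, int h < 0 *)
      ~ controlled G -> int_h < 0 ->
        (forall Tinf : R,
          exists T,
            ae_unique G
              (fun T' => solution G T0 T' /\ at_infinity G T' (cst Tinf)) T /\
            given_by G lam U (phiD - Tinf *: Phi) (fun=> cst Tinf) T) /\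
        (forall T, solution G T0 T ->
          exists Tinf : R, at_infinity G T (cst Tinf)),
      (* b, int h > 0 *)
      ~ controlled G -> 0 < int_h ->
        denom != 0 /\
        let Tinf := dot G (Phi - Pproj (B Phi)) phiD * denom^-1 in
        exists T, [/\ ae_unique G (solution G T0) T,
                      given_by G lam U (phiD - Tinf *: Phi) (fun=> cst Tinf) T &
                      at_infinity G T (cst Tinf)] &
      (* c *)
      balanced G ->
        denom != 0 /\
        let c1 (c2 : R) : R :=
          dot G (Phi - Pproj (B Phi)) (phiD - c2 *: (s0, 0)) * denom^-1 in
        let formula (c2 : R) (T : R -> plane R -> R) :=
          given_by G lam U (phiD - c1 c2 *: Phi - c2 *: (s0, 0))
            (fun z => cst (c1 c2) + c2 *: (cst z + s0)) T in
        [/\ forall T, solution G T0 T <-> exists c2, formula c2 T,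
            forall c2, exists T, formula c2 T,
            forall c2 T, formula c2 T ->
              sublinear G
                (fun z => T z - (cst (c2 * z) + (c2 *: s0 + cst (c1 c2)))) &
            forall c2 T, formula c2 T -> sublinear G T ->
              c2 = 0 /\ at_infinity G T (cst (c1 0))]].
Proof.
move=> phiD Phi B int_h denom.
have LT0 : L2 area (Om G) T0 := phiD_HH.1.
have hE : int_h = iph G (cst 1) (cst 1) := int_hE G.
have nb0 : int_h != 0 -> ~ balanced G by move=> h0 [_ h]; rewrite /int_h h eqxx in h0.
(* Outside the balanced case the slope is 0, and the inlet data of the formulas are those of [rest]
   with [k = 0]. *)
have pE (c : R) : phiD - c *: Phi = (T0 - rest s0 c 0, 0).
  congr (_, _); apply/funext => x.
    have X (t s : R) : t - c * 1 = t - (c + 0 * s) by ring.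
    exact: X.
  have X : (0 : R) - c * 0 = 0 by ring.
  exact: X.
have rE (c z : R) : cst c = rest s0 c 0 + cst (0 * z).
  apply/funext => x; have X (s : R) : c = c + 0 * s + 0 * z by ring.
  exact: X.
split.
- move=> ctr; have nb : ~ balanced G by move=> [nc _]; exact: nc ctr.
  have ad : admissible G lam U s0 T0 0 0 by split.
  have [T sT] := sol_form_exists setting basis ad.
  exists T; split; last exact: (at_infinity_sol_form setting basis invertible LT0 ad sT).
    split; first exact: (sol_form_solution setting basis invertible LT0 ad sT).
    move=> T' sT' z z0.
    have [c [k [[cc kb _] fT']]] := solution_sol_form setting basis invertible LT0 sT'.
    rewrite (cc ctr) (kb nb) in fT'; exact: (sol_form_unique sT fT').
  apply/(given_by_sol_form setting basis invertible LT0 _ ad) => //.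
    have e := pE 0; rewrite scale0r in e; exact: etrans (esym (subr0 phiD)) e.
  by move=> z; rewrite -rE.
(* For a negative integral every constant is admissible, so existence holds for each prescribed
   limit, and the limit singles out the constant. *)
- move=> nc hneg; have nb := nb0 (ltr0_neq0 hneg).
  have ad c : admissible G lam U s0 T0 c 0.
    split=> // _; left; rewrite -hE; exact: hneg.
  split=> [c|T sT].
    have [T sT] := sol_form_exists setting basis (ad c).
    exists T; split.
      split.
        split; first exact: (sol_form_solution setting basis invertible LT0 (ad c) sT).
        exact: (at_infinity_sol_form setting basis invertible LT0 (ad c) sT).
      move=> T' [sT' inf'] z z0.
      have [c' [k [[_ kb _] fT']]] := solution_sol_form setting basis invertible LT0 sT'.
      rewrite (kb nb) in fT'.
      have inf := at_infinity_sol_form setting basis invertible LT0 (ad c') fT'.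
      have cc := at_infinity_unique setting (sol_form_LT fT') inf' inf.
      rewrite -cc in fT'; exact: (sol_form_unique sT fT').
    apply/(given_by_sol_form setting basis invertible LT0 _ (ad c));
      [exact: pE|by move=> z; exact: rE|exact: sT].
  have [c' [k [[_ kb _] fT]]] := solution_sol_form setting basis invertible LT0 sT.
  rewrite (kb nb) in fT; exists c'.
  exact: (at_infinity_sol_form setting basis invertible LT0 (ad c') fT).
(* For a positive integral admissibility is the orthogonality condition, so the constant of any
   solution is forced to be [Tinf]. *)
- move=> nc hpos; have nb := nb0 (lt0r_neq0 hpos).
  have h0 : 0 <= iph G (cst 1) (cst 1) by rewrite -hE ltW.
  have D0 := denom_neq0 setting basis invertible nc h0; split; first exact: D0.
  move=> Tinf; have rest0 c : T0 - rest s0 c 0 = T0 - cst c.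
    by rewrite /rest scale0r addr0.
  have ad : admissible G lam U s0 T0 Tinf 0.
    split=> // _; right; split=> //; rewrite rest0.
    by apply/(defect_rest setting basis invertible _ LT0 nc h0).
  have [T sT] := sol_form_exists setting basis ad.
  exists T; split; last exact: (at_infinity_sol_form setting basis invertible LT0 ad sT).
    split; first exact: (sol_form_solution setting basis invertible LT0 ad sT).
    move=> T' sT' z z0.
    have [c [k [[_ kb dk] fT']]] := solution_sol_form setting basis invertible LT0 sT'.
    rewrite (kb nb) in fT' dk; have cT : c = Tinf.
      have [hlt|[_ d0]] := dk nc; first by rewrite ltNge h0 in hlt.
      rewrite rest0 in d0.
      exact: (defect_rest setting basis invertible c LT0 nc h0).1 d0.
    rewrite cT in fT'; exact: (sol_form_unique sT fT').
  apply/(given_by_sol_form setting basis invertible LT0 _ ad);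
      [exact: pE|by move=> z; exact: rE|exact: sT].
- move=> bal; have [nc hz] := bal.
  have h0 : 0 <= iph G (cst 1) (cst 1) by rewrite -hE /int_h hz.
  have D0 := denom_neq0 setting basis invertible nc h0; split; first exact: D0.
  move=> c1 formula; have [_ Ls0] : HH G (cst 1, s0) /\ L2 area (Om G) s0.
    have H0 := HH_kernel setting basis bal; split; [exact: H0|exact: (V_L2 H0.2)].
  have Lk k : L2 area (Om G) (T0 - k *: s0).
    exact: (L2B (Om_measurable setting) LT0 (L2Z (Om_measurable setting) k Ls0)).
  have restE c k : T0 - rest s0 c k = T0 - k *: s0 - cst c.
    apply/funext => x; have X (t s : R) : t - (c + k * s) = t - k * s - c by ring.
    exact: X.
  have pk k : phiD - k *: (s0, 0) = (T0 - k *: s0, 0).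
    congr (_, _); apply/funext => x; have X : (0 : R) - k * 0 = 0 by ring.
    exact: X.
  (* The same linear equation, with [T0 - k * s0] as inlet: the slope [k] stays free and determines
     the constant. *)
  have c1E k c : ipc G (defect G lam U) (T0 - k *: s0 - cst c) = 0 <-> c = c1 k.
    rewrite /c1 pk; exact: (defect_rest setting basis invertible c (Lk k) nc h0).
  have ad k : admissible G lam U s0 T0 (c1 k) k.
    split=> // _; right; split=> //; rewrite restE; exact: (c1E k (c1 k)).2.
  have fE k T : formula k T <-> sol_form G lam U s0 T0 (c1 k) k T.
    apply: (given_by_sol_form setting basis invertible LT0 _ (ad k)).
      congr (_, _); apply/funext => x.
        have X (t c s : R) : t - c * 1 - k * s = t - (c + k * s) by ring.
        exact: X.
      have X (c : R) : (0 : R) - c * 0 - k * 0 = 0 by ring.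
      exact: X.
    move=> z; apply/funext => x.
    have X (c s : R) : c + k * (z + s) = c + k * s + k * z by ring.
    exact: X.
  split.
  + move=> T; split=> [sT|[k /fE fT]].
      have [c [k [[_ _ dk] fT]]] := solution_sol_form setting basis invertible LT0 sT.
      have cE : c = c1 k.
        have [hlt|[_ d0]] := dk nc; first by rewrite ltNge h0 in hlt.
        by rewrite restE in d0; exact: (c1E k c).1.
      by exists k; apply/fE; rewrite -cE.
    exact: (sol_form_solution setting basis invertible LT0 (ad k) fT).
  + move=> k; have [T fT] := sol_form_exists setting basis (ad k).
    by exists T; apply/fE.
  + move=> k T /fE fT; exact: (sublinear_remainder setting basis invertible LT0 (ad k) fT).
  + move=> k T /fE fT sub.
    have k0 := sublinear_slope setting basis invertible LT0 (ad k) fT sub.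
    split; first exact: k0.
    rewrite k0 in fT; exact: (at_infinity_sol_form setting basis invertible LT0 (ad 0) fT).
Qed.
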